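(* Let $d\in[1,+\infty]$, let $(D_t)_{t\ge0}=(\mathbb A_{r(t)})_{t\ge0}$ be a canonical domain system of order $d$ which is either degenerate or of mixed type, i.e. $\{t\ge0:r(t)=0\}\ne\emptyset$. Let $(f_t)$ be a Loewner chain of order $d$ over $(D_t)$ and $G$ the vector field associated with $(f_t)$. Put $$I:=-\int_0^{+\infty}\mathrm{Re}\,\mathcal N\big(w\mapsto G(w,t)/w\big)\,dt.$$ Then the Loewner chain $(f_t)$ is of type II if $I<+\infty$ and of type IV otherwise.
   Context: Notation: $\mathbb D:=\{z:|z|<1\}$, $\mathbb C^*:=\mathbb C\setminus\{0\}$, $\mathbb A_r:=\{z\in\mathbb C: r<|z|<1\}$ for $0\le r<1$, $\mathbb D^*:=\mathbb A_0$; $\mathbb T$ is the unit circle. For a closed curve $\gamma\subset\mathbb C^*$, $I(\gamma)$ is the index of the origin with respect to $\gamma$. For $d\in[1,+\infty]$, $AC^d(X,Y)$ is the class of all locally absolutely continuous $f:X\to Y$ with $f'\in L^d_{\mathrm{loc}}(X,\mathbb C)$. Put $\omega(r):=-\pi/\log r$ for $r\in(0,1)$ and $\omega(0):=0$. ''Univalent'' means holomorphic and injective. For $f$ holomorphic in $\mathbb A_r$, $\mathcal N(f):=\int_{\mathbb T}f(\rho\xi)\,\frac{|d\xi|}{2\pi}$, for any $\rho\in(r,1)$ (free term of the Laurent development). Canonical domain system of order $d$: a family $(D_t)_{t\ge0}$ of annuli $D_t=\mathbb A_{r(t)}$, $r(t)\in[0,1)$, such that $t\mapsto\omega(r(t))$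 belongs to $AC^d([0,+\infty),[0,+\infty))$ and is non-increasing. Degenerate: $r\equiv0$. Mixed type: for some $T>0$, $r(t)>0$ on $[0,T)$ and $r(t)=0$ on $[T,+\infty)$. Loewner chain of order $d$ over $(D_t)$: a family $(f_t)_{t\ge0}$ of holomorphic functions $f_t:D_t\to\mathbb C$ such that (LC1) each $f_t$ is univalent; (LC2) $f_s(D_s)\subset f_t(D_t)$ whenever $0\le s<t<+\infty$; (LC3) for any compact interval $[S,T]\subset[0,+\infty)$ and any compact set $K\subset D_S$ there is a non-negative $k\in L^d([S,T],\mathbb R)$ such that $|f_s(z)-f_t(z)|\le\int_s^t k(\xi)\,d\xi$ for all $z\in K$ and all $S\le s\le t\le T$. Weak holomorphic vector field of order $d$ over $(D_t)$: a function $G:\mathcal D\to\mathbb C$, $\mathcal D:=\{(z,t):t\ge0,\ z\in D_t\}$, such that $G(z,\cdot)$ is measurable in $\{t\ge0:z\in D_t\}$ for each $z$; $G(\cdot,t)$ is holomorphic in $D_t$ for each $t\ge0$; and for each compact $K\subset\mathcal D$ there is a non-negative $k_K\in L^d(\mathrm{pr}_{\mathbb R}(K),\mathbb R)$ ($\mathrm{pr}_{\mathbb R}$ being the projection $(z,t)\mapsto t$) with $|G(z,t)|\le k_K(t)$ for all $(z,t)\in K$. Vector field associated with $(f_t)$: the weak holomorphic vector field $G$ of order $d$ over $(D_t)$, unique up to a null-set of values of $s$, such that for a.e. $s\ge0$, $\frac{\partial f_s(z)}{\partial s}=-G(z,s)f_s'(z)$ for all $z\in D_s$. Moreover, $\varphi_{s,t}:=f_t^{-1}\circ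 f_s$ satisfies, for each $s\ge0$ and $z\in D_s$, $\frac{d}{dt}\varphi_{s,t}(z)=G(\varphi_{s,t}(z),t)$ for a.e. $t\ge s$. Standard Loewner chain (with $r_\infty:=\lim_{t\to+\infty}r(t)$): a Loewner chain $(h_t)$ over $(D_t)$ such that $I(h_t\circ\gamma)=I(\gamma)$ for any closed curve $\gamma\subset D_t$ and any $t\ge0$; $\bigcup_{t\ge0}h_t(D_t)=\mathbb A_{r_\infty}$ if $0<r_\infty<1$; and $\bigcup_{t\ge0}h_t(D_t)\in\{\mathbb D^*,\ \mathbb C\setminus\overline{\mathbb D},\ \mathbb C^*\}$ if $r_\infty=0$. For every Loewner chain $(f_t)$ of order $d$ over $(D_t)$ there is a biholomorphism $F$ of $\bigcup_{t\ge0}f_t(D_t)$ onto a domain $L[(f_t)]$, which is one of $\mathbb D^*$, $\mathbb C\setminus\overline{\mathbb D}$, $\mathbb C^*$, $\mathbb A_\rho$ with $\rho>0$, such that $h_t:=F\circ f_t$ defines a standard Loewner chain of order $d$ over $(D_t)$; the domain $L[(f_t)]$ is uniquely determined. Conformal type: $(f_t)$ is of type I if $L[(f_t)]=\mathbb A_\rho$ for some $\rho>0$; of type II if $L[(f_t)]=\mathbb D^*$; of type III if $L[(f_t)]=\mathbb C\setminus\overline{\mathbb D}$; of type IV if $L[(f_t)]=\mathbb C^*$. *)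

(* Defs.v *)
From HB Require Import structures.
From mathcomp Require Import all_boot all_order all_algebra.
From mathcomp Require Import all_classical all_reals all_analysis.
From mathcomp.real_closed Require Export complex.

Set Implicit Arguments.
Unset Strict Implicit.
Unset Printing Implicit Defensive.

Import Order.TTheory GRing.Theory Num.Theory.
Import numFieldNormedType.Exports.

Local Open Scope classical_set_scope.
Local Open Scope ring_scope.
Local Open Scope complex_scope.

(* Functions on subsets of C = R[i] or of [0, +oo[ are represented by total
   functions whose values outside the domain are never constrained. The normed
   topology of C is the one carried by [R[i]^o]. *)

Section ComplexPlane.
Variable R : realType.
Implicit Types (D U V : set R[i]) (f : R[i] -> R[i]).

Definition cnorm (z : R[i]) : R := Normc.normc z.

Definition expi (x : R) : R[i] := cos x +i* sin x.

Definition annulus (r : R) : set R[i] := [set z | r < cnorm z < 1].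

Definition punctured_disk : set R[i] := annulus 0.

Definition disk_exterior : set R[i] := [set z | 1 < cnorm z].

Definition punctured_plane : set R[i] := [set z | z != 0].

(* Only used for open [D], where complex differentiability at a point does not
   depend on the values outside [D]. *)
Definition holomorphic_on D f :=
  forall z, D z -> derivable (f : R[i]^o -> R[i]^o) z 1.

Definition cderive f (z : R[i]) : R[i] := derive1 (f : R[i]^o -> R[i]^o) z.

Definition univalent_on D f := holomorphic_on D f /\ {in D &, injective f}.

Definition biholomorphism U V f :=
  [/\ holomorphic_on U f, f @` U = V &
      exists g, [/\ holomorphic_on V g, g @` V = U &
                    forall z, U z -> g (f z) = z]].

(* The mean of [f] over the circle of radius [rho] centred at 0, which is the
   free term of the Laurent expansion of [f] when [f] is holomorphic in
   [annulus r] and r < rho < 1. *)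
Definition circle_mean (rho : R) f : R[i] :=
  let avg (u : R[i] -> R) : R :=
    (2 * pi)^-1 * \int[lebesgue_measure]_(x in `[0, 2 * pi])
                     u (f (rho%:C * expi x)) in
  avg (@complex.Re R) +i* avg (@complex.Im R).

Definition closed_curve D (gam : R -> R[i]) :=
  [/\ {within `[0, 1], continuous (gam : R -> R[i]^o)}, gam 0 = gam 1 &
      forall x : R, 0 <= x <= 1 -> D (gam x)].

Definition has_index (gam : R -> R[i]) (n : int) :=
  (forall x : R, 0 <= x <= 1 -> gam x != 0) /\
  exists arg : R -> R,
    [/\ {within `[0, 1], continuous arg},
        forall x : R, 0 <= x <= 1 -> gam x = (cnorm (gam x))%:C * expi (arg x) &
        arg 1 - arg 0 = 2 * pi * n%:~R].

(* For a closed curve in C \ {0} there is exactly one such integer. *)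
Definition index0 (gam : R -> R[i]) : int := xget 0 [set n | has_index gam n].

End ComplexPlane.

Arguments punctured_disk {R}.
Arguments disk_exterior {R}.
Arguments punctured_plane {R}.

Section LebesgueClasses.
Variable R : realType.
Implicit Types (E : set R) (k f : R -> R) (d : \bar R).

(* The real line with the sigma-algebra of all Lebesgue measurable sets; the
   default one on [R] is the Borel sigma-algebra. *)
Definition lebesgueR := caratheodory_type (((@wlength R idfun)^*)%mu).

Definition lebesgue_measurable_fun E k :=
  measurable_fun (E : set lebesgueR) (k : lebesgueR -> R).

Definition in_Ld d E k :=
  lebesgue_measurable_fun E k /\
  ('N[@completed_lebesgue_measure R]_d[EFin \o (k \_ E)] < +oo)%E.

Definition absolutely_continuous_on (a b : R) f :=
  forall e : R, 0 < e -> exists2 del : R, 0 < del &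
    forall (n : nat) (x y : 'I_n -> R),
      (forall i, a <= x i /\ x i <= y i /\ y i <= b) ->
      trivIset [set: 'I_n] (fun i => `]x i, y i[%classic) ->
      \sum_(i < n) (y i - x i) < del ->
      \sum_(i < n) `|f (y i) - f (x i)| < e.

(* The class AC^d on [0, +oo[. The derivative of [f] exists almost everywhere
   there; its values elsewhere are irrelevant. *)
Definition AC_loc d f :=
  forall a b : R, 0 <= a -> a <= b ->
    absolutely_continuous_on a b f /\ in_Ld d `[a, b] (derive1 f).

End LebesgueClasses.

Section LoewnerChains.
Variable R : realType.
Implicit Types (d : \bar R) (r : R -> R) (f h : R -> R[i] -> R[i])
  (G : R[i] -> R -> R[i]) (L : set R[i]).

Definition omega (x : R) : R := if x == 0 then 0 else - pi / ln x.

(* The system of annuli D_t = annulus (r t), t >= 0, is represented by [r]. *)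
Definition canonical_domain_system d r :=
  [/\ forall t : R, 0 <= t -> 0 <= r t < 1,
      AC_loc d (omega \o r) &
      forall s t : R, 0 <= s -> s <= t -> omega (r t) <= omega (r s)].

Definition degenerate r := forall t : R, 0 <= t -> r t = 0.

Definition mixed_type r := exists T : R, [/\ 0 < T,
  forall t : R, 0 <= t < T -> 0 < r t & forall t : R, T <= t -> r t = 0].

Definition loewner_chain d r f :=
  [/\ forall t : R, 0 <= t -> univalent_on (annulus (r t)) (f t),
      forall s t : R, 0 <= s -> s < t ->
        f s @` annulus (r s) `<=` f t @` annulus (r t) &
      forall (S T : R) (K : set R[i]), 0 <= S -> S <= T ->
        compact (K : set R[i]^o) -> K `<=` annulus (r S) ->
        exists k : R -> R, [/\ in_Ld d `[S, T] k,
          forall x : R, S <= x <= T -> 0 <= k x &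
          forall (z : R[i]) (s t : R), K z -> S <= s -> s <= t -> t <= T ->
            ((cnorm (f s z - f t z))%:E <=
             \int[@completed_lebesgue_measure R]_(x in `[s, t]) (k x)%:E)%E]].

Definition weak_holomorphic_vector_field d r G :=
  [/\ forall z, let E := [set t : R | 0 <= t /\ annulus (r t) z] in
        lebesgue_measurable_fun E (fun t => complex.Re (G z t)) /\
        lebesgue_measurable_fun E (fun t => complex.Im (G z t)),
      forall t : R, 0 <= t -> holomorphic_on (annulus (r t)) (fun z => G z t) &
      forall K : set (R[i]^o * R)%type, compact K ->
        K `<=` [set p | 0 <= p.2 /\ annulus (r p.2) p.1] ->
        exists k : R -> R, [/\ in_Ld d (snd @` K) k,
          forall t, (snd @` K) t -> 0 <= k t &
          forall z t, K (z, t) -> cnorm (G z t) <= k t]].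

(* For s > 0 and z in D_s the points [z] and [h + s] lie in the domain of the
   chain for all small real [h], so the limit below is the partial derivative
   of f_s(z) with respect to s. *)
Definition associated_vector_field d r f G :=
  weak_holomorphic_vector_field d r G /\
  {ae @completed_lebesgue_measure R, forall s : R, 0 <= s ->
    forall z, annulus (r s) z ->
      (((h^-1)%:C * (f (h + s) z - f s z) : R[i]^o) @[h --> 0^'] -->
       (- G z s * cderive (f s) z : R[i]^o))}.

Definition chain_range r f : set R[i] :=
  \bigcup_(t in `[0, +oo[) (f t @` annulus (r t)).

Definition standard_loewner_chain d r h :=
  let roo : R := lim (r t @[t --> +oo]) in
  [/\ loewner_chain d r h,
      forall (t : R) gam, 0 <= t -> closed_curve (annulus (r t)) gam ->
        index0 (h t \o gam) = index0 gam,
      0 < roo < 1 -> chain_range r h = annulus roo &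
      roo = 0 -> [\/ chain_range r h = punctured_disk,
                     chain_range r h = disk_exterior |
                     chain_range r h = punctured_plane]].

Definition canonical_range L :=
  [\/ L = punctured_disk, L = disk_exterior, L = punctured_plane |
      exists2 rho : R, 0 < rho < 1 & L = annulus rho].

(* L = L[(f_t)]: this determines [L] uniquely. *)
Definition loewner_range d r f L :=
  canonical_range L /\
  exists F, biholomorphism (chain_range r f) L F /\
            standard_loewner_chain d r (fun t => F \o f t).

Definition type_I d r f :=
  exists2 rho : R, 0 < rho < 1 & loewner_range d r f (annulus rho).
Definition type_II d r f := loewner_range d r f (punctured_disk).
Definition type_III d r f := loewner_range d r f (disk_exterior).
Definition type_IV d r f := loewner_range d r f (punctured_plane).

End LoewnerChains.

(* Main.v *)
Require Import Defs.
From mathcomp Require Import all_boot all_order all_algebra.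
From mathcomp Require Import all_classical all_reals all_analysis.
From mathcomp Require Import measurable_realfun.
From mathcomp Require Import ring lra.

Set Implicit Arguments.
Unset Strict Implicit.
Unset Printing Implicit Defensive.

Import Order.TTheory GRing.Theory Num.Theory.
Import numFieldNormedType.Exports.

Local Open Scope classical_set_scope.
Local Open Scope ring_scope.
Local Open Scope complex_scope.

(** Let [T0] be a time from which on all the domains are the punctured disk.

    Why only two types occur. For [T0 <= s <= t] the transition map from time
    [s] to time [t] is a univalent self-map of the punctured disk, so it extends
    over the puncture, and it fixes 0 because for close times it is close to the
    identity on a circle ([ptrans_near_tends0], [ptrans_tends0]). Therefore all
    the functions [f t] with [T0 <= t] behave alike at the puncture: either they
    have the same finite limit, or they have a pole and then omit a common value
    ([pole_omitted]). In both cases one Moebius map [M], injective on the union of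
    the images, turns the chain into a chain of univalent functions [g t] of the
    whole disk with [g t 0 = 0] ([normalization]). By Schwarz's lemma
    [b t = |(g t)'(0)|] is nondecreasing.

    If [b] is bounded, the rotated inverses of the [g t] form a Cauchy sequence,
    since their transition maps have derivatives at 0 close to 1 and are
    therefore close to the identity; the limit maps the union of the images onto
    the disk ([chain_map_image]), and the range of [f] onto the punctured disk.
    If [b] is unbounded, a Koebe-type argument shows that the images of the [g t]
    exhaust the plane ([chain_unbounded_cover]), so [M] maps the range of [f] onto
    the punctured plane. In both cases the composition of the chain with the map
    obtained is a standard Loewner chain ([standard_of_map]): regularity in time
    passes to it because holomorphic maps are locally Lipschitz, and the index is
    preserved because the new functions, on the punctured disk, have the form
    [z * exp (P z)]; earlier times are reached by a homotopy.

    Why the integral decides. Dividing the Loewner equation for [g t] by [z] and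
    letting [z] tend to 0 gives that [ln b] has the derivative [- Re p(0)], where
    [p] is the extension over 0 of [G(., t) / z], and [p(0)] is the mean [N] by the
    mean value property. Hence the integral of [- Re N] over [[s, t]] is
    [ln (b t) - ln (b s)] ([log_integral]). On [[0, T0]] the integral is finite by
    the bounds on the vector field ([mean_vf_integrable]), so [I < +oo] means that
    [b] is bounded ([half_line_bounded], [half_line_finite]).

    The two analytic difficulties in [log_integral] are solved without
    differentiating an integral almost everywhere. The increments of [g t] are
    controlled, through Schwarz's lemma, by [(K t - K s) * |z|] with [K] a
    primitive of an integrable function. By Fatou's lemma, for almost every time
    the difference quotients of [K] are bounded along a subsequence
    ([dq_bounded_often]); this is enough to extend [G(., t) / z] over the puncture
    and to let [z] tend to 0 along those indices ([derivative_limit]). And a form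
    of Vitali's convergence theorem which only requires convergence at such
    indices ([vitali]) yields the fundamental theorem of calculus ([ac_ftc]). *)

(** * Complex differentiation in terms of the modulus *)

#[local] Arguments cnorm : simpl never.

Section ComplexBasics.
Variable R : realType.
Implicit Types (z w l : R[i]) (f g : R[i] -> R[i]).

Lemma cnormE z : `|z| = (cnorm z)%:C. Proof. by []. Qed.

Lemma cnorm_ge0 z : 0 <= cnorm z.
Proof. by rewrite -ler0c -cnormE. Qed.

Lemma cnormM z w : cnorm (z * w) = cnorm z * cnorm w.
Proof. exact: Normc.normcM. Qed.

Lemma cnormV z : cnorm z^-1 = (cnorm z)^-1.
Proof. exact: Normc.normcV. Qed.

Lemma cnormD z w : cnorm (z + w) <= cnorm z + cnorm w.
Proof. exact: le_normcD. Qed.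

Lemma cnormN z : cnorm (- z) = cnorm z.
Proof. exact: normcN. Qed.

Lemma cnormB z w : cnorm (z - w) <= cnorm z + cnorm w.
Proof. by rewrite -(cnormN w); exact: cnormD. Qed.

Lemma cnormC z w : cnorm (z - w) = cnorm (w - z).
Proof. by rewrite -cnormN opprB. Qed.

Lemma cnorm0 : cnorm (0 : R[i]) = 0. Proof. exact: Normc.normc0. Qed.

Lemma cnorm1 : cnorm (1 : R[i]) = 1. Proof. exact: Normc.normc1. Qed.

Lemma cnormX z n : cnorm (z ^+ n) = cnorm z ^+ n.
Proof. by elim: n => [|n IH]; rewrite ?cnorm1// !exprS cnormM IH. Qed.

Lemma cnorm_eq0 z : (cnorm z == 0) = (z == 0).
Proof.
by apply/eqP/eqP => [/Normc.eq0_normc //|->]; exact: cnorm0.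
Qed.

Lemma cnorm_gt0 z : (0 < cnorm z) = (z != 0).
Proof. by rewrite lt_neqAle cnorm_ge0 andbT eq_sym cnorm_eq0. Qed.

Lemma cnorm_real (x : R) : cnorm x%:C = `|x|.
Proof. by rewrite /cnorm /= expr0n addr0 sqrtr_sqr. Qed.

Lemma cnorm_nat (n : nat) : cnorm (n%:R : R[i]) = n%:R.
Proof. by rewrite -(rmorph_nat (real_complex R)) cnorm_real ger0_norm. Qed.

Lemma cnorm_i : cnorm ('i : R[i]) = 1.
Proof. by rewrite /cnorm /= expr0n add0r expr1n sqrtr1. Qed.

Lemma cnorm_sq z : cnorm z ^+ 2 = complex.Re z ^+ 2 + complex.Im z ^+ 2.
Proof. by case: z => a b; rewrite /cnorm /= sqr_sqrtr // addr_ge0 // sqr_ge0. Qed.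

Lemma Re_le_cnorm z : `|complex.Re z| <= cnorm z.
Proof.
rewrite -(ler_pXn2r (n := 2)) ?nnegrE ?cnorm_ge0 // real_normK ?num_real //.
by rewrite cnorm_sq lerDl sqr_ge0.
Qed.

Lemma Im_le_cnorm z : `|complex.Im z| <= cnorm z.
Proof.
rewrite -(ler_pXn2r (n := 2)) ?nnegrE ?cnorm_ge0 // real_normK ?num_real //.
by rewrite cnorm_sq lerDr sqr_ge0.
Qed.

Lemma cnorm_le_ReIm z : cnorm z <= `|complex.Re z| + `|complex.Im z|.
Proof.
case: z => a b /=; have -> : a +i* b = a%:C + 'i * b%:C by rewrite [LHS]complexE.
by apply: le_trans (cnormD _ _) _; rewrite cnormM cnorm_i mul1r !cnorm_real.
Qed.

Lemma cdist_triangle z w l : cnorm (z - w) <= cnorm (z - l) + cnorm (l - w).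
Proof. by rewrite -(subrKA l); exact: cnormD. Qed.

Lemma cnorm_sub_ge z w : cnorm z - cnorm w <= cnorm (z - w).
Proof.
rewrite lerBlDr -{1}(subrK w z).
exact: cnormD.
Qed.

Lemma cnorm_expi (x : R) : cnorm (expi x) = 1.
Proof. by rewrite /cnorm /expi /= cos2Dsin2 sqrtr1. Qed.

Lemma ReM z w : complex.Re (z * w) =
  complex.Re z * complex.Re w - complex.Im z * complex.Im w.
Proof. by case: z => a b; case: w. Qed.

Lemma ImM z w : complex.Im (z * w) =
  complex.Re z * complex.Im w + complex.Im z * complex.Re w.
Proof. by case: z => a b; case: w. Qed.

Lemma ReD z w : complex.Re (z + w) = complex.Re z + complex.Re w.
Proof. by case: z => a b; case: w. Qed.

Lemma ImD z w : complex.Im (z + w) = complex.Im z + complex.Im w.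
Proof. by case: z => a b; case: w. Qed.

Lemma ReN z : complex.Re (- z) = - complex.Re z.
Proof. by case: z. Qed.

Lemma ImN z : complex.Im (- z) = - complex.Im z.
Proof. by case: z. Qed.

Lemma ReZ (x : R) z : complex.Re (x%:C * z) = x * complex.Re z.
Proof. by rewrite ReM /= mul0r subr0. Qed.

Lemma ImZ (x : R) z : complex.Im (x%:C * z) = x * complex.Im z.
Proof. by rewrite ImM /= mul0r addr0. Qed.

(** Topological continuity and differentiability on the plane, restated with
    the real-valued modulus. *)

Definition ccont f z := forall e : R, 0 < e ->
  exists2 d : R, 0 < d & forall w, cnorm (w - z) < d -> cnorm (f w - f z) < e.

(** The remainder bound is the non-strict one, which also covers [w = z]; this
    avoids dividing by [w - z]. *)
Definition cd f z l := forall e : R, 0 < e ->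
  exists2 d : R, 0 < d & forall w, cnorm (w - z) < d ->
    cnorm (f w - f z - l * (w - z)) <= e * cnorm (w - z).

Lemma posc_real (e : R[i]) : 0 < e -> exists2 x : R, 0 < x & e = x%:C.
Proof.
case: e => a b; rewrite ltcE /= => /andP[/eqP -> a0]; by exists a.
Qed.

Lemma nbhs_cP (z : R[i]) (P : set R[i]) : nbhs (z : R[i]^o) P <->
  exists2 d : R, 0 < d & forall w, cnorm (w - z) < d -> P w.
Proof.
rewrite -(@nbhs_ballE R[i] R[i]^o); split.
- move=> [e /= e0 H]; have [x x0 ex] := posc_real e0.
  exists x => // w wd; apply: H; rewrite /ball /= ex.
  by rewrite -[`|_|]/((cnorm _)%:C) ltcR cnormC.
- move=> [d d0 H]; exists d%:C; first by rewrite /= ltcR.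
  move=> w; rewrite /ball /= -[`|_|]/((cnorm _)%:C) ltcR cnormC => h; exact: H.
Qed.

Lemma cvg_cP (T : topologicalType) (F : set_system T) {FF : Filter F}
    (f : T -> R[i]) (l : R[i]) :
  (f x @[x --> F] --> (l : R[i]^o)) <->
  forall e : R, 0 < e -> \forall x \near F, cnorm (f x - l) < e.
Proof.
split.
- move=> H e e0; apply: (H [set w | cnorm (w - l) < e]).
  by apply/nbhs_cP; exists e.
- move=> H A /nbhs_cP [d d0 dA]; have := H _ d0; apply: filterS => x; exact: dA.
Qed.

Lemma ccontP f z : ccont f z <-> {for z, continuous (f : R[i]^o -> R[i]^o)}.
Proof.
split.
- move=> H; apply/(@cvg_cP R[i]^o (nbhs (z : R[i]^o)) _ f) => e e0.
  by apply/nbhs_cP; exact: H.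
- move=> /(@cvg_cP R[i]^o (nbhs (z : R[i]^o)) _ f) H e e0.
  by have /nbhs_cP := H _ e0.
Qed.

Lemma ccont_near f g z : (exists2 d : R, 0 < d & forall w, cnorm (w - z) < d -> f w = g w) ->
  ccont f z -> ccont g z.
Proof.
move=> [d d0 fg] cf e e0; have [d1 d10 H] := cf e e0.
exists (Num.min d d1); first by rewrite lt_min d0.
move=> w; rewrite lt_min => /andP[wd wd1]; rewrite -fg // -fg ?H //.
by rewrite subrr cnorm0.
Qed.

Lemma ccont_cst l z : ccont (fun=> l) z.
Proof. by move=> e e0; exists 1 => // w _; rewrite subrr cnorm0. Qed.

Lemma ccont_id z : ccont id z.
Proof. by move=> e e0; exists e. Qed.

Lemma ccontD f g z : ccont f z -> ccont g z -> ccont (fun w => f w + g w) z.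
Proof. by move=> /ccontP cf /ccontP cg; apply/ccontP; exact: (continuousD cf cg). Qed.

Lemma ccontM f g z : ccont f z -> ccont g z -> ccont (fun w => f w * g w) z.
Proof. by move=> /ccontP cf /ccontP cg; apply/ccontP; exact: (continuousM cf cg). Qed.

Lemma ccontN f z : ccont f z -> ccont (fun w => - f w) z.
Proof. by move=> /ccontP cf; apply/ccontP; exact: (continuousN cf). Qed.

Lemma ccontB f g z : ccont f z -> ccont g z -> ccont (fun w => f w - g w) z.
Proof. by move=> cf cg; apply: ccontD => //; exact: ccontN. Qed.

Lemma ccontV f z : f z != 0 -> ccont f z -> ccont (fun w => (f w)^-1) z.
Proof. by move=> f0 /ccontP cf; apply/ccontP; exact: (continuousV f0 cf). Qed.

Lemma ccont_comp f g z : ccont f z -> ccont g (f z) -> ccont (fun w => g (f w)) z.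
Proof.
move=> cf cg e /cg [d d0 H]; have [d1 d10 H1] := cf _ d0; exists d1 => // w /H1; exact: H.
Qed.

(** Caratheodory's form of differentiability: it turns the rules of calculus
    into continuity of the slope [q]. *)
Lemma cd_slope f z l : cd f z l <->
  exists q : R[i] -> R[i], [/\ ccont q z, q z = l &
    exists2 d : R, 0 < d & forall w, cnorm (w - z) < d -> f w = f z + q w * (w - z)].
Proof.
split.
- move=> H; exists (fun w => if w == z then l else (f w - f z) / (w - z)).
  split; last 2 first.
  + by rewrite eqxx.
  + exists 1 => // w _; case: eqVneq => [->|wz]; first by rewrite subrr mulr0 addr0.
    by rewrite divfK ?subr_eq0 // addrC subrK.
  move=> e e0; have e20 : 0 < e / 2 by rewrite divr_gt0.
  have [d d0 {}H] := H _ e20; exists d => // w wd; rewrite eqxx.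
  case: eqVneq => [_|wz]; first by rewrite subrr cnorm0.
  have wz0 : w - z != 0 by rewrite subr_eq0.
  have -> : (f w - f z) / (w - z) - l = (f w - f z - l * (w - z)) / (w - z).
    by rewrite [in RHS]mulrBl mulfK.
  rewrite cnormM cnormV ltr_pdivrMr ?cnorm_gt0 //.
  apply: le_lt_trans (H _ wd) _; rewrite ltr_pM2r ?cnorm_gt0 //.
  by rewrite ltr_pdivrMr // ltr_pMr // ltr1n.
- move=> [q [cq ql [d d0 H]]] e e0; have [d1 d10 H1] := cq e e0.
  exists (Num.min d d1); first by rewrite lt_min d0.
  move=> w; rewrite lt_min => /andP[wd wd1].
  have -> : f w - f z - l * (w - z) = (q w - q z) * (w - z) by rewrite (H w wd) ql; ring.
  by rewrite cnormM ler_wpM2r ?cnorm_ge0 // ltW // H1.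
Qed.

Lemma cd_ccont f z l : cd f z l -> ccont f z.
Proof.
move=> /cd_slope [q [cq ql [d d0 H]]].
apply: (@ccont_near (fun w => f z + q w * (w - z))).
  by exists d => // w wd; rewrite -(H w wd).
apply: ccontD; first exact: ccont_cst.
by apply: ccontM => //; apply: ccontB; [exact: ccont_id|exact: ccont_cst].
Qed.

Lemma cd_near f g z l : (exists2 d : R, 0 < d & forall w, cnorm (w - z) < d -> f w = g w) ->
  cd f z l -> cd g z l.
Proof.
move=> [d d0 fg] cf e e0; have [d1 d10 H] := cf e e0.
exists (Num.min d d1); first by rewrite lt_min d0.
move=> w; rewrite lt_min => /andP[wd wd1]; rewrite -fg // -fg ?H //.
by rewrite subrr cnorm0.
Qed.

Lemma cd_cst l z : cd (fun=> l) z 0.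
Proof. by move=> e e0; exists 1 => // w _; rewrite mul0r !subr0 subrr cnorm0 mulr_ge0 ?cnorm_ge0 // ltW. Qed.

Lemma cd_id z : cd id z 1.
Proof. by move=> e e0; exists 1 => // w _; rewrite mul1r subrr cnorm0 mulr_ge0 ?cnorm_ge0 // ltW. Qed.

Lemma cdD f g z l m : cd f z l -> cd g z m -> cd (fun w => f w + g w) z (l + m).
Proof.
move=> /cd_slope [q [cq <- [d d0 H]]] /cd_slope [p [cp <- [d' d'0 H']]].
apply/cd_slope; exists (fun w => q w + p w); split => //; first exact: ccontD.
exists (Num.min d d'); first by rewrite lt_min d0.
by move=> w; rewrite lt_min => /andP[wd wd1]; rewrite (H w wd) (H' w wd1); ring.
Qed.

Lemma cdM f g z l m : cd f z l -> cd g z m ->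
  cd (fun w => f w * g w) z (l * g z + f z * m).
Proof.
move=> cf cg; have /cd_slope [q [cq <- [d d0 H]]] := cf.
have /cd_slope [p [cp <- [d' d'0 H']]] := cg.
apply/cd_slope; exists (fun w => q w * g z + f w * p w); split => //.
  apply: ccontD; first by apply: ccontM => //; exact: ccont_cst.
  by apply: ccontM => //; apply: cd_ccont cf.
exists (Num.min d d'); first by rewrite lt_min d0.
by move=> w; rewrite lt_min => /andP[wd wd1]; rewrite (H' w wd1) (H w wd); ring.
Qed.

Lemma cdZ (c : R[i]) f z l : cd f z l -> cd (fun w => c * f w) z (c * l).
Proof.
by move=> cf; have := cdM (cd_cst c z) cf; rewrite mul0r add0r.
Qed.

Lemma cdN f z l : cd f z l -> cd (fun w => - f w) z (- l).
Proof.
move=> /(cdZ (-1)); rewrite mulN1r; apply: cd_near.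
by exists 1 => // w _; rewrite mulN1r.
Qed.

Lemma cdB f g z l m : cd f z l -> cd g z m -> cd (fun w => f w - g w) z (l - m).
Proof. by move=> cf cg; apply: cdD => //; exact: cdN. Qed.

Lemma ccont_neq0 f z : ccont f z -> f z != 0 ->
  exists2 d : R, 0 < d & forall w, cnorm (w - z) < d -> f w != 0.
Proof.
move=> cf f0; have [d d0 H] := cf (cnorm (f z)) ltac:(by rewrite cnorm_gt0).
exists d => // w /H; apply: contraPneq => ->.
by rewrite sub0r cnormN ltxx.
Qed.

Lemma cdV f z l : f z != 0 -> cd f z l -> cd (fun w => (f w)^-1) z (- l / f z ^+ 2).
Proof.
move=> f0 cf; have [d2 d20 fn0] := ccont_neq0 (cd_ccont cf) f0.
have /cd_slope [q [cq <- [d d0 H]]] := cf.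
apply/cd_slope; exists (fun w => - q w / (f w * f z)); split => //.
  apply: ccontM; first exact: ccontN.
  apply: ccontV; first by rewrite mulf_neq0.
  by apply: ccontM; [exact: cd_ccont cf|exact: ccont_cst].
exists (Num.min d d2); first by rewrite lt_min d0.
move=> w; rewrite lt_min => /andP[wd wd1].
have fw0 := fn0 _ wd1.
have -> : - q w / (f w * f z) * (w - z) = - (q w * (w - z)) / (f w * f z) by ring.
have -> : q w * (w - z) = f w - f z by rewrite (H w wd); ring.
by field; rewrite f0.
Qed.

Lemma cd_comp f g z l m : cd f z l -> cd g (f z) m -> cd (fun w => g (f w)) z (m * l).
Proof.
move=> cf cg; have /cd_slope [q [cq <- [d d0 H]]] := cf.
have /cd_slope [p [cp <- [d' d'0 H']]] := cg.
have [d2 d20 H2] := cd_ccont cf d'0.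
apply/cd_slope; exists (fun w => p (f w) * q w); split => //.
  by apply: ccontM => //; apply: ccont_comp => //; apply: cd_ccont cf.
exists (Num.min d d2); first by rewrite lt_min d0.
move=> w; rewrite lt_min => /andP[wd wd2].
by rewrite [in LHS](H' _ (H2 w wd2)) -mulrA; congr (_ + _ * _); rewrite (H w wd); ring.
Qed.

Lemma cd_uniq f z l m : cd f z l -> cd f z m -> l = m.
Proof.
move=> cl cm; have c0 := cdB cl cm.
suff: cnorm (l - m) <= 0.
  by move=> h; apply/eqP; rewrite -subr_eq0 -cnorm_eq0 eq_le h cnorm_ge0.
rewrite leNgt; apply/negP => p0.
have [d d0 H] := c0 (cnorm (l - m) / 2) ltac:(by rewrite divr_gt0).
have d2 : 0 < d / 2 by rewrite divr_gt0.
have h1 : d / 2 < d by rewrite ltr_pdivrMr // ltr_pMr // ltr1n.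
have := H (z + (d / 2)%:C).
have -> : z + (d / 2)%:C - z = (d / 2)%:C by ring.
rewrite !subrr !sub0r !cnormN cnormM cnorm_real (ger0_norm (ltW d2)).
move=> /(_ h1); rewrite ler_pM2r // => h2.
have : cnorm (l - m) / 2 < cnorm (l - m) by rewrite ltr_pdivrMr // ltr_pMr // ltr1n.
by rewrite ltNge h2.
Qed.

Lemma cd_is_derive f z l : cd f z l -> is_derive (z : R[i]^o) 1 (f : R[i]^o -> R[i]^o) l.
Proof.
move=> H.
have C : (fun h : R[i]^o => h^-1 *: ((f \o shift z) (h *: (1 : R[i]^o)) - f z) : R[i]^o)
    @ 0^' --> (l : R[i]^o).
  apply/(@cvg_cP R[i]^o (0 : R[i]^o)^' _) => e e0.
  have [d d0 {}H] := H (e / 2) ltac:(by rewrite divr_gt0).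
  rewrite near_withinE; apply/nbhs_cP; exists d => // w wd w0 /=.
  have := H (w + z); rewrite addrK -(subr0 w) => /(_ wd); rewrite subr0 => {}H.
  have -> : w^-1 *: (f (w *: (1 : R[i]^o) + z) - f z) - l
    = (f (w + z) - f z - l * w) / w.
    rewrite -[_ *: (1 : R[i]^o)]/(w * 1) mulr1 [in RHS]mulrBl mulfK // mulrC; congr (_ - _).
  rewrite cnormM cnormV ltr_pdivrMr ?cnorm_gt0 //.
  apply: le_lt_trans H _; rewrite ltr_pM2r ?cnorm_gt0 //.
  by rewrite ltr_pdivrMr // ltr_pMr // ltr1n.
apply: DeriveDef; first by apply/cvg_ex; exists l.
exact: (cvg_lim (@norm_hausdorff _ _) C).
Qed.

Lemma derivable_cd f z : derivable (f : R[i]^o -> R[i]^o) z 1 -> cd f z (cderive f z).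
Proof.
move=> df; rewrite /cderive derive1E.
have C : (fun h : R[i]^o => h^-1 *: ((f \o shift z) (h *: (1 : R[i]^o)) - f z) : R[i]^o)
    @ 0^' --> ('D_1 (f : R[i]^o -> R[i]^o) z : R[i]^o) by [].
move=> e e0; have /(@cvg_cP R[i]^o (0 : R[i]^o)^' _) /(_ e e0) := C.
rewrite near_withinE => /nbhs_cP [d d0 H]; exists d => // w wd.
have [->|wz] := eqVneq w z; first by rewrite !subrr mulr0 subrr cnorm0 mulr0.
have wz0 : w - z != 0 by rewrite subr_eq0.
move/(_ (w - z)): H; rewrite subr0 => /(_ wd wz0) /=.
have -> : ((w - z) *: (1 : R[i]^o) : R[i]^o) = w - z by exact: mulr1.
rewrite subrK => /ltW; set m := 'D_ _ _ _ => h.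
have -> : f w - f z - m * (w - z) = ((w - z)^-1 * (f w - f z) - m) * (w - z).
  by rewrite mulrBl mulrAC mulVf // mul1r.
by rewrite cnormM ler_wpM2r // cnorm_ge0.
Qed.

Lemma cd_derivable f z l : cd f z l -> derivable (f : R[i]^o -> R[i]^o) z 1.
Proof. by move=> /cd_is_derive. Qed.

Lemma cd_cderive f z l : cd f z l -> cderive f z = l.
Proof. by move=> h; apply: (cd_uniq _ h); apply: derivable_cd; apply: cd_derivable h. Qed.

Lemma holP U f : holomorphic_on U f <-> forall z, U z -> cd f z (cderive f z).
Proof.
by split=> H z /H; [exact: derivable_cd|exact: cd_derivable].
Qed.

Lemma hol_cd U f z : holomorphic_on U f -> U z -> cd f z (cderive f z).
Proof. by move=> /holP; apply. Qed.

End ComplexBasics.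

(** * Integrals of complex functions of a real variable *)

Section ComplexIntegral.
Variable R : realType.
Implicit Types (g h : R -> R[i]) (a b c d m : R).
Notation mu := (@lebesgue_measure R).

Definition rcont g (x : R) := forall e : R, 0 < e ->
  exists2 d : R, 0 < d & forall y, `|y - x| < d -> cnorm (g y - g x) < e.

Definition contI a b g := forall x, a <= x <= b -> rcont g x.

Definition cint a b g : R[i] :=
  (\int[mu]_(x in `[a, b]) complex.Re (g x)) +i*
  (\int[mu]_(x in `[a, b]) complex.Im (g x)).

Lemma rcont_Re g x : rcont g x -> {for x, continuous (fun y => complex.Re (g y))}.
Proof.
move=> cg; apply/cvgrPdist_lt => e e0; have [d d0 H] := cg e e0.
near=> y; rewrite -opprB normrN -ReN -ReD.
apply: le_lt_trans (Re_le_cnorm _) _; apply: H.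
by near: y; apply/nbhs_ballP; exists d => // y; rewrite /ball /= distrC.
Unshelve. all: by end_near. Qed.

Lemma rcont_Im g x : rcont g x -> {for x, continuous (fun y => complex.Im (g y))}.
Proof.
move=> cg; apply/cvgrPdist_lt => e e0; have [d d0 H] := cg e e0.
near=> y; rewrite -opprB normrN -ImN -ImD.
apply: le_lt_trans (Im_le_cnorm _) _; apply: H.
by near: y; apply/nbhs_ballP; exists d => // y; rewrite /ball /= distrC.
Unshelve. all: by end_near. Qed.

Lemma rcont_comp (f : R[i] -> R[i]) g x : rcont g x -> ccont f (g x) -> rcont (fun y => f (g y)) x.
Proof. by move=> cg cf e /cf[d d0 H]; have [d' d'0 H'] := cg d d0; exists d' => // y /H'; exact: H. Qed.

Lemma rcontD g h x : rcont g x -> rcont h x -> rcont (fun y => g y + h y) x.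
Proof.
move=> cg ch e e0; have e2 : 0 < e / 2 by rewrite divr_gt0.
have [d d0 H] := cg _ e2; have [d' d'0 H'] := ch _ e2.
exists (Num.min d d'); first by rewrite lt_min d0.
move=> y; rewrite lt_min => /andP[/H h1 /H' h2].
have -> : g y + h y - (g x + h x) = (g y - g x) + (h y - h x) by ring.
by apply: le_lt_trans (cnormD _ _) _; rewrite (splitr e) ltrD.
Qed.

Lemma rcontZ (k : R[i]) g x : rcont g x -> rcont (fun y => k * g y) x.
Proof.
move=> cg; apply: (@rcont_comp (fun z => k * z)) => //.
by apply: ccontM; [exact: ccont_cst|exact: ccont_id].
Qed.

Lemma rcont_eq g h x : g =1 h -> rcont g x -> rcont h x.
Proof.
by move=> gh cg e /cg[d d0 H]; exists d => // y /H; rewrite !gh.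
Qed.

Lemma continuous_segment_integrable a b (u : R -> R) :
  (forall x, a <= x <= b -> {for x, continuous u}) ->
  mu.-integrable `[a, b] (EFin \o u).
Proof.
move=> cu; apply: continuous_compact_integrable; first exact: segment_compact.
by apply: continuous_in_subspaceT => x; rewrite inE /= in_itv /= => /cu.
Qed.

Lemma contI_Re a b g : contI a b g -> mu.-integrable `[a, b] (EFin \o (fun x => complex.Re (g x))).
Proof. by move=> cg; apply: continuous_segment_integrable => x /cg; exact: rcont_Re. Qed.

Lemma contI_Im a b g : contI a b g -> mu.-integrable `[a, b] (EFin \o (fun x => complex.Im (g x))).
Proof. by move=> cg; apply: continuous_segment_integrable => x /cg; exact: rcont_Im. Qed.

Hint Resolve contI_Re contI_Im : core.

Lemma contIZ a b (k : R[i]) g : contI a b g -> contI a b (fun y => k * g y).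
Proof. by move=> cg x xab; apply: rcontZ; exact: cg. Qed.

Lemma cint_eq a b g h : (forall x, a <= x <= b -> g x = h x) -> cint a b g = cint a b h.
Proof.
move=> gh; congr (_ +i* _); apply: eq_Rintegral => x; rewrite inE /= in_itv /= => xab;
  by rewrite gh.
Qed.

Lemma cintD a b g h : contI a b g -> contI a b h ->
  cint a b (fun x => g x + h x) = cint a b g + cint a b h.
Proof.
move=> cg ch; rewrite /cint; set u := RHS.
have -> : u = (\int[mu]_(x in `[a, b]) complex.Re (g x) + \int[mu]_(x in `[a, b]) complex.Re (h x)) +i*
  (\int[mu]_(x in `[a, b]) complex.Im (g x) + \int[mu]_(x in `[a, b]) complex.Im (h x)) by [].
rewrite -!RintegralD //; try exact: contI_Re; try exact: contI_Im.
by congr (_ +i* _); apply: eq_Rintegral => x _; rewrite ?ReD ?ImD.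
Qed.

Lemma RintZ a b (u : R -> R) k : mu.-integrable `[a, b] (EFin \o u) ->
  \int[mu]_(x in `[a, b]) (k * u x) = k * \int[mu]_(x in `[a, b]) u x.
Proof. by move=> iu; rewrite RintegralZl. Qed.

Lemma integrable_RZ a b (u : R -> R) k : mu.-integrable `[a, b] (EFin \o u) ->
  mu.-integrable `[a, b] (EFin \o (fun x => k * u x)).
Proof.
move=> iu; have -> : EFin \o (fun x => k * u x) = (fun x => k%:E * (EFin \o u) x)%E.
  by apply/funext => x /=; rewrite EFinM.
exact: integrableZl.
Qed.

Lemma cintZ a b (k : R[i]) g : contI a b g ->
  cint a b (fun x => k * g x) = k * cint a b g.
Proof.
move=> cg; apply/eqP; rewrite eq_complex ReM ImM /=.
rewrite -!RintZ //; try exact: contI_Re; try exact: contI_Im.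
rewrite -RintegralB //; try (apply: integrable_RZ; [exact: contI_Re || exact: contI_Im]).
rewrite -RintegralD //; try (apply: integrable_RZ; [exact: contI_Re || exact: contI_Im]).
by apply/andP; split; apply/eqP; apply: eq_Rintegral => x _; rewrite ?ReM ?ImM.
Qed.

Lemma Rint_split a b m (u : R -> R) : a <= m <= b -> mu.-integrable `[a, b] (EFin \o u) ->
  \int[mu]_(x in `[a, b]) u x = \int[mu]_(x in `[a, m]) u x + \int[mu]_(x in `[m, b]) u x.
Proof.
move=> /andP[am mb] iu.
have := @Rintegral_itvB _ u (BLeft a) (BRight b) m iu.
rewrite !bnd_simp => /(_ am mb) H.
rewrite -(@Rintegral_itv_obnd_cbnd _ m (BRight b)) -?H; first by rewrite addrC subrK.
apply: integrableS iu => //; apply: subset_itvr.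
by rewrite bnd_simp.
Qed.

Lemma cint_split a b m g : a <= m <= b -> contI a b g ->
  cint a b g = cint a m g + cint m b g.
Proof.
move=> amb cg; rewrite /cint (Rint_split amb (contI_Re cg)).
by rewrite (Rint_split amb (contI_Im cg)).
Qed.

Lemma Rint_cst a b (k : R) : a <= b -> \int[mu]_(x in `[a, b]) k = k * (b - a).
Proof.
move=> ab; rewrite Rintegral_cst //; congr (_ * _).
have E : mu `[a, b]%classic = (if (a < b)%R then (b - a)%:E else 0%E).
  by rewrite lebesgue_measure_itv /= lte_fin EFinB.
apply: (etrans (congr1 fine E)).
by move: ab; rewrite le_eqVlt => /predU1P[->|->] //=; rewrite ltxx subrr.
Qed.

Lemma cint_cst a b (k : R[i]) : a <= b -> cint a b (fun=> k) = k * (b - a)%:C.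
Proof.
move=> ab; rewrite /cint !Rint_cst //.
by case: k => x y /=; rewrite -[RHS]/(Complex _ _) mulr0 subr0 mulr0 add0r.
Qed.

Lemma rcont_cst (k : R[i]) x : rcont (fun=> k) x.
Proof. by move=> e e0; exists 1 => // y _; rewrite subrr cnorm0. Qed.

(** Rotating the value of the integral onto the positive reals reduces the
    estimate to the real part of a rotated integrand. *)
Lemma cint_norm a b g M : a <= b -> contI a b g ->
  (forall x, a <= x <= b -> cnorm (g x) <= M) -> cnorm (cint a b g) <= M * (b - a).
Proof.
move=> ab cg gM; set v := cint a b g.
have M0 : 0 <= M by apply: le_trans (cnorm_ge0 (g a)) (gM a _); rewrite lexx.
have [->|v0] := eqVneq v 0; first by rewrite cnorm0 mulr_ge0 // subr_ge0.
have nv : cnorm v != 0 by rewrite cnorm_eq0.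
(* [u] is the unimodular number that rotates [v] onto the positive reals *)
pose u := (cnorm v)%:C * v^-1.
have uv : u * v = (cnorm v)%:C by rewrite -mulrA mulVf // mulr1.
have nu : cnorm u = 1.
  by rewrite cnormM cnorm_real cnormV ger0_norm ?cnorm_ge0 // mulfV.
rewrite -[leLHS]/(complex.Re (cnorm v)%:C) -uv -cintZ // /= -Rint_cst //.
apply: le_Rintegral => //.
- by apply: contI_Re; exact: contIZ.
- by apply: continuous_segment_integrable => x _; exact: cvg_cst.
- move=> x /=; rewrite in_itv /= => /gM; apply: le_trans.
  rewrite -[leRHS]mul1r -nu -cnormM.
  by apply: le_trans (Re_le_cnorm _); exact: ler_norm.
Qed.

Lemma Rint_FTC a b (u U : R -> R) : a <= b ->
  (forall x : R, is_derive x (1 : R) U (u x)) -> continuous u ->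
  \int[mu]_(x in `[a, b]) u x = U b - U a.
Proof.
rewrite le_eqVlt => /predU1P[->|ab] dU cu; first by rewrite set_itv1 Rintegral_set1 subrr.
rewrite /Rintegral (@continuous_FTC2 R u U) //=.
- exact: continuous_subspaceT.
- have cU : continuous U.
    by move=> x; apply/differentiable_continuous/derivable1_diffP; have [] := dU x.
  split => [x _||]; first by have [] := dU x.
  + by apply: cvg_at_right_filter; exact: cU.
  + by apply: cvg_at_left_filter; exact: cU.
- by move=> x _; rewrite derive1E; have [] := dU x.
Qed.

Lemma Rint_id a b : a <= b -> \int[mu]_(x in `[a, b]) x = (b ^+ 2 - a ^+ 2) / 2.
Proof.
move=> ab.
have dU : forall x : R, is_derive x (1 : R) (fun x => 2^-1 * x ^+ 2) x.
  by move=> x; apply: is_derive_eq; rewrite /GRing.scale /=; field.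
rewrite (Rint_FTC ab dU); first by field.
by move=> x; exact: cvg_id.
Qed.

Lemma cint_affine a b (k l : R[i]) : a <= b ->
  cint a b (fun x => k + l * x%:C) = k * (b - a)%:C + l * ((b ^+ 2 - a ^+ 2) / 2)%:C.
Proof.
move=> ab; have ci : contI a b (fun x => x%:C).
  move=> x _ e e0; exists e => // y yx.
  by rewrite -rmorphB cnorm_real.
rewrite cintD; [|by move=> x _; exact: rcont_cst|exact: contIZ].
rewrite cint_cst // cintZ //; congr (_ + _ * _).
by rewrite /cint /= Rint_id // Rint_cst // mul0r.
Qed.

End ComplexIntegral.

(** * Goursat's theorem for rectangles *)

Section Goursat.
Variable R : realType.
Implicit Types (g h : R[i] -> R[i]) (a b c d m n : R).

Lemma cplxE (x y : R) : x +i* y = x%:C + 'i * y%:C.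
Proof. by rewrite [LHS]complexE. Qed.

(** The horizontal and vertical edges enter separately because a rectangle is
    cut by splitting two parallel edges. *)
Definition hint g c a b := cint a b (fun x => g (x +i* c)).
Definition vint g a c d := cint c d (fun y => g (a +i* y)).
Definition bint g a b c d : R[i] :=
  hint g c a b - hint g d a b + 'i * (vint g b c d - vint g a c d).

Definition edge_cont g a b c d :=
  [/\ contI a b (fun x => g (x +i* c)), contI a b (fun x => g (x +i* d)),
      contI c d (fun y => g (a +i* y)) & contI c d (fun y => g (b +i* y))].

Lemma ccont_rconth g x c : ccont g (x +i* c) -> rcont (fun x => g (x +i* c)) x.
Proof.
move=> cg; apply: (@rcont_comp _ g (fun x => x +i* c)) => // e e0.
exists e => // y yx; have -> : (y +i* c) - (x +i* c) = (y - x)%:C.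
  by apply/eqP; rewrite eq_complex /= subrr !eqxx.
by rewrite cnorm_real.
Qed.

Lemma ccont_rcontv g a y : ccont g (a +i* y) -> rcont (fun y => g (a +i* y)) y.
Proof.
move=> cg; apply: (@rcont_comp _ g (fun y => a +i* y)) => // e e0.
exists e => // y' yx; have -> : (a +i* y') - (a +i* y) = 'i * (y' - y)%:C.
  by apply/eqP; rewrite eq_complex /=; apply/andP; split; apply/eqP; ring.
by rewrite cnormM cnorm_i mul1r cnorm_real.
Qed.

Definition rect_cont g a b c d :=
  forall x y, a <= x <= b -> c <= y <= d -> ccont g (x +i* y).

Lemma rect_edge g a b c d : a <= b -> c <= d -> rect_cont g a b c d -> edge_cont g a b c d.
Proof.
move=> ab cd H; split=> x xi; (apply: ccont_rconth || apply: ccont_rcontv); apply: H;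
  by rewrite ?lexx ?ab ?cd.
Qed.

Lemma bint_splitx g a b c d m : a <= m <= b ->
  contI a b (fun x => g (x +i* c)) -> contI a b (fun x => g (x +i* d)) ->
  bint g a b c d = bint g a m c d + bint g m b c d.
Proof.
move=> amb h1 h2; rewrite /bint /hint (cint_split amb h1) (cint_split amb h2).
by ring.
Qed.

Lemma bint_splity g a b c d m : c <= m <= d ->
  contI c d (fun y => g (a +i* y)) -> contI c d (fun y => g (b +i* y)) ->
  bint g a b c d = bint g a b c m + bint g a b m d.
Proof.
move=> cmd h1 h2; rewrite /bint /vint (cint_split cmd h1) (cint_split cmd h2).
by ring.
Qed.

Lemma bintD g h a b c d : edge_cont g a b c d -> edge_cont h a b c d ->
  bint (fun z => g z + h z) a b c d = bint g a b c d + bint h a b c d.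
Proof.
move=> [g1 g2 g3 g4] [h1 h2 h3 h4]; rewrite /bint /hint /vint !cintD //.
by ring.
Qed.

Lemma bint_norm g a b c d M : a <= b -> c <= d -> edge_cont g a b c d ->
  (forall x y, a <= x <= b -> c <= y <= d ->
     (x == a) || (x == b) || (y == c) || (y == d) -> cnorm (g (x +i* y)) <= M) ->
  cnorm (bint g a b c d) <= 2 * M * ((b - a) + (d - c)).
Proof.
move=> ab cd [g1 g2 g3 g4] gM.
have H1 : cnorm (hint g c a b) <= M * (b - a).
  by apply: cint_norm => // x xab; apply: gM; rewrite ?lexx ?cd // eqxx !orbT.
have H2 : cnorm (hint g d a b) <= M * (b - a).
  by apply: cint_norm => // x xab; apply: gM; rewrite ?lexx ?cd // eqxx !orbT.
have H3 : cnorm (vint g a c d) <= M * (d - c).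
  by apply: cint_norm => // x xab; apply: gM; rewrite ?lexx ?ab // eqxx ?orbT.
have H4 : cnorm (vint g b c d) <= M * (d - c).
  by apply: cint_norm => // x xab; apply: gM; rewrite ?lexx ?ab // eqxx ?orbT.
apply: le_trans (cnormD _ _) _; rewrite cnormM cnorm_i mul1r.
have := cnormB (hint g c a b) (hint g d a b).
have := cnormB (vint g b c d) (vint g a c d).
lra.
Qed.

(** An affine function has a primitive, so this case of the theorem is a
    direct computation; it disposes of the linear part in [goursat]. *)
Lemma bint_affine (k l : R[i]) a b c d : a <= b -> c <= d ->
  bint (fun z => k + l * z) a b c d = 0.
Proof.
move=> ab cd; rewrite /bint /hint /vint.
have E e : cint a b (fun x => k + l * (x +i* e)) =
   (k + l * 'i * e%:C) * (b - a)%:C + l * ((b ^+ 2 - a ^+ 2) / 2)%:C.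
  rewrite -cint_affine //; apply: cint_eq => x _.
  by rewrite (cplxE x e); ring.
have F e : cint c d (fun y => k + l * (e +i* y)) =
   (k + l * e%:C) * (d - c)%:C + (l * 'i) * ((d ^+ 2 - c ^+ 2) / 2)%:C.
  rewrite -cint_affine //; apply: cint_eq => y _.
  by rewrite (cplxE e y); ring.
rewrite !E !F !rmorphM !rmorphB /= !rmorphXn /=.
have -> : ((2^-1)%:C : R[i]) = 2^-1 by rewrite fmorphV rmorph_nat.
move: ('i : R[i]) => I; ring.
Qed.

Lemma nested_point (u v : nat -> R) : (forall n : nat, u n <= u n.+1) -> (forall n : nat, v n.+1 <= v n) ->
  (forall n : nat, u n <= v n) -> exists x, forall n : nat, u n <= x <= v n.
Proof.
move=> iu dv uv.
have mu (n k : nat) : u n <= u (n + k)%N.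
  by elim: k => [|k IH]; rewrite ?addn0 // addnS (le_trans IH).
have mv (n k : nat) : v (n + k)%N <= v n.
  by elim: k => [|k IH]; rewrite ?addn0 // addnS (le_trans (dv _)).
have uvk (n k : nat) : u n <= v k.
  by apply: le_trans (mu n k) (le_trans (uv _) _); rewrite addnC.
have hs : has_sup (range u).
  by split; [exists (u 0%N), 0%N|exists (v 0%N) => _ [n _ <-]].
exists (sup (range u)) => n; apply/andP; split.
  by apply: ub_le_sup; [case: hs|exists n].
by apply: ge_sup; [case: hs|move=> _ [k _ <-]].
Qed.

(** A rectangle on which the boundary integral exceeds [e] times the square of
    the half perimeter has a quarter with the same property, since the half
    perimeter is halved and there are four quarters. *)
Lemma bint_quarter g a b c d e : a <= b -> c <= d -> rect_cont g a b c d ->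
  e * (b - a + (d - c)) ^+ 2 < cnorm (bint g a b c d) ->
  exists a' b' c' d', [/\ a <= a', a' <= b', b' <= b, b' - a' = (b - a) / 2 &
    [/\ c <= c', c' <= d', d' <= d, d' - c' = (d - c) / 2 &
    e * (b' - a' + (d' - c')) ^+ 2 < cnorm (bint g a' b' c' d')]].
Proof.
move=> ab cd cg H.
pose m := (a + b) / 2; pose n := (c + d) / 2.
have am : a <= m by rewrite /m; lra.
have mb : m <= b by rewrite /m; lra.
have cn : c <= n by rewrite /n; lra.
have nd : n <= d by rewrite /n; lra.
have ma2 : m - a = (b - a) / 2 by rewrite /m; field.
have bm2 : b - m = (b - a) / 2 by rewrite /m; field.
have nc2 : n - c = (d - c) / 2 by rewrite /n; field.
have dn2 : d - n = (d - c) / 2 by rewrite /n; field.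
have [g1 g2 g3 g4] := rect_edge ab cd cg.
have gm : contI c d (fun y => g (m +i* y)).
  by move=> y yi; apply: ccont_rcontv; apply: cg => //; rewrite am mb.
have E : bint g a b c d = (bint g a m c n + bint g a m n d) + (bint g m b c n + bint g m b n d).
  rewrite (@bint_splitx g a b c d m) ?am // (@bint_splity g a m c d n) ?cn //.
  by rewrite (@bint_splity g m b c d n) ?cn.
have [h1|h1] := ltP (e * (m - a + (n - c)) ^+ 2) (cnorm (bint g a m c n)).
  by exists a, m, c, n; split.
have [h2|h2] := ltP (e * (m - a + (d - n)) ^+ 2) (cnorm (bint g a m n d)).
  by exists a, m, n, d; split.
have [h3|h3] := ltP (e * (b - m + (n - c)) ^+ 2) (cnorm (bint g m b c n)).
  by exists m, b, c, n; split.
have [h4|h4] := ltP (e * (b - m + (d - n)) ^+ 2) (cnorm (bint g m b n d)).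
  by exists m, b, n, d; split.
exfalso; move: H; rewrite ltNge => /negP; apply; rewrite E.
apply: le_trans (cnormD _ _) _.
have := cnormD (bint g a m c n) (bint g a m n d).
have := cnormD (bint g m b c n) (bint g m b n d).
have -> : e * (b - a + (d - c)) ^+ 2 = e * (m - a + (n - c)) ^+ 2 +
  e * (m - a + (d - n)) ^+ 2 + (e * (b - m + (n - c)) ^+ 2 + e * (b - m + (d - n)) ^+ 2).
  by rewrite /m /n; field.
move: (lerD (lerD h1 h2) (lerD h3 h4)) => h p q; apply: le_trans h.
exact: lerD.
Qed.

Lemma half_lt_eps (x e : R) : 0 < e -> exists n : nat, x / 2 ^+ n < e.
Proof.
move=> e0; exists (Num.truncn (`|x| / e)).+1.
rewrite ltr_pdivrMr ?exprn_gt0 //.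
have h : `|x| / e < (Num.truncn (`|x| / e)).+1%:R by rewrite truncnS_gt.
apply: le_lt_trans (ler_norm _) _.
move: h; rewrite ltr_pdivrMr // mulrC => /lt_le_trans; apply.
rewrite ler_pM2l // -natrX ler_nat; apply: ltnW; exact: ltn_expl.
Qed.

(** Repeated quartering leads to a point of the rectangle at which the linear
    approximation of [g] contributes nothing and its error is too small for
    the assumed lower bound. *)
Lemma goursat g a b c d : a <= b -> c <= d ->
  (forall x y, a <= x <= b -> c <= y <= d -> exists l, cd g (x +i* y) l) ->
  bint g a b c d = 0.
Proof.
move=> ab cdd dg.
have cg : rect_cont g a b c d by move=> x y xi yi; have [l /cd_ccont] := dg x y xi yi.
apply/eqP; rewrite -cnorm_eq0; apply/eqP/le_anti; rewrite cnorm_ge0 andbT leNgt.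
apply/negP => B0.
pose s0 := b - a + (d - c).
pose e := cnorm (bint g a b c d) / (2 * (s0 ^+ 2 + 1)).
have s1 : 0 < s0 ^+ 2 + 1 by rewrite ltr_wpDl ?sqr_ge0.
have e0 : 0 < e by rewrite divr_gt0 // mulr_gt0.
pose good (q : (R * R) * (R * R)) := [/\ a <= q.1.1, q.1.1 <= q.1.2, q.1.2 <= b &
  [/\ c <= q.2.1, q.2.1 <= q.2.2, q.2.2 <= d &
   e * (q.1.2 - q.1.1 + (q.2.2 - q.2.1)) ^+ 2 < cnorm (bint g q.1.1 q.1.2 q.2.1 q.2.2)]].
pose next (q q' : (R * R) * (R * R)) := [/\ q.1.1 <= q'.1.1, q'.1.2 <= q.1.2,
  q.2.1 <= q'.2.1, q'.2.2 <= q.2.2 &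
  (q'.1.2 - q'.1.1) = (q.1.2 - q.1.1) / 2 /\ (q'.2.2 - q'.2.1) = (q.2.2 - q.2.1) / 2].
have step : forall q : {q | good q}, exists q' : {q | good q}, next (sval q) (sval q').
  move=> [[[a1 b1] [c1 d1]] [/= aa1 ab1 bb1 [cc1 cd1 dd1 H]]].
  have cg1 : rect_cont g a1 b1 c1 d1.
    move=> x y /andP[x1 x2] /andP[y1 y2]; apply: cg.
      by rewrite (le_trans aa1 x1) (le_trans x2 bb1).
    by rewrite (le_trans cc1 y1) (le_trans y2 dd1).
  have [a2 [b2 [c2 [d2 [h1 h2 h3 h4 [h5 h6 h7 h8 h9]]]]]] := bint_quarter ab1 cd1 cg1 H.
  have gq : good ((a2, b2), (c2, d2)).
    by split=> /=; rewrite ?(le_trans aa1) ?(le_trans h3) //; split=> //; rewrite ?(le_trans cc1) ?(le_trans h7).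
  by exists (exist _ _ gq).
have g0 : good ((a, b), (c, d)).
  split=> //=; split=> //=; rewrite -/s0 /e.
  rewrite mulrAC ltr_pdivrMr ?mulr_gt0 // ltr_pM2l // .
  have := sqr_ge0 s0; lra.
have [F HF] := choice step.
pose q (n : nat) := sval (iter n F (exist _ _ g0)).
have qg (n : nat) : good (q n) by rewrite /q; case: (iter _ _ _).
have qn (n : nat) : next (q n) (q n.+1) by rewrite /q iterS; exact: HF.
have [x Hx] : exists x, forall n : nat, (q n).1.1 <= x <= (q n).1.2.
  by apply: nested_point => n; [case: (qn n)|case: (qn n)|case: (qg n)].
have [y Hy] : exists y, forall n : nat, (q n).2.1 <= y <= (q n).2.2.
  by apply: nested_point => n; [case: (qn n)|case: (qn n)|case: (qg n) => _ _ _ []].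
have sz (n : nat) : (q n).1.2 - (q n).1.1 + ((q n).2.2 - (q n).2.1) = s0 / 2 ^+ n.
  elim: n => [|n IH]; first by rewrite /q /= expr0 divr1.
  have [_ _ _ _ [-> ->]] := qn n; rewrite -mulrDl IH exprS.
  by field; rewrite expf_neq0.
have [l Hl] := dg x y (Hx 0%N) (Hy 0%N).
have e4 : 0 < e / 4 by rewrite divr_gt0.
have [del del0 {}Hl] := Hl _ e4.
have [n Hn] := half_lt_eps s0 del0.
have := qg n; have := sz n; have := Hx n; have := Hy n.
case: (q n) => [[a1 b1] [c1 d1]] /= /andP[cy yd] /andP[ax xb] sz1 [aa1 ab1 bb1 [cc1 cd1 dd1]].
apply/negP; rewrite -leNgt.
set p := x +i* y in Hl.
pose L z := (g p - l * p) + l * z.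
pose E z := g z - g p - l * (z - p).
have cg1 : rect_cont g a1 b1 c1 d1.
  move=> x' y' /andP[x1 x2] /andP[y1 y2]; apply: cg.
    by rewrite (le_trans aa1 x1) (le_trans x2 bb1).
  by rewrite (le_trans cc1 y1) (le_trans y2 dd1).
have cL z : ccont L z.
  apply: ccontD; first exact: ccont_cst.
  by apply: ccontM; [exact: ccont_cst|exact: ccont_id].
have cE : rect_cont E a1 b1 c1 d1.
  move=> x' y' h1 h2; apply: (@ccont_near _ (fun z => g z - L z)).
    by exists 1 => // w _; rewrite /E /L; ring.
  by apply: ccontB; [exact: cg1|exact: cL].
have -> : g = (fun z => L z + E z).
  by apply/funext => z; rewrite /E /L; ring.
rewrite bintD; [|by apply: rect_edge => // *; exact: cL|exact: rect_edge].
(* only the error term of the linear approximation at the limit point is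
   left *)
rewrite bint_affine // add0r.
set s := b1 - a1 + (d1 - c1) in sz1 *.
have s_ge0 : 0 <= s by rewrite /s addr_ge0 ?subr_ge0.
apply: le_trans (@bint_norm E a1 b1 c1 d1 (e / 4 * s) ab1 cd1 _ _) _.
- exact: rect_edge.
- move=> x' y' /andP[h1 h2] /andP[h3 h4] _.
  have hs : cnorm (x' +i* y' - p) <= s.
    apply: le_trans (cnorm_le_ReIm _) _ => /=; rewrite /s.
    by apply: lerD; rewrite ler_norml; apply/andP; split; clear -ax xb cy yd h1 h2 h3 h4; lra.
  have hl : cnorm (x' +i* y' - p) < del.
    by apply: le_lt_trans hs _; rewrite sz1.
  apply: le_trans (Hl _ hl) _; apply: ler_wpM2l => //; exact: ltW.
- rewrite -/s.
  have -> : 2 * (e / 4 * s) * s = e * s ^+ 2 / 2 by field.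
  have : 0 <= e * s ^+ 2 by rewrite mulr_ge0 ?sqr_ge0 // ltW.
  by move: (e * s ^+ 2) => u; clear; lra.
Qed.

(** A bounded isolated singularity in the interior does not matter: all
    rectangles of a subdivision avoiding it contribute nothing, and the one
    around it can be taken arbitrarily small. *)
Lemma goursat_bounded g a b c d (px py : R) M (del : R) : a < px < b -> c < py < d -> 0 < del ->
  (forall x y, a <= x <= b -> c <= y <= d -> x +i* y != px +i* py -> exists l, cd g (x +i* y) l) ->
  (forall z, z != px +i* py -> cnorm (z - (px +i* py)) < del -> cnorm (g z) <= M) ->
  bint g a b c d = 0.
Proof.
move=> /andP[ap pb] /andP[cp pd] del0 dg gM.
apply/eqP; rewrite -cnorm_eq0; apply/eqP/le_anti; rewrite cnorm_ge0 andbT leNgt.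
apply/negP => B0.
have M0 : 0 <= M.
  apply: le_trans (cnorm_ge0 (g ((px +i* py) + (del / 2)%:C))) (gM _ _ _).
    rewrite -subr_eq0 addrAC subrr add0r -cnorm_eq0 cnorm_real normr_eq0.
    by rewrite gt_eqF // divr_gt0.
  rewrite addrAC subrr add0r cnorm_real gtr0_norm ?divr_gt0 //; lra.
(* the bound by [M] on a square of half side [h] gives at most [8 M h] *)
pose h := Num.min (Num.min (Num.min (px - a) (b - px)) (Num.min (py - c) (d - py)))
   (Num.min (del / 4) (cnorm (bint g a b c d) / (16 * (M + 1)))).
have hp : 0 < h.
  rewrite /h !lt_min !subr_gt0 ap pb cp pd !divr_gt0 ?mulr_gt0 ?(ltr_wpDl M0) //=.
have : h <= h by [].
rewrite {2}/h !le_min => /andP[/andP[/andP[h1 h2] /andP[h3 h4]] /andP[h5 h6]].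
have ax : a <= px - h by lra.
have xb : px + h <= b by lra.
have cy : c <= py - h by lra.
have yd : py + h <= d by lra.
have xx : px - h <= px + h by lra.
have yy : py - h <= py + h by lra.
have ne_x x y : x != px -> x +i* y != px +i* py.
  by apply: contra => /eqP[->].
have ne_y x y : y != py -> x +i* y != px +i* py.
  by apply: contra => /eqP[_ ->].
have Z a' b' c' d' : a <= a' -> a' <= b' -> b' <= b -> c <= c' -> c' <= d' -> d' <= d ->
  (b' < px \/ px < a' \/ d' < py \/ py < c') -> bint g a' b' c' d' = 0.
  move=> i1 i2 i3 i4 i5 i6 out; apply: goursat => // x y /andP[x1 x2] /andP[y1 y2].
  apply: dg; [lra|lra|].
  case: out => [?|[?|[?|?]]]; [apply: ne_x|apply: ne_x|apply: ne_y|apply: ne_y];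
    apply/eqP; lra.
have hc (y x1 x2 : R) : a <= x1 -> x2 <= b -> c <= y <= d -> y != py ->
    contI x1 x2 (fun x => g (x +i* y)).
  move=> ? ? hy yp x /andP[? ?]; apply: ccont_rconth.
  have [l /cd_ccont //] : exists l, cd g (x +i* y) l.
  by apply: dg; [lra|by []|exact: ne_y].
have vc (x y1 y2 : R) : c <= y1 -> y2 <= d -> a <= x <= b -> x != px ->
    contI y1 y2 (fun y => g (x +i* y)).
  move=> ? ? hx xp y /andP[? ?]; apply: ccont_rcontv.
  have [l /cd_ccont //] : exists l, cd g (x +i* y) l.
  by apply: dg; [by []|lra|exact: ne_x].
have np (x : R) : x = px - h \/ x = px + h -> x != px.
  by move=> H; apply/eqP; clear -hp H; lra.
have nq (y : R) : y = py - h \/ y = py + h -> y != py.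
  by move=> H; apply/eqP; clear -hp H; lra.
have z1 : bint g a (px - h) c d = 0.
  by apply: Z; [exact: lexx|lra|lra|exact: lexx|lra|exact: lexx|left; lra].
have z2 : bint g (px + h) b c d = 0.
  by apply: Z; [lra|lra|exact: lexx|exact: lexx|lra|exact: lexx|right; left; lra].
have z3 : bint g (px - h) (px + h) c (py - h) = 0.
  by apply: Z; [lra|lra|lra|exact: lexx|lra|lra|right; right; left; lra].
have z4 : bint g (px - h) (px + h) (py + h) d = 0.
  by apply: Z; [lra|lra|lra|lra|lra|exact: lexx|right; right; right; lra].
have cne : c != py by apply/eqP; lra.
have dne : d != py by apply/eqP; lra.
have cd_ : c <= c <= d by lra.
have dd_ : c <= d <= d by lra.
have xm : a <= px - h <= b by lra.
have xp : a <= px + h <= b by lra.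
have E : bint g a b c d = bint g (px - h) (px + h) (py - h) (py + h).
  rewrite (@bint_splitx g a b c d (px - h)) //; [|exact: hc|exact: hc].
  rewrite z1 add0r.
  rewrite (@bint_splitx g (px - h) b c d (px + h)); [|lra|exact: hc|exact: hc].
  rewrite z2 addr0.
  rewrite (@bint_splity g (px - h) (px + h) c d (py - h)); [|lra| |];
    try by apply: vc => //; apply: np; auto.
  rewrite z3 add0r.
  rewrite (@bint_splity g (px - h) (px + h) (py - h) d (py + h)); [|lra| |];
    try by apply: vc => //; apply: np; auto.
  by rewrite z4 addr0.
have : cnorm (bint g a b c d) <= 2 * M * (px + h - (px - h) + (py + h - (py - h))).
  rewrite E; apply: bint_norm => //.
    by split; [apply: hc|apply: hc|apply: vc|apply: vc] => //; try lra; try (apply: np; auto); apply: nq; auto.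
  move=> x y /andP[x1 x2] /andP[y1 y2] bd; apply: gM.
    case/orP: bd => [/orP[/orP[]|]|] /eqP ->; [apply: ne_x|apply: ne_x|apply: ne_y|apply: ne_y];
      apply/eqP; lra.
  apply: le_lt_trans (cnorm_le_ReIm _) _ => /=.
  apply: (@le_lt_trans _ _ (h + h)); last by lra.
  by apply: lerD; rewrite ler_norml; apply/andP; split; lra.
move: h6; rewrite ler_pdivlMr ?mulr_gt0 ?ltr_wpDl // => h6.
have hM : 0 <= h * M by rewrite mulr_ge0 // ltW.
move: h6 hM hp; nra.
Qed.

End Goursat.

(** * Means over circles *)

Section CircleMeans.
Variable R : realType.
Implicit Types (f g q : R[i] -> R[i]) (z w : R[i]).

Definition cexp (z : R[i]) : R[i] := (expR (complex.Re z))%:C * expi (complex.Im z).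

Lemma expiD (x y : R) : expi (x + y) = expi x * expi y.
Proof.
by apply/eqP; rewrite eq_complex /= cosD sinD; apply/andP; split; apply/eqP; ring.
Qed.

Lemma cexpD z w : cexp (z + w) = cexp z * cexp w.
Proof.
rewrite /cexp ReD ImD expRD expiD rmorphM /=; ring.
Qed.

Lemma cnorm_cexp z : cnorm (cexp z) = expR (complex.Re z).
Proof. by rewrite /cexp cnormM cnorm_expi mulr1 cnorm_real ger0_norm // expR_ge0. Qed.

Lemma cexp_neq0 z : cexp z != 0.
Proof. by rewrite -cnorm_gt0 cnorm_cexp expR_gt0. Qed.

Lemma is_derive_eps (u : R -> R) (x l : R) : is_derive x (1 : R) u l ->
  forall e : R, 0 < e -> exists2 d : R, 0 < d & forall y, `|y - x| < d ->
    `|u y - u x - l * (y - x)| <= e * `|y - x|.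
Proof.
move=> [du lE] e e0; rewrite /derivable /= in du; rewrite -lE.
have C : (fun h : R => h^-1 *: ((u \o shift x) (h *: (1 : R)) - u x) : R)
    @ 0^' --> ('D_1 u x : R) by [].
have /cvgrPdist_lt /(_ e e0) := C.
rewrite near_withinE => /nbhs_ballP [d d0 H]; exists d => // y yd.
have [->|yx] := eqVneq y x; first by rewrite !subrr mulr0 subrr normr0 mulr0.
have yx0 : y - x != 0 by rewrite subr_eq0.
have := H (y - x); rewrite /ball /= sub0r normrN => /(_ yd yx0).
have -> : ((y - x) *: (1 : R) : R) = y - x by exact: mulr1.
rewrite subrK => /ltW; set m := 'D_ _ _ _ => h.
have -> : u y - u x - m * (y - x) = - ((m - (y - x)^-1 * (u y - u x)) * (y - x)).
  by field.
by rewrite normrN normrM ler_wpM2r.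
Qed.

(** The addition theorem reduces the differentiability of the exponential to
    the origin, where it follows from that of its three real factors. *)
Lemma cd_cexp0 : cd cexp 0 1.
Proof.
move=> e e0.
pose e1 : R := Num.min (e / 8) 1.
have e10 : 0 < e1 by rewrite lt_min divr_gt0 //= ltr01.
have [d1 d10 H1] := is_derive_eps (is_derive_expR (0 : R)) e10.
have [d2 d20 H2] := is_derive_eps (is_derive_cos (0 : R)) e10.
have [d3 d30 H3] := is_derive_eps (is_derive_sin (0 : R)) e10.
exists (Num.min (Num.min d1 (e1 / 2)) (Num.min d2 d3)).
  by rewrite !lt_min d10 d20 d30 divr_gt0.
case=> x y; rewrite subr0 !lt_min => /andP[/andP[h1 h4] /andP[h2 h3]].
have xn := Re_le_cnorm (x +i* y); have yn := Im_le_cnorm (x +i* y); rewrite /= in xn yn.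
set N := cnorm (x +i* y) in h1 h2 h3 h4 xn yn *.
have := H1 x; rewrite !subr0 expR0 mul1r => /(_ (le_lt_trans xn h1)) {}H1.
have := H2 y; rewrite !subr0 cos0 sin0 oppr0 mul0r subr0 => /(_ (le_lt_trans yn h2)) {}H2.
have := H3 y; rewrite !subr0 cos0 sin0 mul1r subr0 => /(_ (le_lt_trans yn h3)) {}H3.
have -> : cexp 0 = 1 by rewrite /cexp /= expR0 /expi cos0 sin0 mul1r.
rewrite mul1r.
have -> : cexp (x +i* y) - 1 - (x +i* y) = (expR x - 1 - x)%:C +
   (expR x)%:C * ((cos y - 1) +i* (sin y - y)) + 'i * (y * (expR x - 1))%:C.
  by apply/eqP; rewrite eq_complex /=; apply/andP; split; apply/eqP; ring.
have e1le : e1 <= e / 8 by rewrite ge_min lexx.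
have e11 : e1 <= 1 by rewrite ge_min lexx orbT.
have ex : `|expR x - 1| <= 2 * `|x|.
  have -> : expR x - 1 = (expR x - 1 - x) + x by ring.
  apply: le_trans (ler_normD _ _) _.
  have : e1 * `|x| <= `|x| by rewrite ler_piMl.
  by move: H1; clear; lra.
have ex2 : `|expR x| <= 2.
  have -> : expR x = (expR x - 1) + 1 by ring.
  apply: le_trans (ler_normD _ _) _; rewrite normr1.
  by clear -ex xn h4 e11; lra.
apply: le_trans (cnormD _ _) _.
apply: le_trans (lerD (cnormD _ _) (lexx _)) _.
rewrite !cnormM cnorm_i mul1r !cnorm_real normrM.
have a1 : `|expR x - 1 - x| <= e1 * N by apply: le_trans H1 _; rewrite ler_pM2l.
have a2 : cnorm ((cos y - 1) +i* (sin y - y)) <= 2 * e1 * N.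
  apply: le_trans (cnorm_le_ReIm _) _ => /=.
  have : e1 * `|y| <= e1 * N by rewrite ler_pM2l.
  by move: H2 H3; clear; lra.
have a3 : `|expR x| * cnorm ((cos y - 1) +i* (sin y - y)) <= 2 * (2 * e1 * N).
  by apply: ler_pM => //; exact: cnorm_ge0.
have a4 : `|y| * `|expR x - 1| <= N * e1.
  apply: ler_pM => //; apply: le_trans ex _; clear -xn h4; lra.
have a5 : e1 * N <= e / 8 * N by rewrite ler_wpM2r // cnorm_ge0.
have a6 : 0 <= e * N by rewrite mulr_ge0 ?cnorm_ge0 // ltW.
by clear -a1 a3 a4 a5 a6; lra.
Qed.

Lemma cd_cexp z : cd cexp z (cexp z).
Proof.
have H : cd (fun w => cexp (w - z)) z (1 * 1).
  apply: (@cd_comp _ (fun w => w - z) cexp); last by rewrite subrr; exact: cd_cexp0.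
  rewrite -[X in cd _ _ X](subr0 1); apply: cdB; [exact: cd_id|exact: cd_cst].
have := cdZ (cexp z) H; rewrite !mulr1; apply: cd_near.
by exists 1 => // w _; rewrite -cexpD addrC subrK.
Qed.

Lemma expi_2pi (x : R) : expi (x + 2 * pi) = expi x.
Proof. by rewrite /expi mulr_natl sinD2pi cosD2pi. Qed.

Lemma cexp_ln (rho x : R) : 0 < rho -> cexp (ln rho +i* x) = rho%:C * expi x.
Proof. by move=> r0; rewrite /cexp /= lnK. Qed.

Lemma circle_rcont f (rho x : R) : ccont f (rho%:C * expi x) -> 0 < rho ->
  rcont (fun x => f (rho%:C * expi x)) x.
Proof.
move=> cf r0; apply: (@rcont_eq _ (fun x => f (cexp (ln rho +i* x)))).
  by move=> y; rewrite cexp_ln.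
apply: (@ccont_rcontv _ (fun z => f (cexp z))).
by apply: ccont_comp; [apply: cd_ccont; exact: cd_cexp|rewrite cexp_ln].
Qed.

Definition cmean (rho : R) f : R[i] :=
  ((2 * pi)^-1)%:C * cint 0 (2 * pi) (fun x => f (rho%:C * expi x)).

Lemma circle_meanE (rho : R) f : circle_mean rho f = cmean rho f.
Proof.
by apply/eqP; rewrite eq_complex ReZ ImZ /= !eqxx.
Qed.

Lemma pi2_gt0 : 0 < 2 * pi :> R. Proof. by rewrite mulr_gt0 // pi_gt0. Qed.

Definition circ_cont (rho : R) f := forall z, cnorm z = rho -> ccont f z.

Lemma cnorm_circle (rho x : R) : 0 <= rho -> cnorm (rho%:C * expi x) = rho.
Proof. by move=> r0; rewrite cnormM cnorm_expi mulr1 cnorm_real ger0_norm. Qed.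

Lemma circ_contI (rho : R) f a b : 0 < rho -> circ_cont rho f ->
  contI a b (fun x => f (rho%:C * expi x)).
Proof.
by move=> r0 cf x _; apply: circle_rcont => //; apply: cf; rewrite cnorm_circle // ltW.
Qed.

Lemma cmean_eq (rho : R) f g : 0 <= rho -> (forall z, cnorm z = rho -> f z = g z) ->
  cmean rho f = cmean rho g.
Proof.
by move=> r0 fg; congr (_ * _); apply: cint_eq => x _; rewrite fg // cnorm_circle.
Qed.

Lemma cmeanD (rho : R) f g : 0 < rho -> circ_cont rho f -> circ_cont rho g ->
  cmean rho (fun z => f z + g z) = cmean rho f + cmean rho g.
Proof.
by move=> r0 cf cg; rewrite /cmean cintD ?mulrDr //; exact: circ_contI.
Qed.

Lemma cmeanZ (rho : R) f (k : R[i]) : 0 < rho -> circ_cont rho f ->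
  cmean rho (fun z => k * f z) = k * cmean rho f.
Proof.
by move=> r0 cf; rewrite /cmean cintZ 1?mulrCA //; exact: circ_contI.
Qed.

Lemma cmean_cst (rho : R) (k : R[i]) : cmean rho (fun=> k) = k.
Proof.
rewrite /cmean cint_cst ?(ltW pi2_gt0) // subr0 mulrCA -rmorphM /= mulVf ?mulr1 //.
by rewrite gt_eqF // pi2_gt0.
Qed.

Lemma cmean_norm (rho : R) f M : 0 < rho -> circ_cont rho f ->
  (forall z, cnorm z = rho -> cnorm (f z) <= M) -> cnorm (cmean rho f) <= M.
Proof.
move=> r0 cf fM; rewrite cnormM cnorm_real gtr0_norm ?invr_gt0 ?pi2_gt0 //.
rewrite ler_pdivrMl ?pi2_gt0 // [leRHS]mulrC -[X in M * X](subr0 (2 * pi)).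
apply: cint_norm; [exact: ltW pi2_gt0|exact: circ_contI|].
by move=> x _; apply: fM; rewrite cnorm_circle // ltW.
Qed.

(** The horizontal sides of the rectangle [ln rho, ln rho'] x [0, 2 pi] are
    identified by [cexp], so only the vertical ones, the two circles, remain. *)
Lemma cmean_bint f (rho rho' : R) : 0 < rho -> 0 < rho' ->
  bint (fun z => f (cexp z)) (ln rho) (ln rho') 0 (2 * pi) = 0 -> cmean rho f = cmean rho' f.
Proof.
move=> r0 r0'; rewrite /bint.
have -> : hint (fun z => f (cexp z)) (2 * pi) (ln rho) (ln rho') =
          hint (fun z => f (cexp z)) 0 (ln rho) (ln rho').
  by apply: cint_eq => x _; rewrite /cexp /= -[2 * pi]add0r expi_2pi.
rewrite subrr add0r => /eqP; rewrite mulf_eq0 -cnorm_eq0 cnorm_i oner_eq0 /= subr_eq0.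
move=> /eqP E; rewrite /cmean; congr (_ * _).
have V s : 0 < s -> cint 0 (2 * pi) (fun x => f (s%:C * expi x)) =
     vint (fun z => f (cexp z)) (ln s) 0 (2 * pi).
  by move=> s0; apply: cint_eq => x _; rewrite cexp_ln.
exact: (etrans (V _ r0) (etrans (esym E) (esym (V _ r0')))).
Qed.

Lemma cexp_strip (rho rho' x y : R) : 0 < rho -> 0 < rho' -> ln rho <= x <= ln rho' ->
  rho <= cnorm (cexp (x +i* y)) <= rho'.
Proof.
move=> r0 r0' /andP[h1 h2]; rewrite cnorm_cexp /=.
by rewrite -{1}[rho]lnK // -[X in _ <= _ <= X]lnK // !ler_expR h1.
Qed.

Lemma cd_f_cexp f z : (exists l, cd f (cexp z) l) -> exists l, cd (fun z => f (cexp z)) z l.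
Proof.
by move=> [l fl]; exists (l * cexp z); apply: cd_comp fl; exact: cd_cexp.
Qed.

(** The exponential turns an annulus into a strip, hence circles into vertical
    lines and Cauchy's theorem for annuli into the one for rectangles. *)
Lemma cmean_annulus f (rho rho' : R) : 0 < rho -> rho <= rho' ->
  (forall z, rho <= cnorm z <= rho' -> exists l, cd f z l) -> cmean rho f = cmean rho' f.
Proof.
move=> r0 rr H; have r0' : 0 < rho' by exact: lt_le_trans rr.
apply: cmean_bint => //; apply: goursat; rewrite ?(ltW pi2_gt0) ?ler_ln //.
by move=> x y hx hy; apply: cd_f_cexp; apply: H; exact: cexp_strip.
Qed.

Lemma polar w : w != 0 -> exists2 al : R, 0 <= al < 2 * pi & w = (cnorm w)%:C * expi al.
Proof.
move=> w0; have n0 : 0 < cnorm w by rewrite cnorm_gt0.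
pose c := complex.Re w / cnorm w.
have c1 : -1 <= c <= 1.
  rewrite -ler_norml /c normrM normfV (gtr0_norm n0) ler_pdivrMr // mul1r.
  exact: Re_le_cnorm.
have sq : Num.sqrt (1 - c ^+ 2) = `|complex.Im w| / cnorm w.
  rewrite -(gtr0_norm n0) -normfV -normrM -sqrtr_sqr; congr Num.sqrt.
  rewrite /c !exprMn exprVn -[1](mulfV (x := cnorm w ^+ 2)) ?expf_neq0 ?gt_eqF //.
  by rewrite -mulrBl cnorm_sq addrAC subrr add0r.
have rw : complex.Re w = cnorm w * c by rewrite /c mulrC divfK // gt_eqF.
have [im0|im0] := leP 0 (complex.Im w).
- exists (acos c).
    rewrite acos_ge0 //=; apply: le_lt_trans (acos_lepi c1) _.
    by have := pi_gt0 R; lra.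
  apply/eqP; rewrite eq_complex ReZ ImZ /= acosK ?sin_acos // ?in_itv //=.
  apply/andP; split; apply/eqP; first exact: rw.
  by rewrite sq ger0_norm // mulrC divfK // gt_eqF.
- have c1' : c < 1.
    rewrite lt_neqAle; case/andP: c1 => _ ->; rewrite andbT; apply/eqP => c1.
    move: sq; rewrite c1 expr1n subrr sqrtr0 => /esym/eqP.
    by rewrite mulf_eq0 invr_eq0 (gt_eqF n0) orbF normr_eq0 lt_eqF.
  have a0 : 0 < acos c by apply: acos_gt0; rewrite c1'; case/andP: c1 => ->.
  exists (2 * pi - acos c).
    have := acos_lepi c1; have := pi_gt0 R; move: a0; clear; lra.
  have -> : 2 * pi - acos c = - acos c + 2 * pi by ring.
  rewrite expi_2pi; apply/eqP; rewrite eq_complex ReZ ImZ /= cosN sinN acosK ?sin_acos //.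
  apply/andP; split; apply/eqP; first exact: rw.
  by rewrite sq ltr0_norm // mulNr opprK mulrC divfK // gt_eqF.
Qed.

Lemma expi_inj (x y : R) : `|x - y| < 2 * pi -> expi x = expi y -> x = y.
Proof.
move=> xy [cE sE]; apply/eqP/negPn/negP => ne.
have c1 : cos (x - y) = 1 by rewrite cosB cE sE -!expr2 cos2Dsin2.
pose t := `|x - y| / 2.
have t0 : 0 < t < pi by rewrite divr_gt0 ?normr_gt0 ?subr_eq0 //= ltr_pdivrMr // mulrC.
have : cos (t *+ 2) = 1.
  by rewrite -mulr_natr divfK // cos_norm c1.
rewrite cos_mulr2n cos2sin2 => h.
have := sin_gt0_pi t0; have := sqr_ge0 (sin t).
have : sin t ^+ 2 = 0 by move: h; rewrite -mulr_natr; lra.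
by move=> /eqP; rewrite sqrf_eq0 => /eqP ->; rewrite ltxx.
Qed.

(** A singular point [w] off the positive real axis has exactly one logarithm
    in the rectangle and this logarithm is an interior point, so that
    [goursat_bounded] applies to the composition with the exponential. *)
Lemma cmean_annulus_bounded f (rho rho' : R) w M del :
  0 < rho -> rho < cnorm w < rho' -> 0 < del -> w <> (cnorm w)%:C ->
  (forall z, rho <= cnorm z <= rho' -> z != w -> exists l, cd f z l) ->
  (forall z, z != w -> cnorm (z - w) < del -> cnorm (f z) <= M) ->
  cmean rho f = cmean rho' f.
Proof.
move=> r0 /andP[rw wr] del0 wpos H fM.
have n0 : 0 < cnorm w by exact: lt_trans rw.
have r0' : 0 < rho' by exact: lt_trans wr.
have w0 : w != 0 by rewrite -cnorm_gt0.
have [al /andP[al0 al2] wE] := polar w0.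
have {al0} al0 : 0 < al.
  rewrite lt_neqAle al0 andbT; apply/eqP => a0; apply: wpos.
  by rewrite {1}wE -a0 /expi cos0 sin0 mulr1.
have wE' : w = cexp (ln (cnorm w) +i* al) by rewrite cexp_ln.
have inj x y : 0 <= y <= 2 * pi -> cexp (x +i* y) = w -> x +i* y = ln (cnorm w) +i* al.
  move=> /andP[y0 y2] E; have xE : x = ln (cnorm w).
    by have := congr1 (@cnorm R) E; rewrite cnorm_cexp /= => <-; rewrite expRK.
  move: E; rewrite {1}wE' xE !cexp_ln //.
  move=> /(mulfI _) H1; rewrite (@expi_inj y al) ?H1 //.
    by rewrite ltr_norml; apply/andP; split; clear -y0 y2 al0 al2; lra.
  by rewrite -cnorm_eq0 cnorm_real normr_eq0 gt_eqF.
have [d d0 Hd] : exists2 d : R, 0 < d & forall z, cnorm (z - (ln (cnorm w) +i* al)) < d ->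
     cnorm (cexp z - w) < del /\ `|complex.Im z - al| < Num.min al (2 * pi - al).
  have [d d0 H1] := cd_ccont (cd_cexp (ln (cnorm w) +i* al)) del0.
  exists (Num.min d (Num.min al (2 * pi - al))).
    by rewrite !lt_min d0 al0 subr_gt0.
  move=> z; rewrite lt_min => /andP[h1 h2]; split; first by rewrite [X in _ - X]wE'; exact: H1.
  have -> : complex.Im z - al = complex.Im (z - (ln (cnorm w) +i* al)).
    by rewrite ImD ImN.
  by apply: le_lt_trans (Im_le_cnorm _) h2.
apply: cmean_bint => //.
apply: (@goursat_bounded R (fun z => f (cexp z)) _ _ _ _ (ln (cnorm w)) al M d) => //.
- by rewrite !ltr_ln // rw.
- by rewrite al0.
- move=> x y hx hy ne; apply: cd_f_cexp; apply: H; first exact: cexp_strip.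
  by apply: contra ne => /eqP /inj ->.
- case=> x y ne /Hd [/= h1 h2]; apply: fM => //; apply: contra ne => /eqP E.
  apply/eqP; apply: inj => //; move: h2; rewrite lt_min !ltr_norml.
  by move=> /andP[/andP[h3 h4] /andP[h5 h6]]; clear -h3 h4 h5 h6; lra.
Qed.

End CircleMeans.

(** * Cauchy's formula with a bounded singularity *)

Section CauchyFormula.
Variable R : realType.
Implicit Types (f g q : R[i] -> R[i]) (z w c : R[i]) (U : set R[i]).

Definition cdiff f z := exists l, cd f z l.

Lemma cdiffD f g z : cdiff f z -> cdiff g z -> cdiff (fun w => f w + g w) z.
Proof. by move=> [l ?] [m ?]; exists (l + m); exact: cdD. Qed.

Lemma cdiffB f g z : cdiff f z -> cdiff g z -> cdiff (fun w => f w - g w) z.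
Proof. by move=> [l ?] [m ?]; exists (l - m); exact: cdB. Qed.

Lemma cdiffM f g z : cdiff f z -> cdiff g z -> cdiff (fun w => f w * g w) z.
Proof. by move=> [l ?] [m ?]; exists (l * g z + f z * m); exact: cdM. Qed.

Lemma cdiffV f z : f z != 0 -> cdiff f z -> cdiff (fun w => (f w)^-1) z.
Proof. by move=> f0 [l ?]; exists (- l / f z ^+ 2); exact: cdV. Qed.

Lemma cdiff_cst c z : cdiff (fun=> c) z.
Proof. by exists 0; exact: cd_cst. Qed.

Lemma cdiff_id z : cdiff id z.
Proof. by exists 1; exact: cd_id. Qed.

Lemma cdiffX n f z : cdiff f z -> cdiff (fun w => f w ^+ n) z.
Proof.
move=> df; elim: n => [|n IH]; first exact: cdiff_cst.
have -> : (fun w => f w ^+ n.+1) = (fun w => f w * f w ^+ n).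
  by apply/funext => w; rewrite exprS.
exact: cdiffM.
Qed.

Lemma cdiff_comp f g z : cdiff f z -> cdiff g (f z) -> cdiff (fun w => g (f w)) z.
Proof. by move=> [l ?] [m ?]; exists (m * l); exact: cd_comp. Qed.

Lemma cdiff_near f g z : (exists2 d : R, 0 < d & forall w, cnorm (w - z) < d -> f w = g w) ->
  cdiff f z -> cdiff g z.
Proof. by move=> H [l ?]; exists l; exact: cd_near H _. Qed.

Lemma cdiff_ccont f z : cdiff f z -> ccont f z.
Proof. by move=> [l]; exact: cd_ccont. Qed.

Lemma hol_cdiff U f : holomorphic_on U f <-> forall z, U z -> cdiff f z.
Proof.
split=> H z Uz; first by exists (cderive f z); exact: hol_cd H Uz.
by have [l] := H z Uz; exact: cd_derivable.
Qed.

Lemma cdiff_cd f z : cdiff f z -> cd f z (cderive f z).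
Proof. by move=> [l H]; rewrite (cd_cderive H). Qed.

Lemma cnorm_small z : (forall e : R, 0 < e -> cnorm z <= e) -> z = 0.
Proof.
move=> H; apply/eqP; rewrite -cnorm_eq0 eq_le cnorm_ge0 andbT leNgt; apply/negP => z0.
by have := H (cnorm z / 2) (divr_gt0 z0 (ltr0Sn _ _)); rewrite leNgt ltr_pdivrMr // ltr_pMr // ltr1n.
Qed.

Lemma circ_polar (rho : R) z : 0 < rho -> cnorm z = rho ->
  exists2 x : R, 0 <= x <= 2 * pi & z = rho%:C * expi x.
Proof.
move=> r0 zr; have z0 : z != 0 by rewrite -cnorm_gt0 zr.
by have [x /andP[x0 /ltW x2] E] := polar z0; exists x; rewrite ?x0 // -zr.
Qed.

Lemma contI_bounded a b (g : R -> R[i]) : a <= b -> contI a b g ->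
  exists M, forall x, a <= x <= b -> cnorm (g x) <= M.
Proof.
move=> ab cg; have [|x _ H] := @EVT_max R (fun x => cnorm (g x)) _ _ ab.
  apply: continuous_in_subspaceT => x; rewrite inE /= in_itv /= => xab.
  apply/cvgrPdist_lt => e e0; have [d d0 H] := cg x xab e e0.
  near=> y; apply: le_lt_trans (_ : cnorm (g y - g x) < e).
    have := cnorm_sub_ge (g y) (g x); have := cnorm_sub_ge (g x) (g y).
    by rewrite cnormC ler_norml => h1 h2; apply/andP; split; move: h1 h2; clear; lra.
  by apply: H; near: y; apply/nbhs_ballP; exists d => // y; rewrite /ball /= distrC.
by exists (cnorm (g x)) => y yab; apply: H; rewrite in_itv.
Unshelve. all: by end_near. Qed.

Lemma circ_bounded (rho : R) f : 0 < rho -> circ_cont rho f ->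
  exists2 M, 0 < M & forall z, cnorm z = rho -> cnorm (f z) <= M.
Proof.
move=> r0 cf; have [M HM] := contI_bounded (ltW (pi2_gt0 R)) (circ_contI r0 cf).
exists (Num.max M 1); first by rewrite lt_max ltr01 orbT.
by move=> z /(circ_polar r0)[x x2 ->]; rewrite le_max HM.
Qed.

Lemma circ_min (rho : R) f : 0 < rho -> circ_cont rho f ->
  (forall z, cnorm z = rho -> f z != 0) ->
  exists2 m, 0 < m & forall z, cnorm z = rho -> m <= cnorm (f z).
Proof.
move=> r0 cf f0.
have [M M0 HM] := @circ_bounded rho (fun z => (f z)^-1) r0
  (fun z zr => ccontV (f0 z zr) (cf z zr)).
exists M^-1; first by rewrite invr_gt0.
move=> z zr; have := HM z zr; rewrite cnormV.
have p : 0 < cnorm (f z) by rewrite cnorm_gt0 f0.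
by move=> h; rewrite -[leRHS]invrK lef_pV2 ?posrE ?invr_gt0.
Qed.

(** The second-order bound is uniform on the circle, so it survives taking the
    mean. *)
Lemma cd_cmean (k : R[i] -> R[i] -> R[i]) (k' : R[i] -> R[i]) (rho : R) w0 (C del : R) :
  0 < rho -> 0 < del ->
  (forall w, cnorm (w - w0) < del -> circ_cont rho (fun z => k z w)) -> circ_cont rho k' ->
  (forall z w, cnorm z = rho -> cnorm (w - w0) < del ->
     cnorm (k z w - k z w0 - k' z * (w - w0)) <= C * cnorm (w - w0) ^+ 2) ->
  cd (fun w => cmean rho (fun z => k z w)) w0 (cmean rho k').
Proof.
move=> r0 del0 ck ck' H e e0.
have C1 : 0 < `|C| + 1 by rewrite ltr_wpDl.
exists (Num.min del (e / (`|C| + 1))); first by rewrite lt_min del0 divr_gt0.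
move=> w; rewrite lt_min => /andP[wd we].
have k0 : circ_cont rho (fun z => k z w0) by apply: ck; rewrite subrr cnorm0.
have cZ (c : R[i]) g : circ_cont rho g -> circ_cont rho (fun z => c * g z).
  by move=> cg z zr; apply: ccontM; [exact: ccont_cst|exact: cg].
have -> : cmean rho (fun z => k z w) - cmean rho (fun z => k z w0) - cmean rho k' * (w - w0) =
   cmean rho (fun z => k z w + (- 1 * k z w0 + (- (w - w0)) * k' z)).
  rewrite cmeanD //; [|exact: ck|by move=> z zr; apply: ccontD; exact: cZ].
  rewrite cmeanD ?cmeanZ //; [ring|exact: cZ|exact: cZ].
apply: cmean_norm => //.
  by move=> z zr; apply: ccontD; [exact: ck|apply: ccontD; exact: cZ].
move=> z zr.
have -> : k z w + (- 1 * k z w0 + (- (w - w0)) * k' z) = k z w - k z w0 - k' z * (w - w0).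
  by ring.
apply: le_trans (H z w zr wd) _; rewrite expr2 mulrA.
apply: ler_wpM2r; first exact: cnorm_ge0.
apply: (@le_trans _ _ ((`|C| + 1) * cnorm (w - w0))).
  apply: ler_wpM2r; first exact: cnorm_ge0.
  by apply: le_trans (ler_norm _) _; rewrite lerDl.
by move: we; rewrite ltr_pdivlMr // mulrC => /ltW.
Qed.

Lemma kernel_neq0 (rho : R) z w : cnorm z = rho -> cnorm w < rho -> z - w != 0.
Proof.
move=> zr wr; rewrite subr_eq0; apply/eqP => zw; move: wr.
by rewrite -zr zw ltxx.
Qed.

Lemma kernel_cont (rho : R) q w n : circ_cont rho q -> cnorm w < rho ->
  circ_cont rho (fun z => q z / (z - w) ^+ n).
Proof.
move=> cq wr z zr; apply: ccontM; first exact: cq.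
apply: ccontV; first by rewrite expf_neq0 // (kernel_neq0 zr wr).
elim: n => [|n IH]; first exact: ccont_cst.
apply: (@ccont_near _ (fun z => (z - w) * (z - w) ^+ n)).
  by exists 1 => // y _; rewrite exprS.
apply: ccontM => //; apply: ccontB; [exact: ccont_id|exact: ccont_cst].
Qed.

Lemma kernel_far (rho : R) z w w0 : cnorm z = rho -> cnorm w0 < rho ->
  cnorm (w - w0) < (rho - cnorm w0) / 2 ->
  (rho - cnorm w0) / 2 <= cnorm (z - w) /\ (rho - cnorm w0) / 2 <= cnorm (z - w0).
Proof.
move=> zr wr wd; have h1 := cnorm_sub_ge z w; have h2 := cnorm_sub_ge z w0.
have h3 := cnorm_sub_ge w w0; rewrite zr in h1 h2.
by split; clear -h1 h2 h3 wr wd; lra.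
Qed.

(** The kernels are differentiated explicitly: the second-order remainder is
    bounded because the circle stays at distance at least half of [rho - |w0|]
    from the variable. *)
Lemma cauchy_cd1 (rho : R) q w0 : 0 < rho -> circ_cont rho q -> cnorm w0 < rho ->
  cd (fun w => cmean rho (fun z => q z / (z - w))) w0 (cmean rho (fun z => q z / (z - w0) ^+ 2)).
Proof.
move=> r0 cq wr; pose eta := (rho - cnorm w0) / 2.
have eta0 : 0 < eta by rewrite divr_gt0 // subr_gt0.
have [Q Q0 HQ] := circ_bounded r0 cq.
apply: (@cd_cmean (fun z w => q z / (z - w)) _ rho w0 (Q / eta ^+ 3) eta) => //.
- move=> w wd; have wr' : cnorm w < rho.
    by have := cnorm_sub_ge w w0; move: wd; rewrite /eta; clear -wr; lra.
  by move=> z zr; have := @kernel_cont rho q w 1 cq wr' z zr; apply: ccont_near; exists 1.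
- exact: kernel_cont.
- move=> z w zr wd; have [h1 h2] := kernel_far zr wr wd; rewrite -/eta in h1 h2.
  clearbody eta.
  have p1 : 0 < cnorm (z - w) by exact: lt_le_trans h1.
  have p2 : 0 < cnorm (z - w0) by exact: lt_le_trans h2.
  have n1 : z - w != 0 by rewrite -cnorm_gt0.
  have n2 : z - w0 != 0 by rewrite -cnorm_gt0.
  have -> : q z / (z - w) - q z / (z - w0) - q z / (z - w0) ^+ 2 * (w - w0) =
      q z / ((z - w0) ^+ 2 * (z - w)) * (w - w0) ^+ 2.
    by field; rewrite n1 n2.
  rewrite cnormM cnormX ler_wpM2r ?exprn_ge0 ?cnorm_ge0 //.
  rewrite cnormM cnormV cnormM cnormX.
  apply: ler_pM; rewrite ?cnorm_ge0 ?invr_ge0 ?mulr_ge0 ?exprn_ge0 ?cnorm_ge0 ?HQ //.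
  rewrite lef_pV2 ?posrE ?mulr_gt0 ?exprn_gt0 //.
  by rewrite exprSr ler_pM ?exprn_ge0 ?(ltW eta0) // lerXn2r ?nnegrE ?(ltW eta0) ?(ltW p2).
Qed.

Lemma cauchy_cd2 (rho : R) q w0 : 0 < rho -> circ_cont rho q -> cnorm w0 < rho ->
  cd (fun w => cmean rho (fun z => q z / (z - w) ^+ 2)) w0
     (cmean rho (fun z => 2 * q z / (z - w0) ^+ 3)).
Proof.
move=> r0 cq wr; pose eta := (rho - cnorm w0) / 2.
have eta0 : 0 < eta by rewrite divr_gt0 // subr_gt0.
have [Q Q0 HQ] := circ_bounded r0 cq.
apply: (@cd_cmean (fun z w => q z / (z - w) ^+ 2) _ rho w0 (Q * (3 / eta ^+ 4)) eta) => //.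
- move=> w wd; have wr' : cnorm w < rho.
    by have := cnorm_sub_ge w w0; move: wd; rewrite /eta; clear -wr; lra.
  exact: kernel_cont.
- apply: (@kernel_cont rho (fun z => 2 * q z)) => // z zr.
  by apply: ccontM; [exact: ccont_cst|exact: cq].
- move=> z w zr wd; have [h1 h2] := kernel_far zr wr wd; rewrite -/eta in h1 h2.
  clearbody eta.
  have p1 : 0 < cnorm (z - w) by exact: lt_le_trans h1.
  have p2 : 0 < cnorm (z - w0) by exact: lt_le_trans h2.
  have n1 : z - w != 0 by rewrite -cnorm_gt0.
  have n2 : z - w0 != 0 by rewrite -cnorm_gt0.
  have -> : q z / (z - w) ^+ 2 - q z / (z - w0) ^+ 2 - 2 * q z / (z - w0) ^+ 3 * (w - w0) =
      q z * ((((z - w0) * (z - w)) ^+ 2)^-1 + 2 * ((z - w0) ^+ 3 * (z - w))^-1) * (w - w0) ^+ 2.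
    by field; rewrite n1 n2.
  rewrite cnormM (cnormX (w - w0)) ler_wpM2r ?exprn_ge0 ?cnorm_ge0 // cnormM.
  apply: ler_pM; rewrite ?cnorm_ge0 ?HQ //.
  apply: le_trans (cnormD _ _) _.
  have c2 : cnorm (2 : R[i]) = 2.
    exact: cnorm_nat.
  rewrite (cnormM 2) !cnormV !(cnormX, cnormM) c2.
  have e1 : (eta ^+ 4) <= (cnorm (z - w0) * cnorm (z - w)) ^+ 2.
    rewrite (exprM _ 2 2) lerXn2r ?nnegrE ?mulr_ge0 ?exprn_ge0 ?(ltW eta0) ?cnorm_ge0 //.
    by rewrite expr2; apply: ler_pM => //; exact: ltW.
  have e2 : (eta ^+ 4) <= cnorm (z - w0) ^+ 3 * cnorm (z - w).
    rewrite exprSr ler_pM ?exprn_ge0 ?(ltW eta0) //.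
    by rewrite lerXn2r ?nnegrE ?(ltW eta0) ?cnorm_ge0.
  have i1 : ((cnorm (z - w0) * cnorm (z - w)) ^+ 2)^-1 <= (eta ^+ 4)^-1.
    by rewrite lef_pV2 ?posrE ?exprn_gt0 // mulr_gt0.
  have i2 : (cnorm (z - w0) ^+ 3 * cnorm (z - w))^-1 <= (eta ^+ 4)^-1.
    by rewrite lef_pV2 ?posrE ?mulr_gt0 ?exprn_gt0.
  by move: i1 i2; clear; lra.
Qed.

Lemma ccont_cnorm_ge (rho : R) w : cnorm w < rho -> circ_cont rho (fun z => z / (z - w)).
Proof.
move=> wr z zr; apply: ccontM; first exact: ccont_id.
by apply: ccontV; [exact: kernel_neq0 zr wr|apply: ccontB; [exact: ccont_id|exact: ccont_cst]].
Qed.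

(** The mean of z / (z - w) does not depend on the radius and tends to 1 as
    the radius grows. *)
Lemma cmean_kernel1 (rho : R) w : cnorm w < rho -> cmean rho (fun z => z / (z - w)) = 1.
Proof.
move=> wr; have r0 : 0 < rho by exact: le_lt_trans (cnorm_ge0 w) wr.
apply/eqP; rewrite -subr_eq0; apply/eqP/cnorm_small => e e0.
pose rho' := cnorm w + rho + cnorm w / e.
have we : 0 <= cnorm w / e by rewrite divr_ge0 ?cnorm_ge0 // ltW.
have rr : rho <= rho' by rewrite /rho'; have := cnorm_ge0 w; move: we; clear; lra.
have wr' : cnorm w < rho' by exact: lt_le_trans rr.
have r0' : 0 < rho' by exact: lt_le_trans rr.
rewrite (@cmean_annulus _ _ rho rho') //; last first.
  move=> z /andP[zr _]; apply: cdiffM; first exact: cdiff_id.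
  apply: cdiffV; last by apply: cdiffB; [exact: cdiff_id|exact: cdiff_cst].
  by apply: (@kernel_neq0 (cnorm z)) => //; exact: lt_le_trans zr.
have -> : cmean rho' (fun z => z / (z - w)) - 1 =
   cmean rho' (fun z => z / (z - w) + (-1)).
  rewrite cmeanD ?cmean_cst //; first exact: ccont_cnorm_ge.
  by move=> z _; exact: ccont_cst.
apply: cmean_norm => //.
  by move=> z zr; apply: ccontD; [exact: (ccont_cnorm_ge wr')|exact: ccont_cst].
move=> z zr; have n1 := kernel_neq0 zr wr'.
have -> : z / (z - w) + (-1) = w / (z - w) by field.
rewrite cnormM cnormV ler_pdivrMr ?cnorm_gt0 //.
have h := cnorm_sub_ge z w; rewrite zr in h.
have : e * (rho + cnorm w / e) <= e * cnorm (z - w).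
  by rewrite ler_pM2l //; move: h; rewrite /rho'; clear; lra.
rewrite mulrDr [e * (_ / _)]mulrCA mulfV ?gt_eqF // mulr1.
by have := mulr_gt0 e0 r0; clear; lra.
Qed.

(** The mean of [z (f z - f w) / (z - w)] does not depend on the radius, the
    singularity at [w] being bounded, and it tends to 0 for small circles, [f]
    being bounded near the origin. Expanding it gives the formula; for
    positive [w], excluded by [cmean_annulus_bounded], continuity is used. *)
Lemma cauchy_punctured f (rho M del : R) w : 0 < del -> 0 < cnorm w -> cnorm w < rho ->
  (forall z, 0 < cnorm z <= rho -> cdiff f z) ->
  (forall z, 0 < cnorm z < del -> cnorm (f z) <= M) ->
  f w = cmean rho (fun z => f z * z / (z - w)).
Proof.
move=> del0 w0 wr df fM.
have r0 : 0 < rho by exact: lt_trans wr.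
have cf (s : R) : 0 < s <= rho -> circ_cont s (fun z => f z * z).
  move=> /andP[s0 sr] z zr; apply: ccontM; last exact: ccont_id.
  by apply: cdiff_ccont; apply: df; rewrite zr s0.
have cfr : circ_cont rho (fun z => f z * z) by apply: cf; rewrite r0 lexx.
have G v : 0 < cnorm v -> cnorm v < rho -> v <> (cnorm v)%:C ->
    f v = cmean rho (fun z => f z * z / (z - v)).
  move=> v0 vr vpos.
  have nv : v != 0 by rewrite -cnorm_gt0.
  pose k z := z * ((f z - f v) / (z - v)).
  have dk z : 0 < cnorm z <= rho -> z != v -> cdiff k z.
    move=> zR zv; apply: cdiffM; first exact: cdiff_id.
    apply: cdiffM; first by apply: cdiffB; [exact: df|exact: cdiff_cst].
    apply: cdiffV; first by rewrite subr_eq0.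
    by apply: cdiffB; [exact: cdiff_id|exact: cdiff_cst].
  have ck (s : R) : 0 < s -> s <= rho -> s != cnorm v -> circ_cont s k.
    move=> s0 sR sv z zr; apply/cdiff_ccont/dk; first by rewrite zr s0.
    by apply: contra sv => /eqP <-; rewrite zr.
  (* difference quotients stay bounded near [v] *)
  have [l fl] : cdiff f v by apply: df; rewrite v0 ltW.
  have [d d0 Hd] := fl 1 ltr01.
  have kM z : z != v -> cnorm (z - v) < Num.min d 1 -> cnorm (k z) <= (cnorm v + 1) * (cnorm l + 1).
    rewrite lt_min => zv /andP[/Hd h1 h2]; rewrite cnormM; apply: ler_pM; rewrite ?cnorm_ge0 //.
      by have := cnorm_sub_ge z v; move: h2; clear; lra.
    have p : 0 < cnorm (z - v) by rewrite cnorm_gt0 subr_eq0.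
    rewrite cnormM cnormV ler_pdivrMr //.
    have -> : f z - f v = (f z - f v - l * (z - v)) + l * (z - v) by ring.
    apply: le_trans (cnormD _ _) _; rewrite cnormM.
    by move: h1; rewrite mul1r; clear; lra.
  have step (s : R) : 0 < s -> s < cnorm v -> cmean s k = cmean rho k.
    move=> s0 sv.
    apply: (@cmean_annulus_bounded _ k s rho v ((cnorm v + 1) * (cnorm l + 1)) (Num.min d 1)) => //.
    - by rewrite sv.
    - by rewrite lt_min d0 ltr01.
    - move=> z /andP[z1 z2]; apply: dk.
      by rewrite (lt_le_trans s0).
  (* the mean over small circles tends to 0 *)
  have k0 : cmean rho k = 0.
    apply: cnorm_small => e e0.
    have K0 : 0 < `|M| + cnorm (f v) + 1 by rewrite ltr_wpDl ?addr_ge0 ?cnorm_ge0.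
    pose s := Num.min (Num.min (cnorm v / 2) (del / 2)) (e * (cnorm v / 2) / (`|M| + cnorm (f v) + 1)).
    have v2 : 0 < cnorm v / 2 by rewrite divr_gt0.
    have s0 : 0 < s.
      by rewrite !lt_min v2 divr_gt0 //= divr_gt0 // mulr_gt0.
    have : s <= s by [].
    rewrite {2}/s !le_min => /andP[/andP[s1 s2] s3].
    have sv : s < cnorm v by move: s1 v0; clear; lra.
    rewrite -(step s s0 sv); apply: cmean_norm => //.
      by apply: ck => //; [exact: ltW (lt_trans sv vr)|rewrite lt_eqF].
    move=> z zs; rewrite cnormM zs.
    have zv := cnorm_sub_ge v z; rewrite zs cnormC in zv.
    have hv : cnorm v / 2 <= cnorm (z - v) by move: zv s1; clear; lra.
    have pz : 0 < cnorm (z - v) by exact: lt_le_trans hv.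
    have hf : cnorm (f z - f v) <= `|M| + cnorm (f v) + 1.
      apply: le_trans (cnormB _ _) _.
      have : cnorm (f z) <= M by apply: fM; rewrite zs s0 /=; move: s2 del0; clear; lra.
      by have := ler_norm M; clear; lra.
    have hq : cnorm ((f z - f v) / (z - v)) <= (`|M| + cnorm (f v) + 1) / (cnorm v / 2).
      rewrite cnormM cnormV; apply: ler_pM; rewrite ?cnorm_ge0 ?invr_ge0 ?cnorm_ge0 //.
      by rewrite lef_pV2 ?posrE.
    apply: le_trans (ler_wpM2l (ltW s0) hq) _.
    by rewrite mulrA ler_pdivrMr // -ler_pdivlMr.
  have c1 : circ_cont rho (fun z => f z * z / (z - v)).
    by have := @kernel_cont rho _ v 1 cfr vr.
  have c2 := ccont_cnorm_ge vr.
  have : cmean rho k = cmean rho (fun z => f z * z / (z - v) + (- f v) * (z / (z - v))).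
    apply: cmean_eq; first exact: ltW.
    move=> z zr; have := kernel_neq0 zr vr; rewrite /k => ?; by field.
  rewrite k0 cmeanD ?cmeanZ //; last first.
    by move=> z zr; apply: ccontM; [exact: ccont_cst|exact: c2].
  rewrite cmean_kernel1 // mulr1 => /eqP; rewrite eq_sym subr_eq0.
  by move=> /eqP <-.
(* positive reals are limits of other points *)
have cw : ccont (fun w => f w - cmean rho (fun z => f z * z / (z - w))) w.
  apply: ccontB.
    by apply: cdiff_ccont; apply: df; rewrite w0 ltW.
  exact: cd_ccont (cauchy_cd1 r0 cfr wr).
apply/eqP; rewrite -subr_eq0; apply/eqP/cnorm_small => e e0.
have [d d0 H] := cw e e0.
have [wp|] := pselect (w = (cnorm w)%:C); last by move=> /(G w w0 wr) <-; rewrite subrr cnorm0 ltW.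
pose t := Num.min (d / 2) ((rho - cnorm w) / 2).
have t0 : 0 < t by rewrite lt_min !divr_gt0 // subr_gt0.
have : t <= t by [].
rewrite {2}/t le_min => /andP[t1 t2].
pose v := w + 'i * t%:C.
have vw : cnorm (v - w) = t.
  by rewrite addrAC subrr add0r cnormM cnorm_i mul1r cnorm_real gtr0_norm.
have imv : complex.Im v = t.
  by rewrite ImD ImM wp /= mul0r mul1r !add0r.
have v0 : 0 < cnorm v.
  by apply: lt_le_trans (Im_le_cnorm _); rewrite imv gtr0_norm.
have vr : cnorm v < rho.
  by have := cnorm_sub_ge v w; rewrite vw; move: t2 wr; clear; lra.
have := H v; rewrite vw => /(_ _); rewrite -(G v v0 vr); last first.
  by move=> E; move: imv t0; rewrite E /= => <-; rewrite ltxx.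
rewrite subrr sub0r cnormN => h; apply/ltW/h.
by move: t1 t0; clear; lra.
Qed.

End CauchyFormula.

(** * Consequences of Cauchy's formula *)

#[local] Opaque cderive.

Section CauchyConsequences.
Variable R : realType.
Implicit Types (f g q : R[i] -> R[i]) (z w c : R[i]) (U : set R[i]).

Lemma ccont_punct_eq f g c (d : R) : 0 < d -> ccont f c -> ccont g c ->
  (forall w, 0 < cnorm (w - c) < d -> f w = g w) -> f c = g c.
Proof.
move=> d0 cf cg H; apply/eqP; rewrite -subr_eq0; apply/eqP/cnorm_small => e e0.
have [d1 d10 H1] := ccontB cf cg e0.
pose t := Num.min d d1 / 2.
have t0 : 0 < t by rewrite divr_gt0 // lt_min d0.
have td : t < Num.min d d1 by rewrite /t ltr_pdivrMr // ltr_pMr ?ltr1n // lt_min d0.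
move: td; rewrite lt_min => /andP[td td1].
have ct : cnorm (c + t%:C - c) = t by rewrite addrAC subrr add0r cnorm_real gtr0_norm.
have := H1 (c + t%:C); rewrite ct => /(_ td1).
by rewrite H ?ct ?t0 // subrr sub0r cnormN => /ltW.
Qed.

Lemma cdiff_bounded_near f c : cdiff f c ->
  exists2 d : R, 0 < d & forall z, cnorm (z - c) < d -> cnorm (f z) <= cnorm (f c) + 1.
Proof.
move=> /cdiff_ccont /(_ 1 ltr01) [d d0 H]; exists d => // z /H h.
by have := cnorm_sub_ge (f z) (f c); move: h; clear; lra.
Qed.

Lemma circ_cdiff (rho : R) f : (forall z, cnorm z <= rho -> cdiff f z) -> circ_cont rho f.
Proof. by move=> df z zr; apply/cdiff_ccont/df; rewrite zr. Qed.

Lemma circ_contM (rho : R) f g : circ_cont rho f -> circ_cont rho g -> circ_cont rho (fun z => f z * g z).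
Proof. by move=> cf cg z zr; apply: ccontM; [exact: cf|exact: cg]. Qed.

Lemma circ_cont_id (rho : R) : circ_cont rho id.
Proof. by move=> z _; exact: ccont_id. Qed.

(** Off the centre this is [cauchy_punctured]; both sides are continuous at
    the centre. *)
Lemma cauchy_disk f (rho : R) w : cnorm w < rho ->
  (forall z, cnorm z <= rho -> cdiff f z) -> f w = cmean rho (fun z => f z * z / (z - w)).
Proof.
move=> wr df; have r0 : 0 < rho by exact: le_lt_trans (cnorm_ge0 w) wr.
have [d d0 Hd] : exists2 d : R, 0 < d & forall z, cnorm (z - 0) < d -> cnorm (f z) <= cnorm (f 0) + 1.
  by apply: cdiff_bounded_near; apply: df; rewrite cnorm0 ltW.
have G v : 0 < cnorm v -> cnorm v < rho -> f v = cmean rho (fun z => f z * z / (z - v)).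
  move=> v0 vr; apply: (@cauchy_punctured _ f rho (cnorm (f 0) + 1) d) => //.
    by move=> z /andP[_ zr]; exact: df.
  by move=> z /andP[_ zr]; apply: Hd; rewrite subr0.
have [w0|w0] := eqVneq w 0; last by apply: G => //; rewrite cnorm_gt0.
apply: (@ccont_punct_eq f (fun w => cmean rho (fun z => f z * z / (z - w))) w rho) => //.
- by apply/cdiff_ccont/df/ltW.
- apply: cd_ccont; apply: cauchy_cd1 => //.
  by apply: circ_contM; [exact: circ_cdiff|exact: circ_cont_id].
- by move=> v; rewrite w0 subr0 => /andP[v0 vr]; exact: G.
Qed.

Lemma mean_value f (rho : R) : 0 < rho ->
  (forall z, cnorm z <= rho -> cdiff f z) -> f 0 = cmean rho f.
Proof.
move=> r0 df; rewrite (@cauchy_disk f rho 0) ?cnorm0 //.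
apply: cmean_eq; first exact: ltW.
by move=> z zr; rewrite subr0 mulfK // -cnorm_gt0 zr.
Qed.

(** The Cauchy integral of [f] is holomorphic in the whole disk and agrees
    with [f] off the origin. *)
Lemma removable f (R' M del : R) : 0 < R' -> 0 < del ->
  (forall z, 0 < cnorm z < R' -> cdiff f z) ->
  (forall z, 0 < cnorm z < del -> cnorm (f z) <= M) ->
  exists g, (forall z, cnorm z < R' -> cdiff g z) /\ (forall z, z != 0 -> g z = f z).
Proof.
move=> R0 del0 df fM; pose rho := R' / 2.
have r0 : 0 < rho by rewrite divr_gt0.
have rR : rho < R' by rewrite /rho ltr_pdivrMr // ltr_pMr // ltr1n.
pose g z := if z == 0 then cmean rho (fun z => f z * z / (z - 0)) else f z.
have gE z : z != 0 -> g z = f z by rewrite /g => /negbTE ->.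
exists g; split => // z zR; have [z0|z0] := eqVneq z 0; last first.
  apply: (@cdiff_near _ f); last by apply: df; rewrite cnorm_gt0 z0.
  exists (cnorm z) => [|w wz]; first by rewrite cnorm_gt0.
  rewrite gE //; apply: contraPneq wz => ->.
  by rewrite sub0r cnormN ltxx.
rewrite z0; apply: (@cdiff_near _ (fun w => cmean rho (fun z => f z * z / (z - w)))).
  exists rho => // w; rewrite subr0 => wr; rewrite /g.
  case: eqVneq => [->//|w0]; apply/esym/(@cauchy_punctured _ f rho M del) => //.
    by rewrite cnorm_gt0.
  by move=> v /andP[v0 vr]; apply: df; rewrite v0 (le_lt_trans vr).
exists (cmean rho (fun z => f z * z / (z - 0) ^+ 2)); apply: cauchy_cd1 => //.
  move=> v vr; apply: ccontM; last exact: ccont_id.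
  by apply/cdiff_ccont/df; rewrite vr r0.
by rewrite cnorm0.
Qed.

Lemma cdiff_shift f c z : cdiff f (c + z) -> cdiff (fun z => f (c + z)) z.
Proof.
move=> df; apply: (@cdiff_comp _ (fun z => c + z) f) => //.
by apply: cdiffD; [exact: cdiff_cst|exact: cdiff_id].
Qed.

Lemma cd_shift f c z l : cd f (c + z) l -> cd (fun z => f (c + z)) z l.
Proof.
move=> df; rewrite -(mulr1 l); apply: (@cd_comp _ (fun z => c + z) f) => //.
by rewrite -[X in cd _ _ X]add0r; apply: cdD; [exact: cd_cst|exact: cd_id].
Qed.

Lemma cderive_shift f c z : cdiff f (c + z) -> cderive (fun z => f (c + z)) z = cderive f (c + z).
Proof. by move=> [l df]; rewrite (cd_cderive (cd_shift df)) (cd_cderive df). Qed.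

(** The Cauchy kernel can be differentiated twice. *)
Lemma cdiff_cderive0 f (rho : R) w : cnorm w < rho ->
  (forall z, cnorm z <= rho -> cdiff f z) -> cdiff (cderive f) w.
Proof.
move=> wr df; have r0 : 0 < rho by exact: le_lt_trans (cnorm_ge0 w) wr.
have cq : circ_cont rho (fun z => f z * z).
  by apply: circ_contM; [exact: circ_cdiff|exact: circ_cont_id].
have near_w v : cnorm v < rho -> exists2 d : R, 0 < d & forall u, cnorm (u - v) < d -> cnorm u < rho.
  move=> vr; exists (rho - cnorm v); first by rewrite subr_gt0.
  by move=> u; have := cnorm_sub_ge u v; clear; lra.
apply: (@cdiff_near _ (fun w => cmean rho (fun z => f z * z / (z - w) ^+ 2))).
  have [d d0 Hd] := near_w w wr; exists d => // v /Hd vr; apply/esym/cd_cderive.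
  apply: cd_near (cauchy_cd1 r0 cq vr).
  have [d' d'0 Hd'] := near_w v vr; exists d' => // u /Hd' ur.
  exact/esym/cauchy_disk.
by exists (cmean rho (fun z => 2 * (f z * z) / (z - w) ^+ 3)); exact: cauchy_cd2.
Qed.

Lemma cdiff_cderive f c (rho : R) : 0 < rho ->
  (forall z, cnorm (z - c) < rho -> cdiff f z) -> cdiff (cderive f) c.
Proof.
move=> r0 df.
have r2 : 0 < rho / 2 by rewrite divr_gt0.
have df0 z : cnorm z < rho -> cdiff (fun z => f (c + z)) z.
  by move=> zr; apply/cdiff_shift/df; rewrite addrC addKr.
have : cdiff (cderive (fun z => f (c + z))) 0.
  apply: (@cdiff_cderive0 _ (rho / 2)); first by rewrite cnorm0.
  by move=> z zr; apply: df0; move: zr r0; clear; lra.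
move=> H; have H' : cdiff (fun z => cderive (fun z => f (c + z)) (- c + z)) c.
  by apply: cdiff_shift; rewrite addNr.
apply: (@cdiff_near _ (fun z => cderive (fun z => f (c + z)) (- c + z)) _ _ _ H').
exists rho; [exact: r0|move=> w wr].
have E : c + (- c + w) = w by rewrite addrA subrr add0r.
have := @cderive_shift f c (- c + w); rewrite E; apply; exact: df.
Qed.

Lemma cnorm_circ_ge0 (rho : R) f M : 0 < rho -> (forall z, cnorm z = rho -> cnorm (f z) <= M) -> 0 <= M.
Proof.
move=> r0 H; apply: le_trans (cnorm_ge0 (f rho%:C)) (H _ _).
by rewrite cnorm_real gtr0_norm.
Qed.

(** Bernoulli's inequality: powers of a number larger than 1 are unbounded. *)
Lemma pow_bounded (x C : R) : (forall n : nat, x ^+ n <= C) -> x <= 1.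
Proof.
move=> H; rewrite leNgt; apply/negP => x1.
have x0 : 0 < x - 1 by rewrite subr_gt0.
have B (n : nat) : 1 + n%:R * (x - 1) <= x ^+ n.
  elim: n => [|n IH]; first by rewrite mul0r addr0.
  have n0 : 0 <= n%:R :> R by [].
  rewrite exprS -natr1; move: IH; set y := x ^+ n; set k := n%:R in n0 *.
  move=> IH; apply: le_trans (ler_wpM2l _ IH); last by clear -x1; lra.
  by have := mulr_ge0 n0 (sqr_ge0 (x - 1)); clear; lra.
have [n Hn] : exists n : nat, C / (x - 1) < n%:R.
  by exists (Num.truncn (C / (x - 1))).+1; rewrite truncnS_gt.
have := B n; have := H n; rewrite ltr_pdivrMr // in Hn.
by move: Hn; clear; lra.
Qed.

(** Cauchy's formula bounds [f w] up to a factor depending on [w]; applied to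
    the powers of [f], the factor disappears. *)
Lemma max_circle f (rho M : R) w : 0 < rho -> (forall z, cnorm z <= rho -> cdiff f z) ->
  (forall z, cnorm z = rho -> cnorm (f z) <= M) -> cnorm w <= rho -> cnorm (f w) <= M.
Proof.
move=> r0 df fM; rewrite le_eqVlt => /predU1P[/fM //|wr].
have M0 : 0 <= M by exact: cnorm_circ_ge0 fM.
have K (n : nat) : cnorm (f w) ^+ n <= M ^+ n * (rho / (rho - cnorm w)).
  have dfn z : cnorm z <= rho -> cdiff (fun z => f z ^+ n) z by move=> /df; exact: cdiffX.
  rewrite -cnormX (cauchy_disk wr dfn).
  have rw : 0 < rho - cnorm w by rewrite subr_gt0.
  apply: cmean_norm => //.
    have cq : circ_cont rho (fun z => f z ^+ n * z).
      by apply: circ_contM; [exact: circ_cdiff|exact: circ_cont_id].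
    exact: (@kernel_cont _ rho _ w 1 cq wr).
  move=> z zr; rewrite cnormM cnormV cnormM cnormX zr -mulrA.
  apply: ler_pM; rewrite ?exprn_ge0 ?cnorm_ge0 ?mulr_ge0 ?invr_ge0 ?(ltW r0) ?cnorm_ge0 //.
    by rewrite lerXn2r ?nnegrE ?cnorm_ge0 ?fM.
  rewrite ler_pM2l // lef_pV2 ?posrE ?cnorm_gt0 ?(kernel_neq0 zr wr) //.
  by have := cnorm_sub_ge z w; rewrite zr.
have [M00|Mp] := eqVneq M 0.
  by have := K 1%N; rewrite !expr1 M00 mul0r.
have {M0} Mp0 : 0 < M by rewrite lt_neqAle eq_sym Mp.
rewrite -[leRHS]mul1r -ler_pdivrMr //; apply: (@pow_bounded _ (rho / (rho - cnorm w))) => n.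
by rewrite expr_div_n ler_pdivrMr ?exprn_gt0 // mulrC.
Qed.

(** The difference of two Cauchy kernels is a multiple of [w1 - w2]. *)
Lemma lip_disk f (rho rho1 M : R) w1 w2 : rho1 < rho -> 0 < rho -> (forall z, cnorm z <= rho -> cdiff f z) ->
  (forall z, cnorm z = rho -> cnorm (f z) <= M) -> cnorm w1 <= rho1 -> cnorm w2 <= rho1 ->
  cnorm (f w1 - f w2) <= M * (rho / (rho - rho1) ^+ 2) * cnorm (w1 - w2).
Proof.
move=> rr r0 df fM w1r w2r.
have M0 : 0 <= M by exact: cnorm_circ_ge0 fM.
have w1R := le_lt_trans w1r rr; have w2R := le_lt_trans w2r rr.
have cq : circ_cont rho (fun z => f z * z).
  by apply: circ_contM; [exact: circ_cdiff|exact: circ_cont_id].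
have c1 : circ_cont rho (fun z => f z * z / (z - w1)) := @kernel_cont _ rho _ w1 1 cq w1R.
have c2 : circ_cont rho (fun z => f z * z / (z - w2)) := @kernel_cont _ rho _ w2 1 cq w2R.
have c3 : circ_cont rho (fun z => -1 * (f z * z / (z - w2))).
  by apply: circ_contM => // z _; exact: ccont_cst.
have -> : f w1 - f w2 = cmean rho (fun z => f z * z / (z - w1) + -1 * (f z * z / (z - w2))).
  by rewrite cmeanD // cmeanZ // mulN1r -(cauchy_disk w1R df) -(cauchy_disk w2R df).
apply: cmean_norm => //.
  by move=> z zr; apply: ccontD; [exact: c1|exact: c3].
move=> z zr; have n1 := kernel_neq0 zr w1R; have n2 := kernel_neq0 zr w2R.
have -> : f z * z / (z - w1) + -1 * (f z * z / (z - w2)) =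
    f z * (z * ((z - w1) * (z - w2))^-1) * (w1 - w2) by field; rewrite ?n1 ?n2.
rewrite cnormM; apply: ler_wpM2r; first exact: cnorm_ge0.
rewrite cnormM; apply: ler_pM; rewrite ?cnorm_ge0 ?fM //.
have rr0 : 0 < rho - rho1 by rewrite subr_gt0.
rewrite cnormM zr cnormV cnormM ler_pM2l // lef_pV2 ?posrE ?exprn_gt0 ?mulr_gt0 ?cnorm_gt0 //.
have h1 := cnorm_sub_ge z w1; have h2 := cnorm_sub_ge z w2; rewrite zr in h1 h2.
by rewrite expr2; apply: ler_pM; rewrite ?(ltW rr0) //; clear -h1 h2 w1r w2r; lra.
Qed.

(** The difference quotient at 0 is bounded near 0, so [removable] extends
    it. *)
Lemma factor0 f (R' : R) : 0 < R' -> f 0 = 0 -> (forall z, cnorm z < R' -> cdiff f z) ->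
  exists g, [/\ forall z, cnorm z < R' -> cdiff g z,
    forall z, f z = z * g z & cd f 0 (g 0)].
Proof.
move=> R0 f0 df.
have [l fl] : cdiff f 0 by apply: df; rewrite cnorm0.
have [d d0 Hd] := fl 1 ltr01.
have dq z : 0 < cnorm z < R' -> cdiff (fun z => f z / z) z.
  move=> /andP[z0 zR]; apply: cdiffM; first exact: df.
  by apply: cdiffV; [rewrite -cnorm_gt0|exact: cdiff_id].
have bq z : 0 < cnorm z < d -> cnorm (f z / z) <= cnorm l + 1.
  move=> /andP[z0 zd]; rewrite cnormM cnormV ler_pdivrMr //.
  have := Hd z; rewrite subr0 => /(_ zd); rewrite f0 subr0 mul1r => h.
  have -> : f z = (f z - l * z) + l * z by ring.
  apply: le_trans (cnormD _ _) _; rewrite cnormM; move: h; clear; lra.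
have [g [dg gE]] := removable R0 d0 dq bq.
have fg z : f z = z * g z.
  have [->|z0] := eqVneq z 0; first by rewrite f0 mul0r.
  by rewrite gE // mulrC divfK.
exists g; split => //.
have [m gm] : cdiff g 0 by apply: dg; rewrite cnorm0.
have := cdM (cd_id 0) gm; rewrite mul0r addr0 mul1r.
by apply: cd_near; exists 1 => // w _; rewrite fg.
Qed.

(** The maximum principle for the quotient by the coordinate. *)
Lemma schwarz_circle f (rho R' M : R) w : 0 < rho -> rho < R' -> f 0 = 0 ->
  (forall z, cnorm z < R' -> cdiff f z) -> (forall z, cnorm z = rho -> cnorm (f z) <= M) ->
  cnorm w <= rho -> cnorm (f w) <= M / rho * cnorm w.
Proof.
move=> r0 rR f0 df fM wr; have R0 : 0 < R' by exact: lt_trans rR.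
have [g [dg fg _]] := factor0 R0 f0 df.
rewrite fg cnormM mulrC; apply: ler_wpM2r; first exact: cnorm_ge0.
apply: (@max_circle g rho) => //; first by move=> z zr; apply: dg; exact: le_lt_trans rR.
move=> z zr; have := fM z zr; rewrite fg cnormM zr.
by rewrite ler_pdivlMr // mulrC.
Qed.

(** Inequalities on all circles of radius less than 1 pass to the unit
    disk. *)
Lemma limit_lt1 (x y a : R) : a < 1 -> (forall rho : R, a < rho -> rho < 1 -> x * rho <= y) -> x <= y.
Proof.
move=> a1 H; rewrite leNgt; apply/negP => yx.
have [x0|x0] := leP x 0.
  have h : a < (a + 1) / 2 < 1 by clear -a1; lra.
  have := H ((a + 1) / 2); case/andP: h => h1 h2 /(_ h1 h2).
  by move: yx x0 h2; clear; nra.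
pose s := Num.max ((a + 1) / 2) ((1 + y / x) / 2).
have yx1 : y / x < 1 by rewrite ltr_pdivrMr // mul1r.
have s1 : s < 1 by rewrite gt_max; apply/andP; split; [clear -a1|clear -yx1]; lra.
have s2 : a < s by rewrite lt_max; apply/orP; left; clear -a1; lra.
have := H s s2 s1; rewrite leNgt => /negP; apply.
rewrite -ltr_pdivrMl // mulrC lt_max; apply/orP; right.
by clear -yx1; lra.
Qed.

Lemma schwarz_disk f M w : f 0 = 0 -> (forall z, cnorm z < 1 -> cdiff f z) ->
  (forall z, cnorm z < 1 -> cnorm (f z) <= M) -> cnorm w < 1 -> cnorm (f w) <= M * cnorm w.
Proof.
move=> f0 df fM w1; apply: (@limit_lt1 _ _ (cnorm w)) => // rho wr r1.
have r0 : 0 < rho by exact: le_lt_trans (cnorm_ge0 w) wr.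
have : cnorm (f w) <= M / rho * cnorm w.
  apply: (@schwarz_circle f rho 1) => //; last exact: ltW.
  by move=> z zr; apply: fM; rewrite zr.
by rewrite mulrAC ler_pdivlMr.
Qed.

(** If [f] is smaller at the centre than on the boundary circle, it has a zero:
    otherwise [1/f] would violate the maximum principle. *)
Lemma zero_exists f c (rho m : R) : 0 < rho -> (forall z, cnorm (z - c) <= rho -> cdiff f z) ->
  (forall z, cnorm (z - c) = rho -> m <= cnorm (f z)) -> cnorm (f c) < m ->
  exists2 z, cnorm (z - c) < rho & f z = 0.
Proof.
move=> r0 df fm fc.
have m0 : 0 < m by exact: le_lt_trans (cnorm_ge0 _) fc.
have [//|nz] := pselect (exists2 z, cnorm (z - c) < rho & f z = 0); exfalso.
have f0 z : cnorm (z - c) <= rho -> f z != 0.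
  rewrite le_eqVlt => /predU1P[/fm h|h].
    by rewrite -cnorm_gt0; exact: lt_le_trans h.
  by apply/eqP => fz; apply: nz; exists z.
pose g z := (f (c + z))^-1.
have cz z : c + z - c = z by rewrite addrC addKr.
have : cnorm (g 0) <= m^-1.
  apply: (@max_circle g rho) => //; last by rewrite cnorm0 ltW.
    move=> z zr; apply: cdiffV; first by apply: f0; rewrite cz.
    by apply/cdiff_shift/df; rewrite cz.
  move=> z zr; rewrite /g cnormV lef_pV2 ?posrE ?fm ?cz // cnorm_gt0.
  by apply: f0; rewrite cz zr.
rewrite /g addr0 cnormV lef_pV2 ?posrE // ?cnorm_gt0.
  by rewrite leNgt fc.
by apply: f0; rewrite subrr cnorm0 ltW.
Qed.

End CauchyConsequences.

(** * Injective holomorphic functions and logarithms *)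

Section Univalent.
Variable R : realType.
Implicit Types (f g q : R[i] -> R[i]) (z w c : R[i]) (U : set R[i]).

Definition copen U := forall z, U z ->
  exists2 d : R, 0 < d & forall w, cnorm (w - z) < d -> U w.

Lemma disk_open c (rho : R) : copen [set z | cnorm (z - c) < rho].
Proof.
move=> z /= zr; exists (rho - cnorm (z - c)); first by rewrite subr_gt0.
move=> w wz /=; have := cdist_triangle w c z; move: wz; clear; lra.
Qed.

(** A function holomorphic at the origin has a finite order of vanishing there
    unless it is zero: an infinite order would give [|f w| <= M (|w|/rho)^n]
    for all [n]. *)
Lemma vanishing_order f (R' : R) : 0 < R' -> (forall z, cnorm z < R' -> cdiff f z) ->
  (exists n g, [/\ forall z, cnorm z < R' -> cdiff g z, g 0 != 0 &
     forall z, f z = z ^+ n * g z]) \/ (forall z, cnorm z < R' -> f z = 0).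
Proof.
move=> R0 df; have [|no] := pselect (exists n g, [/\ forall z, cnorm z < R' -> cdiff g z,
  g 0 != 0 & forall z, f z = z ^+ n * g z]); first by left.
right=> w wR.
have G (n : nat) : exists g, (forall z, cnorm z < R' -> cdiff g z) /\ (forall z, f z = z ^+ n * g z).
  elim: n => [|n [g [dg fg]]]; first by exists f; split => // z; rewrite mul1r.
  have g0 : g 0 = 0.
    by apply/eqP/negPn/negP => g0; apply: no; exists n, g; split.
  have [h [dh gh _]] := factor0 R0 g0 dg.
  by exists h; split => // z; rewrite fg gh exprSr mulrA.
have [w0|w0] := eqVneq w 0.
  by have [g [_ ->]] := G 1%N; rewrite w0 expr1 mul0r.
have wp : 0 < cnorm w by rewrite cnorm_gt0.
pose rho := (cnorm w + R') / 2.
have wr : cnorm w < rho by rewrite /rho; move: wR; clear; lra.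
have rR : rho < R' by rewrite /rho; move: wR; clear; lra.
have r0 : 0 < rho by exact: lt_trans wr.
have [M M0 HM] : exists2 M, 0 < M & forall z, cnorm z = rho -> cnorm (f z) <= M.
  by apply: circ_bounded => //; apply: circ_cdiff => z zr; apply: df; exact: le_lt_trans rR.
apply/eqP; rewrite -cnorm_eq0; apply/negPn/negP => fw0.
have fwp : 0 < cnorm (f w) by rewrite lt_neqAle eq_sym fw0 cnorm_ge0.
suff : rho / cnorm w <= 1 by rewrite ler_pdivrMr // mul1r leNgt wr.
apply: (@pow_bounded _ _ (M / cnorm (f w))) => n.
have [g [dg fg]] := G n.
have gM : cnorm (g w) <= M / rho ^+ n.
  apply: (@max_circle _ g rho) => //; last exact: ltW.
    by move=> z zr; apply: dg; exact: le_lt_trans rR.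
  move=> z zr; have := HM z zr; rewrite fg cnormM cnormX zr.
  by rewrite ler_pdivlMr ?exprn_gt0 // mulrC.
have : cnorm (f w) <= cnorm w ^+ n * (M / rho ^+ n).
  by rewrite fg cnormM cnormX ler_pM2l ?exprn_gt0.
rewrite mulrA ler_pdivlMr ?exprn_gt0 // => h.
by rewrite expr_div_n ler_pdivrMr ?exprn_gt0 // mulrAC ler_pdivlMr // mulrC [leRHS]mulrC.
Qed.

Lemma zero_isolated f c (R' : R) : 0 < R' -> (forall z, cnorm (z - c) < R' -> cdiff f z) ->
  (exists2 d : R, 0 < d & forall z, 0 < cnorm (z - c) < d -> f z != 0) \/
  (forall z, cnorm (z - c) < R' -> f z = 0).
Proof.
move=> R0 df.
have df0 z : cnorm z < R' -> cdiff (fun z => f (c + z)) z.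
  by move=> zr; apply/cdiff_shift/df; rewrite addrC addKr.
have [[n [g [dg g0 fg]]]|H] := vanishing_order R0 df0; [left|right].
  have cg : ccont g 0 by apply/cdiff_ccont/dg; rewrite cnorm0.
  have [d d0 Hd] := ccont_neq0 cg g0; exists d => // z /andP[z0 zd].
  have -> : f z = (z - c) ^+ n * g (z - c) by rewrite -fg addrC subrK.
  rewrite mulf_neq0 //; first by rewrite expf_neq0 // -cnorm_gt0.
  by apply: Hd; rewrite subr0.
by move=> z zr; have := H _ zr; rewrite addrC subrK.
Qed.

(** Through the order of vanishing of [f - f 0]: at a zero of order [n + 1]
    the derivative would have a zero of order [n] only. *)
Lemma deriv0_cst f (R' : R) : 0 < R' -> (forall z, cnorm z < R' -> cd f z 0) ->
  forall z, cnorm z < R' -> f z = f 0.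
Proof.
move=> R0 df; pose h z := f z - f 0.
have dh z : cnorm z < R' -> cd h z 0.
  by move=> /df H; have := cdB H (cd_cst (f 0) z); rewrite subr0.
have [[n [g [dg g0 hg]]]|H] := @vanishing_order h R' R0 (fun z zr => ex_intro _ _ (dh z zr)); last first.
  by move=> z zr; apply/eqP; rewrite -subr_eq0; apply/eqP/H.
exfalso; case: n hg => [hg|n hg].
  by move: (hg 0); rewrite /h subrr expr0 mul1r => /esym/eqP; apply/negP.
(* z^(n+1) g has derivative z^n ((n+1) g + z g'), whose second factor is
   continuous and nonzero at the origin *)
have dg0 : cdiff g 0 by apply: dg; rewrite cnorm0.
have cdg : cdiff (cderive g) 0.
  by apply: (@cdiff_cderive _ _ _ R') => // z; rewrite subr0; exact: dg.
have : n.+1%:R * g 0 + 0 * cderive g 0 = 0.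
  apply: (@ccont_punct_eq _ (fun z => n.+1%:R * g z + z * cderive g z) (fun=> 0) 0 R') => //.
  - apply: ccontD; first by apply: ccontM; [exact: ccont_cst|exact: cdiff_ccont].
    by apply: ccontM; [exact: ccont_id|exact: cdiff_ccont].
  - exact: ccont_cst.
  move=> z; rewrite subr0 => /andP[z0 zR].
  have zn : z != 0 by rewrite -cnorm_gt0.
  have dX m : cd (fun z => z ^+ m.+1) z (m.+1%:R * z ^+ m).
    elim: m => [|m IH]; first by rewrite expr0 mulr1; apply: cd_near (cd_id z); exists 1 => // v _; rewrite expr1.
    have -> : m.+2%:R * z ^+ m.+1 = 1 * z ^+ m.+1 + z * (m.+1%:R * z ^+ m).
      by rewrite -[in LHS]natr1 exprS; ring.
    apply: cd_near (cdM (cd_id z) IH); exists 1 => // v _; by rewrite -exprS.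
  have := cdM (dX n) (cdiff_cd (dg z zR)) => H1.
  have H2 : cd h z (n.+1%:R * z ^+ n * g z + z ^+ n.+1 * cderive g z).
    by apply: cd_near H1; exists 1 => // v _; rewrite hg.
  have := cd_uniq H2 (dh z zR).
  have -> : n.+1%:R * z ^+ n * g z + z ^+ n.+1 * cderive g z =
     z ^+ n * (n.+1%:R * g z + z * cderive g z) by rewrite exprSr; ring.
  by move/eqP; rewrite mulf_eq0 expf_eq0 (negbTE zn) andbF /= => /eqP.
by rewrite mul0r addr0 => /eqP; rewrite mulf_eq0 pnatr_eq0 (negbTE g0).
Qed.

(** An injective holomorphic function is open: [f - f c] is bounded below on a
    small circle around [c], so [f - v] has a zero inside for [v] near [f c]. *)
Lemma univ_open U f c (e : R) : copen U -> (forall z, U z -> cdiff f z) ->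
  (forall z w, U z -> U w -> f z = f w -> z = w) -> U c -> 0 < e ->
  exists2 m : R, 0 < m & forall v, cnorm (v - f c) < m ->
    exists z, [/\ U z, cnorm (z - c) < e & f z = v].
Proof.
move=> oU df fi Uc e0; have [d d0 Hd] := oU c Uc.
pose r := Num.min (d / 2) (e / 2).
have r0 : 0 < r by rewrite lt_min !divr_gt0.
have rd : r < d by rewrite gt_min; apply/orP; left; move: d0; clear; lra.
have re : r < e by rewrite gt_min; apply/orP; right; move: e0; clear; lra.
have Ur z : cnorm (z - c) <= r -> U z by move=> zr; apply: Hd; exact: le_lt_trans rd.
have cz z : c + z - c = z by rewrite addrC addKr.
have [m m0 Hm] : exists2 m, 0 < m & forall z, cnorm z = r -> m <= cnorm (f (c + z) - f c).
  apply: (@circ_min _ r (fun z => f (c + z) - f c)) => // z zr.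
    apply: ccontB; last exact: ccont_cst.
    by apply/cdiff_ccont/cdiff_shift/df/Ur; rewrite cz zr.
  rewrite subr_eq0; apply/eqP => E.
  have Ucz : U (c + z) by apply: Ur; rewrite cz zr.
  have : z = 0 by rewrite -(cz z) (fi _ _ Ucz Uc E) subrr.
  by move=> z0; move: zr; rewrite z0 cnorm0 => /eqP; rewrite lt_eqF.
exists (m / 2) => [|v vm]; first by rewrite divr_gt0.
have [z zr fz] : exists2 z, cnorm (z - c) < r & f z - v = 0.
  apply: (@zero_exists _ _ c r (m / 2)) => //.
  - by move=> z /Ur /df dz; apply: cdiffB => //; exact: cdiff_cst.
  - move=> z zr; have := Hm (z - c) zr; rewrite [c + _]addrC subrK => h.
    have := cdist_triangle (f z) (f c) v; move: vm h; clear; lra.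
  - by rewrite cnormC.
exists z; split; first exact/Ur/ltW.
  exact: lt_trans re.
by apply/eqP; rewrite -subr_eq0 fz.
Qed.

(** Continuity of the inverse is openness of [f]. *)
Lemma inverse_ccont U f g c : copen U -> (forall z, U z -> cdiff f z) ->
  (forall z, U z -> g (f z) = z) -> U c -> ccont g (f c).
Proof.
move=> oU df gf Uc e e0.
have fi z w : U z -> U w -> f z = f w -> z = w by move=> Uz Uw E; rewrite -(gf z) // E gf.
have [m m0 H] := univ_open oU df fi Uc e0.
by exists m => // v /H [z [Uz ze <-]]; rewrite !gf.
Qed.

(** In terms of slopes: the slope of the inverse is the reciprocal of the
    slope of [f]. *)
Lemma inverse_cd U f g c : copen U -> (forall z, U z -> cdiff f z) ->
  (forall z, U z -> g (f z) = z) -> U c -> cderive f c != 0 -> cd g (f c) (cderive f c)^-1.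
Proof.
move=> oU df gf Uc f0.
have fi z w : U z -> U w -> f z = f w -> z = w by move=> Uz Uw E; rewrite -(gf z) // E gf.
have cg := inverse_ccont oU df gf Uc.
have /cd_slope [q [cq qc [d d0 H]]] := cdiff_cd (df c Uc).
apply/cd_slope; exists (fun v => (q (g v))^-1); split.
- have qc0 : q (g (f c)) != 0 by rewrite gf // qc.
  by apply: ccontV => //; apply: ccont_comp => //; rewrite gf.
- by rewrite gf // qc.
have [d1 d10 H1] : exists2 d1 : R, 0 < d1 & forall w, cnorm (w - c) < d1 -> q w != 0.
  by apply: ccont_neq0 => //; rewrite qc.
have mn : 0 < Num.min d d1 by rewrite lt_min d0.
have [m m0 Hm] := univ_open oU df fi Uc mn.
exists m => // v vm; have [z [Uz]] := Hm v vm.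
rewrite lt_min => /andP[zd zd1] <-; rewrite !gf // (H z zd).
by rewrite addrAC subrr add0r mulKf ?H1 // addrC subrK.
Qed.

(** Zeros of [f'] are isolated, so the inverse is holomorphic off a discrete
    set; being continuous, it is holomorphic, and the chain rule excludes that
    [f'] vanishes. *)
Lemma univ_inverse U f g c : copen U -> (forall z, U z -> cdiff f z) ->
  (forall z, U z -> g (f z) = z) -> U c ->
  cderive f c != 0 /\ cd g (f c) (cderive f c)^-1.
Proof.
move=> oU df gf Uc.
suff f0 : cderive f c != 0 by split => //; exact: inverse_cd gf Uc f0.
have fi z w : U z -> U w -> f z = f w -> z = w by move=> Uz Uw E; rewrite -(gf z) // E gf.
have [d d0 Hd] := oU c Uc.
have ddf z : cnorm (z - c) < d -> cdiff (cderive f) z.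
  move=> zd; have [d' d'0 Hd'] := oU z (Hd z zd).
  by apply: (@cdiff_cderive _ f z d') => // w /Hd'; exact: df.
have cz z : c + z - c = z by rewrite addrC addKr.
have [[d1 d10 H1]|H] := zero_isolated d0 ddf; last first.
  exfalso; have K z : cnorm z < d -> cd (fun z => f (c + z)) z 0.
    move=> zd; have zc : cnorm (c + z - c) < d by rewrite cz.
    by rewrite -(H _ zc); apply: cd_shift; apply/cdiff_cd/df/Hd.
  have h2 : 0 < d / 2 < d by move: d0; clear; lra.
  case/andP: h2 => h2 h3.
  have zd : cnorm ((d / 2)%:C : R[i]) < d by rewrite cnorm_real gtr0_norm.
  have := deriv0_cst d0 K zd; rewrite addr0 => E.
  have Ucz : U (c + (d / 2)%:C) by apply: Hd; rewrite cz.
  have : ((d / 2)%:C : R[i]) = 0 by rewrite -(cz (d / 2)%:C) (fi _ _ Ucz Uc E) subrr.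
  by move/eqP; rewrite -cnorm_eq0 cnorm_real normr_eq0 gt_eqF.
have cg := inverse_ccont oU df gf Uc.
have mn : 0 < Num.min d d1 by rewrite lt_min d0.
have [m m0 Hm] := univ_open oU df fi Uc mn.
have dgv v : 0 < cnorm (v - f c) < m -> cdiff g v.
  move=> /andP[v0 vm]; have [z [Uz]] := Hm v vm.
  rewrite lt_min => /andP[zd zd1] fz; rewrite -fz; exists (cderive f z)^-1.
  apply: inverse_cd gf Uz _ => //; apply: H1; rewrite zd1 andbT cnorm_gt0 subr_eq0.
  by apply: contraTneq v0 => zc; rewrite -fz zc subrr cnorm0 ltxx.
have [d2 d20 H2] := cg 1 ltr01.
have dg0 z : 0 < cnorm z < m -> cdiff (fun z => g (f c + z)) z.
  by move=> zm; apply/cdiff_shift/dgv; rewrite addrC addKr.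
have bg0 z : 0 < cnorm z < d2 -> cnorm (g (f c + z)) <= cnorm c + 1.
  move=> /andP[_ zd]; have := H2 (f c + z); rewrite [f c + z]addrC addrK => /(_ zd).
  by rewrite gf // => h; have := cnorm_sub_ge (g (z + f c)) c; move: h; clear; lra.
have [gh [dgh ghE]] := removable m0 d20 dg0 bg0.
have gh0 : g (f c) = gh 0.
  rewrite -[X in _ = gh X](addNr (f c)).
  apply: (@ccont_punct_eq _ g (fun v => gh (- f c + v)) (f c) m) => //.
  - apply: (@ccont_comp _ (fun v => - f c + v) gh).
      by apply: ccontD; [exact: ccont_cst|exact: ccont_id].
    by rewrite addNr; apply/cdiff_ccont/dgh; rewrite cnorm0.
  - move=> v /andP[v0 vm]; rewrite ghE ?addNKr //.
    by rewrite addrC -cnorm_gt0.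
have [l gl] : cdiff g (f c).
  apply: (@cdiff_near _ (fun v => gh (- f c + v))).
    exists m; [exact: m0|move=> v vm].
    have [->|ne] := eqVneq v (f c); first by rewrite addNr gh0.
    by rewrite ghE ?addNKr // addrC subr_eq0.
  by apply: cdiff_shift; rewrite addNr; apply: dgh; rewrite cnorm0.
have H3 := cd_comp (cdiff_cd (df c Uc)) gl.
have H4 : cd (fun w => g (f w)) c 1.
  by apply: cd_near (cd_id c); exists d; [exact: d0|move=> w /Hd Uw; rewrite gf].
apply/eqP => f0; have := cd_uniq H3 H4; rewrite f0 mulr0 => /eqP.
by rewrite eq_sym oner_eq0.
Qed.

Lemma univ_image_open U f : copen U -> (forall z, U z -> cdiff f z) ->
  (forall z w, U z -> U w -> f z = f w -> z = w) -> copen (f @` U).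
Proof.
move=> oU df fi _ [c Uc <-]; have [m m0 H] := univ_open oU df fi Uc ltr01.
by exists m => // v /H [z [Uz _ <-]]; exists z.
Qed.

Definition inv_on U f (v : R[i]) : R[i] := xget 0 [set z | U z /\ f z = v].

Lemma inv_onP U f v : (f @` U) v -> U (inv_on U f v) /\ f (inv_on U f v) = v.
Proof.
move=> [z Uz fz]; rewrite /inv_on; case: xgetP => [y -> //|H].
by exfalso; apply: (H z).
Qed.

Lemma inv_onK U f z : (forall z w, U z -> U w -> f z = f w -> z = w) -> U z ->
  inv_on U f (f z) = z.
Proof.
move=> fi Uz; have [|Uv fv] := @inv_onP U f (f z); first by exists z.
exact: fi.
Qed.

Lemma inv_on_cdiff U f v : copen U -> (forall z, U z -> cdiff f z) ->
  (forall z w, U z -> U w -> f z = f w -> z = w) -> (f @` U) v -> cdiff (inv_on U f) v.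
Proof.
move=> oU df fi [z Uz <-]; exists (cderive f z)^-1.
by have [] := @univ_inverse U f (inv_on U f) z oU df (fun w => @inv_onK U f w fi) Uz.
Qed.

Lemma univ_deriv_neq0 U f z : copen U -> (forall z, U z -> cdiff f z) ->
  (forall z w, U z -> U w -> f z = f w -> z = w) -> U z -> cderive f z != 0.
Proof.
by move=> oU df fi Uz; have [] := @univ_inverse U f (inv_on U f) z oU df (fun w => @inv_onK U f w fi) Uz.
Qed.

(** The principal logarithm on the right half plane. *)
Definition plog z : R[i] := ln (cnorm z) +i* atan (complex.Im z / complex.Re z).

Lemma cexp_plog z : 0 < complex.Re z -> cexp (plog z) = z.
Proof.
case: z => x y /= x0; have zp : 0 < cnorm (x +i* y).
  by apply: lt_le_trans (Re_le_cnorm _); rewrite /= gtr0_norm.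
rewrite /plog cexp_ln //= /expi.
have c0 : 0 < cos (atan (y / x)).
  by apply: cos_gt0_pihalf; rewrite atan_gtNpi2 atan_ltpi2.
have cE : cos (atan (y / x)) = x / cnorm (x +i* y).
  rewrite cos_atan.
  have -> : Num.sqrt (1 + (y / x) ^+ 2) = cnorm (x +i* y) / x.
    rewrite -[RHS]ger0_norm ?divr_ge0 ?(ltW zp) ?(ltW x0) // -sqrtr_sqr; congr Num.sqrt.
    by rewrite !expr_div_n cnorm_sq /=; field; rewrite gt_eqF.
  by rewrite invf_div.
have sE : sin (atan (y / x)) = y / cnorm (x +i* y).
  have : tan (atan (y / x)) = y / x by rewrite atanK.
  rewrite /tan => /(congr1 (fun t => t * cos (atan (y / x)))).
  rewrite divfK ?gt_eqF // => ->; rewrite cE.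
  by field; rewrite !gt_eqF.
apply/eqP; rewrite eq_complex /= cE sE.
by apply/andP; split; apply/eqP; field; rewrite gt_eqF.
Qed.

Lemma plog_cdiff z : 0 < complex.Re z -> cdiff plog z.
Proof.
move=> z0; rewrite -(cexp_plog z0).
pose U : set R[i] := [set w | - (pi / 2) < complex.Im w < pi / 2].
have oU : copen U.
  move=> w /= /andP[w1 w2].
  exists (Num.min (complex.Im w + pi / 2) (pi / 2 - complex.Im w)).
    by rewrite lt_min; apply/andP; split; [move: w1|move: w2]; clear; lra.
  move=> v; rewrite lt_min => /andP[h1 h2] /=.
  have := Im_le_cnorm (v - w); rewrite ImD ImN ler_norml => /andP[h3 h4].
  by apply/andP; split; [move: h1 h3|move: h2 h4]; clear; lra.
have UL : U (plog z) by rewrite /U /= atan_gtNpi2 atan_ltpi2.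
have K w : U w -> plog (cexp w) = w.
  case: w => x y; rewrite /U /= => yU; rewrite /plog cnorm_cexp /= expRK.
  have cy : 0 < cos y by exact: cos_gt0_pihalf.
  rewrite !mul0r addr0 subr0 -mulf_div mulfV ?mul1r; last by rewrite gt_eqF // expR_gt0.
  by rewrite -/(tan y) tanK // in_itv.
have [_ H] := @univ_inverse U (@cexp R) plog (plog z) oU
  (fun w _ => ex_intro _ _ (cd_cexp w)) K UL.
by exists (cderive (@cexp R) (plog z))^-1.
Qed.

(** A zero-free function on a disk has a logarithm on smaller concentric disks:
    [u z / u 0] is the product of the ratios [u (s' z) / u (s z)] for
    consecutive [s < s'] in a subdivision of [0,1]; for a fine subdivision
    these are close to 1 and have principal logarithms. *)
Lemma disk_log u (R' rho : R) : 0 < rho -> rho < R' ->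
  (forall z, cnorm z < R' -> cdiff u z) -> (forall z, cnorm z < R' -> u z != 0) ->
  exists P, forall z, cnorm z <= rho -> cdiff P z /\ cexp (P z) = u z.
Proof.
move=> r0 rR du u0.
pose rho' := (rho + R') / 2.
have rr' : rho < rho' by rewrite /rho'; move: rR; clear; lra.
have r'R : rho' < R' by rewrite /rho'; move: rR; clear; lra.
have r'0 : 0 < rho' by exact: lt_trans rr'.
have du' z : cnorm z <= rho' -> cdiff u z by move=> zr; apply: du; exact: le_lt_trans r'R.
have [M M0 HM] := circ_bounded r'0 (circ_cdiff du').
have [m m0 Hm] : exists2 m, 0 < m & forall z, cnorm z <= rho -> m <= cnorm (u z).
  have dV z : cnorm z <= rho' -> cdiff (fun z => (u z)^-1) z.
    by move=> zr; apply: cdiffV; [apply: u0; exact: le_lt_trans r'R|exact: du'].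
  have [N N0 HN] := circ_bounded r'0 (circ_cdiff dV).
  exists N^-1; first by rewrite invr_gt0.
  move=> z zr; have p : 0 < cnorm (u z).
    by rewrite cnorm_gt0; apply: u0; apply: le_lt_trans zr rR.
  have := max_circle r'0 dV HN (ltW (le_lt_trans zr rr')).
  by rewrite cnormV => h; rewrite -[leRHS]invrK lef_pV2 ?posrE ?invr_gt0.
pose L := M * (rho' / (rho' - rho) ^+ 2).
have Lip w1 w2 : cnorm w1 <= rho -> cnorm w2 <= rho -> cnorm (u w1 - u w2) <= L * cnorm (w1 - w2).
  by move=> h1 h2; exact: lip_disk.
have L0 : 0 < L by rewrite mulr_gt0 // divr_gt0 // exprn_gt0 // subr_gt0.
have [N HN] : exists N : nat, L * rho / m < N.+1%:R.
  by exists (Num.truncn (L * rho / m)); rewrite truncnS_gt.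
have N0 : 0 < N.+1%:R :> R by [].
pose s (k : nat) : R := k%:R / N.+1%:R.
have s01 k : (k <= N.+1)%N -> 0 <= s k <= 1.
  by move=> kN; rewrite divr_ge0 //= ler_pdivrMr // mul1r ler_nat.
have sz k z : (k <= N.+1)%N -> cnorm z <= rho -> cnorm ((s k)%:C * z) <= rho.
  move=> /s01 /andP[h1 h2] zr; rewrite cnormM cnorm_real ger0_norm //.
  by apply: le_trans zr; rewrite ler_piMl // cnorm_ge0.
have dsz k z : (k <= N.+1)%N -> cnorm z <= rho -> cdiff (fun z => u ((s k)%:C * z)) z.
  move=> kN zr; apply: (@cdiff_comp _ (fun z => (s k)%:C * z) u).
    by apply: cdiffM; [exact: cdiff_cst|exact: cdiff_id].
  by apply: du'; apply: le_trans (sz _ _ kN zr) (ltW rr').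
have nsz k z : (k <= N.+1)%N -> cnorm z <= rho -> u ((s k)%:C * z) != 0.
  by move=> kN zr; rewrite -cnorm_gt0; exact: lt_le_trans (Hm _ (sz _ _ kN zr)).
suff H (k : nat) : (k <= N.+1)%N -> exists P, forall z, cnorm z <= rho ->
    cdiff P z /\ cexp (P z) = u ((s k)%:C * z).
  have [P HP] := H N.+1 (leqnn _); exists P => z /HP [dP ->]; split => //.
  by rewrite /s divff // mul1r.
elim: k => [_|k IH kN].
  have [p pE] : exists p, cexp p = u 0.
    have n0 : u 0 != 0 by apply: u0; rewrite cnorm0; exact: lt_trans rR.
    have [al _ uE] := polar n0; exists (ln (cnorm (u 0)) +i* al).
    by rewrite cexp_ln ?cnorm_gt0.
  by exists (fun=> p) => z _; split; [exact: cdiff_cst|rewrite /s mul0r mul0r].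
have [P HP] := IH (ltnW kN).
pose ratio z := u ((s k.+1)%:C * z) / u ((s k)%:C * z).
have rpos z : cnorm z <= rho -> 0 < complex.Re (ratio z).
  move=> zr; have nz := nsz k z (ltnW kN) zr.
  have : cnorm (ratio z - 1) < 1.
    have -> : ratio z - 1 = (u ((s k.+1)%:C * z) - u ((s k)%:C * z)) / u ((s k)%:C * z).
      by rewrite /ratio mulrBl divff.
    rewrite cnormM cnormV ltr_pdivrMr ?cnorm_gt0 // mul1r.
    apply: lt_le_trans (Hm _ (sz _ _ (ltnW kN) zr)).
    apply: le_lt_trans (Lip _ _ (sz _ _ kN zr) (sz _ _ (ltnW kN) zr)) _.
    rewrite -mulrBl -rmorphB /= cnormM cnorm_real /s -mulrBl -natr1 addrAC subrr add0r.
    rewrite mul1r ger0_norm ?invr_ge0 //.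
    apply: (@le_lt_trans _ _ (L * (N.+1%:R^-1 * rho))).
      by rewrite ler_pM2l // ler_pM2l ?invr_gt0.
    by rewrite mulrCA ltr_pdivrMl // -ltr_pdivrMr.
  move=> h; have := Re_le_cnorm (ratio z - 1); rewrite ReD ReN /= ler_norml.
  by move=> /andP[h1 h2]; move: h h1; clear; lra.
exists (fun z => P z + plog (ratio z)) => z zr; have [dP eP] := HP z zr.
split.
  apply: cdiffD => //; apply: (@cdiff_comp _ ratio plog); last exact: plog_cdiff (rpos z zr).
  apply: cdiffM; first exact: dsz.
  by apply: cdiffV; [exact: nsz (ltnW kN) zr|exact: dsz (ltnW kN) zr].
by rewrite cexpD eP cexp_plog ?rpos // /ratio mulrC divfK // nsz // ltnW.
Qed.

End Univalent.

(** * Maps of the disk fixing the origin *)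

Section DiskMaps.
Variable R : realType.
Implicit Types (f g h : R[i] -> R[i]) (z w v : R[i]).

Definition udisk : set R[i] := [set z | cnorm z < 1].

Lemma udisk_open : copen udisk.
Proof. by move=> z /= z1; have [d d0 H] := @disk_open R 0 1 z ltac:(by rewrite /= subr0); exists d => // w /H /=; rewrite subr0. Qed.

Definition univ0 g := [/\ forall z, udisk z -> cdiff g z,
  forall z w, udisk z -> udisk w -> g z = g w -> z = w & g 0 = 0].

Lemma udisk0 : udisk 0. Proof. by rewrite /udisk /= cnorm0. Qed.

Lemma univ0_deriv g : univ0 g -> cderive g 0 != 0.
Proof. by move=> [dg gi _]; apply: (@univ_deriv_neq0 _ udisk) => //; [exact: udisk_open|exact: udisk0]. Qed.

(** The transition map of the inclusion of two images, a univalent self-map of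
    the disk fixing the origin. *)
Definition trans g h z := inv_on udisk h (g z).

Lemma transP g h z : g @` udisk `<=` h @` udisk -> udisk z ->
  udisk (trans g h z) /\ h (trans g h z) = g z.
Proof. by move=> gh z1; apply: inv_onP; apply: gh; exists z. Qed.

Lemma trans_cdiff g h z : univ0 g -> univ0 h -> g @` udisk `<=` h @` udisk -> udisk z ->
  cdiff (trans g h) z.
Proof.
move=> [dg gi g0] [dh hi h0] gh z1; apply: (@cdiff_comp _ g (inv_on udisk h)); first exact: dg.
by apply: inv_on_cdiff => //; [exact: udisk_open|apply: gh; exists z].
Qed.

Lemma trans0 g h : univ0 g -> univ0 h -> trans g h 0 = 0.
Proof. by move=> [_ _ g0] [_ hi h0]; rewrite /trans g0 -{1}h0 inv_onK //; exact: udisk0. Qed.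

Lemma trans_le g h z : univ0 g -> univ0 h -> g @` udisk `<=` h @` udisk -> udisk z ->
  cnorm (trans g h z) <= cnorm z.
Proof.
move=> ug uh gh z1; rewrite -[leRHS]mul1r; apply: schwarz_disk => //.
- exact: trans0.
- by move=> w w1; exact: trans_cdiff.
- by move=> w w1; have [/ltW] := transP gh w1.
Qed.

Lemma trans_inj g h z w : univ0 g -> univ0 h -> g @` udisk `<=` h @` udisk -> udisk z -> udisk w ->
  trans g h z = trans g h w -> z = w.
Proof.
move=> [_ gi _] _ gh z1 w1 E; apply: gi => //.
have [_ <-] := transP gh z1; have [_ <-] := transP gh w1; by rewrite E.
Qed.

Lemma trans_comp f g h z : univ0 f -> univ0 g -> univ0 h ->
  f @` udisk `<=` g @` udisk -> g @` udisk `<=` h @` udisk -> udisk z ->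
  trans g h (trans f g z) = trans f h z.
Proof.
move=> uf [_ gi _] [_ hi _] fg gh z1; have [t1 tE] := transP fg z1.
by rewrite /trans -/(trans f g z) tE.
Qed.

Lemma trans_id g z : univ0 g -> udisk z -> trans g g z = z.
Proof. by move=> [_ gi _] z1; exact: inv_onK. Qed.

Lemma trans_deriv g h : univ0 g -> univ0 h -> g @` udisk `<=` h @` udisk ->
  cd (trans g h) 0 (cderive g 0 / cderive h 0).
Proof.
move=> ug uh gh; have h0 := univ0_deriv uh.
have [l tl] := trans_cdiff ug uh gh udisk0.
suff -> : cderive g 0 / cderive h 0 = l by [].
have [dg _ _] := ug; have [dh _ _] := uh.
have H : cd (fun z => h (trans g h z)) 0 (cderive h 0 * l).
  apply: cd_comp => //; rewrite trans0 //; apply/cdiff_cd/dh; exact: udisk0.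
have -> : cderive g 0 = cderive h 0 * l; last by rewrite mulrAC mulfV // mul1r.
apply: (cd_uniq (cdiff_cd (dg 0 udisk0))).
apply: (@cd_near _ (fun z => h (trans g h z))) H; exists 1; [exact: ltr01|move=> w].
by rewrite subr0 => w1; have [] := transP gh w1.
Qed.

Lemma schwarz_deriv f l : f 0 = 0 -> (forall z, udisk z -> cdiff f z) ->
  (forall z, udisk z -> cnorm (f z) <= 1) -> cd f 0 l -> cnorm l <= 1.
Proof.
move=> f0 df f1 fl.
have [g [dg fg gl]] := factor0 ltr01 f0 df.
rewrite (cd_uniq fl gl); apply: (@limit_lt1 _ _ _ 0) => // rho r0 r1.
rewrite -ler_pdivlMr // div1r; apply: (@max_circle _ g rho) => //.
- by move=> z zr; apply: dg; exact: le_lt_trans r1.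
- move=> z zr; have := f1 z; rewrite /udisk /= fg cnormM zr => /(_ r1).
  by rewrite -ler_pdivlMl // mulr1.
- by rewrite cnorm0 ltW.
Qed.

Lemma trans_deriv_le g h : univ0 g -> univ0 h -> g @` udisk `<=` h @` udisk ->
  cnorm (cderive g 0) <= cnorm (cderive h 0).
Proof.
move=> ug uh gh; have h0 : 0 < cnorm (cderive h 0) by rewrite cnorm_gt0 univ0_deriv.
rewrite -[leRHS]mul1r -ler_pdivrMr // -cnormV -cnormM.
apply: (@schwarz_deriv (trans g h)); [exact: trans0| | |exact: trans_deriv].
- by move=> z z1; exact: trans_cdiff.
- by move=> z z1; have [/ltW] := transP gh z1.
Qed.

(** A self-map of the disk fixing the origin with derivative close to 1 there
    is close to the identity: [1 - f z / z] has nonnegative real part, so it is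
    controlled by its value at the origin (Harnack). *)
Lemma near_identity f (be rho : R) z : f 0 = 0 -> (forall z, udisk z -> cdiff f z) ->
  (forall z, udisk z -> cnorm (f z) <= 1) -> cd f 0 be%:C -> be <= 1 -> rho < 1 ->
  cnorm z <= rho -> cnorm (f z - z) <= 2 * (1 - be) / (1 - rho).
Proof.
move=> f0 df f1 fl be1 r1 zr.
have r0 : 0 <= rho by exact: le_trans (cnorm_ge0 z) zr.
have z1 : cnorm z < 1 by exact: le_lt_trans r1.
have [v [dv fv vl]] := factor0 ltr01 f0 df.
have v0 : v 0 = be%:C by exact: cd_uniq vl fl.
have v1 w : cnorm w < 1 -> cnorm (v w) <= 1.
  move=> w1; have [->|w0] := eqVneq w 0.
    rewrite v0; apply: (schwarz_deriv f0 df f1 fl).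
  have := schwarz_disk f0 df f1 w1; rewrite mul1r fv cnormM.
  by rewrite -[X in _ <= X]mulr1 ler_pM2l ?cnorm_gt0.
have H (eta : R) : 0 < eta -> cnorm (v z - be%:C) * (1 - rho) <= 2 * rho * (1 + eta - be).
  move=> eta0; pose p0 := 1 + eta - be.
  have p00 : 0 < p0 by rewrite /p0; move: be1 eta0; clear; lra.
  (* the Moebius map of the half plane [Re < 1 + eta] onto the disk sending
     [be] to 0, applied to [v]; the [eta] makes the denominator nonzero *)
  pose q w := (be%:C - v w) / ((1 + eta + p0)%:C - v w).
  have den w : cnorm w < 1 -> cnorm (be%:C - v w) < cnorm ((1 + eta + p0)%:C - v w).
    move=> w1; rewrite -(@ltr_pXn2r _ 2) ?nnegrE ?cnorm_ge0 //.
    rewrite !cnorm_sq !ReD !ImD !ReN !ImN /=.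
    have := le_trans (ler_norm _) (le_trans (Re_le_cnorm _) (v1 w w1)).
    move: (complex.Re (v w)) (complex.Im (v w)) => a b ha; rewrite /p0.
    rewrite ltrD2r -subr_gt0.
    have -> : (1 + eta + (1 + eta - be) - a) ^+ 2 - (be - a) ^+ 2 =
       4 * (1 + eta - be) * (1 + eta - a) by ring.
    rewrite mulr_gt0 //; first by rewrite mulr_gt0.
    by move: ha eta0; clear; lra.
  have den0 w : cnorm w < 1 -> (1 + eta + p0)%:C - v w != 0.
    by move=> /den h; rewrite -cnorm_gt0; exact: le_lt_trans (cnorm_ge0 _) h.
  have q1 : cnorm (q z) <= 1 * cnorm z.
    apply: schwarz_disk => //.
    - by rewrite /q v0 subrr mul0r.
    - move=> w w1; apply: cdiffM; first by apply: cdiffB; [exact: cdiff_cst|exact: dv].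
      by apply: cdiffV; [exact: den0|apply: cdiffB; [exact: cdiff_cst|exact: dv]].
    - move=> w w1; rewrite cnormM cnormV ler_pdivrMr ?cnorm_gt0 ?den0 // mul1r.
      by rewrite ltW // den.
  move: q1; rewrite mul1r cnormM cnormV ler_pdivrMr ?cnorm_gt0 ?den0 // => q1.
  have : cnorm ((1 + eta + p0)%:C - v z) <= cnorm (be%:C - v z) + 2 * p0.
    have -> : (1 + eta + p0)%:C - v z = (be%:C - v z) + (2 * p0)%:C.
      have -> : 1 + eta + p0 = be + 2 * p0 by rewrite /p0; ring.
      by rewrite rmorphD /=; ring.
    apply: le_trans (cnormD _ _) _; rewrite cnorm_real ger0_norm //.
    by rewrite mulr_ge0 // ltW.
  have := cnorm_ge0 (be%:C - v z); rewrite (cnormC (v z)).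
  move: (cnorm (be%:C - v z)) q1 zr r0 p00 (cnorm_ge0 z) => X.
  move: (cnorm ((1 + eta + p0)%:C - v z)) (cnorm z) => Y Z q1 zr r0 p00 Z0 X0 Y1.
  have h1 : Z * Y <= Z * (X + 2 * p0) by rewrite ler_wpM2l.
  have h2 : Z * (X + 2 * p0) <= rho * (X + 2 * p0).
    by rewrite ler_wpM2r // addr_ge0 // mulr_ge0 // ltW.
  by rewrite -/p0; move: q1 h1 h2; clear; lra.
have K : cnorm (v z - be%:C) * (1 - rho) <= 2 * rho * (1 - be).
  rewrite leNgt; apply/negP => h.
  set A := cnorm _ * _ in h; set B := 2 * rho * (1 - be) in h.
  have e0 : 0 < (A - B) / (4 * (rho + 1)).
    by rewrite divr_gt0 ?subr_gt0 // mulr_gt0 // ltr_wpDl.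
  have := H _ e0; rewrite -/A.
  have -> : 2 * rho * (1 + (A - B) / (4 * (rho + 1)) - be) = B + (A - B) * (rho / (2 * (rho + 1))).
    by rewrite /B; field; rewrite gt_eqF // ltr_wpDl.
  have : rho / (2 * (rho + 1)) <= 1 / 2.
    have : 0 < 2 * (rho + 1) by move: r0; clear; lra.
    by move=> ?; rewrite ler_pdivrMr //; lra.
  move: h; clear; nra.
rewrite ler_pdivlMr ?subr_gt0 //.
have -> : f z - z = z * (v z - 1) by rewrite fv; ring.
rewrite cnormM.
have t : cnorm (v z - 1) <= cnorm (v z - be%:C) + (1 - be).
  apply: le_trans (cdist_triangle _ _ be%:C) _; rewrite lerD2l.
  by rewrite -(rmorph1 (real_complex R)) -rmorphB /= cnorm_real distrC ger0_norm // subr_ge0.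
have h1 : cnorm z * cnorm (v z - 1) <= 1 * cnorm (v z - 1).
  by rewrite ler_wpM2r ?cnorm_ge0 // ltW.
have h2 : cnorm z * cnorm (v z - 1) * (1 - rho) <= cnorm (v z - 1) * (1 - rho).
  by rewrite ler_wpM2r ?subr_ge0 ?(ltW r1) // -[leRHS]mul1r.
have h3 : cnorm (v z - 1) * (1 - rho) <= (cnorm (v z - be%:C) + (1 - be)) * (1 - rho).
  by rewrite ler_wpM2r ?subr_ge0 ?(ltW r1).
move: h2 h3 K r1 be1 r0; clear; nra.
Qed.

(** Cauchy's formula passes to the uniform limit and exhibits it as a Cauchy
    integral. *)
Lemma unif_limit (h : nat -> R[i] -> R[i]) H (rho : R) (eps : nat -> R) w : cnorm w < rho ->
  (forall n z, cnorm z <= rho -> cdiff (h n) z) ->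
  (forall n z, cnorm z <= rho -> cnorm (h n z - H z) <= eps n) ->
  (forall e : R, 0 < e -> exists n, eps n <= e) -> cdiff H w.
Proof.
move=> wr dh hH e0.
have r0 : 0 < rho by exact: le_lt_trans (cnorm_ge0 w) wr.
pose sg : R := (cnorm w + rho) / 2.
have ws : cnorm w < sg by rewrite /sg; move: wr; clear; lra.
have sr : sg < rho by rewrite /sg; move: wr; clear; lra.
have s0 : 0 < sg by exact: le_lt_trans (cnorm_ge0 w) ws.
have cH v : cnorm v < rho -> ccont H v.
  move=> vr e ep; have e4 : 0 < e / 4 by rewrite divr_gt0.
  have [n en] := e0 _ e4.
  have [d d0 Hd] := cdiff_ccont (dh n v (ltW vr)) e4.
  exists (Num.min d (rho - cnorm v)); first by rewrite lt_min d0 subr_gt0.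
  move=> u; rewrite lt_min => /andP[/Hd h1 h2].
  have ur : cnorm u <= rho by have := cnorm_sub_ge u v; move: h2; clear; lra.
  have h3 := hH n u ur; have h4 := hH n v (ltW vr).
  have -> : H u - H v = (H u - h n u) + (h n u - h n v) + (h n v - H v) by ring.
  apply: le_lt_trans (cnormD _ _) _; have := cnormD (H u - h n u) (h n u - h n v).
  rewrite cnormC in h3.
  by move: h1 h3 h4 en; clear -ep; lra.
have cq : circ_cont sg (fun z => H z * z).
  apply: circ_contM; last exact: circ_cont_id.
  by move=> z zs; apply: cH; rewrite zs.
apply: (@cdiff_near _ (fun w => cmean sg (fun z => H z * z / (z - w)))); last first.
  by exists (cmean sg (fun z => H z * z / (z - w) ^+ 2)); exact: cauchy_cd1.
exists (sg - cnorm w); first by rewrite subr_gt0.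
move=> v vw; have vs : cnorm v < sg by have := cnorm_sub_ge v w; move: vw; clear; lra.
apply/eqP; rewrite -subr_eq0; apply/eqP/cnorm_small => e ep.
pose C := 1 + sg / (sg - cnorm v).
have C0 : 0 < C by rewrite addr_gt0 // divr_gt0 // subr_gt0.
have [n en] := e0 _ (divr_gt0 ep C0).
have dn z : cnorm z <= sg -> cdiff (h n) z by move=> zs; apply: dh; exact: le_trans (ltW sr).
have cqn : circ_cont sg (fun z => h n z * z).
  by apply: circ_contM; [exact: circ_cdiff|exact: circ_cont_id].
have c1 : circ_cont sg (fun z => H z * z / (z - v)) := @kernel_cont _ sg _ v 1 cq vs.
have c2 : circ_cont sg (fun z => h n z * z / (z - v)) := @kernel_cont _ sg _ v 1 cqn vs.
have c3 : circ_cont sg (fun z => -1 * (h n z * z / (z - v))).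
  by apply: circ_contM => // z _; exact: ccont_cst.
have -> : cmean sg (fun z => H z * z / (z - v)) - H v =
   cmean sg (fun z => H z * z / (z - v) + -1 * (h n z * z / (z - v))) + (h n v - H v).
  rewrite cmeanD // cmeanZ // mulN1r -(cauchy_disk vs dn); ring.
apply: le_trans (cnormD _ _) _.
have h1 : cnorm (h n v - H v) <= eps n by apply: hH; exact: ltW (lt_trans vs sr).
have h2 : cnorm (cmean sg (fun z => H z * z / (z - v) + -1 * (h n z * z / (z - v)))) <=
    eps n * (sg / (sg - cnorm v)).
  apply: cmean_norm => //.
    by move=> z zs; apply: ccontD; [exact: c1|exact: c3].
  move=> z zs; have nz := kernel_neq0 zs vs.
  have -> : H z * z / (z - v) + -1 * (h n z * z / (z - v)) = (H z - h n z) * (z / (z - v)).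
    by field.
  rewrite cnormM; apply: ler_pM; rewrite ?cnorm_ge0 //.
    by rewrite cnormC; apply: hH; rewrite zs ltW.
  rewrite cnormM cnormV zs ler_pM2l // lef_pV2 ?posrE ?subr_gt0 ?cnorm_gt0 //.
  by have := cnorm_sub_ge z v; rewrite zs.
apply: le_trans (lerD h2 h1) _.
have -> : eps n * (sg / (sg - cnorm v)) + eps n = eps n * C by rewrite /C; ring.
by rewrite -ler_pdivlMr.
Qed.

(** The rate is kept since the limit functions are compared with the
    approximating ones. The factor 2 comes from bounding real and imaginary
    parts separately. *)
Lemma cauchy_limit (x : nat -> R[i]) (eps : nat -> R) (m : nat) :
  (forall n k, (m <= n <= k)%N -> cnorm (x k - x n) <= eps n) ->
  exists l, forall n, (m <= n)%N -> cnorm (x n - l) <= 2 * eps n.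
Proof.
move=> H.
have real_case (u : R[i] -> R) : (forall z w, `|u z - u w| <= cnorm (z - w)) ->
   exists a, forall n, (m <= n)%N -> `|u (x n) - a| <= eps n.
  move=> u1; pose A := [set u (x (m + n)%N) - eps (m + n)%N | n in [set: nat]].
  have AB n k : u (x (m + n)%N) - eps (m + n)%N <= u (x (m + k)%N) + eps (m + k)%N.
    have e_ge0 j : 0 <= eps (m + j)%N.
      by apply: le_trans (cnorm_ge0 _) (H (m + j)%N (m + j)%N _); rewrite leq_addr leqnn.
    have [nk|/ltnW kn] := leqP n k.
      have := le_trans (u1 _ _) (H (m + n)%N (m + k)%N _); rewrite leq_addr leq_add2l nk => /(_ isT).
      by rewrite ler_norml; have := e_ge0 k; clear; lra.
    have := le_trans (u1 _ _) (H (m + k)%N (m + n)%N _); rewrite leq_addr leq_add2l kn => /(_ isT).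
    by rewrite ler_norml; have := e_ge0 n; clear; lra.
  have hs : has_sup A.
    split; first by exists (u (x (m + 0)%N) - eps (m + 0)%N), 0%N.
    by exists (u (x (m + 0)%N) + eps (m + 0)%N) => _ [n _ <-].
  exists (sup A) => n mn; rewrite -(subnKC mn); set k := (n - m)%N.
  have h1 : u (x (m + k)%N) - eps (m + k)%N <= sup A.
    by apply: ub_le_sup; [case: hs|exists k].
  have h2 : sup A <= u (x (m + k)%N) + eps (m + k)%N.
    by apply: ge_sup; [case: hs|move=> _ [j _ <-]].
  by rewrite ler_norml; move: h1 h2; clear; lra.
have [a Ha] := real_case (@complex.Re R) (fun z w => ltac:(by rewrite -ReN -ReD; exact: Re_le_cnorm)).
have [b Hb] := real_case (@complex.Im R) (fun z w => ltac:(by rewrite -ImN -ImD; exact: Im_le_cnorm)).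
exists (a +i* b) => n mn; apply: le_trans (cnorm_le_ReIm _) _.
rewrite ReD ImD ReN ImN /=.
by have := Ha n mn; have := Hb n mn; clear; lra.
Qed.

End DiskMaps.

(** * Increasing sequences of images of the disk *)

Section DiskChain.
Variable R : realType.
Variable g : nat -> R[i] -> R[i].
Hypothesis ug : forall n, univ0 (g n).
Hypothesis gg : forall n, g n @` (@udisk R) `<=` g n.+1 @` (@udisk R).

Local Notation D := (@udisk R).

Lemma chain_sub m n : (m <= n)%N -> g m @` D `<=` g n @` D.
Proof.
move=> mn; rewrite -(subnKC mn); elim: (n - m)%N => [|k IH]; first by rewrite addn0.
by rewrite addnS; apply: subset_trans IH _; exact: gg.
Qed.

Definition chain_deriv n : R := cnorm (cderive (g n) 0).
Local Notation be := chain_deriv.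

Lemma chain_derivE n : be n = cnorm (cderive (g n) 0).
Proof. by []. Qed.

Lemma chain_deriv_gt0 n : 0 < be n.
Proof. by rewrite /be cnorm_gt0 univ0_deriv. Qed.

Lemma chain_deriv_le m n : (m <= n)%N -> be m <= be n.
Proof. by move=> mn; apply: trans_deriv_le => //; exact: chain_sub. Qed.

Definition chain_union : set R[i] := [set v | exists n z, D z /\ g n z = v].

Section Bounded.
Hypothesis bB : exists B, forall n, be n <= B.

Definition chain_sup : R := sup (range be).
Local Notation B0 := chain_sup.
(** The defect measures how far the [n]-th derivative is from the supremum; it
    is introduced through a sigma type to keep its definition opaque. *)
Lemma chain_defect_exists : {d : nat -> R | forall n, d n = 1 - be n / B0}.
Proof. by exists (fun n => 1 - be n / B0). Qed.

Definition chain_defect := sval chain_defect_exists.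

Lemma chain_defectE n : chain_defect n = 1 - be n / B0.
Proof. by rewrite /chain_defect; case: chain_defect_exists. Qed.

Local Notation del := chain_defect.

Lemma chain_has_sup : has_sup (range be).
Proof. by have [B HB] := bB; split; [exists (be 0%N), 0%N|exists B => _ [n _ <-]]. Qed.

Lemma chain_deriv_sup n : be n <= B0.
Proof. by apply: ub_le_sup; [case: chain_has_sup|exists n]. Qed.

Lemma chain_sup_gt0 : 0 < B0.
Proof. exact: lt_le_trans (chain_deriv_gt0 0) (chain_deriv_sup 0). Qed.

#[local] Hint Resolve chain_sup_gt0 chain_has_sup chain_deriv_sup : core.

Lemma chain_defect_le m n : (m <= n)%N -> del n <= del m.
Proof.
move=> mn; rewrite !chain_defectE lerD2l lerN2; apply: ler_wpM2r; first by rewrite invr_ge0 ltW.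
exact: chain_deriv_le.
Qed.

Lemma chain_defect_small (e : R) m : 0 < e -> exists2 n, (m <= n)%N & del n <= e.
Proof.
move=> e0; have [|_ [n _ <-] h] := @sup_adherent _ (range be) (e * B0) _ chain_has_sup.
  by rewrite mulr_gt0.
exists (maxn m n); first exact: leq_maxl.
apply: le_trans (chain_defect_le (leq_maxr m n)) _.
rewrite chain_defectE lerBlDr -lerBlDl ler_pdivlMr // mulrBl mul1r; exact: ltW.
Qed.

Lemma chain_defect_ratio n k : 1 - be n / be k <= del n.
Proof.
rewrite !chain_defectE lerD2l lerN2; apply: ler_wpM2l; first exact: ltW (chain_deriv_gt0 n).
by rewrite lef_pV2 ?posrE ?chain_deriv_gt0.
Qed.

#[local] Opaque chain_deriv.

(** Rotations that make the derivative of the normalized transition maps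
    positive. *)
Definition chain_rot n : R[i] := cderive (g n) 0 / (be n)%:C.
Local Notation ro := chain_rot.

Lemma chain_rot_norm n : cnorm (ro n) = 1.
Proof.
rewrite cnormM cnormV cnorm_real gtr0_norm ?chain_deriv_gt0 // mulfV //.
by rewrite gt_eqF // chain_deriv_gt0.
Qed.

Lemma chain_rot_neq0 n : ro n != 0.
Proof. by rewrite -cnorm_gt0 chain_rot_norm. Qed.

Definition chain_inv n v := ro n * inv_on D (g n) v.
Local Notation hh := chain_inv.

#[local] Hint Resolve chain_rot_neq0 : core.

Lemma chain_invE m n z : hh n (g m z) = ro n * trans (g m) (g n) z. Proof. by []. Qed.

(** In the coordinate of the [n]-th disk the transition map, rotated so that
    its derivative at 0 is the positive number [be n / be k], is close to the
    identity: this number is close to 1 because the derivatives converge. *)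
Lemma chain_inv_step m n k z (rho : R) : (m <= n)%N -> (n <= k)%N -> rho < 1 -> cnorm z <= rho ->
  cnorm (hh k (g m z) - hh n (g m z)) <= 2 * del n / (1 - rho).
Proof.
move=> mn nk r1 zr; have z1 : D z by exact: le_lt_trans r1.
have [smn snk] := (chain_sub mn, chain_sub nk).
have [t1 _] := transP smn z1.
pose psi w := ro k * trans (g n) (g k) ((ro n)^-1 * w).
have D' w : D w -> D ((ro n)^-1 * w) by rewrite /D /udisk /= cnormM cnormV chain_rot_norm invr1 mul1r.
have psi0 : psi 0 = 0 by rewrite /psi mulr0 trans0 // mulr0.
have dpsi w : D w -> cdiff psi w.
  move=> /D' w1; apply: cdiffM; first exact: cdiff_cst.
  apply: (@cdiff_comp _ (fun w => (ro n)^-1 * w) (trans (g n) (g k))); last exact: trans_cdiff.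
  by apply: cdiffM; [exact: cdiff_cst|exact: cdiff_id].
have psi1 w : D w -> cnorm (psi w) <= 1.
  by move=> /D' w1; rewrite cnormM chain_rot_norm mul1r; have [/ltW] := transP snk w1.
have psid : cd psi 0 (be n / be k)%:C.
  have H : cd (fun w => (ro n)^-1 * w) 0 ((ro n)^-1 * 1) by apply: cdZ; exact: cd_id.
  have T : cd (trans (g n) (g k)) ((ro n)^-1 * 0) (cderive (g n) 0 / cderive (g k) 0).
    by rewrite mulr0; exact: trans_deriv.
  have := cdZ (ro k) (cd_comp H T); rewrite mulr1.
  have -> : ro k * (cderive (g n) 0 / cderive (g k) 0 * (ro n)^-1) = (be n / be k)%:C => //.
  have n1 := univ0_deriv (ug n); have n2 := univ0_deriv (ug k).
  have p1 : (be n)%:C != 0 :> R[i].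
    by rewrite -cnorm_eq0 cnorm_real normr_eq0 gt_eqF // chain_deriv_gt0.
  have p2 : (be k)%:C != 0 :> R[i].
    by rewrite -cnorm_eq0 cnorm_real normr_eq0 gt_eqF // chain_deriv_gt0.
  have alg (x y a b : R[i]) : x != 0 -> y != 0 -> a != 0 -> b != 0 ->
      y / b * (x / y * (x / a)^-1) = a * b^-1.
    by move=> x0 y0 a0 b0; field; rewrite x0 y0 a0 b0.
  rewrite rmorphM /= fmorphV; exact: alg.
have -> : hh k (g m z) = psi (hh n (g m z)).
  by rewrite /psi !chain_invE mulKf // trans_comp.
have bk : be n / be k <= 1.
  by rewrite ler_pdivrMr ?chain_deriv_gt0 // mul1r chain_deriv_le.
have := near_identity psi0 dpsi psi1 psid bk r1.
move=> /(_ (hh n (g m z))); rewrite {1}chain_invE cnormM chain_rot_norm mul1r.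
move=> /(_ (le_trans (trans_le (ug m) (ug n) smn z1) zr)) h; apply: le_trans h _.
apply: ler_wpM2r; first by rewrite invr_ge0 subr_ge0 ltW.
rewrite ler_pM2l //; exact: chain_defect_ratio.
Qed.

Definition is_chain_lim v l := forall e : R, 0 < e -> exists N, forall n, (N <= n)%N -> cnorm (hh n v - l) <= e.

(** The limit of the rotated inverses. *)
Definition chain_map v : R[i] := xget 0 [set l | is_chain_lim v l].
Local Notation F := chain_map.

Lemma chain_map_rate m n z (rho : R) : (m <= n)%N -> rho < 1 -> cnorm z <= rho ->
  cnorm (hh n (g m z) - F (g m z)) <= 4 * del n / (1 - rho).
Proof.
move=> mn r1 zr.
have rr : 0 < 1 - rho by rewrite subr_gt0.
have [|l Hl] := @cauchy_limit R (fun n => hh n (g m z)) (fun n => 2 * del n / (1 - rho)) m.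
  by move=> a b /andP[ma ab]; exact: chain_inv_step.
have {}Hl k : (m <= k)%N -> cnorm (hh k (g m z) - l) <= 4 * del k / (1 - rho).
  move=> /Hl; have -> : 2 * (2 * del k / (1 - rho)) = 4 * del k / (1 - rho) by ring.
  by [].
suff -> : F (g m z) = l by exact: Hl.
have L : is_chain_lim (g m z) l.
  move=> e e0; have [N mN dN] := @chain_defect_small (e * (1 - rho) / 4) m ltac:(by rewrite divr_gt0 // mulr_gt0).
  exists N => k Nk; apply: le_trans (Hl k (leq_trans mN Nk)) _.
  rewrite ler_pdivrMr //; have := chain_defect_le Nk; move: dN; clear -ug gg bB; lra.
rewrite /F; case: xgetP => [y _ Hy|/(_ l) //].
apply/eqP; rewrite -subr_eq0; apply/eqP/cnorm_small => e e0.
have e2 : 0 < e / 2 by rewrite divr_gt0.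
have [N1 H1] := Hy _ e2; have [N2 H2] := L _ e2.
have h1 := H1 _ (leq_maxl N1 N2); have h2 := H2 _ (leq_maxr N1 N2).
apply: le_trans (cdist_triangle _ _ (hh (maxn N1 N2) (g m z))) _.
by rewrite cnormC in h1; move: h1 h2; clear -ug gg bB; lra.
Qed.

Lemma chain_map_near n z (rho : R) : rho < 1 -> cnorm z <= rho ->
  cnorm (F (g n z) - ro n * z) <= 4 * del n / (1 - rho).
Proof.
move=> r1 zr; have := chain_map_rate (leqnn n) r1 zr; rewrite chain_invE trans_id // 1?cnormC //.
exact: le_lt_trans r1.
Qed.

Lemma midpoint_lt1 (a : R) : a < 1 -> a < (a + 1) / 2 < 1.
Proof. by clear -ug gg bB; lra. Qed.

Lemma chain_map_comp_cdiff m z : D z -> cdiff (fun z => F (g m z)) z.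
Proof.
move=> z1; have /andP[zr r1] := midpoint_lt1 z1.
have rr : 0 < 1 - (cnorm z + 1) / 2 by rewrite subr_gt0.
apply: (@unif_limit _ (fun n z => ro (m + n)%N * trans (g m) (g (m + n)%N) z) _
  ((cnorm z + 1) / 2) (fun n => 4 * del (m + n)%N / (1 - (cnorm z + 1) / 2))) => //.
- move=> n w wr; apply: cdiffM; first exact: cdiff_cst.
  by apply: trans_cdiff => //; [exact/chain_sub/leq_addr|exact: le_lt_trans r1].
- by move=> n w wr; rewrite -chain_invE; apply: chain_map_rate => //; exact: leq_addr.
- move=> e e0; set s := 1 - _ in rr *.
  have [n mn dn] := @chain_defect_small (e * s / 4) m ltac:(by rewrite divr_gt0 // mulr_gt0).
  exists n; rewrite ler_pdivrMr //; have := chain_defect_le (leq_addl m n); move: dn; clear -ug gg bB; lra.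
Qed.

(** For large [k], in the coordinate of the [k]-th disk the limit is a
    rotation up to a perturbation with Lipschitz constant less than 1, which
    cannot identify two points. *)
Lemma chain_map_comp_inj m z w : D z -> D w -> F (g m z) = F (g m w) -> z = w.
Proof.
move=> z1 w1 E; pose rho := Num.max (cnorm z) (cnorm w).
have r1 : rho < 1 by rewrite gt_max; apply/andP; split.
have /andP[rr2 r21] := midpoint_lt1 r1; set rho2 := (rho + 1) / 2 in rr2 r21.
have r0 : 0 <= rho by rewrite le_max cnorm_ge0.
have r20 : 0 < rho2 by exact: le_lt_trans rr2.
pose c := rho2 / (rho2 - rho) ^+ 2.
have c0 : 0 < c by rewrite divr_gt0 // exprn_gt0 // subr_gt0.
have s0 : 0 < 1 - rho2 by rewrite subr_gt0.
have [k mk dk] := @chain_defect_small ((1 - rho2) / (8 * c)) m ltac:(by rewrite divr_gt0 // mulr_gt0).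
have smk := chain_sub mk.
pose a := trans (g m) (g k) z; pose a' := trans (g m) (g k) w.
have [a1 aE] := transP smk z1; have [a1' aE'] := transP smk w1.
have ar : cnorm a <= rho by apply: le_trans (trans_le _ _ smk z1) _ => //; rewrite le_max lexx.
have ar' : cnorm a' <= rho by apply: le_trans (trans_le _ _ smk w1) _ => //; rewrite le_max lexx orbT.
have lip : cnorm ((F (g k a) - ro k * a) - (F (g k a') - ro k * a')) <=
    4 * del k / (1 - rho2) * c * cnorm (a - a').
  apply: (@lip_disk _ (fun y => F (g k y) - ro k * y) rho2 rho) => //.
    move=> y yr; apply: cdiffB; first by apply: chain_map_comp_cdiff; exact: le_lt_trans r21.
    by apply: cdiffM; [exact: cdiff_cst|exact: cdiff_id].
  by move=> y yr; apply: chain_map_near => //; rewrite yr.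
have FE : F (g k a) = F (g k a') by rewrite /a /a' aE aE'.
have := lip; rewrite FE.
have -> : F (g k a') - ro k * a - (F (g k a') - ro k * a') = - (ro k * (a - a')) by ring.
rewrite cnormN cnormM chain_rot_norm mul1r => h.
clearbody c rho2.
have aa : a = a'.
  apply/eqP; rewrite -subr_eq0 -cnorm_eq0; apply/negPn/negP => n0.
  have p : 0 < cnorm (a - a') by rewrite lt_neqAle eq_sym n0 cnorm_ge0.
  have : 4 * del k / (1 - rho2) * c <= 1 / 2.
    rewrite mulrAC ler_pdivrMr //.
    move: dk; rewrite ler_pdivlMr ?mulr_gt0 //; clear -ug gg bB; lra.
  by move: h p; generalize (cnorm (a - a')); clear -ug gg bB => X; nra.
exact: (trans_inj (ug m) (ug k) smk z1 w1 aa).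
Qed.

Lemma chain_map_cdiff v : chain_union v -> cdiff F v.
Proof.
move=> [m [z [z1 <-]]]; have [dg gi _] := ug m.
apply: (@cdiff_near _ (fun v => F (g m (inv_on D (g m) v)))).
  have [d d0 Hd] := univ_image_open (@udisk_open R) dg gi (ex_intro2 _ _ z z1 erefl : (g m @` D) (g m z)).
  by exists d => // y /Hd; move=> /inv_onP [_ ->].
apply: (@cdiff_comp _ (inv_on D (g m)) (fun z => F (g m z))).
  by apply: (inv_on_cdiff (@udisk_open R) dg gi); exists z.
by rewrite inv_onK //; exact: chain_map_comp_cdiff.
Qed.

Lemma chain_map_inj v w : chain_union v -> chain_union w -> F v = F w -> v = w.
Proof.
move=> [m [z [z1 <-]]] [n [y [y1 <-]]].
have [tz zE] := transP (chain_sub (leq_maxl m n)) z1.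
have [ty yE] := transP (chain_sub (leq_maxr m n)) y1.
by rewrite -zE -yE => /chain_map_comp_inj -> .
Qed.

Lemma chain_map0 : F 0 = 0.
Proof.
have g0 : g 0%N 0 = 0 by have [] := ug 0.
apply: cnorm_small => e e0; have [n _ dn] := @chain_defect_small (e / 4) 0 ltac:(by rewrite divr_gt0).
have := @chain_map_rate 0%N n 0 0 (leq0n n) ltr01; rewrite cnorm0 lexx => /(_ isT).
rewrite g0 /chain_inv.
have -> : inv_on D (g n) 0 = 0.
  by have [_ gi gn0] := ug n; rewrite -{1}gn0 inv_onK //; exact: udisk0.
rewrite mulr0 sub0r cnormN subr0 divr1 => /le_trans; apply.
by move: dn; clear -ug gg bB; lra.
Qed.

(** The values lie in the disk because the approximating maps do not increase
    the modulus. A point [w] of the disk is a value because [F] is close to a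
    rotation on a small circle around the preimage of [w] under that
    rotation. *)
Lemma chain_map_image : F @` chain_union = D.
Proof.
apply/seteqP; split => [_ [_ [m [z [z1 <-]]] <-]|w w1].
- apply: (le_lt_trans _ (z1 : cnorm z < 1)); rewrite -subr_le0 leNgt; apply/negP => p.
  have s0 : 0 < 1 - cnorm z by rewrite subr_gt0; exact: z1.
  set t := cnorm (F (g m z)) - cnorm z in p.
  have [n mn dn] := @chain_defect_small (t * (1 - cnorm z) / 8) m ltac:(by rewrite divr_gt0 // mulr_gt0).
  have := chain_map_rate mn z1 (lexx _); rewrite cnormC ler_pdivlMr // => h1.
  have h2 := cnorm_sub_ge (F (g m z)) (hh n (g m z)).
  have h3 : cnorm (hh n (g m z)) <= cnorm z.
    by rewrite chain_invE cnormM chain_rot_norm mul1r; apply: trans_le => //; exact: chain_sub.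
  have h4 : t <= cnorm (F (g m z) - hh n (g m z)) by rewrite /t; move: h2 h3; clear -ug gg bB; lra.
  have h5 := ler_wpM2r (ltW s0) h4.
  have h6 : 0 < t * (1 - cnorm z) by rewrite mulr_gt0.
  by move: h1 h5 h6 dn; clear -ug gg bB; lra.
have /andP[wr r1] := midpoint_lt1 w1; set rho := (cnorm w + 1) / 2 in wr r1.
pose r := (1 - cnorm w) / 2.
have r0 : 0 < r by rewrite divr_gt0 // subr_gt0.
have s0 : 0 < 1 - rho by rewrite subr_gt0.
have [n _ dn] := @chain_defect_small (r * (1 - rho) / 16) 0 ltac:(by rewrite divr_gt0 // mulr_gt0).
have small : 4 * del n / (1 - rho) <= r / 4.
  by rewrite ler_pdivrMr //; move: dn; clear -ug gg bB; lra.
pose c := (ro n)^-1 * w.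
have cw : cnorm c = cnorm w by rewrite cnormM cnormV chain_rot_norm invr1 mul1r.
have zin z : cnorm (z - c) <= r -> cnorm z <= rho.
  by have := cnorm_sub_ge z c; rewrite cw /r /rho; clear -ug gg bB; lra.
have cr : cnorm c <= rho by rewrite cw ltW.
have [z zr fz] : exists2 z, cnorm (z - c) < r & F (g n z) - w = 0.
  apply: (@zero_exists _ _ c r (r / 2)) => //.
  - move=> z /zin zr; apply: cdiffB; last exact: cdiff_cst.
    by apply: chain_map_comp_cdiff; exact: le_lt_trans r1.
  - move=> z zr; have h := chain_map_near n r1 (zin z ltac:(by rewrite zr)).
    have e1 : cnorm (ro n * z - w) = r.
      have -> : ro n * z - w = ro n * (z - c) by rewrite /c mulrBr mulVKf.
      by rewrite cnormM chain_rot_norm mul1r.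
    have := cdist_triangle (ro n * z) w (F (g n z)); rewrite e1 (cnormC (ro n * z)).
    by move: h small r0; clear -ug gg bB; lra.
  - have := chain_map_near n r1 cr; rewrite /c mulVKf // => h.
    by move: h small r0; clear -ug gg bB; lra.
exists (g n z); last by apply/eqP; rewrite -subr_eq0 fz.
by exists n, z; split => //; apply: le_lt_trans (zin _ (ltW zr)) r1.
Qed.

End Bounded.

(** A Koebe-type bound. If all [g n] omit [w0], then [1 - g n / w0] has square
    roots [s n] with [s n 0 = 1]. The image of [s 0] contains a disk around 1
    and that of [s n] avoids its opposite, so [1 / (s n + 1)] is bounded
    independently of [n], which bounds the derivatives of the [g n]. *)
Lemma chain_unbounded_cover : (forall B, exists n, B < be n) -> forall v, chain_union v.
Proof.
move=> unb w0; have [//|no] := pselect (chain_union w0); exfalso.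
have g0 n : g n 0 = 0 by have [] := ug n.
have w00 : w0 != 0.
  apply/eqP => E; apply: no; exists 0%N, 0; split; [exact: udisk0|by rewrite g0].
pose u n z := 1 - w0^-1 * g n z.
have du n z : cnorm z < 1 -> cdiff (u n) z.
  move=> z1; apply: cdiffB; first exact: cdiff_cst.
  by apply: cdiffM; [exact: cdiff_cst|have [dg _ _] := ug n; exact: dg].
have un0 n z : cnorm z < 1 -> u n z != 0.
  move=> z1; rewrite subr_eq0; apply/eqP => E; apply: no; exists n, z; split => //.
  by rewrite -[RHS]mulr1 E mulVKf.
have uE n z z' m : u n z = u m z' -> g n z = g m z'.
  move=> /(congr1 (fun t => w0 * (1 - t))); rewrite /u !opprB !addrA.
  have A t : w0 * (1 + w0^-1 * t - 1) = t by rewrite [1 + _]addrC addrK mulVKf.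
  by rewrite !A.
have uz n : u n 0 = 1 by rewrite /u g0 mulr0 subr0.
have h34 : 0 < 3 / 4 :> R by lra.
have h341 : 3 / 4 < 1 :> R by lra.
have /choice [P HP] n : exists P, forall z, cnorm z <= 3 / 4 -> cdiff P z /\ cexp (P z) = u n z.
  by apply: (@disk_log _ (u n) 1); [| |exact: du|exact: un0].
pose s n z := cexp (2^-1 * (P n z - P n 0)).
have z34 : cnorm (0 : R[i]) <= 3 / 4 by rewrite cnorm0 ltW.
have s2 n z : cnorm z <= 3 / 4 -> s n z ^+ 2 = u n z.
  move=> zr; rewrite /s expr2 -cexpD.
  have -> : 2^-1 * (P n z - P n 0) + 2^-1 * (P n z - P n 0) = P n z - P n 0 by field.
  apply: (mulIf (cexp_neq0 (P n 0))); rewrite -cexpD subrK.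
  by have [_ ->] := HP n z zr; have [_ ->] := HP n 0 z34; rewrite uz mulr1.
have s0 n : s n 0 = 1 by rewrite /s subrr mulr0 /cexp /= expR0 /expi cos0 sin0 mul1r.
have ds n z : cnorm z <= 3 / 4 -> cdiff (s n) z.
  move=> zr; apply: (@cdiff_comp _ (fun z => 2^-1 * (P n z - P n 0)) (@cexp R)).
    apply: cdiffM; first exact: cdiff_cst.
    by apply: cdiffB; [have [] := HP n z zr|exact: cdiff_cst].
  by exists (cexp (2^-1 * (P n z - P n 0))); exact: cd_cexp.
have sn0 n z : s n z != 0 by exact: cexp_neq0.
pose U : set R[i] := [set z | cnorm z < 1 / 2].
have U34 z : U z -> cnorm z <= 3 / 4 by rewrite /U /=; clear -ug gg; lra.
have U1 z : U z -> D z by rewrite /U /D /udisk /=; clear -ug gg; lra.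
have oU : copen U.
  move=> z zU; have [d d0 H] := @disk_open R 0 (1 / 2) z ltac:(by rewrite /= subr0).
  by exists d => // w /H /=; rewrite subr0.
have si n z w : U z -> U w -> s n z = s n w -> z = w.
  move=> zU wU E; have [_ gi _] := ug n; apply: gi; [exact: U1|exact: U1|].
  by apply: uE; rewrite -!s2 ?U34 // E.
have U0 : U 0 by rewrite /U /= cnorm0; lra.
have [m m0 Hm] := univ_open oU (fun z zU => ds 0%N z (U34 z zU)) (si 0%N) U0 ltr01.
rewrite s0 in Hm.
(* [s n] does not take the opposite of a value of [s 0] *)
have opp n z ze : U z -> U ze -> s n z = - s 0%N ze -> False.
  move=> zU zeU E; have sub := chain_sub (leq0n n).
  pose phi := trans (g 0%N) (g n).
  have zphi : z = phi ze.
    have [pD pE] := transP sub (U1 _ zeU); have [_ gi _] := ug n.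
    apply: gi; [exact: U1|exact: pD|rewrite pE; apply: uE].
    by rewrite -(s2 _ _ (U34 _ zU)) -(s2 _ _ (U34 _ zeU)) E sqrrN.
  (* the quotient along the segment from 0 to [ze] is continuous with values
     in {1, -1}, equal to 1 at the start and to -1 at the end *)
  have tU (t : R) : 0 <= t <= 1 -> U (t%:C * ze).
    move=> /andP[t0 t1]; rewrite /U /= cnormM cnorm_real ger0_norm //.
    by apply: le_lt_trans zeU; rewrite ler_piMl // cnorm_ge0.
  have pU w : U w -> U (phi w).
    by move=> wU; apply: (le_lt_trans _ (wU : cnorm w < 1 / 2)); apply: trans_le => //; exact: U1.
  pose sg (t : R) := s n (phi (t%:C * ze)) / s 0%N (t%:C * ze).
  have sg2 t : 0 <= t <= 1 -> sg t ^+ 2 = 1.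
    move=> /tU tt; rewrite /sg expr_div_n (s2 _ _ (U34 _ (pU _ tt))) (s2 _ _ (U34 _ tt)).
    have [_ pE] := transP sub (U1 _ tt); rewrite /u pE divff // un0 //; exact: U1.
  have sg0 : sg 0 = 1.
    rewrite /sg mul0r.
    have -> : phi 0 = 0 by apply: trans0.
    by rewrite !s0 divr1.
  have sg1 : sg 1 = -1 by rewrite /sg mul1r -zphi E mulNr divff.
  have csg t : 0 <= t <= 1 -> rcont sg t.
    move=> t01; apply: (@rcont_comp _ (fun w => s n (phi w) / s 0%N w) (fun t => t%:C * ze)).
      have -> : (fun t : R => t%:C * ze) = (fun t : R => ze * t%:C).
        by apply/funext => x; rewrite mulrC.
      apply: rcontZ => e e0; exists e => // y; by rewrite -rmorphB cnorm_real.
    have tt := tU _ t01; apply: cdiff_ccont; apply: cdiffM.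
      apply: (@cdiff_comp _ phi (s n)); last by apply: ds; apply: U34; exact: pU.
      by apply: trans_cdiff => //; exact: U1.
    by apply: cdiffV => //; apply: ds; exact: U34.
  have cR : {within `[0, 1], continuous (fun t => complex.Re (sg t))}.
    by apply: continuous_in_subspaceT => t; rewrite inE /= in_itv /= => /csg; exact: rcont_Re.
  have R01 : Num.min (complex.Re (sg 0)) (complex.Re (sg 1)) <= 0 <=
             Num.max (complex.Re (sg 0)) (complex.Re (sg 1)).
    by rewrite sg0 sg1 /= ge_min le_max; apply/andP; split; apply/orP; [right|left]; lra.
  have [t t01' rt] := IVT ler01 cR R01.
  have t01 : 0 <= t <= 1 by move: t01'; rewrite in_itv.
  move: (sg2 t t01) rt; generalize (sg t) => x /(congr1 (@complex.Re R)).
  rewrite expr2 ReM => h rx; move: h; rewrite rx mul0r sub0r -expr2 => h.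
  have := sqr_ge0 (complex.Im x); rewrite -oppr_le0 h.
  by apply/negP; rewrite -ltNge ltr01.
have far n z : U z -> m <= cnorm (s n z + 1).
  move=> zU; rewrite leNgt; apply/negP => h.
  have := Hm (- s n z); rewrite -opprD cnormN => /(_ h) [ze [zeU _ E]].
  by apply: (opp n z ze) => //; rewrite E opprK.
have nz1 n z : U z -> s n z + 1 != 0.
  by move=> /(far n); rewrite -cnorm_gt0; exact: lt_le_trans.
(* the bound on [|(g n)'(0)|] obtained at the end from [(g n)'(0) = 8 w0
   k'(0)] *)
pose C := 4 * (m^-1 + 1 / 2) * (8 * cnorm w0).
have [n Cn] := unb C.
pose k z := (s n z + 1)^-1 - 2^-1.
have k0 : k 0 = 0.
  by rewrite /k s0; have -> : 1 + 1 = 2 :> R[i] by []; rewrite subrr.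
have dk z : cnorm z < 1 / 2 -> cdiff k z.
  move=> zU; apply: cdiffB; last exact: cdiff_cst.
  apply: cdiffV; first exact: nz1.
  by apply: cdiffD; [apply: ds; exact: U34|exact: cdiff_cst].
have h12 : 0 < 1 / 2 :> R by lra.
have c2 : cnorm (2 : R[i]) = 2.
  exact: cnorm_nat.
have [q [dq kq kd]] := factor0 h12 k0 dk.
have kM z : cnorm z = 1 / 4 -> cnorm (k z) <= m^-1 + 1 / 2.
  move=> zr; have zU : U z by rewrite /U /= zr; lra.
  apply: le_trans (cnormB _ _) _; rewrite !cnormV c2 div1r lerD2r lef_pV2 ?posrE //.
    exact: far.
  by rewrite cnorm_gt0 nz1.
have q0 : cnorm (q 0) <= 4 * (m^-1 + 1 / 2).
  apply: (@max_circle _ q (1 / 4)).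
  - by clear -ug gg; lra.
  - by move=> z zr; apply: dq; apply: le_lt_trans zr _; lra.
  - by move=> z zr; have := kM z zr; rewrite kq cnormM zr; clear -ug gg; lra.
  - by rewrite cnorm0; lra.
(* the derivative of [k] at 0 through that of [g n] *)
have [l sl] := ds n 0 z34.
have [dgn _ _] := ug n.
have gl := cdiff_cd (dgn 0 (udisk0 R)).
have ul : cd (u n) 0 (0 - w0^-1 * cderive (g n) 0).
  by apply: cdB; [exact: cd_cst|exact: cdZ].
have ul' : cd (u n) 0 (l * s n 0 + s n 0 * l).
  apply: cd_near (cdM sl sl); exists (3 / 4); [exact: h34|move=> w; rewrite subr0 => wr].
  by rewrite -expr2 s2 // ltW.
have lE : l + l = - (w0^-1 * cderive (g n) 0).
  by have := cd_uniq ul' ul; rewrite s0 mulr1 mul1r sub0r.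
have kl : cd k 0 (- (l + 0) / (s n 0 + 1) ^+ 2 - 0).
  apply: cdB; last exact: cd_cst.
  apply: cdV; first exact: nz1.
  by apply: cdD => //; exact: cd_cst.
have qE : cderive (g n) 0 = 8 * w0 * q 0.
  have := cd_uniq kd kl; rewrite s0 addr0 subr0 => ->.
  have -> : (1 + 1 : R[i]) = 2 by [].
  have -> : cderive (g n) 0 = - (w0 * (l + l)) by rewrite lE mulrN opprK mulVKf.
  by field.
move: Cn; rewrite chain_derivE qE !cnormM.
have -> : cnorm (8 : R[i]) = 8.
  exact: cnorm_nat.
rewrite ltNge => /negP; apply.
rewrite /C mulrC; by apply: ler_wpM2r => //; rewrite mulr_ge0 // cnorm_ge0.
Qed.

End DiskChain.

(** * Chains on the punctured disk and their normalization *)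

Section CompactnessTools.
Variable R : realType.
Implicit Types (z w v : R[i]).

(** Bisection: a relation between the ends of subintervals that is additive
    and holds locally holds globally. *)
Lemma interval_induction (Q : R -> R -> Prop) a b : a <= b ->
  (forall s m t, a <= s -> s <= m -> m <= t -> t <= b -> Q s m -> Q m t -> Q s t) ->
  (forall u, a <= u <= b -> exists2 d : R, 0 < d & forall s t, a <= s -> s <= u -> u <= t -> t <= b ->
     u - d < s -> t < u + d -> Q s t) ->
  Q a b.
Proof.
move=> ab add loc; apply: contrapT => nQ.
pose bad (q : R * R) := [/\ a <= q.1, q.1 <= q.2, q.2 <= b & ~ Q q.1 q.2].
pose next (q q' : R * R) := [/\ q.1 <= q'.1, q'.2 <= q.2 & q'.2 - q'.1 = (q.2 - q.1) / 2].
have step : forall q : {q | bad q}, exists q' : {q | bad q}, next (sval q) (sval q').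
  move=> [[s t] [/= as_ st tb nq]]; pose m := (s + t) / 2.
  have sm : s <= m by rewrite /m; move: st; clear; lra.
  have mt : m <= t by rewrite /m; move: st; clear; lra.
  have [qsm|qsm] := pselect (Q s m).
    have B : bad (m, t) by split => //=; [exact: le_trans sm|move=> qmt; apply: nq; exact: add qsm qmt].
    by exists (exist _ _ B); split => //=; rewrite /m; field.
  have B : bad (s, m) by split => //=; exact: le_trans tb.
  by exists (exist _ _ B); split => //=; rewrite /m; field.
have B0 : bad (a, b) by [].
have [F HF] := choice step.
pose q (n : nat) := sval (iter n F (exist _ _ B0)).
have qb n : bad (q n) by rewrite /q; case: (iter _ _ _).
have qn n : next (q n) (q n.+1) by rewrite /q iterS; exact: HF.
have [u Hu] : exists u, forall n : nat, (q n).1 <= u <= (q n).2.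
  by apply: nested_point => n; [case: (qn n)|case: (qn n)|case: (qb n)].
have sz n : (q n).2 - (q n).1 = (b - a) / 2 ^+ n.
  elim: n => [|n IH]; first by rewrite /q /= expr0 divr1.
  have [_ _ ->] := qn n; rewrite IH exprS.
  by field; rewrite expf_neq0.
have [d d0 H] := loc u (Hu 0%N).
have [n Hn] := half_lt_eps (b - a) d0.
have [h1 h2 h3] := qb n; apply; have /andP[h4 h5] := Hu n; have h6 := sz n.
by apply: H => //; move: h4 h5 h6 Hn; clear; lra.
Qed.

(** Compactness in the form used below: a property that holds locally for all
    small parameters holds on a compact set for one parameter. *)
Lemma compact_uniform (K : set R[i]) (P : R -> R[i] -> Prop) : compact (K : set R[i]^o) ->
  (forall z, K z -> exists2 d : R, 0 < d & forall e w, 0 < e -> e < d -> cnorm (w - z) < d -> P e w) ->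
  exists2 e : R, 0 < e & forall z, K z -> P e z.
Proof.
move=> cK H; have nK := cK; rewrite compact_near_coveringP in nK.
have := nK R (0 : R)^'+ P _.
case.
  move=> z Kz; have [d d0 Hd] := H z Kz.
  exists ([set w : R[i]^o | cnorm (w - z) < d], [set e : R | 0 < e < d]).
    split => /=; first by apply/nbhs_cP; exists d.
    near=> e; apply/andP; split; near: e; [exact: nbhs_right_gt|exact: nbhs_right_lt].
  by move=> [w e] [/= wd /andP[e0 ed]]; exact: Hd.
move=> d /= d0 Hd; exists (d / 2); first by rewrite divr_gt0.
apply: Hd; last by rewrite divr_gt0.
by rewrite /= sub0r normrN gtr0_norm ?divr_gt0 // ltr_pdivrMr // ltr_pMr // ltr1n.
Unshelve. all: by end_near. Qed.

(** Continuous image of a rectangle under polar coordinates. *)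
Lemma ring_compact (a b : R) : 0 <= a -> compact ([set z | a <= cnorm z <= b] : set R[i]^o).
Proof.
move=> a0.
have -> : [set z : R[i]^o | a <= cnorm z <= b] =
   (fun p : (R * R)%type => (p.1%:C * expi p.2 : R[i]^o)) @` (`[a, b] `*` `[0, 2 * pi]).
  apply/seteqP; split => [z /= zab|_ [[x y] [/= xab _] <-]].
  - have [z0|z0] := eqVneq z 0.
      exists (0, 0); last by rewrite /= mul0r z0.
      by split; rewrite /= in_itv /=; [rewrite z0 cnorm0 in zab|rewrite lexx ltW // pi2_gt0].
    have [x /andP[x0 x2] zE] := polar z0; exists (cnorm z, x); last by rewrite /= -zE.
    by split; rewrite /= in_itv //= x0 ltW.
  - move: xab; rewrite in_itv /= => /andP[h1 h2].
    by rewrite cnorm_circle ?h1 // (le_trans a0).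
apply: continuous_compact; last first.
  by apply: compact_setX; exact: segment_compact.
apply: continuous_subspaceT => -[x y].
apply/(@cvg_cP R (R * R)%type (nbhs (x, y)) _) => e e0.
have e4 : 0 < e / 4 by rewrite divr_gt0.
have M0 : 0 < `|x| + 1 by rewrite ltr_wpDl.
have eM : 0 < e / 4 / (`|x| + 1) by rewrite divr_gt0.
have cc := @continuous_cos R y; have cs := @continuous_sin R y.
have {}cc : \forall t \near (y : R), `|cos y - cos t| < e / 4 / (`|x| + 1).
  by move/cvgrPdist_lt: cc; apply.
have {}cs : \forall t \near (y : R), `|sin y - sin t| < e / 4 / (`|x| + 1).
  by move/cvgrPdist_lt: cs; apply.
have cx : \forall s \near (x : R), `|s - x| < e / 4.
  by apply/nbhs_ballP; exists (e / 4) => //= s; rewrite /ball /= distrC.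
exists ([set s | `|s - x| < e / 4],
  [set t | `|cos y - cos t| < e / 4 / (`|x| + 1) /\ `|sin y - sin t| < e / 4 / (`|x| + 1)]).
  by split => //=; apply: filterI.
move=> [s t] /= [hs [hc hsn]].
have -> : s%:C * expi t - x%:C * expi y = (s - x)%:C * expi t + x%:C * (expi t - expi y).
  by rewrite rmorphB /=; ring.
apply: le_lt_trans (cnormD _ _) _; rewrite !cnormM cnorm_expi mulr1 !cnorm_real.
have h1 : cnorm (expi t - expi y) <= e / 2 / (`|x| + 1).
  apply: le_trans (cnorm_le_ReIm _) _; rewrite ReD ImD ReN ImN /= distrC [X in _ + X]distrC.
  move: hc hsn; clear; lra.
have h2 : `|x| * cnorm (expi t - expi y) <= (`|x| + 1) * (e / 2 / (`|x| + 1)).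
  by apply: ler_pM => //; [exact: cnorm_ge0|rewrite lerDl].
have : (`|x| + 1) * (e / 2 / (`|x| + 1)) = e / 2 by field; rewrite gt_eqF.
by move: hs h2 e0; clear; lra.
Qed.

(** Liouville: the Lipschitz constant of [lip_disk] tends to 0 as the radius
    grows. *)
Lemma bounded_entire_cst (f : R[i] -> R[i]) M : (forall z, cdiff f z) ->
  (forall z, cnorm (f z) <= M) -> forall z w, f z = f w.
Proof.
move=> df fM z w; apply/eqP; rewrite -subr_eq0; apply/eqP/cnorm_small => e e0.
have M0 : 0 <= M by apply: le_trans (fM 0); exact: cnorm_ge0.
pose r1 := Num.max (cnorm z) (cnorm w) + 1.
have r10 : 0 < r1 by rewrite ltr_wpDl // le_max cnorm_ge0.
pose A := M * cnorm (z - w) * 2.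
have A0 : 0 <= A by rewrite /A !mulr_ge0 ?cnorm_ge0.
pose s := 2 * r1 + A / e + A.
have Ae : 0 <= A / e by rewrite divr_ge0 // ltW.
have rs : r1 < s by rewrite /s; move: r10 A0 Ae; clear; lra.
have s0 : 0 < s by exact: lt_trans rs.
have mr : Num.max (cnorm z) (cnorm w) <= r1 by rewrite lerDl.
have zr : cnorm z <= r1 by apply: le_trans mr; rewrite le_max lexx.
have wr : cnorm w <= r1 by apply: le_trans mr; rewrite le_max lexx orbT.
apply: le_trans (@lip_disk _ f s r1 M z w rs s0 (fun z _ => df z) (fun z _ => fM z) zr wr) _.
have d0 : 0 < s - r1 by rewrite subr_gt0.
have -> : M * (s / (s - r1) ^+ 2) * cnorm (z - w) = (A / 2) * s / (s - r1) ^+ 2.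
  by rewrite /A; field; rewrite gt_eqF.
rewrite ler_pdivrMr ?exprn_gt0 //.
(* s <= 2 (s - r1) and A <= e (s - r1) *)
have h1 : s <= 2 * (s - r1) by rewrite /s; move: Ae A0; clear; lra.
have h2 : A <= e * (s - r1).
  have -> : s - r1 = A / e + (r1 + A) by rewrite /s; ring.
  rewrite mulrDr mulrCA mulfV ?gt_eqF // mulr1 lerDl mulr_ge0 ?(ltW e0) //.
  by rewrite addr_ge0 // ltW.
have h3 := ler_pM A0 (ltW s0) h2 h1.
by move: h3; rewrite expr2; clear; lra.
Qed.

End CompactnessTools.

Section PuncturedDisk.
Variable R : realType.
Implicit Types (f g : R[i] -> R[i]) (z w v c : R[i]).

Local Notation D := (@udisk R).
Local Notation D' := (@punctured_disk R).

Lemma pdisk_neq0 z : D' z -> z != 0.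
Proof. by rewrite /punctured_disk /annulus /= -cnorm_gt0 => /andP[]. Qed.

Lemma pdisk_udisk z : D' z <-> z != 0 /\ D z.
Proof. by rewrite /punctured_disk /annulus /udisk /= -cnorm_gt0; split => [/andP|[-> ->]]. Qed.

Lemma pdisk_open : copen D'.
Proof.
move=> z /andP[z0 z1]; exists (Num.min (cnorm z) (1 - cnorm z)).
  by rewrite lt_min z0 subr_gt0.
move=> w; rewrite lt_min => /andP[h1 h2].
have := cnorm_sub_ge w z; have := cnorm_sub_ge z w; rewrite cnormC => h3 h4.
by apply/andP; split; [move: h1 h3|move: h2 h4]; clear; lra.
Qed.

Definition tends0 f c := forall e : R, 0 < e ->
  exists2 d : R, 0 < d & forall z, 0 < cnorm z < d -> cnorm (f z - c) < e.

(** Off the puncture nothing changes, so that functions on the punctured disk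
    can be transferred without coercions. *)
Definition ext0 c f z := if z == 0 then c else f z.

Lemma ext0E c f z : z != 0 -> ext0 c f z = f z.
Proof. by rewrite /ext0 => /negbTE ->. Qed.

Lemma ext00 c f : ext0 c f 0 = c. Proof. by rewrite /ext0 eqxx. Qed.

Lemma ext0_cdiff f c : (forall z, D' z -> cdiff f z) -> tends0 f c ->
  forall z, D z -> cdiff (ext0 c f) z.
Proof.
move=> df fc z z1.
have [d d0 Hd] := fc 1 ltr01.
have bf w : 0 < cnorm w < d -> cnorm (f w) <= cnorm c + 1.
  by move=> /Hd h; have := cnorm_sub_ge (f w) c; move: h; clear; lra.
have [g [dg gE]] := removable ltr01 d0 df bf.
suff -> : ext0 c f = g by exact: dg.
apply/funext => w; rewrite /ext0; have [->|w0] := eqVneq w 0; last by rewrite gE.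
apply/eqP; rewrite -subr_eq0; apply/eqP/cnorm_small => e e0.
have e2 : 0 < e / 2 by rewrite divr_gt0.
have [d1 d10 H1] := fc _ e2.
have g0 : cdiff g 0 by apply: dg; rewrite cnorm0.
have [d2 d20 H2] := cdiff_ccont g0 e2.
pose t := Num.min d1 d2 / 2.
have t0 : 0 < t by rewrite divr_gt0 // lt_min d10.
have tm : t < Num.min d1 d2 by rewrite /t ltr_pdivrMr // ltr_pMr ?ltr1n // lt_min d10.
move: tm; rewrite lt_min => /andP[t1 t2].
have nt : cnorm (t%:C : R[i]) = t by rewrite cnorm_real gtr0_norm.
have h1 := H1 t%:C; rewrite nt t0 t1 in h1.
have h2 := H2 t%:C; rewrite subr0 nt t2 in h2.
have tE : g t%:C = f t%:C by rewrite gE // -cnorm_gt0 nt.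
have := cdist_triangle c (g 0) (f t%:C).
have := h1 isT; have := h2 isT; rewrite tE (cnormC c (f t%:C)).
by clear; lra.
Qed.

Lemma bounded_tends0 f M (d : R) : 0 < d -> (forall z, D' z -> cdiff f z) ->
  (forall z, 0 < cnorm z < d -> cnorm (f z) <= M) -> exists c, tends0 f c.
Proof.
move=> d0 df fM; have [g [dg gE]] := removable ltr01 d0 df fM.
exists (g 0) => e e0.
have g0 : cdiff g 0 by apply: dg; rewrite cnorm0.
have [d1 d10 H1] := cdiff_ccont g0 e0; exists d1 => // z /andP[z0 zd].
by rewrite -gE -?cnorm_gt0 //; apply: H1; rewrite subr0.
Qed.

Lemma ext0_ccont f c : tends0 f c -> ccont (ext0 c f) 0.
Proof.
move=> fc e e0; have [d d0 H] := fc e e0; exists d => // w; rewrite subr0 => wd.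
rewrite ext00; have [->|w0] := eqVneq w 0; first by rewrite ext00 subrr cnorm0.
by rewrite ext0E //; apply: H; rewrite cnorm_gt0 w0.
Qed.

(** The limit at the puncture of an injective function is not one of its
    values, since the values near it are already taken near the puncture. *)
Lemma limit_not_value f c z : (forall z, D' z -> cdiff f z) ->
  (forall z w, D' z -> D' w -> f z = f w -> z = w) -> tends0 f c -> D' z -> f z <> c.
Proof.
move=> df fi fc z1 fz.
have z0 : 0 < cnorm z by case/andP: z1.
have z2 : 0 < cnorm z / 2 by rewrite divr_gt0.
have [m m0 Hm] := univ_open pdisk_open df fi z1 z2; rewrite fz in Hm.
have [d d0 Hd] := fc m m0.
pose t := Num.min (Num.min (d / 2) (cnorm z / 2)) (1 / 2).
have t0 : 0 < t by rewrite !lt_min z2 !divr_gt0.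
have : t <= t by [].
rewrite {2}/t !le_min => /andP[/andP[t1 t2] t3].
have nt : cnorm (t%:C : R[i]) = t by rewrite cnorm_real gtr0_norm.
have td : 0 < cnorm (t%:C : R[i]) < d by rewrite nt t0 /=; move: t1 d0; clear; lra.
have tD : D' t%:C.
  by rewrite /punctured_disk /annulus /= nt t0 /=; move: t3; clear; lra.
have [w [wD wz wE]] := Hm _ (Hd _ td).
have wt := fi _ _ wD tD wE; rewrite wt in wz.
by have := cnorm_sub_ge z t%:C; rewrite nt cnormC; move: wz t2; clear; lra.
Qed.

Lemma ext0_inj f c : (forall z, D' z -> cdiff f z) ->
  (forall z w, D' z -> D' w -> f z = f w -> z = w) -> tends0 f c ->
  forall z w, D z -> D w -> ext0 c f z = ext0 c f w -> z = w.
Proof.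
move=> df fi fc z w z1 w1.
have [->|z0] := eqVneq z 0; have [->|w0] := eqVneq w 0 => //.
- rewrite ext00 ext0E // => E; exfalso; apply: (limit_not_value df fi fc _ (esym E)).
  exact/pdisk_udisk.
- rewrite ext00 ext0E // => E; exfalso; apply: (limit_not_value df fi fc _ E).
  exact/pdisk_udisk.
- by rewrite !ext0E //; apply: fi; exact/pdisk_udisk.
Qed.

Lemma ext0_univ0 f : (forall z, D' z -> cdiff f z) ->
  (forall z w, D' z -> D' w -> f z = f w -> z = w) -> tends0 f 0 -> univ0 (ext0 0 f).
Proof.
move=> df fi f0; split; [exact: ext0_cdiff|exact: ext0_inj|exact: ext00].
Qed.

End PuncturedDisk.

Section PuncturedChain.
Variable R : realType.
Variables (f : R -> R[i] -> R[i]) (T : R).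
Local Notation D := (@udisk R).
Local Notation D' := (@punctured_disk R).

Hypothesis df : forall t, T <= t -> forall z, D' z -> cdiff (f t) z.
Hypothesis fi : forall t, T <= t -> forall z w, D' z -> D' w -> f t z = f t w -> z = w.
Hypothesis ff : forall s t, T <= s -> s <= t -> f s @` D' `<=` f t @` D'.
Hypothesis fcont : forall u, T <= u -> forall a b e : R, 0 < a -> b < 1 -> 0 < e ->
  exists2 d : R, 0 < d & forall t, T <= t -> `|t - u| < d ->
    forall z, a <= cnorm z <= b -> cnorm (f t z - f u z) < e.

Definition ptrans s t z := inv_on D' (f t) (f s z).

Lemma ptransP s t z : T <= s -> s <= t -> D' z ->
  D' (ptrans s t z) /\ f t (ptrans s t z) = f s z.
Proof. by move=> Ts st z1; apply: inv_onP; apply: (ff Ts st); exists z. Qed.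

Lemma ptrans_cdiff s t z : T <= s -> s <= t -> D' z -> cdiff (ptrans s t) z.
Proof.
move=> Ts st z1; have Tt := le_trans Ts st.
apply: (@cdiff_comp _ (f s) (inv_on D' (f t))); first exact: df.
by apply: inv_on_cdiff; [exact: pdisk_open|exact: df|exact: fi|apply: (ff Ts st); exists z].
Qed.

Lemma ptrans_inj s t z w : T <= s -> s <= t -> D' z -> D' w ->
  ptrans s t z = ptrans s t w -> z = w.
Proof.
move=> Ts st z1 w1 E; apply: (fi Ts) => //.
have [_ <-] := ptransP Ts st z1; have [_ <-] := ptransP Ts st w1; by rewrite E.
Qed.

Lemma ptrans_limit s t : T <= s -> s <= t -> exists c, tends0 (ptrans s t) c.
Proof.
move=> Ts st; apply: (@bounded_tends0 _ _ 1 1) => //.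
  by move=> z; exact: ptrans_cdiff.
by move=> z z1; have [/andP[_ /ltW]] := ptransP Ts st z1.
Qed.

Lemma half_circle z : cnorm z = 1 / 2 -> D' z.
Proof. by rewrite /punctured_disk /annulus /= => ->; apply/andP; split; lra. Qed.

(** On the circle [f u] is injective with a margin: it moves points at
    distance 1/8 apart by at least some [m > 0], uniformly by compactness. For
    times close to [u] this survives the perturbation, and [zero_exists]
    locates the preimage of [f s z] under [f t] within 1/8 of [z]. *)
Lemma ptrans_near u : T <= u -> exists2 d : R, 0 < d & forall s t, T <= s -> s <= t ->
  `|s - u| < d -> `|t - u| < d -> forall z, cnorm z = 1 / 2 -> cnorm (ptrans s t z - z) <= 1 / 8.
Proof.
move=> Tu.
have [m m0 Hm] : exists2 m : R, 0 < m & forall z, [set z | 1 / 2 <= cnorm z <= 1 / 2] z ->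
    forall y, cnorm (y - z) = 1 / 8 -> m <= cnorm (f u y - f u z).
  apply: compact_uniform; first by apply: ring_compact; lra.
  move=> z /= /andP[z1 z2]; have zD : D' z by apply: half_circle; apply/eqP; rewrite eq_le z1 z2.
  have e16 : 0 < 1 / 16 :> R by lra.
  have [m m0 Hm] := univ_open (@pdisk_open R) (df Tu) (fi Tu) zD e16.
  have m2 : 0 < m / 2 by rewrite divr_gt0.
  have [d d0 Hd] := cdiff_ccont (df Tu zD) m2.
  exists (Num.min (Num.min d (1 / 16)) (m / 2)); first by rewrite !lt_min d0 m2 e16.
  move=> e w e0; rewrite !lt_min => /andP[_ em] /andP[/andP[wd w16] _] y yw.
  rewrite leNgt; apply/negP => h.
  have yD : D' y.
    have := cnorm_sub_ge y w; have := cnorm_sub_ge w y; rewrite cnormC yw.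
    have := cnorm_sub_ge z w; have := cnorm_sub_ge w z; rewrite (cnormC z).
    rewrite /punctured_disk /annulus /= => h1 h2 h3 h4.
    by apply/andP; split; [move: h2 h3|move: h1 h4]; move: w16 z1 z2; clear -df fi ff fcont; lra.
  have h' : cnorm (f u y - f u z) < m.
    have := cdist_triangle (f u y) (f u z) (f u w); have := Hd w wd.
    by move: h em; clear -df fi ff fcont; lra.
  have [y' [y'D y'z y'E]] := Hm _ h'.
  have yy := fi Tu y'D yD y'E; rewrite yy in y'z.
  have := cdist_triangle y w z; rewrite yw (cnormC z); move: y'z w16; clear -df fi ff fcont; lra.
have m4 : 0 < m / 4 by rewrite divr_gt0.
have a0 : 0 < 3 / 8 :> R by lra.
have b1 : 5 / 8 < 1 :> R by lra.
have [d d0 Hd] := fcont Tu a0 b1 m4.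
exists d => // s t Ts st sd td z zr.
have Tt := le_trans Ts st.
have ring y : cnorm (y - z) <= 1 / 8 -> 3 / 8 <= cnorm y <= 5 / 8.
  have := cnorm_sub_ge y z; have := cnorm_sub_ge z y; rewrite cnormC zr => h1 h2 h3.
  by apply/andP; split; [move: h1|move: h2]; move: h3; clear -df fi ff fcont; lra.
have ringD y : cnorm (y - z) <= 1 / 8 -> D' y.
  move=> /ring; rewrite /punctured_disk /annulus /= => /andP[h1 h2].
  by apply/andP; split; [move: h1|move: h2]; clear -df fi ff fcont; lra.
have zz : cnorm (z - z) <= 1 / 8 by rewrite subrr cnorm0; lra.
have hs := Hd s Ts sd z (ring z zz); have ht := Hd t Tt td.
have [y yz fy] : exists2 y, cnorm (y - z) < 1 / 8 & f t y - f s z = 0.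
  apply: (@zero_exists _ _ z (1 / 8) (m / 2)).
  - by lra.
  - by move=> y /ringD yD; apply: cdiffB; [exact: df|exact: cdiff_cst].
  - move=> y yz; have hy := ht y (ring y ltac:(by rewrite yz)).
    have hm : m <= cnorm (f u y - f u z) by apply: Hm => //=; rewrite zr lexx.
    have := cdist_triangle (f u y) (f u z) (f t y).
    have := cdist_triangle (f t y) (f u z) (f s z).
    by rewrite (cnormC (f u y) (f t y)); move: hm hy hs; clear -df fi ff fcont; lra.
  - have hy := ht z (ring z zz).
    have := cdist_triangle (f t z) (f s z) (f u z); rewrite (cnormC (f u z) (f s z)).
    by move: hy hs => /=; clear -df fi ff fcont; lra.
have yD := ringD y (ltW yz).
have -> : ptrans s t z = y; last exact: ltW.
have fE : f t y = f s z by apply/eqP; rewrite -subr_eq0 fy.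
by rewrite /ptrans -fE inv_onK //; exact: fi.
Qed.

(** If the transition map is close to the identity on the circle, its value
    [c] at the puncture is small, and [c != 0] would contradict the maximum
    principle for its inverse. *)
Lemma ptrans_near_tends0 s t : T <= s -> s <= t ->
  (forall z, cnorm z = 1 / 2 -> cnorm (ptrans s t z - z) <= 1 / 8) -> tends0 (ptrans s t) 0.
Proof.
move=> Ts st H; have [c Hc] := ptrans_limit Ts st.
suff -> : 0 = c by [].
have dp := @ptrans_cdiff s t.
have dg := ext0_cdiff (fun z => dp z Ts st) Hc.
set g := ext0 c (ptrans s t) in dg.
have h12 : 0 < 1 / 2 :> R by lra.
have gE z : z != 0 -> g z = ptrans s t z by exact: ext0E.
have in1 z : cnorm z <= 1 / 2 -> D z by rewrite /udisk /=; move: h12; clear -df fi ff fcont; lra.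
have circ z : cnorm z = 1 / 2 -> z != 0 by move=> zr; rewrite -cnorm_gt0 zr.
have c8 : cnorm c <= 1 / 8.
  have := @max_circle _ (fun z => g z - z) (1 / 2) (1 / 8) 0 h12.
  rewrite subr0 /g ext00 cnorm0; apply.
  - by move=> z /in1 zD; apply: cdiffB; [exact: dg|exact: cdiff_id].
  - by move=> z zr; rewrite ext0E ?circ //; exact: H.
  - exact: ltW.
apply/esym/eqP/negPn/negP => c0.
have g0 z : D z -> g z != 0.
  move=> zD; have [->|z0] := eqVneq z 0; first by rewrite /g ext00.
  rewrite gE //; have zD' : D' z by exact/pdisk_udisk.
  by have [/pdisk_neq0] := ptransP Ts st zD'.
have : cnorm (g 0)^-1 <= 8 / 3.
  apply: (@max_circle _ (fun z => (g z)^-1) (1 / 2)) => //.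
  - by move=> z /in1 zD; apply: cdiffV; [exact: g0|exact: dg].
  - move=> z zr; rewrite cnormV gE ?circ //.
    have := H z zr; have := cnorm_sub_ge z (ptrans s t z); rewrite cnormC zr => h1 h2.
    have h3 : 3 / 8 <= cnorm (ptrans s t z) by move: h1 h2; clear -df fi ff fcont; lra.
    have -> : 8 / 3 = (3 / 8)^-1 :> R by rewrite invf_div.
    have p38 : 0 < 3 / 8 :> R by lra.
    by rewrite lef_pV2 ?posrE // (lt_le_trans p38).
  - by rewrite cnorm0 ltW.
rewrite /g ext00 cnormV.
have cp : 0 < cnorm c by rewrite cnorm_gt0.
have : 8 <= (cnorm c)^-1.
  have -> : 8 = (1 / 8)^-1 :> R by rewrite invf_div divr1.
  by rewrite lef_pV2 ?posrE //; lra.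
by clear -df fi ff fcont; lra.
Qed.

(** The set of time intervals for which this holds is closed under
    concatenation, and short intervals belong to it. *)
Lemma ptrans_tends0 s t : T <= s -> s <= t -> tends0 (ptrans s t) 0.
Proof.
move=> Ts st; apply: (@interval_induction _ (fun a b => tends0 (ptrans a b) 0) s t st).
- move=> a m b sa am mb bt Ham Hmb e e0.
  have Ta := le_trans Ts sa; have Tm := le_trans Ta am.
  have [d d0 Hd] := Hmb e e0; have [d1 d10 H1] := Ham d d0.
  exists (Num.min d1 1); first by rewrite lt_min d10 ltr01.
  move=> z; rewrite lt_min => /andP[z0 /andP[zd z1]].
  have zD : D' z by apply/andP.
  have [pD pE] := ptransP Ta am zD.
  have -> : ptrans a b z = ptrans m b (ptrans a m z) by rewrite /ptrans -/(ptrans a m z) pE.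
  apply: Hd; have := H1 z; rewrite z0 zd subr0 => /(_ isT) ->.
  by rewrite andbT cnorm_gt0; exact: pdisk_neq0.
- move=> u /andP[su ut]; have Tu := le_trans Ts su.
  have [d d0 Hd] := ptrans_near Tu; exists d => // a b sa au ub bt ad bd.
  have Ta := le_trans Ts sa; have ab := le_trans au ub.
  apply: ptrans_near_tends0 => //; apply: Hd => //.
    by rewrite ler0_norm ?subr_le0 //; move: ad; clear -df fi ff fcont; lra.
  by rewrite ger0_norm ?subr_ge0 //; move: bd; clear -df fi ff fcont; lra.
Qed.

(** Near the puncture, the values of [f t] are values of [f s] near the
    puncture, as the transition map is open there. *)
Lemma limit_transfer s t (e : R) : T <= s -> s <= t -> 0 < e -> exists2 d : R, 0 < d &
  forall v, 0 < cnorm v < d -> exists z, [/\ 0 < cnorm z < e, D' z & f t v = f s z].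
Proof.
move=> Ts st e0; have p0 := ptrans_tends0 Ts st.
have [dg gi g0] := ext0_univ0 (fun z => @ptrans_cdiff s t z Ts st)
   (fun z w => @ptrans_inj s t z w Ts st) p0.
have [m m0 Hm] := univ_open (@udisk_open R) dg gi (@udisk0 R) e0.
rewrite g0 in Hm; exists m => // v /andP[v0 vm].
have := Hm v; rewrite subr0 => /(_ vm) [z [zD]]; rewrite subr0 => ze zE.
have z0 : z != 0.
  by apply: contraTneq v0 => zz; rewrite -zE zz g0 cnorm0 ltxx.
have zD' : D' z by exact/pdisk_udisk.
exists z; split => //; first by rewrite cnorm_gt0 z0.
by have [_ <-] := ptransP Ts st zD'; rewrite -zE ext0E.
Qed.

Definition punion : set R[i] := [set w | exists t z, [/\ T <= t, D' z & f t z = w]].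

Lemma punion_open : copen punion.
Proof.
move=> _ [t [z [Tt zD <-]]].
have zI : (f t @` D') (f t z) by exists z.
have [d d0 H] := univ_image_open (@pdisk_open R) (df Tt) (fi Tt) zI.
by exists d => // w /H [y yD <-]; exists t, y.
Qed.

(** A chain consisting of functions with a pole at the puncture omits a value:
    otherwise the complement of the image of the first function, which is
    compact, would be covered by one of the images, whose inverse would be a
    bounded entire function. *)
Lemma pole_omitted : ~ (exists c, tends0 (f T) c) ->
  exists b, ~ punion b /\ tends0 (fun z => (f T z - b)^-1) 0.
Proof.
move=> nb; have TT := lexx T.
have h12 : cnorm ((1 / 2)%:C : R[i]) = 1 / 2 by rewrite cnorm_real ger0_norm //; lra.
pose z1 : R[i] := (1 / 2)%:C; have z1D : D' z1 by exact: half_circle.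
pose w1 := f T z1.
have e4 : 0 < 1 / 4 :> R by lra.
have [m m0 Hm] := univ_open (@pdisk_open R) (df TT) (fi TT) z1D e4.
have far z : 0 < cnorm z < 1 / 4 -> m <= cnorm (f T z - w1).
  move=> /andP[z0 z4]; rewrite leNgt; apply/negP => /Hm [y [yD yz yE]].
  have zD : D' z by apply/andP; split => //; move: z4; clear -df fi ff fcont; lra.
  have yy := fi TT yD zD yE; rewrite yy in yz.
  by have := cnorm_sub_ge z1 z; rewrite h12 cnormC; move: yz z4; clear -df fi ff fcont; lra.
have ne0 z : 0 < cnorm z < 1 / 4 -> f T z - w1 != 0.
  by move=> /far h; rewrite -cnorm_gt0; exact: lt_le_trans h.
pose q z := (f T (z / 4) - w1)^-1.
have n4 z : cnorm (z / 4) = cnorm z / 4.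
  by rewrite cnormM cnormV cnorm_nat.
have z4 z : D' z -> 0 < cnorm (z / 4) < 1 / 4.
  by rewrite /punctured_disk /annulus /= n4 => /andP[h1 h2]; apply/andP; split; move: h1 h2; clear -df fi ff fcont; lra.
have z4D z : D' z -> D' (z / 4).
  by move=> /z4 /andP[h1 h2]; apply/andP; split => //; move: h2; clear -df fi ff fcont; lra.
have dq z : D' z -> cdiff q z.
  move=> zD; apply: cdiffV; first exact/ne0/z4.
  apply: cdiffB; last exact: cdiff_cst.
  apply: (@cdiff_comp _ (fun z => z / 4) (f T)); last exact/df/z4D.
  by apply: cdiffM; [exact: cdiff_id|exact: cdiff_cst].
have c40 : (4 : R[i]) != 0 by rewrite pnatr_eq0.
have qi z w : D' z -> D' w -> q z = q w -> z = w.
  move=> zD wD /invr_inj /addIr /(fi TT (z4D z zD) (z4D w wD)) E.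
  by apply: (mulIf (_ : 4^-1 != 0)) => //; rewrite invr_neq0.
have [c qc] : exists c, tends0 q c.
  apply: (@bounded_tends0 _ q m^-1 1) => // z zD.
  rewrite cnormV lef_pV2 ?posrE //; first exact/far/z4.
  by rewrite cnorm_gt0; apply/ne0/z4.
(* a finite nonzero limit of 1/(f - w1) would give a finite limit of f *)
have c0 : c = 0.
  apply/eqP/negPn/negP => c0; apply: nb; exists (w1 + c^-1).
  have cV : ccont (fun z => w1 + (ext0 c q z)^-1) 0.
    apply: ccontD; first exact: ccont_cst.
    by apply: ccontV; [rewrite ext00|exact: ext0_ccont].
  move=> e e0; have [d d0 Hd] := cV e e0; exists (Num.min (d / 4) (1 / 4)).
    by rewrite lt_min e4 divr_gt0.
  move=> z /andP[z0]; rewrite lt_min => /andP[zd zz].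
  have n4z : cnorm (4 * z) = 4 * cnorm z.
    by rewrite cnormM cnorm_nat.
  have zn : 4 * z != 0 by rewrite mulf_neq0 // -cnorm_gt0.
  have := Hd (4 * z); rewrite subr0 n4z ext00 ext0E // /q invrK.
  have -> : 4 * z / 4 = z by rewrite mulrAC mulfV // mul1r.
  rewrite [w1 + (_ - w1)]addrC subrK; apply; move: zd; clear -df fi ff fcont; lra.
rewrite c0 in qc.
have [dqh qhi qh0] := ext0_univ0 dq qi qc.
have [k k0 Hk] := univ_open (@udisk_open R) dqh qhi (@udisk0 R) ltr01.
rewrite qh0 in Hk.
(* the image of the first function contains a neighbourhood of infinity *)
have cover w : k^-1 < cnorm (w - w1) -> (f T @` D') w.
  move=> wk; have wp : 0 < cnorm (w - w1) by apply: lt_trans wk; rewrite invr_gt0.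
  have := Hk (w - w1)^-1; rewrite subr0 cnormV -[X in _ < X]invrK ltf_pV2 ?posrE ?invr_gt0 //.
  move=> /(_ wk) [z [zD _ zE]].
  have z0 : z != 0.
    apply/eqP => zz; move: zE; rewrite zz qh0 => /esym /eqP.
    by rewrite invr_eq0 -cnorm_eq0 gt_eqF.
  have zD' : D' z by exact/pdisk_udisk.
  exists (z / 4); first exact: z4D.
  by move: zE; rewrite ext0E // => /invr_inj /addIr.
have [b nb'] : exists b, ~ punion b.
  apply: contrapT => /forallNP nn.
  have all w : punion w by exact: contrapT (nn w).
  (* the time [T + 1 / e] grows as [e] decreases, so that one time covers the
     complementary compact disk *)
  have [e e0 He] : exists2 e : R, 0 < e & forall z, [set z | 0 <= cnorm z <= k^-1] z ->
      (f (T + e^-1) @` D') (w1 + z).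
    apply: compact_uniform; first exact: ring_compact.
    move=> z _; have [t [y [Tt yD yE]]] := all (w1 + z).
    have yI : (f t @` D') (f t y) by exists y.
    have [d d0 Hd] := univ_image_open (@pdisk_open R) (df Tt) (fi Tt) yI.
    exists (Num.min d (t - T + 1)^-1).
      by rewrite lt_min d0 invr_gt0 ltr_wpDl // subr_ge0.
    move=> e w e0; rewrite !lt_min => /andP[_ ee] /andP[wd _].
    have te : t <= T + e^-1.
      have : t - T + 1 < e^-1.
        by rewrite -[ltLHS]invrK ltf_pV2 ?posrE ?invr_gt0 // ltr_wpDl // subr_ge0.
      by clear -df fi ff fcont; lra.
    apply: (ff Tt te); apply: Hd; rewrite yE.
    by have -> : w1 + w - (w1 + z) = w - z by ring.
  have Tt : T <= T + e^-1 by rewrite lerDl invr_ge0 ltW.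
  set t := T + e^-1 in He Tt.
  have onto w : (f t @` D') w.
    have [h|h] := ltP k^-1 (cnorm (w - w1)); first by apply: (ff TT Tt); exact: cover.
    by have := He (w - w1); rewrite /= cnorm_ge0 h addrC subrK; apply.
  have dI w : cdiff (inv_on D' (f t)) w.
    by apply: inv_on_cdiff; [exact: pdisk_open|exact: df|exact: fi|exact: onto].
  have bI w : cnorm (inv_on D' (f t) w) <= 1.
    by have [/andP[_ /ltW]] := inv_onP (onto w).
  have := bounded_entire_cst dI bI (f t z1) (f t (z1 / 2)).
  have z2D : D' (z1 / 2).
    by rewrite /punctured_disk /annulus /= cnormM cnormV h12 cnorm_nat; apply/andP; split; lra.
  rewrite !inv_onK //; try exact: fi.
  by move=> /(congr1 (@cnorm R)); rewrite cnormM cnormV h12 cnorm_nat; lra.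
exists b; split => // e e0.
(* [1/(f - b)] tends to 0 because [1/(f - w1)] does *)
pose M := cnorm (w1 - b) + 1 + e^-1.
have M0 : 0 < M by rewrite /M ltr_wpDl ?invr_gt0 // addr_ge0 // cnorm_ge0.
have Mi : 0 < M^-1 by rewrite invr_gt0.
have [d d0 Hd] := qc _ Mi; exists (Num.min (d / 4) (1 / 4)).
  by rewrite lt_min e4 divr_gt0.
move=> z /andP[z0]; rewrite lt_min => /andP[zd zz].
have n4z : cnorm (4 * z) = 4 * cnorm z.
  by rewrite cnormM cnorm_nat.
have := Hd (4 * z); rewrite subr0 n4z /q.
have -> : 4 * z / 4 = z by rewrite mulrAC mulfV // mul1r.
have zp : 0 < cnorm (f T z - w1) by rewrite cnorm_gt0; apply: ne0; rewrite z0.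
rewrite cnormV ltf_pV2 ?posrE // => h.
have {}h : M < cnorm (f T z - w1) by apply: h; apply/andP; split; move: z0 zd; clear -df fi ff fcont; lra.
have h2 : e^-1 < cnorm (f T z - b).
  have := cdist_triangle (f T z) w1 b; rewrite (cnormC b).
  by move: h; rewrite /M; clear -df fi ff fcont; lra.
rewrite subr0 cnormV -[ltRHS]invrK ltf_pV2 ?posrE ?invr_gt0 //.
by apply: lt_trans h2; rewrite invr_gt0.
Qed.

(** The map is [w - a] when [f T] has a finite limit [a] at the puncture, and
    [1 / (w - b)] with an omitted value [b] otherwise; the other times follow
    by [limit_transfer]. *)
Lemma normalization : exists M : R[i] -> R[i],
  [/\ forall v, punion v -> cdiff M v,
      forall v w, punion v -> punion w -> M v = M w -> v = w &
      forall t, T <= t -> tends0 (fun z => M (f t z)) 0].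
Proof.
have transfer (M : R[i] -> R[i]) t : T <= t -> tends0 (fun z => M (f T z)) 0 ->
    tends0 (fun z => M (f t z)) 0.
  move=> Tt H e e0; have [d d0 Hd] := H e e0.
  have [d1 d10 H1] := limit_transfer (lexx T) Tt d0; exists d1 => // v /H1 [z [zd _ ->]].
  exact: Hd.
have [[a Ha]|nb] := pselect (exists c, tends0 (f T) c).
  exists (fun w => w - a); split.
  - by move=> v _; apply: cdiffB; [exact: cdiff_id|exact: cdiff_cst].
  - by move=> v w _ _ /addIr.
  - move=> t Tt; apply: (transfer (fun w => w - a)) => // e e0.
    by have [d d0 Hd] := Ha e e0; exists d => // z /Hd; rewrite subr0.
have [b [bU Hb]] := pole_omitted nb.
exists (fun w => (w - b)^-1); split.
- move=> v vU; apply: cdiffV; last by apply: cdiffB; [exact: cdiff_id|exact: cdiff_cst].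
  by rewrite subr_eq0; apply/eqP => vb; apply: bU; rewrite -vb.
- by move=> v w _ _ /invr_inj /addIr.
- by move=> t Tt; exact: (transfer (fun w => (w - b)^-1)).
Qed.

End PuncturedChain.

(** * Integration with respect to the completed Lebesgue measure *)

Section LebesgueTools.
Variable R : realType.
Notation mu := (@completed_lebesgue_measure R).
Notation LR := (lebesgueR R).

Lemma lmeas_borel_set (A : set R) : measurable A -> measurable (A : set LR).
Proof. by move=> mA; apply: sub_caratheodory; exact: mA. Qed.

Lemma lmeas_itv (i : interval R) : measurable ([set` i] : set LR).
Proof. by apply: lmeas_borel_set; exact: measurable_itv. Qed.

Lemma lmeas_borel (u : R -> R) (D : set LR) : measurable_fun [set: R] u ->
  measurable_fun D (u : LR -> R).
Proof.
move=> mu_ mD Y mY; apply: measurableI => //; apply: lmeas_borel_set.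
by rewrite -[X in measurable X]setTI; exact: mu_.
Qed.

Lemma lmeas_cont (u : R -> R) (D : set LR) : continuous u -> measurable_fun D (u : LR -> R).
Proof. by move=> cu; apply: lmeas_borel; exact: continuous_measurable_fun. Qed.

Lemma mu_itv (a b : R) : a <= b -> mu `[a, b]%classic = (b - a)%:E.
Proof.
move=> ab; have := @lebesgue_measure_itv R `[a, b].
rewrite /= lte_fin => E; apply: (etrans E).
by move: ab; rewrite le_eqVlt => /predU1P[->|->]; rewrite ?ltxx ?subrr // EFinB.
Qed.

Lemma lint_cst_integrable (a b M : R) : a <= b -> mu.-integrable `[a, b] (fun=> M%:E).
Proof.
move=> ab; apply/integrableP; split; first exact: measurable_cst.
rewrite (_ : (fun x : LR => `|M%:E|%E) = cst `|M|%:E) //.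
rewrite integral_cst; last exact: lmeas_itv.
by rewrite /= mu_itv ?ltry.
Qed.

Lemma lint_bounded_integrable (a b M : R) (u : LR -> R) : a <= b ->
  measurable_fun (`[a, b] : set LR) u -> (forall x, a <= x <= b -> `|u x| <= M) ->
  mu.-integrable `[a, b] (EFin \o u).
Proof.
move=> ab mu_ uM; apply: (le_integrable (lmeas_itv _) _ _ (lint_cst_integrable M ab)).
  exact/measurable_EFinP.
move=> x; rewrite /= in_itv /= => xab; rewrite lee_fin.
by apply: le_trans (uM x xab) (ler_norm _).
Qed.

Lemma cont_bounded (a b : R) (u : R -> R) : a <= b -> continuous u ->
  exists M, forall x, a <= x <= b -> `|u x| <= M.
Proof.
move=> ab cu.
have cn : {within `[a, b], continuous (fun x => `|u x|)}.
  apply: continuous_subspaceT => x; exact: (continuous_comp (cu x) (@norm_continuous _ _ _)).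
have [x _ H] := EVT_max ab cn.
by exists `|u x| => y yab; apply: H; rewrite in_itv.
Qed.

Lemma lint_cont_integrable (a b : R) (u : R -> R) : a <= b -> continuous u ->
  mu.-integrable `[a, b] (EFin \o (u : LR -> R)).
Proof.
move=> ab cu; have [M HM] := cont_bounded ab cu.
by apply: (lint_bounded_integrable ab _ HM); exact: lmeas_cont.
Qed.

(** The fundamental theorem of calculus for the completed measure: the identity
    map transports it to the Borel one. *)
Lemma lint_FTC (a b : R) (u U : R -> R) : a <= b -> continuous u ->
  (forall x : R, a <= x <= b -> is_derive x (1 : R) U (u x)) ->
  (\int[mu]_(x in `[a, b]) (u x)%:E = (U b - U a)%:E)%E.
Proof.
move=> ab cu dU.
have mid : measurable_fun [set: LR] (idfun : LR -> measurableTypeR R).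
  by move=> _ Y mY; rewrite setTI; exact: lmeas_borel_set.
have mf : measurable_fun [set: measurableTypeR R] (EFin \o u).
  by apply/measurable_EFinP; exact: continuous_measurable_fun.
have E := @integral_pushforward _ _ LR (measurableTypeR R) R idfun mid mu `[a, b]%classic
   (EFin \o u) mf (lint_cont_integrable ab cu) (measurable_itv _).
transitivity (\int[mu]_(x in idfun @^-1` `[a, b]%classic) ((EFin \o u) \o idfun) x)%E => //.
rewrite -E.
transitivity (\int[@lebesgue_measure R]_(x in `[a, b]) (u x)%:E)%E.
  by apply: eq_measure_integral.
move: ab; rewrite le_eqVlt => /predU1P[ab|ab].
  by rewrite ab subrr set_itv1 integral_set1.
have cU x : a <= x <= b -> {for x, continuous U}.
  by move=> /dU [dx _]; apply/differentiable_continuous/derivable1_diffP.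
rewrite (@continuous_FTC2 R u U) //=.
- exact: continuous_subspaceT.
- split => [x||].
  + by rewrite in_itv /= => /andP[/ltW ax /ltW xb]; have [] := dU x ltac:(by rewrite ax).
  + by apply: cvg_at_right_filter; apply: cU; rewrite lexx ltW.
  + by apply: cvg_at_left_filter; apply: cU; rewrite lexx ltW.
- move=> x; rewrite in_itv /= => /andP[/ltW ax /ltW xb].
  by rewrite derive1E; have [] := dU x ltac:(by rewrite ax).
Qed.

Lemma primitive_exists (a : R) (u : R -> R) : continuous u ->
  exists U : R -> R, forall x : R, a <= x -> is_derive x (1 : R) U (u x).
Proof.
move=> cu; exists (fun x => \int[@lebesgue_measure R]_(t in `[a - 1, x]) u t) => x ax.
have ui : (@lebesgue_measure R).-integrable `[a - 1, x + 1] (EFin \o u).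
  by apply: continuous_segment_integrable => y _; exact: cu.
have [] := @continuous_FTC1_closed R u (a - 1) x (x + 1) _ ui _ (cu x).
- by rewrite ltrDl.
- by move: ax; clear; lra.
move=> d1 d2; rewrite derive1E in d2.
exact: (DeriveDef d1 d2).
Qed.

(** A difference quotient of a primitive is a primitive of the difference
    quotient. *)
Lemma lint_diffquot (a b h : R) (y V : R -> R) : a <= b -> 0 < h -> continuous y ->
  (forall x : R, a <= x -> is_derive x (1 : R) V (y x)) ->
  (\int[mu]_(x in `[a, b]) (h^-1 * (y (x + h)%R - y x))%:E =
   (h^-1 * ((V (b + h)%R - V b) - (V (a + h)%R - V a)))%:E)%E.
Proof.
move=> ab h0 cy dV.
have cs : continuous (fun x : R => x + h).
  by move=> x; apply: cvgD; [exact: cvg_id|exact: cvg_cst].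
pose u := fun x => h^-1 * (y (x + h) - y x); pose U := fun x => h^-1 * (V (x + h) - V x).
transitivity (U b - U a)%:E; last by congr EFin; rewrite /U; ring.
apply: (@lint_FTC a b u U ab).
- move=> x; apply: cvgM; first exact: cvg_cst.
  apply: cvgB; last exact: cy.
  exact: (continuous_comp (cs x) (cy (x + h))).
- move=> x /andP[ax _].
  have d1 : is_derive x (1 : R) V (y x) := dV x ax.
  have d2 : is_derive (x + h) (1 : R) V (y (x + h)).
    by apply: dV; move: ax h0; clear; lra.
  have d3 : is_derive x (1 : R) (fun x => x + h) 1.
    by apply: is_derive_eq; rewrite addr0.
  have d4 : is_derive x (1 : R) (V \o (fun x => x + h)) (y (x + h)).
    have := @is_derive1_comp R V (fun x => x + h) x (y (x + h)) 1 d2 d3.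
    by rewrite mulr1.
  have d5 : is_derive x (1 : R) (V \o (fun x => x + h) - V) (y (x + h) - y x).
    exact: is_deriveB.
  have := @is_deriveZ _ _ _ _ h^-1 x 1 _ d5.
  by [].
Qed.

Lemma primitive_mono (b h : R) (Y V : R -> R) : 0 < h -> {homo Y : x z / x <= z} ->
  (forall x : R, b <= x -> is_derive x (1 : R) V (Y x)) -> continuous Y ->
  h * Y b <= V (b + h) - V b <= h * Y (b + h).
Proof.
move=> h0 mY dV cY; have bh : b < b + h by rewrite ltrDl.
have dV' x : x \in `]b, b + h[ -> is_derive x (1 : R) V (Y x).
  by rewrite in_itv /= => /andP[/ltW bx _]; exact: dV.
have [|c] := MVT bh dV'.
  apply: continuous_in_subspaceT => x; rewrite inE /= in_itv /= => /andP[bx _].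
  by have [dx _] := dV x bx; apply/differentiable_continuous/derivable1_diffP.
rewrite in_itv /= => /andP[/ltW bc /ltW cb]; rewrite addrAC subrr add0r mulrC => ->.
by rewrite !ler_pM2l // !mY.
Qed.

Lemma einf_le (u : (\bar R)^nat) (C : \bar R) : (forall n, u n <= C)%E -> (limn_einf u <= C)%E.
Proof.
move=> uC; rewrite limn_einf_lim; apply: lime_le; first exact: is_cvg_einfs.
by apply: nearW => n; apply: le_trans (uC n); apply: ereal_inf_lbound; exists n => /=.
Qed.

End LebesgueTools.

(** * Controls of increments *)

Section FiniteMeasureSet.
Context d0 (T : measurableType d0) (R : realType).
Variables (mu : {measure set T -> \bar R}) (E : set T).
Hypotheses (mE : measurable E) (muE : (mu E < +oo)%E).

Lemma fin_set_integral_cst_lt (y : \bar R) : (0 <= y)%E -> (y < +oo)%E ->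
  (\int[mu]_(x in E) y < +oo)%E.
Proof.
move=> y0 yoo; rewrite integral_cst //.
by apply: lte_mul_pinfty => //; rewrite ge0_fin_numE.
Qed.

(** On a set of finite measure, [|k|] is bounded by [1 + |k| ^ d], or by its
    essential supremum. *)
Lemma Lnorm_integrable (d : \bar R) (k : T -> R) : (1 <= d)%E -> measurable_fun E k ->
  ('N[mu]_d[EFin \o (k \_ E)] < +oo)%E -> mu.-integrable E (EFin \o k).
Proof.
move=> d1 mk kd.
have mEk : measurable_fun E (EFin \o k) by exact/measurable_EFinP.
have mkE : measurable_fun setT (k \_ E) by apply/(measurable_restrictT _ mE).
have kE x : E x -> (k \_ E) x = k x by move=> xE; rewrite patchE mem_set.
have mEa : measurable_fun E (fun x => `|(EFin \o k) x|%E) by exact: measurableT_comp.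
apply/integrableP; split => //.
case: d d1 kd => [p||] //.
- rewrite lee_fin => p1 kp; have p0 : p != 0 by rewrite gt_eqF // (lt_le_trans _ p1).
  have {}kp := poweR_lty p kp; rewrite poweR_Lnorm // in kp.
  have m1 : measurable_fun setT (fun x => (`|(EFin \o (k \_ E)) x| `^ p)%E).
    apply: (measurableT_comp (measurable_poweR p)); apply: measurableT_comp => //.
    exact/measurable_EFinP.
  have m1E := measurable_funS measurableT (@subsetT _ E) m1.
  apply: (@le_lt_trans _ _ (\int[mu]_(x in E) (1%:E + `|(EFin \o (k \_ E)) x| `^ p))%E).
    apply: ge0_le_integral => //.
    + by apply: emeasurable_funD => //; exact: measurable_cst.
    + move=> x xE; rewrite /= kE // lee_fin.
      have [k1|k1] := leP `|k x| 1; first by rewrite (le_trans k1) // lerDl powR_ge0.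
      apply: (@le_trans _ _ (`|k x| `^ p)); last by rewrite lerDr ler01.
      by rewrite -{1}[`|k x|]powRr1 ?normr_ge0 //; apply: ler_powR => //; exact: ltW.
  rewrite ge0_integralD //; last by move=> x _; rewrite poweR_ge0.
  rewrite lte_add_pinfty ?fin_set_integral_cst_lt ?ltry //.
  apply: le_lt_trans kp; apply: ge0_subset_integral => //.
  by move=> x _; rewrite poweR_ge0.
- move=> _; rewrite unlock /=.
  have [muT|] := ltP 0%E (mu setT); last first.
    move=> muT; have E0 : mu E = 0%E.
      apply/eqP; rewrite eq_le measure_ge0 andbT (le_trans _ muT) //.
      by apply: le_measure; rewrite ?inE.
    by rewrite (null_set_integral _ mEa E0).
  move=> /ereal_inf_lt[y yk yoo].
  apply: (@le_lt_trans _ _ (\int[mu]_(x in E) (maxe y 0))%E).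
    apply: ae_ge0_le_integral => //.
    + by move=> x _; rewrite le_max lexx orbT.
    + apply: filterS yk => x /= yx xE; rewrite kE // in yx.
      by rewrite (le_trans yx) // le_max lexx.
  by rewrite fin_set_integral_cst_lt // ?le_max ?lexx ?orbT // gt_max yoo ltry.
Qed.

(** Dominated convergence applied to the truncations; this is the uniform
    integrability behind [integrable_control]. *)
Lemma integrable_tail_gen (u : T -> R) (e : R) :
  mu.-integrable E (EFin \o u) -> (forall x, E x -> 0 <= u x) -> 0 < e ->
  exists n : nat, (\int[mu]_(x in E) (Num.max (u x - n%:R) 0)%:E <= e%:E)%E.
Proof.
move=> iu u0 e0.
have mu_ : measurable_fun E u by apply/measurable_EFinP; exact: (measurable_int _ iu).
pose g n := (\int[mu]_(x in E) (Num.max (u x - n%:R) 0)%:E)%E.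
have H : g n @[n --> \oo] --> (0 : \bar R)%E.
  rewrite -[X in _ --> X](@integral0 _ _ _ mu E).
  apply: (@dominated_cvg _ _ _ mu _ mE (fun n x => (Num.max (u x - n%:R) 0)%:E) _ (EFin \o u)) => //.
  - by move=> n; apply/measurable_EFinP; apply: measurable_maxr => //; apply: measurable_funB.
  - move=> x _; apply: (@cvg_near_cst _ _ _ (fun n => (Num.max (u x - n%:R) 0)%:E)).
    near=> n; congr EFin; apply/max_idPr; rewrite subr_le0.
    by near: n; exact: nbhs_infty_ger.
  - move=> n x xE; rewrite lee_fin ger0_norm ?le_max ?lexx ?orbT //.
    by rewrite ge_max u0 // lerBlDr lerDl andbT.
have /H [N _ HN] : nbhs (0 : \bar R)%E [set y | (y < e%:E)%E].
  by apply: open_nbhs_nbhs; split; [exact: open_ereal_lt_ereal|rewrite /= lte_fin].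
by exists N; apply: ltW; apply: (HN N) => /=.
Unshelve. all: by end_near.
Qed.

Lemma Lnorm_scale (d : \bar R) (k : T -> R) (C : R) : (1 <= d)%E -> 0 <= C -> measurable_fun E k ->
  ('N[mu]_d[EFin \o (k \_ E)] < +oo)%E -> ('N[mu]_d[EFin \o ((fun x => (C * k x)%R) \_ E)] < +oo)%E.
Proof.
move=> d1 C0 mk kd.
have mkE : measurable_fun setT (k \_ E) by apply/(measurable_restrictT _ mE).
have kin : (k \_ E) \in Lfun mu d by apply/andP; rewrite !inE.
have := LnormZ (Lfun_Sub d1 kin) C.
rewrite (_ : EFin \o (C \*: _) = EFin \o ((fun x => C * k x) \_ E)); last first.
  by apply/funext => x; rewrite /= !patchE; case: ifP => // _; rewrite scaler0.
by move=> ->; rewrite lte_mul_pinfty.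
Qed.

End FiniteMeasureSet.

Section Controls.
Variable R : realType.
Notation mu := (@completed_lebesgue_measure R).
Notation LR := (lebesgueR R).

Lemma in_Ld_integrable (d : \bar R) (S T : R) (k : R -> R) : (1 <= d)%E -> S <= T ->
  in_Ld d `[S, T] k -> mu.-integrable `[S, T] (EFin \o (k : LR -> R)).
Proof.
move=> d1 ST [mk kd].
apply: (Lnorm_integrable (lmeas_itv `[S, T]) _ d1 mk kd).
by rewrite /= mu_itv // ltry.
Qed.

Lemma in_Ld_scale (d : \bar R) (S T C : R) (k : R -> R) : (1 <= d)%E -> 0 <= C ->
  in_Ld d `[S, T] k -> in_Ld d `[S, T] (fun x => C * k x).
Proof.
move=> d1 C0 [mk kd]; split; last exact: (Lnorm_scale (lmeas_itv `[S, T]) d1 C0 mk kd).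
by apply: (measurable_funM (f := cst C) _ mk); exact: measurable_cst.
Qed.

Lemma mu_set1 (a : R) : mu ([set a] : set LR) = 0%E.
Proof. by rewrite -set_itv1 mu_itv // subrr. Qed.

Lemma lint_openl (b c : R) (u : LR -> R) : b <= c -> mu.-integrable `[b, c] (EFin \o u) ->
  (\int[mu]_(x in `]b, c]) (u x)%:E = \int[mu]_(x in `[b, c]) (u x)%:E)%E.
Proof.
move=> bc iu.
have m1 : measurable ([set b] : set LR) by rewrite -set_itv1; exact: lmeas_itv.
have mb := measurable_int _ iu.
have E : (`[b, c]%classic : set LR) = [set b] `|` `]b, c]%classic by rewrite setU1itv // bnd_simp.
have m2 : measurable (`]b, c]%classic : set LR) := lmeas_itv _.
have dj : [disjoint [set b] & `]b, c]%classic].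
  by apply/disj_setPS => x [/= ->]; rewrite in_itv /= ltxx.
have mE : measurable_fun ([set b] `|` `]b, c]%classic : set LR) (EFin \o u) by rewrite -E.
have m1f : measurable_fun ([set b] : set LR) (EFin \o u).
  by apply: measurable_funS mE; [exact: measurableU|exact: subsetUl].
rewrite E (integral_setU mu m1 m2 mE dj).
by rewrite (null_set_integral m1 m1f (mu_set1 b)) add0e.
Qed.

Lemma lint_sub (a b s t : R) (u : LR -> R) : a <= s -> t <= b ->
  mu.-integrable `[a, b] (EFin \o u) -> mu.-integrable `[s, t] (EFin \o u).
Proof.
move=> as_ tb; apply: integrableS; [exact: lmeas_itv|exact: lmeas_itv|].
by move=> x /=; rewrite !in_itv /= => /andP[sx xt]; rewrite (le_trans as_) // (le_trans xt).
Qed.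

Lemma lint_split (a b c : R) (u : LR -> R) : a <= b -> b <= c ->
  mu.-integrable `[a, c] (EFin \o u) ->
  (\int[mu]_(x in `[a, c]) (u x)%:E =
   \int[mu]_(x in `[a, b]) (u x)%:E + \int[mu]_(x in `[b, c]) (u x)%:E)%E.
Proof.
move=> ab bc iu; rewrite -(lint_openl bc (lint_sub ab (lexx c) iu)).
have m1 : measurable (`[a, b]%classic : set LR) := lmeas_itv _.
have m2 : measurable (`]b, c]%classic : set LR) := lmeas_itv _.
have E : (`[a, c]%classic : set LR) = `[a, b]%classic `|` `]b, c]%classic.
  by rewrite -itv_bndbnd_setU ?bnd_simp.
have dj : [disjoint `[a, b]%classic & `]b, c]%classic].
  apply/disj_setPS => x [/=]; rewrite !in_itv /= => /andP[_ xb] /andP[bx _].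
  by have := le_lt_trans xb bx; rewrite ltxx.
have mf : measurable_fun (`[a, b]%classic `|` `]b, c]%classic : set LR) (EFin \o u).
  by rewrite -E; exact: (measurable_int _ iu).
by rewrite E (integral_setU mu m1 m2 mf dj).
Qed.

Definition clamp (a b x : R) : R := Num.min b (Num.max a x).

Lemma clampP a b x : [\/ clamp a b x = a /\ x <= a <= b, clamp a b x = x /\ a <= x <= b | clamp a b x = b /\ (b <= x \/ b <= a)].
Proof.
rewrite /clamp; case: (leP a x) => h; [case: (leP b x)|case: (leP b a)] => h'.
- by constructor 3; split => //; left.
- by constructor 2; split => //; rewrite /= ltW.
- by constructor 3; split => //; right.
- by constructor 1; split => //; rewrite !ltW.
Qed.
Lemma clamp_id a b x : a <= x <= b -> clamp a b x = x.
Proof. by move=> /andP[ax xb]; rewrite /clamp max_r // min_r. Qed.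

Lemma clamp_itv a b x : a <= b -> a <= clamp a b x <= b.
Proof. by case: (clampP a b x) => [[-> ]|[->]|[->]]; lra. Qed.
Lemma clamp_homo a b x y : x <= y -> clamp a b x <= clamp a b y.
Proof. by case: (clampP a b x) => [[-> ]|[->]|[->]]; case: (clampP a b y) => [[-> ]|[->]|[->]]; lra. Qed.
Lemma clamp_lip a b s t : s <= t -> clamp a b t - clamp a b s <= t - s.
Proof.  by case: (clampP a b s) => [[-> ]|[->]|[->]]; case: (clampP a b t) => [[-> ]|[->]|[->]]; lra. Qed.

Lemma clamp_cont a b : continuous (clamp a b).
Proof.
move=> x; apply: continuous_min; first exact: cvg_cst.
by apply: continuous_max; [exact: cvg_cst|exact: cvg_id].
Qed.

(** A monotone function that is Lipschitz up to any error cannot jump. *)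
Lemma nearly_lip_cont (P : R -> R) : {homo P : x y / x <= y} ->
  (forall e, 0 < e -> exists2 M, 0 <= M & forall s t, s <= t -> P t - P s <= M * (t - s) + e) ->
  continuous P.
Proof.
move=> hP H x; apply/cvgrPdist_le => e e0.
have e20 : 0 < e / 2 by rewrite divr_gt0.
have [M M0 HM] := H (e / 2) e20.
have d0 : 0 < e / 2 / (M + 1) by rewrite divr_gt0 // ltr_wpDl.
near=> y.
have xy : `|x - y| <= e / 2 / (M + 1) by near: y; apply: cvgr_dist_le => //; exact: cvg_id.
have Mx : M * `|x - y| <= e / 2.
  move: xy; rewrite ler_pdivlMr ?ltr_wpDl // mulrC; apply: le_trans.
  by rewrite ler_wpM2r // lerDl.
have [yx|/ltW yx] := leP y x.
  have h1 := hP y x yx; have h2 := HM y x yx.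
  rewrite (ger0_norm (_ : 0 <= P x - P y)) ?subr_ge0 //.
  by rewrite ger0_norm ?subr_ge0 // in Mx; move: Mx h1 h2; clear; lra.
have h1 := hP x y yx; have h2 := HM x y yx.
rewrite distrC (ger0_norm (_ : 0 <= P y - P x)) ?subr_ge0 //.
by rewrite distrC ger0_norm ?subr_ge0 // in Mx; move: Mx h1 h2; clear; lra.
Unshelve. all: by end_near.
Qed.

(** The primitive is extended constantly outside the interval, which is what
    composing with [clamp] expresses, so that it is monotone on the whole
    line. *)
Lemma primitive_of (a b : R) (u : LR -> R) : a <= b -> mu.-integrable `[a, b] (EFin \o u) ->
  (forall x, a <= x <= b -> 0 <= u x) ->
  exists P : R -> R, [/\ {homo P : x y / x <= y}, (forall x, P x = P (clamp a b x)) &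
    forall s t, a <= s -> s <= t -> t <= b ->
      (\int[mu]_(x in `[s, t]) (u x)%:E = (P t - P s)%:E)%E].
Proof.
move=> ab iu u0.
pose P x := fine (\int[mu]_(y in `[a, clamp a b x]) (u y)%:E)%E.
have fin s t : a <= s -> t <= b -> (\int[mu]_(y in `[s, t]) (u y)%:E)%E \is a fin_num.
  by move=> as_ tb; apply: (integrable_fin_num _ (lint_sub as_ tb iu)); exact: lmeas_itv.
have cc x : clamp a b (clamp a b x) = clamp a b x by apply: clamp_id; exact: clamp_itv.
have form s t : a <= s -> s <= t -> t <= b -> (\int[mu]_(x in `[s, t]) (u x)%:E = (P t - P s)%:E)%E.
  move=> as_ st tb; have at_ := le_trans as_ st; have sb := le_trans st tb.
  rewrite /P !clamp_id ?as_ ?at_ ?sb ?tb //.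
  rewrite EFinB !fineK ?fin // (lint_split as_ st (lint_sub (lexx a) tb iu)).
  by rewrite addeAC subee ?fin // add0e.
exists P; split => //; last by move=> x; rewrite /P cc.
move=> x y xy; have := clamp_homo a b xy.
have /andP[ax xb] := clamp_itv x ab; have /andP[ay yb] := clamp_itv y ab => cxy.
rewrite -subr_ge0 -lee_fin.
rewrite -[P y]/(fine _) -(cc y) -[P x]/(fine _) -(cc x).
rewrite -[_ - _]/(P (clamp a b y) - P (clamp a b x)) -form //.
apply: integral_ge0 => z /=; rewrite in_itv /= => /andP[xz zy]; rewrite lee_fin u0 //.
by rewrite (le_trans ax xz) (le_trans zy yb).
Qed.

(** A control: a continuous increment bound which, up to an arbitrarily small
    total variation, is Lipschitz.  Primitives of integrable functions are the
    examples, and this is all that absolute continuity is needed for. *)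
Definition control (a b : R) (K : R -> R) :=
  [/\ {homo K : x y / x <= y}, continuous K &
  forall e : R, 0 < e -> exists (M : R) (ro : R -> R), [/\ 0 <= M, {homo ro : x y / x <= y}, continuous ro,
    ro b - ro a <= e & forall s t : R, a <= s -> s <= t -> t <= b ->
      K t - K s <= M * (t - s) + (ro t - ro s)]].

(** Cutting the integrand at height [n] splits the primitive into a Lipschitz
    part and the primitive of a tail, whose total variation is small by
    [integrable_tail_gen]. Applied to the tail itself this also gives the
    continuity of the latter. *)
Lemma integrable_control (a b : R) (u : LR -> R) : a <= b ->
  mu.-integrable `[a, b] (EFin \o u) -> (forall x, a <= x <= b -> 0 <= u x) ->
  exists2 K, control a b K & forall s t, a <= s -> s <= t -> t <= b ->
      (\int[mu]_(x in `[s, t]) (u x)%:E = (K t - K s)%:E)%E.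
Proof.
move=> ab iu u0.
have mE : measurable (`[a, b]%classic : set LR) := lmeas_itv _.
have muE : (mu (`[a, b]%classic : set LR) < +oo)%E by rewrite mu_itv // ltry.
pose tail (v : LR -> R) (M : R) : LR -> R := fun x => Num.max (v x - M) 0.
have tail_int v M : 0 <= M -> mu.-integrable `[a, b] (EFin \o v) ->
    (forall x, a <= x <= b -> 0 <= v x) -> mu.-integrable `[a, b] (EFin \o tail v M).
  move=> M0 iv v0; apply: (le_integrable mE _ _ iv).
    apply/measurable_EFinP; apply: measurable_maxr; last exact: measurable_cst.
    apply: measurable_funB; last exact: measurable_cst.
    by apply/measurable_EFinP; exact: (measurable_int _ iv).
  move=> x /=; rewrite in_itv /= => xab; rewrite lee_fin.
  rewrite (ger0_norm (v0 x xab)) ger0_norm ?le_max ?lexx ?orbT //.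
  by rewrite ge_max v0 // lerBlDr lerDl M0.
have tail_ge0 v M x : 0 <= tail v M x by rewrite /tail le_max lexx orbT.
have step (v : LR -> R) (P Q : R -> R) (M : R) : 0 <= M -> mu.-integrable `[a, b] (EFin \o v) ->
    (forall x, a <= x <= b -> 0 <= v x) ->
    (forall s t, a <= s -> s <= t -> t <= b ->
      (\int[mu]_(x in `[s, t]) (v x)%:E = (P t - P s)%:E)%E) ->
    (forall s t, a <= s -> s <= t -> t <= b ->
      (\int[mu]_(x in `[s, t]) (tail v M x)%:E = (Q t - Q s)%:E)%E) ->
    forall s t, a <= s -> s <= t -> t <= b -> P t - P s <= M * (t - s) + (Q t - Q s).
  move=> M0 iv v0 HP HQ s t as_ st tb.
  have mst : measurable (`[s, t]%classic : set LR) := lmeas_itv _.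
  have i1 := lint_sub as_ tb iv; have i2 := lint_sub as_ tb (tail_int v M M0 iv v0).
  rewrite -lee_fin [X in (_ <= X)%E]EFinD -(HP s t as_ st tb) -(HQ s t as_ st tb).
  have -> : (M * (t - s))%:E = (\int[mu]_(x in `[s, t]) M%:E)%E.
    by rewrite (integral_cst mu mst) /= mu_itv.
  rewrite -(integralD mst (lint_cst_integrable M st) i2).
  apply: (le_integral mst i1 (integrableD mst (lint_cst_integrable M st) i2)).
  move=> x _; rewrite /= -EFinD lee_fin /tail -lerBlDl le_max lexx //.
have key v : mu.-integrable `[a, b] (EFin \o v) -> (forall x, a <= x <= b -> 0 <= v x) ->
  exists P : R -> R, [/\ {homo P : x y / x <= y}, continuous P & forall s t, a <= s -> s <= t -> t <= b ->
      (\int[mu]_(x in `[s, t]) (v x)%:E = (P t - P s)%:E)%E].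
  move=> iv v0; have [P [hP cP HP]] := primitive_of ab iv v0.
  exists P; split => //; apply: nearly_lip_cont => // e e0.
  have [n Hn] := integrable_tail_gen mE iv v0 e0.
  have n0 : 0 <= n%:R :> R := ler0n _ _.
  have [Q [hQ cQ HQ]] := primitive_of ab (tail_int v _ n0 iv v0) (fun x _ => tail_ge0 v _ x).
  exists n%:R => // s t st; rewrite (cP s) (cP t).
  have /andP[as_ sb] := clamp_itv s ab; have /andP[at_ tb] := clamp_itv t ab.
  apply: le_trans (step v P Q _ n0 iv v0 HP HQ _ _ as_ (clamp_homo a b st) tb) _.
  apply: lerD; first by apply: ler_wpM2l => //; exact: clamp_lip.
  rewrite (HQ a b (lexx a) ab (lexx b)) lee_fin in Hn; apply: le_trans Hn.
  by apply: lerB; apply: hQ.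
have [P [hP cP HP]] := key u iu u0.
exists P => //; split => // e e0.
have [n Hn] := integrable_tail_gen mE iu u0 e0.
have n0 : 0 <= n%:R :> R := ler0n _ _.
have [Q [hQ cQ HQ]] := key _ (tail_int u _ n0 iu u0) (fun x _ => tail_ge0 u _ x).
exists n%:R, Q; split => //; last exact: (step u P Q _ n0 iu u0 HP HQ).
by rewrite -lee_fin -(HQ a b).
Qed.

Lemma control_scale (a b C : R) (K : R -> R) : 0 <= C -> control a b K -> control a b (fun x => C * K x).
Proof.
move=> C0 [hK cK H]; split.
- by move=> x y xy; rewrite ler_wpM2l // hK.
- by move=> x; apply: cvgM; [exact: cvg_cst|exact: cK].
- move=> e e0; have C1 : 0 < C + 1 by rewrite ltr_wpDl.
  have [|M [ro [M0 hro cro rab Kro]]] := H (e / (C + 1)); first by rewrite divr_gt0.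
  exists (C * M), (fun x => C * ro x); split.
  + exact: mulr_ge0.
  + by move=> x y xy; rewrite ler_wpM2l // hro.
  + by move=> x; apply: cvgM; [exact: cvg_cst|exact: cro].
  + rewrite -mulrBr; apply: le_trans (ler_wpM2l C0 rab) _.
    by rewrite mulrCA ler_piMr ?(ltW e0) // ler_pdivrMr // mul1r lerDl.
  + by move=> s t as_ st tb; rewrite -!mulrBr -mulrA -mulrDr ler_wpM2l // Kro.
Qed.

End Controls.

(** * Convergence of integrals at indices of bounded weight *)

Section Excess.
Variable R : realType.
Implicit Types x M : R.

Lemma clamp_dist (a b s t : R) : `|clamp a b s - clamp a b t| <= `|s - t|.
Proof.
wlog st : s t / s <= t => [H|].
  by have [/H//|/ltW/H] := leP s t; rewrite distrC (distrC t).
rewrite distrC (distrC s) !ger0_norm ?subr_ge0 //; first exact: clamp_lip.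
exact: clamp_homo.
Qed.

(** The part of [x] cut off by truncation at height [M]. *)
Definition excess (M x : R) : R := Num.max (`|x| - M) 0.

Lemma excess_ge0 M x : 0 <= excess M x. Proof. by rewrite /excess le_max lexx orbT. Qed.

Lemma excess_clamp M x : 0 <= M -> `|x - clamp (- M) M x| = excess M x.
Proof.
rewrite /excess => M0; case: (clampP (- M) M x) => [[-> H]|[-> H]|[-> H]].
- have x0 : x <= 0 by move: M0 H; clear; lra.
  have x1 : x - - M <= 0 by move: H; clear; lra.
  by rewrite (ler0_norm x0) (ler0_norm x1) max_l; move: x1; clear; lra.
- by rewrite subrr normr0 max_r // subr_le0 ler_norml.
- have [M00|Mx] : M = 0 \/ M <= x by move: M0 H; clear; lra.
    by rewrite M00 !subr0 max_l.
  have x0 : 0 <= x := le_trans M0 Mx.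
  have x1 : 0 <= x - M by rewrite subr_ge0.
  by rewrite (ger0_norm x0) (ger0_norm x1) max_l.
Qed.

Lemma clamp_norm M x : 0 <= M -> `|clamp (- M) M x| <= M.
Proof. by move=> M0; rewrite ler_norml clamp_itv // (@le_trans _ _ 0) // oppr_le0. Qed.

Lemma excess_cont M : continuous (excess M).
Proof.
move=> x; have H : {for x, continuous (fun x : R => `|x| - M)}.
  by apply: cvgB; [exact: norm_continuous|exact: cvg_cst].
exact: (continuous_max H (cvg_cst 0)).
Qed.

End Excess.

Section Penalty.
Variable R : realType.
Implicit Types u ka : nat -> R.

Lemma einf_ge u (c : R) N : (forall j, (N <= j)%N -> c <= u j) ->
  (c%:E <= limn_einf (fun j => (u j)%:E))%E.
Proof.
move=> H; apply: (@le_trans _ _ (einfs (fun j => (u j)%:E) N)).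
  by apply: le_ereal_inf_tmp => _ [j /= Nj <-]; rewrite lee_fin H.
rewrite limn_einf_lim (cvg_lim _ (@cvg_einfs_sup _ _)) //.
by apply: ereal_sup_ubound; exists N.
Qed.

Lemma einf_le_often u (c : R) : (forall N, exists2 j, (N <= j)%N & u j <= c) ->
  (limn_einf (fun j => (u j)%:E) <= c%:E)%E.
Proof.
move=> H; rewrite limn_einf_lim; apply: lime_le; first exact: is_cvg_einfs.
apply: nearW => N; have [j Nj uc] := H N; apply: (@le_trans _ _ (u j)%:E); last by rewrite lee_fin.
by apply: ereal_inf_lbound; exists j.
Qed.

(** Adding a small multiple of the weight makes the lower limit insensitive to
    the indices at which the weight is large. *)
Lemma penalized_einf u ka (l B e : R) : (forall j, 0 <= u j) -> (forall j, 0 <= ka j) ->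
  0 < e -> (forall e' B', 0 < e' -> exists N, forall j, (N <= j)%N -> ka j <= B' -> `|u j - l| <= e') ->
  (forall N, exists2 j, (N <= j)%N & ka j <= B) ->
  (l%:E <= limn_einf (fun j => (u j + e * ka j)%:E) <= (l + e * B)%:E)%E.
Proof.
move=> u0 k0 e0 H often; apply/andP; split; apply/lee_addgt0Pr => e' e'0.
  have [N HN] := H e' (`|l| / e) e'0.
  rewrite -leeBlDr // -EFinB; apply: (@einf_ge _ _ N) => j Nj.
  have ek : 0 <= e * ka j by rewrite mulr_ge0 // ltW.
  have [kj|kj] := leP (ka j) (`|l| / e).
    by have := HN j Nj kj; rewrite ler_norml => /andP[h _]; move: h ek; clear; lra.
  move: kj; rewrite ltr_pdivrMr // mulrC => kj; have := u0 j; have := ler_norm l.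
  by move: kj e'0; clear; lra.
have [N0 HN] := H e' B e'0.
rewrite -EFinD; apply: einf_le_often => N; have [j Nj kj] := often (maxn N N0).
exists j; first by apply: leq_trans Nj; exact: leq_maxl.
have := HN j (leq_trans (leq_maxr _ _) Nj) kj; rewrite ler_norml => /andP[_ h].
have h2 : e * ka j <= e * B by rewrite ler_pM2l.
by move: h h2; clear; lra.
Qed.

End Penalty.

Section Vitali.
Context d0 (T : measurableType d0) (R : realType).
Variables (mu : {measure set T -> \bar R}) (E : set T).
Hypotheses (mE : measurable E) (muE : (mu E < +oo)%E) (muc : measure_is_complete mu).
Implicit Types (q : nat -> T -> R) (n u : T -> R).

Lemma EFin_cvg (u : nat -> R) (l : R) : u @ \oo --> l -> (fun j => (u j)%:E) @ \oo --> l%:E.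
Proof. by move=> H; apply: cvg_EFin; [exact: nearW|exact: H]. Qed.

Lemma bounded_int u M : measurable_fun E u -> (forall x, `|u x| <= M) -> mu.-integrable E (EFin \o u).
Proof.
move=> mu_ uM; apply/integrableP; split; first exact/measurable_EFinP.
have M0 : 0 <= M by exact: le_trans (normr_ge0 _) (uM point).
apply: le_lt_trans (fin_set_integral_cst_lt mE muE (_ : 0 <= M%:E)%E (ltry M)); last by rewrite lee_fin.
apply: ge0_le_integral => //; first by apply: measurableT_comp => //; exact/measurable_EFinP.
by move=> x _; rewrite lee_fin.
Qed.

Lemma cont_mf (g : R -> R) u : continuous g -> measurable_fun E u ->
  measurable_fun E (g \o u).
Proof. by move=> cg mu_; exact: (measurableT_comp (continuous_measurable_fun cg) mu_). Qed.

(** Convergence of the integrals under uniform integrability. The functions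
    [q j] are only assumed to converge while the weights [ka j] stay bounded,
    which, the weights being bounded in mean, is a form of convergence in
    measure. *)
Section Weighted.
Variables (q ka : nat -> T -> R) (n : T -> R) (A : R).
Hypothesis mq : forall j, measurable_fun E (q j).
Hypothesis mk : forall j, measurable_fun E (ka j).
Hypothesis q0 : forall j x, 0 <= q j x.
Hypothesis k0 : forall j x, 0 <= ka j x.
Hypothesis kA : forall j, (\int[mu]_(x in E) (ka j x)%:E <= A%:E)%E.
Hypothesis qn : {ae mu, forall x, E x -> forall e B : R, 0 < e ->
  exists N, forall j, (N <= j)%N -> ka j x <= B -> `|q j x - n x| <= e}.
Hypothesis ko : {ae mu, forall x, E x -> exists B : R, forall N, exists2 j, (N <= j)%N & ka j x <= B}.

Let pen (m j : nat) (x : T) : R := q j x + m.+1%:R^-1 * ka j x.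

Let mpen m j : measurable_fun E (pen m j).
Proof. by apply: measurable_funD => //; apply: measurable_funM => //; exact: measurable_cst. Qed.

Lemma einf_measurable (u : nat -> T -> R) : (forall j, measurable_fun E (u j)) ->
  measurable_fun E (fun x => limn_einf (fun j => (u j x)%:E)).
Proof.
move=> mu_.
have H := @measurable_fun_limn_esup _ T R E (fun j x => (- (u j x)%:E)%E)
  (fun j => measurableT_comp (@oppe_measurable R setT) ((measurable_EFinP _ _).2 (mu_ j))).
exact: (measurableT_comp (@oppe_measurable R setT) H).
Qed.

(** The limit is recovered from lower limits of the penalized functions, the
    penalty tending to 0; it equals a measurable function almost everywhere,
    so the completeness of the measure is needed. *)
Lemma weighted_limit_measurable : measurable_fun E n.
Proof.
apply/measurable_EFinP.
apply: (ae_measurable_fun muc (f := fun x => limn_esup (fun m => limn_einf (fun j => (pen m j x)%:E)))).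
  apply: filterS2 qn ko => x qx kx Ex; have {}qx := qx Ex; have [B HB] := kx Ex.
  have s0 m : 0 < m.+1%:R^-1 :> R by rewrite invr_gt0 ltr0Sn.
  have P m := penalized_einf (fun j => q0 j x) (fun j => k0 j x) (s0 m) qx HB.
  have cB : (fun m => (n x + m.+1%:R^-1 * B)%:E) @ \oo --> (n x)%:E.
    apply: EFin_cvg; rewrite -[X in _ --> X]addr0; apply: cvgD; first exact: cvg_cst.
    by rewrite -(mul0r B); apply: cvgM; [exact: cvg_harmonic|exact: cvg_cst].
  have : (fun m => limn_einf (fun j => (pen m j x)%:E)) @ \oo --> (n x)%:E.
    apply: (squeeze_cvge _ (cvg_cst _) cB); apply: nearW => m; exact: P.
  by move=> /cvg_limn_einf_sup [_ ->].
by apply: measurable_fun_limn_esup => m; exact: einf_measurable.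
Qed.

(** Fatou's lemma for the penalized functions: the penalty costs an
    arbitrarily small amount of integral, the weights being bounded in
    mean. *)
Lemma weighted_fatou (C : R) (g : R -> R) : continuous g -> (forall x, 0 <= g x) ->
  (forall j, \int[mu]_(x in E) (g (q j x))%:E <= C%:E)%E ->
  (\int[mu]_(x in E) (g (n x))%:E <= C%:E)%E.
Proof.
move=> cg g0 gC; have mn := weighted_limit_measurable.
have mg u : measurable_fun E u -> measurable_fun E (fun x => g (u x)).
  by move=> mu_; exact: (cont_mf cg mu_).
apply/lee_addgt0Pr => e e0; pose s := e / (A + 1).
have A0 : 0 <= A.
  by rewrite -lee_fin; apply: le_trans (kA 0); apply: integral_ge0 => x _; rewrite lee_fin.
have s0 : 0 < s by rewrite divr_gt0 // ltr_wpDl.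
have mp j : measurable_fun E (fun x => g (q j x) + s * ka j x).
  by apply: measurable_funD; [exact: mg|apply: measurable_funM => //; exact: measurable_cst].
have ml := einf_measurable mp.
apply: (@le_trans _ _ (\int[mu]_(x in E) limn_einf (fun j => (g (q j x) + s * ka j x)%:E))%E).
  apply: ae_ge0_le_integral => //.
  - by move=> x _; rewrite lee_fin.
  - by apply/measurable_EFinP; exact: mg.
  - move=> x _; apply: (@einf_ge _ _ 0 0) => j _.
    by rewrite addr_ge0 // mulr_ge0 // ltW.
  - apply: filterS2 qn ko => x qx kx Ex; have {}qx := qx Ex; have [B HB] := kx Ex.
    have [] // := andP (penalized_einf (fun j => g0 (q j x)) (fun j => k0 j x) s0 _ HB (l := g (n x))).
    move=> e' B' e'0.
    have H := (@cvgrPdist_le R R^o _ _ _ _ _).1 (cg (n x)) _ e'0.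
    have [d' /= d'0 Hd] := (@nbhs_ballP R R^o (n x) _).1 (H _).
    have d2 : 0 < d' / 2 by rewrite divr_gt0.
    have [N HN] := qx (d' / 2) B' d2; exists N => j Nj kj.
    rewrite distrC; apply: Hd; rewrite /ball /= distrC (le_lt_trans (HN j Nj kj)) //.
    by rewrite ltr_pdivrMr // ltr_pMr // ltr1n.
apply: le_trans (fatou mu mE (fun j => (measurable_EFinP _ _).2 (mp j)) _) _.
  by move=> j x _; rewrite lee_fin addr_ge0 // mulr_ge0 // ltW.
apply: einf_le => j.
have -> : (\int[mu]_(x in E) (EFin \o (fun x => (g (q j x) + s * ka j x)%R)) x =
    \int[mu]_(x in E) ((g (q j x))%:E + s%:E * (ka j x)%:E))%E.
  by apply: eq_integral => x _; rewrite /= EFinD EFinM.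
have mk1 : measurable_fun E (fun x => s%:E * (ka j x)%:E)%E.
  by apply/measurable_EFinP; apply: measurable_funM => //; exact: measurable_cst.
rewrite ge0_integralD //; first last.
- by move=> x _; rewrite -EFinM lee_fin mulr_ge0 // ltW.
- by apply/measurable_EFinP; exact: mg.
- by move=> x _; rewrite lee_fin.
apply: leeD; first exact: gC.
rewrite ge0_integralZl //; first last.
- by rewrite lee_fin ltW.
- by move=> x _; rewrite lee_fin.
- exact/measurable_EFinP.
apply: (@le_trans _ _ (s%:E * A%:E)%E); first by apply: lee_wpmul2l; [rewrite lee_fin ltW|exact: kA].
by rewrite -EFinM lee_fin /s mulrAC ler_pdivrMr ?ltr_wpDl // ler_pM2l // lerDl.
Qed.

(** The integral of [|n - q j|] is split according to size and weight.
    Truncated at height [M] and where the weight is at most [B], the functions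
    converge dominatedly. Where the weight exceeds [B], which happens on a
    small set by Markov's inequality, the truncated functions are bounded. The
    excesses over [M] are small uniformly, and so is that of the limit by
    [weighted_fatou]. *)
Lemma vitali (v : nat -> R) (l : R) : (forall j, mu.-integrable E (EFin \o q j)) ->
  (forall j, \int[mu]_(x in E) (q j x)%:E = (v j)%:E)%E -> v @ \oo --> l ->
  (forall e, 0 < e -> exists2 M, 0 <= M & forall j,
      (\int[mu]_(x in E) (excess M (q j x))%:E <= e%:E)%E) ->
  mu.-integrable E (EFin \o n) /\ (\int[mu]_(x in E) (n x)%:E = l%:E)%E.
Proof.
move=> iq qv vl ui; have mn := weighted_limit_measurable.
have A0 : 0 <= A.
  by rewrite -lee_fin; apply: le_trans (kA 0); apply: integral_ge0 => x _; rewrite lee_fin.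
have mcl M (u : T -> R) : measurable_fun E u -> measurable_fun E (fun x => clamp (- M) M (u x)).
  by move=> mu_; apply: (cont_mf _ mu_); exact: clamp_cont.
have mex M (u : T -> R) : measurable_fun E u -> measurable_fun E (fun x => excess M (u x)).
  by move=> mu_; apply: (cont_mf _ mu_); exact: excess_cont.
have nM M e (M0 : 0 <= M) (qM : forall j, (\int[mu]_(x in E) (excess M (q j x))%:E <= e%:E)%E) :
    (\int[mu]_(x in E) (excess M (n x))%:E <= e%:E)%E.
  by apply: weighted_fatou qM; [exact: excess_cont|exact: excess_ge0].
have iex M (u : T -> R) e : measurable_fun E u ->
    (\int[mu]_(x in E) (excess M (u x))%:E <= e%:E)%E -> mu.-integrable E (EFin \o (fun x => excess M (u x))).
  move=> mu_ ue; apply/integrableP; split; first by apply/measurable_EFinP; exact: mex.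
  apply: le_lt_trans (ltry e); apply: le_trans ue; rewrite le_eqVlt; apply/orP; left; apply/eqP.
  by apply: eq_integral => x _ /=; rewrite ger0_norm // excess_ge0.
have icl M (u : T -> R) : 0 <= M -> measurable_fun E u ->
    mu.-integrable E (EFin \o (fun x => clamp (- M) M (u x))).
  by move=> M0 mu_; apply: (bounded_int (mcl M _ mu_)) => x; exact: (clamp_norm _ M0).
have inn : mu.-integrable E (EFin \o n).
  have [M M0 /(nM M 1 M0) H] := ui 1 ltr01.
  have iM : mu.-integrable E (EFin \o (cst M)).
    by apply: (@bounded_int _ `|M|); [exact: measurable_cst|move=> x].
  apply: (le_integrable mE _ _ (integrableD mE iM (iex M n 1 mn H))); first exact/measurable_EFinP.
  move=> x _; rewrite /= lee_fin [X in _ <= X]ger0_norm ?addr_ge0 ?excess_ge0 //.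
  by rewrite /excess -lerBlDl le_max lexx.
split => //.
have fn : (\int[mu]_(x in E) (n x)%:E)%E \is a fin_num := integrable_fin_num mE inn.
rewrite -(fineK fn); congr EFin; set I := fine _.
have key e : 0 < e -> \forall j \near \oo, `|I - v j| <= 4 * e.
  move=> e0; have [M M0 qM] := ui e e0; have nMe := nM M e M0 qM.
  pose c x := clamp (- M) M x.
  have [B [B0 HB]] : exists B : R, 0 < B /\ 2 * M / B * A <= e.
    have X0 : 0 < 2 * M * A + 1 by rewrite ltr_wpDl ?mulr_ge0.
    exists ((2 * M * A + 1) / e); rewrite divr_gt0 //; split => //.
    have -> : 2 * M / ((2 * M * A + 1) / e) * A = e * ((2 * M * A) / (2 * M * A + 1)).
      by field; rewrite !gt_eqF.
    by rewrite ler_piMr ?(ltW e0) // ler_pdivrMr // mul1r lerDl.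
  pose w j x := if ka j x <= B then `|c (q j x) - c (n x)| else 0.
  have mw j : measurable_fun E (w j).
    apply: measurable_fun_if => //.
    - by apply: measurable_fun_ler => //; exact: measurable_cst.
    - apply: (measurable_funS mE (@subIsetl _ _ _)).
      by apply: measurableT_comp => //; apply: measurable_funB; exact: mcl.
  have wM j x : `|w j x| <= 2 * M.
    rewrite /w; case: ifP => _; last by rewrite normr0 mulr_ge0.
    rewrite normr_id (le_trans (ler_normB _ _)) //.
    by have := clamp_norm (q j x) M0; have := clamp_norm (n x) M0; rewrite /c; lra.
  have w0 : {ae mu, forall x, E x -> (fun j => (w j x)%:E) @ \oo --> (0 : \bar R)%E}.
    apply: filterS qn => x qx Ex; apply: EFin_cvg; apply/(@cvgrPdist_le R R^o) => e' e'0.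
    have [N HN] := qx Ex e' B e'0; exists N => // j /= Nj; rewrite sub0r normrN /w.
    case: ifP => kj; last by rewrite normr0 ltW.
    by rewrite normr_id (le_trans (clamp_dist _ _ _ _)) // HN.
  have iM : mu.-integrable E (EFin \o cst (2 * M)).
    by apply: (@bounded_int _ `|2 * M|); [exact: measurable_cst|move=> x].
  have [_ _ H] := dominated_convergence mE (fun j => (measurable_EFinP _ _).2 (mw j))
     (measurable_cst _) w0 iM (aeW _ (fun x j _ => wM j x)).
  rewrite integral0 in H.
  have near0 : \forall j \near \oo, (\int[mu]_(x in E) (w j x)%:E < e%:E)%E.
    have /H : nbhs (0 : \bar R)%E [set y | (y < e%:E)%E].
      by apply: open_nbhs_nbhs; split; [exact: open_ereal_lt_ereal|rewrite /= lte_fin].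
    exact.
  apply: filterS near0 => j He.
  have iw : mu.-integrable E (EFin \o w j) by apply: (bounded_int (mw j)) (wM j).
  have MB : 0 <= 2 * M / B by rewrite divr_ge0 ?mulr_ge0 // ltW.
  have ikE : (\int[mu]_(x in E) (2 * M / B * ka j x)%:E <= e%:E)%E.
    have -> : (\int[mu]_(x in E) (2 * M / B * ka j x)%:E =
        (2 * M / B)%:E * \int[mu]_(x in E) (ka j x)%:E)%E.
      rewrite -ge0_integralZl //; first exact/measurable_EFinP.
      by move=> x _; rewrite lee_fin.
    apply: (@le_trans _ _ ((2 * M / B)%:E * A%:E)%E); first by apply: lee_wpmul2l; [rewrite lee_fin|exact: kA].
    by rewrite -EFinM lee_fin.
  have ik : mu.-integrable E (EFin \o (fun x => 2 * M / B * ka j x)).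
    apply/integrableP; split.
      by apply/measurable_EFinP; apply: measurable_funM => //; exact: measurable_cst.
    apply: le_lt_trans (ltry e); apply: le_trans ikE; rewrite le_eqVlt; apply/orP; left; apply/eqP.
    by apply: eq_integral => x _ /=; rewrite ger0_norm // mulr_ge0.
  have i1 := integrableD mE iw ik.
  have ib : mu.-integrable E (fun x => (EFin \o n) x - (EFin \o q j) x)%E := integrableB mE inn (iq j).
  have i2 := iex M n e mn nMe; have i3 := iex M (q j) e (mq j) (qM j).
  have i12 := integrableD mE i1 i2.
  rewrite -lee_fin.
  have -> : (`|I - v j|)%:E = `|I%:E - (v j)%:E|%E by [].
  rewrite /I fineK // -(qv j) -(integralB mE inn (iq j)).
  apply: le_trans (le_abse_integral mu mE (measurable_int _ ib)) _.
  have ia : mu.-integrable E (fun x => `|(EFin \o n) x - (EFin \o q j) x|)%E := integrable_abse ib.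
  apply: le_trans (le_integral mE ia (integrableD mE i12 i3) _) _.
    move=> x _; rewrite /= lee_fin -(excess_clamp (n x) M0) -(excess_clamp (q j x) M0).
    have -> : n x - q j x = (c (n x) - c (q j x)) + (n x - c (n x)) + - (q j x - c (q j x)) by ring.
    rewrite (le_trans (ler_normD _ _)) // normrN lerD2r (le_trans (ler_normD _ _)) // lerD2r.
    rewrite /w distrC; case: (leP (ka j x) B) => kj.
      by rewrite lerDl mulr_ge0 // divr_ge0 ?mulr_ge0 // ltW.
    rewrite add0r mulrAC ler_pdivlMr // (le_trans (_ : _ <= 2 * M * B)) //; last first.
      by rewrite ler_wpM2l ?mulr_ge0 // ltW.
    rewrite ler_wpM2r ?(ltW B0) // (le_trans (ler_normB _ _)) //.
    by have := clamp_norm (q j x) M0; have := clamp_norm (n x) M0; rewrite /c; lra.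
  rewrite (integralD mE i12 i3) (integralD mE i1 i2) (integralD mE iw ik).
  have -> : (4 * e)%:E = (e%:E + e%:E + e%:E + e%:E)%E by rewrite -!EFinD; congr EFin; ring.
  apply: leeD; last exact: qM.
  by apply: leeD; [apply: leeD; [exact: ltW He|exact: ikE]|exact: nMe].
apply/eqP; rewrite -subr_eq0 -normr_le0; apply/ler_addgt0Pl => e e0; rewrite addr0.
have e4 : 0 < e / 5 by rewrite divr_gt0.
have [j [H1 H2]] : exists j, `|I - v j| <= 4 * (e / 5) /\ `|l - v j| <= e / 5.
  apply: (@filter_ex _ \oo); near=> j; split; near: j; first exact: key.
  exact: ((@cvgrPdist_le R R^o _ _ _ v l).1 vl _ e4).
have -> : I - l = (I - v j) - (l - v j) by ring.
by rewrite (le_trans (ler_normB _ _)) //; move: H1 H2; lra.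
Unshelve. all: by end_near.
Qed.

End Weighted.

End Vitali.

(** * Absolutely continuous functions and their derivatives *)

Section ACFTC.
Variable R : realType.
Notation mu := (@completed_lebesgue_measure R).
Notation LR := (lebesgueR R).

Definition stp (j : nat) : R := j.+1%:R^-1.

Lemma stp_gt0 j : 0 < stp j. Proof. by rewrite invr_gt0 ltr0Sn. Qed.

Lemma stp_cvg0 : stp @ \oo --> (0 : R).
Proof. exact: cvg_harmonic. Qed.

Lemma stp_dnbhs : stp @ \oo --> (0 : R)^'.
Proof.
move=> P; rewrite /dnbhs /within /= => HP.
have H : \forall j \near \oo, stp j != 0 -> P (stp j) by exact: stp_cvg0 HP.
change (\forall j \near \oo, P (stp j)).
by apply: filterS H => j /=; apply; rewrite gt_eqF ?stp_gt0.
Qed.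

Definition dq (y : R -> R) (j : nat) (x : R) : R := (stp j)^-1 * (y (x + stp j) - y x).

Lemma shift_cont (h : R) : continuous (fun x : R => x + h).
Proof. by move=> x; apply: cvgD; [exact: cvg_id|exact: cvg_cst]. Qed.

Lemma dq_cont y j : continuous y -> continuous (dq y j).
Proof.
move=> cy x; apply: cvgM; first exact: cvg_cst.
apply: cvgB; last exact: cy.
have cs : continuous (fun x : R => x + stp j) by exact: shift_cont.
exact: (continuous_comp (cs x) (cy (x + stp j))).
Qed.

Lemma lint_dq_mono (a b : R) (Z : R -> R) j : a <= b -> {homo Z : x y / x <= y} -> continuous Z ->
  (\int[mu]_(x in `[a, b]) (dq Z j x)%:E <= (Z (b + stp j) - Z a)%:E)%E.
Proof.
move=> ab hZ cZ; have [V dV] := primitive_exists a cZ; have h0 := stp_gt0 j.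
rewrite (lint_diffquot ab h0 cZ dV) lee_fin.
have dVb (x : R) : b <= x -> is_derive x (1 : R) V (Z x) by move=> bx; apply: dV; exact: le_trans bx.
have /andP[_ Hb] := primitive_mono h0 hZ dVb cZ.
have /andP[Ha _] := primitive_mono h0 hZ dV cZ.
rewrite ler_pdivrMl // mulrBr.
by apply: lerB.
Qed.

(** The integral of a difference quotient is a difference quotient of a
    primitive at the ends of the interval, where the primitive is
    differentiable. *)
Lemma lint_dq_cvg (a b : R) (Y : R -> R) : a <= b -> continuous Y ->
  exists2 v : nat -> R, v @ \oo --> Y b - Y a &
    forall j, (\int[mu]_(x in `[a, b]) (dq Y j x)%:E = (v j)%:E)%E.
Proof.
move=> ab cY; have [V dV] := primitive_exists a cY.
exists (fun j => (stp j)^-1 * ((V (b + stp j) - V b) - (V (a + stp j) - V a))); last first.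
  by move=> j; rewrite (lint_diffquot ab (stp_gt0 j) cY dV).
have H (x : R) : a <= x -> (fun j => (stp j)^-1 * (V (x + stp j) - V x)) @ \oo --> Y x.
  move=> ax; have [ex Ex] := dV x ax.
  have E := cvg_comp _ _ stp_dnbhs ex.
  apply: cvg_trans; last by rewrite -Ex; exact: E.
  by apply: near_eq_cvg; near=> j; rewrite /= (mulr1 (stp j) : (stp j)%:A = stp j :> R^o) [stp j + x]addrC.
apply: cvg_trans; last exact: (cvgB (H b ab) (H a (lexx a))).
by apply: near_eq_cvg; near=> j; rewrite -mulrBr.
Unshelve. all: by end_near.
Qed.

Lemma comp_clamp_cont (a b : R) (Z : R -> R) : continuous Z -> continuous (Z \o clamp a b).
Proof. by move=> cZ x; apply: continuous_comp; [exact: clamp_cont|exact: cZ]. Qed.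

Lemma ae_neq (a : R) : {ae mu, forall x : LR, x != a}.
Proof.
exists [set a]; split; first by rewrite -set_itv1; exact: lmeas_itv.
  exact: mu_set1.
by move=> x /= /negP; rewrite negbK => /eqP.
Qed.

(** The integrals of the difference quotients of a control stay bounded, so by
    Fatou's lemma almost every point has a bounded subsequence of them. *)
Lemma dq_bounded_often (a b : R) (K : R -> R) : a < b -> control a b K ->
  {ae mu, forall x : LR, a < x < b -> exists B, forall N, exists2 j, (N <= j)%N & dq K j x <= B}.
Proof.
move=> ab [hK cK _]; have ab' := ltW ab; pose Z := K \o clamp a b.
have hZ : {homo Z : x y / x <= y} by move=> x y xy; apply: hK; exact: clamp_homo.
have cZ : continuous Z by exact: comp_clamp_cont.
have mE : measurable (`[a, b]%classic : set LR) := lmeas_itv _.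
have q0 j x : 0 <= dq Z j x.
  by rewrite /dq mulr_ge0 ?invr_ge0 ?(ltW (stp_gt0 j)) // subr_ge0 hZ // lerDl (ltW (stp_gt0 j)).
have mq j : measurable_fun (`[a, b]%classic : set LR) (fun x : LR => (dq Z j x)%:E).
  by apply/measurable_EFinP; apply: lmeas_cont; exact: dq_cont.
pose L (x : LR) := limn_einf (fun j => (dq Z j x)%:E).
have L0 x : (0 <= L x)%E.
  rewrite /L limn_einf_lim; apply: lime_ge; first exact: is_cvg_einfs.
  by apply: nearW => n; apply: le_ereal_inf_tmp => _ [j _ <-]; rewrite lee_fin.
have mL : measurable_fun (`[a, b]%classic : set LR) L.
  have := measurable_fun_limn_esup (fun j => measurableT_comp (@oppe_measurable R setT) (mq j)).
  move=> /(measurableT_comp (@oppe_measurable R setT)); apply: eq_measurable_fun => x _ /=.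
  by [].
have LI : (\int[mu]_(x in `[a, b]) L x <= (K b - K a)%:E)%E.
  apply: le_trans (fatou mu mE mq _) _; first by move=> j x _; rewrite lee_fin.
  apply: einf_le => j; apply: le_trans (lint_dq_mono j ab' hZ cZ) _.
  rewrite lee_fin /Z /= [X in _ - K X]clamp_id ?lexx ?ab' // lerB //.
  by apply: hK; have /andP[] := clamp_itv (b + stp j) ab'.
have iL : mu.-integrable `[a, b] L.
  apply/integrableP; split => //; apply: le_lt_trans (ltry (K b - K a)); apply: le_trans LI.
  rewrite le_eqVlt; apply/orP; left; apply/eqP; apply: eq_integral => x _.
  by rewrite gee0_abs.
have := integrable_ae mE iL; apply: filterS => x /= H /andP[ax xb].
have {}H : L x \is a fin_num by apply: H; rewrite in_itv /= !ltW.
exists (fine (L x) + 1) => N; apply: contrapT => no.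
have far : \forall j \near \oo, x + stp j <= b.
  near=> j; rewrite -lerBrDl; near: j; apply: (@cvgr_le R _ _ _ stp 0 stp_cvg0).
  by rewrite subr_gt0.
have [N' _ HN'] := far.
pose m := maxn N N'.
have : (einfs (fun j => (dq Z j x)%:E) m <= L x)%E.
  rewrite /L limn_einf_lim (cvg_lim _ (@cvg_einfs_sup _ _)) //.
  by apply: ereal_sup_ubound; exists m.
apply/negP; rewrite -ltNge -(fineK H).
apply: (@lt_le_trans _ _ (fine (L x) + 1)%:E); first by rewrite lte_fin ltrDl.
apply: le_ereal_inf_tmp => _ [j /= mj <-]; rewrite lee_fin leNgt; apply/negP => lt1.
apply: no; exists j; first by apply: leq_trans mj; exact: leq_maxl.
have xj : x + stp j <= b by apply: HN'; apply: leq_trans mj; exact: leq_maxr.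
have h1 : a <= x <= b by rewrite !ltW.
have h2 : a <= x + stp j <= b by have := stp_gt0 j; move: xj ax; clear; lra.
by move: lt1; rewrite /dq /Z /= !clamp_id // => /ltW.
Unshelve. all: by end_near.
Qed.

(** [vitali] for the difference quotients of [y], weighted by those of [K].
    Both functions are extended constantly outside [[a, b]], which at an
    interior point affects finitely many quotients only; the control gives the
    uniform integrability, since [K] is Lipschitz up to a small total
    variation. *)
Lemma ac_ftc (a b : R) (K y n : R -> R) : a < b -> control a b K ->
  (forall s t, a <= s -> s <= t -> t <= b -> `|y t - y s| <= K t - K s) ->
  (forall s t, a <= s -> s <= t -> t <= b -> y s <= y t) ->
  {ae mu, forall x : LR, a < x < b -> forall e B : R, 0 < e ->
     exists N, forall j, (N <= j)%N -> dq K j x <= B -> `|dq y j x - n x| <= e} ->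
  mu.-integrable `[a, b] (EFin \o (n : LR -> R)) /\
  (\int[mu]_(x in `[a, b]) (n x)%:E = (y b - y a)%:E)%E.
Proof.
move=> ab cK0 yK ym qn; have ab' := ltW ab; have [hK cK ctl] := cK0.
pose Y := y \o clamp a b.
have YK s t : s <= t -> `|Y t - Y s| <= K (clamp a b t) - K (clamp a b s).
  move=> st; have /andP[as_ _] := clamp_itv s ab'; have /andP[_ tb] := clamp_itv t ab'.
  by apply: yK => //; exact: clamp_homo.
have cKc : continuous (K \o clamp a b) by exact: comp_clamp_cont.
have cY : continuous Y.
  move=> x; apply/(@cvgrPdist_le R R^o) => e e0.
  have H := (@cvgrPdist_le R R^o _ _ _ _ _).1 (cKc x) e e0; near=> t.
  have : `|(K \o clamp a b) x - (K \o clamp a b) t| <= e by near: t; exact: H.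
  apply: le_trans; rewrite /=.
  have [tx|/ltW tx] := leP t x.
    by rewrite (le_trans (YK t x tx)) // ler_norm.
  by rewrite distrC (le_trans (YK x t tx)) // distrC ler_norm.
have Yab : Y b - Y a = y b - y a by rewrite /Y /= !clamp_id // ?lexx ?ab'.
have mE : measurable (`[a, b]%classic : set LR) := lmeas_itv _.
have muE : (mu (`[a, b]%classic : set LR) < +oo)%E by rewrite mu_itv // ltry.
have [v vl qv] := lint_dq_cvg ab' cY; rewrite Yab in vl.
have hZ : {homo K \o clamp a b : x y / x <= y} by move=> s t st; apply: hK; exact: clamp_homo.
have dq0 (Z : R -> R) j x : {homo Z : x y / x <= y} -> 0 <= dq Z j x.
  move=> hz; rewrite /dq mulr_ge0 ?invr_ge0 ?(ltW (stp_gt0 j)) // subr_ge0 hz // lerDl.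
  by rewrite ltW // stp_gt0.
have mdq (Z : R -> R) j : continuous Z -> measurable_fun (`[a, b] : set LR) (dq Z j : LR -> R).
  by move=> cZ; apply: lmeas_cont; exact: dq_cont.
have window (x : R) : a < x < b -> exists N, forall j, (N <= j)%N -> a <= x + stp j <= b.
  move=> /andP[ax xb]; have far : \forall j \near \oo, stp j <= b - x.
    by apply: (@cvgr_le R _ _ _ stp 0 stp_cvg0); rewrite subr_gt0.
  have [N _ HN] := far; exists N => j Nj; have := HN j Nj; have := stp_gt0 j.
  by move: ax; clear; lra.
have same (Z : R -> R) (x : R) j : a < x < b -> a <= x + stp j <= b -> dq (Z \o clamp a b) j x = dq Z j x.
  by move=> /andP[ax xb] h; rewrite /dq /= !clamp_id // !ltW.
have ends (x : R) : x != a -> x != b -> `[a, b]%classic x -> a < x < b.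
  by move=> xa xb; rewrite /= in_itv /= => /andP[ax bx]; rewrite !lt_neqAle eq_sym xa ax xb bx.
apply: (vitali mE muE completed_lebesgue_measure_is_complete (q := dq Y) (ka := dq (K \o clamp a b))
   (A := K b - K a) _ _ _ _ _ _ _ _ qv vl).
- by move=> j; exact: mdq.
- by move=> j; exact: mdq.
- move=> j x; apply: dq0 => s t st; rewrite /Y /=.
  have /andP[as_ _] := clamp_itv s ab'; have /andP[_ tb] := clamp_itv t ab'.
  by apply: ym => //; exact: clamp_homo.
- by move=> j x; exact: dq0.
- move=> j; apply: le_trans (lint_dq_mono j ab' hZ cKc) _.
  rewrite lee_fin /= [X in _ - K X]clamp_id ?lexx ?ab' // lerB //.
  by apply: hK; have /andP[] := clamp_itv (b + stp j) ab'.
- have ae1 := ae_neq a; have ae2 := ae_neq b.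
  move: ae1 ae2 qn; apply: filterS3 => x /= xa xb qx /(ends x xa xb) axb e B e0.
  have [N1 H1] := window x axb; have [N2 H2] := qx axb e B e0; exists (maxn N1 N2) => j Nj.
  have xj := H1 j (leq_trans (leq_maxl _ _) Nj).
  rewrite !same //; apply: H2; exact: leq_trans (leq_maxr _ _) Nj.
- have ae1 := ae_neq a; have ae2 := ae_neq b; have ae3 := dq_bounded_often ab cK0.
  move: ae1 ae2 ae3; apply: filterS3 => x /= xa xb qx /(ends x xa xb) axb.
  have [B HB] := qx axb; exists B => N; have [N1 H1] := window x axb.
  have [j Nj kj] := HB (maxn N N1); exists j; first exact: leq_trans (leq_maxl _ _) Nj.
  by rewrite same //; apply: H1; exact: leq_trans (leq_maxr _ _) Nj.
- by move=> j; apply: lint_cont_integrable => //; exact: dq_cont.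
- move=> e e0; have [M [ro [M0 hro cro rab Kro]]] := ctl e e0.
  exists M => // j.
  apply: (@le_trans _ _ (\int[mu]_(x in `[a, b]) (dq (ro \o clamp a b) j x)%:E)%E); last first.
    apply: le_trans (lint_dq_mono j ab' _ _) _.
    + by move=> s t st; apply: hro; exact: clamp_homo.
    + exact: comp_clamp_cont.
    + rewrite lee_fin; apply: le_trans rab; rewrite /= [X in _ - ro X]clamp_id ?lexx ?ab' // lerB //.
      by apply: hro; have /andP[] := clamp_itv (b + stp j) ab'.
  apply: (ge0_le_integral mu mE).
  + by move=> x _; rewrite lee_fin excess_ge0.
  + apply/measurable_EFinP; apply: cont_mf; first exact: excess_cont.
    by apply: lmeas_cont; exact: dq_cont.
  + apply/measurable_EFinP; apply: lmeas_cont; apply: dq_cont.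
    exact: comp_clamp_cont.
  + move=> x _; rewrite lee_fin.
    have xs : x <= x + stp j by rewrite lerDl ltW // stp_gt0.
    have /andP[as_ _] := clamp_itv x ab'; have /andP[_ tb] := clamp_itv (x + stp j) ab'.
    have H1 := YK _ _ xs.
    have H2 := Kro _ _ as_ (clamp_homo a b xs) tb.
    have H3 := clamp_lip a b xs.
    have H4 := hro _ _ (clamp_homo a b xs).
    have E1 : `|dq Y j x| = (stp j)^-1 * `|Y (x + stp j) - Y x|.
      by rewrite /dq normrM gtr0_norm // invr_gt0 stp_gt0.
    rewrite /excess ge_max E1 lerBlDl {1}/dq /=.
    have s0 := stp_gt0 j.
    apply/andP; split; last by rewrite /dq mulr_ge0 ?invr_ge0 ?subr_ge0 ?(ltW s0).
    rewrite ler_pdivrMl // mulrDr mulVKf ?gt_eqF //.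
    apply: le_trans H1 _; apply: le_trans H2 _; rewrite lerD2r mulrC ler_wpM2r //.
    by rewrite (le_trans H3) // addrC addKr.
Unshelve. all: by end_near.
Qed.


End ACFTC.

(** * Index of closed curves *)

Section Index.
Variable R : realType.
Implicit Types (gam : R -> R[i]) (n : int).
Local Notation cl := (@clamp R 0 1).

Lemma clamp01 x : 0 <= cl x <= 1. Proof. by apply: clamp_itv; exact: ler01. Qed.

Lemma clamp01_id (x : R) : 0 <= x <= 1 -> cl x = x. Proof. exact: clamp_id. Qed.

Lemma rcont_ccont gam x : rcont gam x <-> ccont (fun z => gam (complex.Re z)) x%:C.
Proof.
split=> H e e0; have [d d0 Hd] := H e e0; exists d => //.
  move=> w wx; apply: Hd; apply: le_lt_trans wx.
  by rewrite (_ : _ - x = complex.Re (w - x%:C)) ?Re_le_cnorm // ReD ReN.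
by move=> y yx; apply: (Hd y%:C); rewrite -rmorphB cnorm_real.
Qed.

Lemma rcontM gam gam' x : rcont gam x -> rcont gam' x -> rcont (fun x => gam x * gam' x) x.
Proof. by rewrite !rcont_ccont; exact: ccontM. Qed.

(** Clamping the parameter to [[0, 1]] turns continuity on the interval into
    continuity on the line. *)
Lemma within_clamp gam : {within `[0, 1], continuous (gam : R -> R[i]^o)} ->
  forall x, rcont (fun x => gam (cl x)) x.
Proof.
move=> /subspace_continuousP H x e e0.
have Hx : `[0, 1]%classic (cl x) by rewrite /= in_itv /= clamp01.
have /cvg_cP /(_ e e0) := H _ Hx.
rewrite near_withinE => /nbhs_ballP [d /= d0 Hd].
exists d => // y yx; apply: Hd; last by rewrite /= in_itv /= clamp01.
by rewrite /ball /= distrC (le_lt_trans (clamp_dist 0 1 y x)).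
Qed.

(** Multiplying by an exponential with periodic exponent adds that exponent to
    the logarithm along the curve without changing its increment. *)
Lemma has_index_mul gam gam' (P : R -> R[i]) n :
  (forall x : R, 0 <= x <= 1 -> gam' x = gam x * cexp (P x)) ->
  (forall x, rcont P x) -> P 0 = P 1 -> has_index gam n -> has_index gam' n.
Proof.
move=> E cP P01 [g0 [arg [ca gE ga]]]; split.
  by move=> x x01; rewrite E // mulf_neq0 ?g0 ?cexp_neq0.
exists (fun x => arg x + complex.Im (P x)); split.
- move=> x; apply: (@continuousD _ _ _ (arg : subspace `[0, 1]%classic -> R)); first exact: ca.
  by apply: (@continuous_subspaceT _ _ _ (fun x => complex.Im (P x))) => y; exact: rcont_Im.
- move=> x x01; rewrite E // cnormM cnorm_cexp expiD {1}gE // /cexp rmorphM /=; ring.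
- by rewrite P01 -ga; ring.
Qed.

Definition curve gam := (forall x, rcont (fun x => gam (cl x)) x) /\ gam 0 = gam 1.

Lemma has_index_ext gam gam' (P : R -> R[i]) n :
  (forall x : R, 0 <= x <= 1 -> gam' x = gam x * cexp (P x)) ->
  (forall x, rcont P x) -> P 0 = P 1 -> has_index gam n <-> has_index gam' n.
Proof.
move=> E cP P01; split; first exact: has_index_mul cP P01.
apply: (@has_index_mul gam' gam (fun x => - P x)) => //; last by rewrite P01.
- move=> x x01; rewrite E // -mulrA -cexpD subrr.
  by rewrite -[LHS]mulr1; congr (_ * _); apply/eqP; rewrite eq_complex /= expR0 cos0 sin0; apply/andP; split; apply/eqP; ring.
- by move=> x e e0; have [d d0 H] := cP x e e0; exists d => // y /H; rewrite -opprD cnormN.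
Qed.

(** Dog-on-a-leash: the quotient of the two curves stays in the right
    half-plane, where the logarithm is single-valued. *)
Lemma has_index_near gam gam' n : curve gam -> curve gam' ->
  (forall x : R, 0 <= x <= 1 -> cnorm (gam' x - gam x) < cnorm (gam x)) ->
  has_index gam n <-> has_index gam' n.
Proof.
move=> [cg g01] [cg' g01'] H.
have g0 x : 0 <= x <= 1 -> gam x != 0.
  by move=> /H h; rewrite -cnorm_gt0; apply: le_lt_trans h; exact: cnorm_ge0.
have q0 x : 0 <= x <= 1 -> 0 < complex.Re (gam' x / gam x).
  move=> x01; have g0x := g0 x x01.
  have : cnorm (gam' x / gam x - 1) < 1.
    have -> : gam' x / gam x - 1 = (gam' x - gam x) / gam x by field.
    by rewrite cnormM cnormV ltr_pdivrMr ?cnorm_gt0 // mul1r; exact: H.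
  rewrite cnormC => h; have := le_lt_trans (Re_le_cnorm _) h; rewrite ReD ReN /=.
  by rewrite ltr_norml => /andP[_]; clear; lra.
apply: (@has_index_ext _ _ (fun x => plog (gam' (cl x) / gam (cl x)))).
- by move=> x x01; rewrite clamp01_id // cexp_plog ?q0 // mulrC mulfVK // g0.
- move=> x; apply: (@rcont_comp _ (@plog R) (fun x => gam' (cl x) / gam (cl x))); last first.
    by apply: cdiff_ccont; apply: plog_cdiff; apply: q0; exact: clamp01.
  apply: rcontM => //; apply: (@rcont_comp _ (fun z => z^-1) (fun x => gam (cl x))) => //.
  by apply: ccontV; [exact: g0 (clamp01 x)|exact: ccont_id].
- by rewrite !clamp01_id ?lexx ?ler01 // g01 g01'.
Qed.

Lemma index0_eq gam gam' : (forall n, has_index gam n <-> has_index gam' n) -> index0 gam = index0 gam'.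
Proof. by move=> H; rewrite /index0; congr xget; apply/seteqP; split => n /=; rewrite H. Qed.

End Index.

(** * Loewner chains transported by a holomorphic map *)

Section ChainBasics.
Variable R : realType.
Notation mu := (@completed_lebesgue_measure R).
Notation LR := (lebesgueR R).

(** The function [- pi / ln r] is increasing in [r], so that a non-increasing
    modulus function gives non-increasing radii. *)
Lemma domains_decreasing (d : \bar R) (r : R -> R) (s t : R) : canonical_domain_system d r ->
  0 <= s -> s <= t -> r t <= r s.
Proof.
move=> [r01 _ om] s0 st; have t0 := le_trans s0 st.
have /andP[rt0 rt1] := r01 t t0; have /andP[rs0 rs1] := r01 s s0.
have [->//|rt] := eqVneq (r t) 0.
have lneg (x : R) : 0 < x -> x < 1 -> ln x < 0 by move=> x0 x1; apply: ln_lt0; rewrite x0.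
have rtp : 0 < r t by rewrite lt_neqAle eq_sym rt.
have lt := lneg _ rtp rt1.
have := om s t s0 st; rewrite /omega (negbTE rt); case: eqVneq => [rs|rs].
  by rewrite leNgt mulNr oppr_gt0 pmulr_rlt0 ?pi_gt0 // invr_lt0 lt.
have rsp : 0 < r s by rewrite lt_neqAle eq_sym rs.
have ls := lneg _ rsp rs1.
rewrite !mulNr lerN2 ler_pM2l ?pi_gt0 // lef_nV2 ?negrE //.
by rewrite ler_ln.
Qed.

(** The regularity of a chain in time is stated for ordered times; the
    symmetric form with the primitive [ka] suits two-sided neighbourhoods of a
    time. *)
Lemma loewner_control (d : \bar R) (r : R -> R) (f : R -> R[i] -> R[i]) (S T : R) (K : set R[i]) :
  (1 <= d)%E -> loewner_chain d r f -> 0 <= S -> S < T -> compact (K : set R[i]^o) ->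
  K `<=` annulus (r S) -> exists k ka, [/\ in_Ld d `[S, T] k, forall x, S <= x <= T -> 0 <= k x,
    control S T ka, forall s t, S <= s -> s <= t -> t <= T ->
      (\int[mu]_(x in `[s, t]) (k x)%:E = (ka t - ka s)%:E)%E &
    forall z s t, K z -> S <= s <= T -> S <= t <= T -> cnorm (f s z - f t z) <= `|ka t - ka s|].
Proof.
move=> d1 [_ _ LC3] S0 ST cK KS; have [k [kd k0 Hk]] := LC3 S T K S0 (ltW ST) cK KS.
have [ka cka kaE] := integrable_control (ltW ST) (in_Ld_integrable d1 (ltW ST) kd) k0.
exists k, ka; split => //.
suff H z s t : K z -> S <= s -> s <= t -> t <= T -> cnorm (f s z - f t z) <= `|ka t - ka s|.
  move=> z s t Kz /andP[Ss sT] /andP[St tT]; have [st|/ltW ts] := leP s t; first exact: H.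
  by rewrite cnormC distrC; exact: H.
move=> Kz Ss st tT; have := Hk z s t Kz Ss st tT; rewrite (kaE s t Ss st tT) lee_fin.
by move/le_trans; apply; exact: ler_norm.
Qed.

Lemma control_near (S T : R) (ka : R -> R) (u e : R) : control S T ka -> 0 < e ->
  exists2 d : R, 0 < d & forall t, `|t - u| < d -> `|ka t - ka u| < e.
Proof.
move=> [_ cka _] e0; have H := (@cvgrPdist_lt R R^o _ _ _ _ _).1 (cka u) e e0.
have [d /= d0 Hd] := (@nbhs_ballP R R^o u _).1 (H _).
by exists d => // t tu; rewrite distrC; apply: Hd; rewrite /ball /= distrC.
Qed.

Lemma rcont_cnorm (gam : R -> R[i]) x : rcont gam x -> {for x, continuous (fun x => cnorm (gam x))}.
Proof.
move=> cg; apply/(@cvgrPdist_lt R R^o) => e e0; have [d' d'0 Hd] := cg e e0.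
apply/(@nbhs_ballP R R^o); exists d' => //= y; rewrite /ball /= distrC => /Hd.
apply: le_lt_trans; rewrite ler_norml.
have h1 := cnorm_sub_ge (gam x) (gam y); have h2 := cnorm_sub_ge (gam y) (gam x).
by rewrite cnormC in h1; apply/andP; split; move: h1 h2; clear; lra.
Qed.

End ChainBasics.

Section LoewnerData.
Variable R : realType.
Variables (d : \bar R) (r : R -> R) (f : R -> R[i] -> R[i]) (T0 : R).
Notation mu := (@completed_lebesgue_measure R).
Notation LR := (lebesgueR R).
Local Notation D := (@udisk R).
Local Notation D' := (@punctured_disk R).

Hypothesis d1 : (1 <= d)%E.
Hypothesis rmono : forall s t, 0 <= s -> s <= t -> r t <= r s.
Hypothesis T00 : 0 <= T0.
Hypothesis rT : forall t, T0 <= t -> r t = 0.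
Hypothesis hf : loewner_chain d r f.

Local Notation A t := (annulus (r t)).

Lemma A_sub s t : 0 <= s -> s <= t -> A s `<=` A t.
Proof. by move=> s0 st z /andP[h1 h2]; apply/andP; split=> //; exact: le_lt_trans (rmono s0 st) h1. Qed.

Lemma A_end t : T0 <= t -> A t = D'.
Proof. by move=> Tt; rewrite rT. Qed.

Lemma f_cdiff t z : 0 <= t -> A t z -> cdiff (f t) z.
Proof. by move=> t0; have [H _ _] := hf; have [/hol_cdiff h _] := H t t0; exact: h. Qed.

Lemma f_inj t z w : 0 <= t -> A t z -> A t w -> f t z = f t w -> z = w.
Proof.
move=> t0 zA wA; have [H _ _] := hf; have [_ h] := H t t0.
by apply: h; rewrite inE.
Qed.

Lemma f_image s t : 0 <= s -> s <= t -> f s @` A s `<=` f t @` A t.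
Proof.
move=> s0; rewrite le_eqVlt => /predU1P[->//|st]; have [_ H _] := hf; exact: H.
Qed.

Lemma end_cdiff t : T0 <= t -> forall z, D' z -> cdiff (f t) z.
Proof. by move=> Tt z; rewrite -(A_end Tt); apply: f_cdiff; exact: le_trans Tt. Qed.

Lemma end_inj t : T0 <= t -> forall z w, D' z -> D' w -> f t z = f t w -> z = w.
Proof. by move=> Tt z w; rewrite -(A_end Tt); apply: f_inj; exact: le_trans Tt. Qed.

Lemma end_image s t : T0 <= s -> s <= t -> f s @` D' `<=` f t @` D'.
Proof.
move=> Ts st; rewrite -{1}(A_end Ts) -(A_end (le_trans Ts st)).
by apply: f_image => //; exact: le_trans Ts.
Qed.

Lemma end_cont u : T0 <= u -> forall a b e : R, 0 < a -> b < 1 -> 0 < e ->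
  exists2 d : R, 0 < d & forall t, T0 <= t -> `|t - u| < d ->
    forall z, a <= cnorm z <= b -> cnorm (f t z - f u z) < e.
Proof.
move=> Tu a b e a0 b1 e0.
have Tu1 : T0 < u + 1 by rewrite (le_lt_trans Tu) // ltrDl.
have KA : [set z | a <= cnorm z <= b] `<=` A T0.
  rewrite A_end // => z /andP[h1 h2]; apply/andP; split; first exact: lt_le_trans h1.
  exact: le_lt_trans b1.
have [_ [ka [_ _ cka _ H]]] := loewner_control d1 hf T00 Tu1 (@ring_compact _ a b (ltW a0)) KA.
have [d' d0 Hd] := control_near u cka e0.
exists (Num.min d' 1); first by rewrite lt_min d0 ltr01.
move=> t Tt; rewrite lt_min => /andP[td t1] z zK.
have uI : T0 <= u <= u + 1 by rewrite Tu lerDl ler01.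
have tI : T0 <= t <= u + 1.
  by rewrite Tt /=; move: t1; rewrite ltr_norml => /andP[_ /ltW]; rewrite lerBlDr addrC.
apply: le_lt_trans (H z t u zK tI uI) _.
by rewrite distrC; exact: Hd.
Qed.

(** Monotonicity of the images makes early times irrelevant for their
    union. *)
Lemma chain_range_punion : chain_range r f = punion f T0.
Proof.
apply/seteqP; split => w.
- move=> [t /=]; rewrite in_itv /= andbT => t0 [z zA <-].
  have tm : t <= Num.max t T0 by rewrite le_max lexx.
  have Tm : T0 <= Num.max t T0 by rewrite le_max lexx orbT.
  have [y yA <-] : (f (Num.max t T0) @` A (Num.max t T0)) (f t z) by apply: (f_image t0 tm); exists z.
  by exists (Num.max t T0), y; split => //; rewrite -(A_end Tm).
- move=> [t [z [Tt zD <-]]]; exists t; first by rewrite /= in_itv /= andbT (le_trans T00).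
  by exists z => //; rewrite A_end.
Qed.

Lemma range_open : copen (chain_range r f).
Proof. rewrite chain_range_punion; exact: (punion_open end_cdiff end_inj). Qed.

Lemma chain_range_mem t z : 0 <= t -> A t z -> chain_range r f (f t z).
Proof. by move=> t0 zA; exists t; [rewrite /= in_itv /= andbT|exists z]. Qed.

Section Transport.
Variable F : R[i] -> R[i].
Hypothesis dF : forall v, chain_range r f v -> cdiff F v.
Hypothesis Fi : forall v w, chain_range r f v -> chain_range r f w -> F v = F w -> v = w.
Hypothesis F0 : forall t, T0 <= t -> tends0 (fun z => F (f t z)) 0.

Definition hchain t z := F (f t z).
Local Notation h := hchain.

Lemma h_cdiff t z : 0 <= t -> A t z -> cdiff (h t) z.
Proof.
move=> t0 zA; apply: (@cdiff_comp _ (f t) F); first exact: f_cdiff.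
by apply: dF; exact: chain_range_mem.
Qed.

Lemma h_inj t z w : 0 <= t -> A t z -> A t w -> h t z = h t w -> z = w.
Proof. by move=> t0 zA wA E; apply: (f_inj t0) => //; apply: Fi => //; exact: chain_range_mem. Qed.

Lemma local_lip (v0 : R[i]) : chain_range r f v0 -> exists m C : R, [/\ 0 < m, 0 <= C &
  forall w1 w2, cnorm (w1 - v0) < m -> cnorm (w2 - v0) < m ->
    cnorm (F w1 - F w2) <= C * cnorm (w1 - w2)].
Proof.
move=> v0R; have [m m0 Hm] := range_open v0R.
have dG z : cnorm z <= m / 2 -> cdiff (fun z => F (v0 + z)) z.
  move=> zm; apply: cdiff_shift; apply: dF; apply: Hm; rewrite addrAC subrr add0r.
  by apply: le_lt_trans zm _; rewrite ltr_pdivrMr // ltr_pMr // ltr1n.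
have m2 : 0 < m / 2 by rewrite divr_gt0.
have m4 : m / 4 < m / 2 by rewrite ltr_pM2l // ltf_pV2 ?posrE // ltr_nat.
have [B _ HB] := circ_bounded m2 (circ_cdiff dG).
pose C := B * (m / 2 / (m / 2 - m / 4) ^+ 2).
exists (m / 4), C; split.
- by rewrite divr_gt0.
- rewrite mulr_ge0 //.
    by have := HB (m / 2)%:C; rewrite cnorm_real gtr0_norm // => /(_ erefl); apply: le_trans; exact: cnorm_ge0.
  by rewrite divr_ge0 ?sqr_ge0 // ltW.
- move=> w1 w2 h1 h2.
  have := lip_disk m4 m2 dG HB (ltW h1) (ltW h2).
  by rewrite !(addrC v0) !subrK opprB addrA subrK.
Qed.

(** For [s] and [t] close to [u] the points [f s z] and [f t z] lie in a disk
    around [f u z] where [F] is Lipschitz; compactness makes the disk sizes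
    and the constants uniform in [z]. A single [e] serves both as window width
    and as inverse Lipschitz constant, which fits [compact_uniform]. *)
Lemma lip_window (S T u : R) (K : set R[i]) : 0 <= S -> S < T -> S <= u <= T ->
  compact (K : set R[i]^o) -> K `<=` A S -> exists2 e : R, 0 < e & forall z, K z ->
    forall s t, S <= s <= T -> S <= t <= T -> `|s - u| < e -> `|t - u| < e ->
      cnorm (h s z - h t z) <= e^-1 * cnorm (f s z - f t z).
Proof.
move=> S0 ST uI cK KS.
have [_ [ka [_ _ cka _ H]]] := loewner_control d1 hf S0 ST cK KS.
have [e e0 He] : exists2 e : R, 0 < e & forall z, K z -> K z ->
    forall s t, S <= s <= T -> S <= t <= T -> `|s - u| < e -> `|t - u| < e ->
      cnorm (h s z - h t z) <= e^-1 * cnorm (f s z - f t z).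
  apply: (@compact_uniform _ K (fun e z => K z -> forall s t, S <= s <= T -> S <= t <= T ->
     `|s - u| < e -> `|t - u| < e -> cnorm (h s z - h t z) <= e^-1 * cnorm (f s z - f t z))) => // z0 Kz0.
  have u0 : 0 <= u by case/andP: uI => Su _; exact: le_trans Su.
  have Au : A S `<=` A u by apply: A_sub => //; case/andP: uI.
  have z0A : A u z0 by apply: Au; exact: KS.
  have [m [C [m0 C0 HC]]] := local_lip (chain_range_mem u0 z0A).
  have m2 : 0 < m / 2 by rewrite divr_gt0.
  have [e1 e10 H1] := control_near u cka m2.
  have [e2 e20 H2] := cdiff_ccont (f_cdiff u0 z0A) m2.
  have C1 : 0 < (C + 1)^-1 by rewrite invr_gt0 ltr_wpDl.
  exists (Num.min (Num.min e1 e2) (C + 1)^-1); first by rewrite !lt_min e10 e20.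
  move=> e w e0; rewrite !lt_min => /andP[/andP[h1 h2] h3] /andP[/andP[_ w2] _] Kw s t sI tI se te.
  have near x : S <= x <= T -> `|x - u| < e -> cnorm (f x w - f u z0) < m.
    move=> xI xe; apply: (le_lt_trans (cdist_triangle _ _ (f u w))).
    have a1 := H1 x (lt_trans xe h1); have a2 := H w x u Kw xI uI; have a3 := H2 w w2.
    by rewrite distrC in a1; rewrite [m]splitr ltrD // (le_lt_trans a2).
  apply: le_trans (HC _ _ (near s sI se) (near t tI te)) _.
  rewrite ler_wpM2r ?cnorm_ge0 //.
  by rewrite (@le_trans _ _ (C + 1)) ?lerDl // -[C + 1]invrK lef_pV2 ?posrE // ltW.
by exists e => // z Kz; exact: He.
Qed.

(** Bounds relative to the bound for [f] are additive in time, so the local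
    Lipschitz constants of [F] add up to a global one. *)
Lemma h_control (S T : R) (K : set R[i]) (ka : R -> R) : 0 <= S -> S < T ->
  compact (K : set R[i]^o) -> K `<=` A S -> {homo ka : x y / x <= y} ->
  (forall z s t, K z -> S <= s <= T -> S <= t <= T -> cnorm (f s z - f t z) <= `|ka t - ka s|) ->
  exists2 C : R, 0 <= C & forall z s t, K z -> S <= s -> s <= t -> t <= T ->
    cnorm (h s z - h t z) <= C * (ka t - ka s).
Proof.
move=> S0 ST cK KS hka H.
pose Q (a b : R) := exists2 C : R, 0 <= C & forall z s t, K z -> a <= s -> s <= t -> t <= b ->
    cnorm (h s z - h t z) <= C * (ka t - ka s).
apply: (@interval_induction R Q S T (ltW ST)).
- move=> a m b Sa am mb bT [C1 C10 H1] [C2 C20 H2]; exists (C1 + C2); first exact: addr_ge0.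
  have wk (C C' s t : R) : 0 <= C' -> s <= t -> C * (ka t - ka s) <= (C + C') * (ka t - ka s).
    by move=> C'0 st; rewrite ler_wpM2r ?subr_ge0 ?hka // lerDl.
  move=> z s t Kz as_ st tb; have [tm|mt] := leP t m.
    by apply: le_trans (H1 z s t Kz as_ st tm) _; exact: (wk _ _ _ _ C20 st).
  have [ms|sm] := leP m s.
    by apply: le_trans (H2 z s t Kz ms st tb) _; rewrite [C1 + C2]addrC; exact: (wk _ _ _ _ C10 st).
  apply: le_trans (cdist_triangle _ _ (h m z)) _.
  have -> : (C1 + C2) * (ka t - ka s) = (C1 + C2) * (ka m - ka s) + (C2 + C1) * (ka t - ka m) by ring.
  apply: lerD.
    by apply: le_trans (H1 z s m Kz as_ (ltW sm) (lexx m)) _; apply: wk => //; exact: ltW.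
  by apply: le_trans (H2 z m t Kz (lexx m) (ltW mt) tb) _; apply: wk => //; exact: ltW.
- move=> u uI; have [e e0 He] := lip_window S0 ST uI cK KS.
  exists e => // a b Sa au ub bT ae be; exists e^-1; first by rewrite invr_ge0 ltW.
  move=> z s t Kz as_ st tb.
  have Ss := le_trans Sa as_; have tT := le_trans tb bT.
  have sI : S <= s <= T by rewrite Ss (le_trans st).
  have tI : S <= t <= T by rewrite tT (le_trans Ss).
  have we x : a <= x -> x <= b -> `|x - u| < e.
    move=> ax xb; rewrite ltr_norml ltrBrDr ltrBlDr addrC (lt_le_trans ae ax) /=.
    by rewrite addrC (le_lt_trans xb).
  apply: le_trans (He z Kz s t sI tI (we s as_ (le_trans st tb)) (we t (le_trans as_ st) tb)) _.
  rewrite ler_wpM2l ?invr_ge0 ?(ltW e0) //; apply: le_trans (H z s t Kz sI tI) _.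
  by rewrite ger0_norm // subr_ge0 hka.
Qed.

(** The bound required for regularity in time is a constant multiple of the
    one for [f], by [h_control]; the case of a single time is separate. *)
Lemma h_chain : loewner_chain d r h.
Proof.
have [LC1 LC2 LC3] := hf; split.
- move=> t t0; split; first by apply/hol_cdiff => z; exact: h_cdiff.
  by move=> z w; rewrite !inE; exact: h_inj.
- move=> s t s0 st _ [z zA <-].
  have [y yA yE] : (f t @` A t) (f s z) by apply: (LC2 s t s0 st); exists z.
  by exists y => //; rewrite /h yE.
- move=> S T K S0; rewrite le_eqVlt => /predU1P[<-|ST] cK KS.
    have [k [kd k0 _]] := LC3 S S K S0 (lexx S) cK KS; exists k; split => // z s t Kz Ss st tS.
    have -> : s = t by apply: le_anti; rewrite st (le_trans tS).
    rewrite subrr cnorm0; apply: integral_ge0 => x /=; rewrite in_itv /= => /andP[tx xt].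
    by rewrite lee_fin k0 // (le_trans Ss) ?(le_trans st) //= (le_trans xt).
  have [k [ka [kd k0 [hka _ _] kaE H]]] := loewner_control d1 hf S0 ST cK KS.
  have [C C0 HC] := h_control S0 ST cK KS hka H.
  exists (fun x => C * k x); split.
  + exact: in_Ld_scale.
  + by move=> x xI; rewrite mulr_ge0 // k0.
  + move=> z s t Kz Ss st tT.
    have ik : mu.-integrable `[s, t] (EFin \o (k : LR -> R)).
      exact: lint_sub Ss tT (in_Ld_integrable d1 (ltW ST) kd).
    have -> : (\int[mu]_(x in `[s, t]) (C * k x)%:E = (C * (ka t - ka s))%:E)%E.
      rewrite EFinM -(kaE s t Ss st tT) -(integralZl (lmeas_itv _) ik).
      by apply: eq_integral => x _; rewrite EFinM.
    by rewrite lee_fin; exact: HC.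
Qed.

Lemma h_end_univ t : T0 <= t -> univ0 (ext0 0 (h t)).
Proof.
move=> Tt; have t0 : 0 <= t := le_trans T00 Tt.
apply: ext0_univ0; last exact: F0.
  by move=> z; rewrite -(A_end Tt); exact: h_cdiff.
by move=> z w; rewrite -(A_end Tt); exact: h_inj.
Qed.

Lemma curve_in t gam : closed_curve (A t) gam -> curve gam.
Proof. by move=> [cg g01 _]; split => //; exact: within_clamp. Qed.

Lemma curve_h s t gam : 0 <= s -> s <= t -> closed_curve (A s) gam -> curve (h t \o gam).
Proof.
move=> s0 st cg; have [c1 c2] := curve_in cg; have [_ _ gA] := cg.
split; last by rewrite /= c2.
move=> x; apply: (@rcont_comp _ (h t) (fun x => gam (clamp 0 1 x))) => //.
apply: cdiff_ccont; apply: h_cdiff; first exact: le_trans st.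
by apply: (A_sub s0 st); apply: gA; exact: clamp01.
Qed.

Lemma curve_compact t gam : closed_curve (A t) gam ->
  compact (gam @` `[0, 1]%classic : set R[i]^o).
Proof.
move=> [cg _ _].
exact: (continuous_compact cg (@segment_compact R 0 1)).
Qed.

(** From time [T0] on, the extension of [h t] to the disk is [z * cexp (P z)],
    which only changes the argument along a curve by a periodic function. *)
Lemma h_index_end t gam : T0 <= t -> closed_curve (A t) gam ->
  forall n, has_index gam n <-> has_index (h t \o gam) n.
Proof.
move=> Tt cg n; have [dg gi g0] := h_end_univ Tt.
have [c1 c2] := curve_in cg; have [_ _ gA] := cg.
have [rho [rho0 rho1 Hrho]] : exists rho : R, [/\ 0 < rho, rho < 1 &
    forall x : R, 0 <= x <= 1 -> cnorm (gam x) <= rho].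
  have cn : {within `[0, 1], continuous (fun x => cnorm (gam (clamp 0 1 x)))}.
    by apply: continuous_subspaceT => x; exact: rcont_cnorm.
  have [y yI Hy] := EVT_max ler01 cn.
  have /andP[y0 y1] : 0 < cnorm (gam (clamp 0 1 y)) < 1.
    by have := gA _ (clamp01 y); rewrite A_end.
  exists (cnorm (gam (clamp 0 1 y))); split => // x x01.
  by have := Hy x; rewrite in_itv /= => /(_ x01); rewrite (clamp01_id x01).
(* on the disk [h t] is [z * u z] with [u] zero-free, and [u] has a logarithm
   on the disk containing the curve *)
have [u [du uE ul]] := factor0 ltr01 g0 dg.
have un0 z : cnorm z < 1 -> u z != 0.
  move=> z1; apply/eqP => uz; have [zz|zn] := eqVneq z 0.
    by rewrite zz in uz; have := univ0_deriv (h_end_univ Tt); rewrite (cd_cderive ul) uz eqxx.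
  have : z = 0 by apply: gi => //; [exact: udisk0|rewrite g0 uE uz mulr0].
  by move/eqP; rewrite (negbTE zn).
have [P HP] := disk_log rho0 rho1 du un0.
apply: (@has_index_ext _ gam _ (fun x => P (gam (clamp 0 1 x)))).
- move=> x x01; rewrite clamp01_id //; have [_ ->] := HP _ (Hrho x x01).
  rewrite -uE ext0E //; apply: (@pdisk_neq0 R); rewrite -(A_end Tt); exact: gA.
- move=> x; apply: (@rcont_comp _ P (fun x => gam (clamp 0 1 x))) => //.
  by apply: cdiff_ccont; have [] := HP _ (Hrho _ (clamp01 x)).
- by rewrite !clamp01_id ?lexx ?ler01 // c2.
Qed.

(** The value 0 is taken only at the puncture by the extension at a later
    time. *)
Lemma h_neq0 t z : 0 <= t -> A t z -> h t z != 0.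
Proof.
move=> t0 zA; set m := Num.max t T0.
have tm : t <= m by rewrite le_max lexx.
have Tm : T0 <= m by rewrite le_max lexx orbT.
have [y yA yE] : (f m @` A m) (f t z) by apply: (f_image t0 tm); exists z.
have [_ gi g0] := h_end_univ Tm; rewrite /h -yE.
rewrite (A_end Tm) in yA; have y0 := pdisk_neq0 yA.
apply/eqP => E; move/eqP: (y0); apply; apply: gi.
- by have [] := (pdisk_udisk y).1 yA.
- exact: udisk0.
- by rewrite g0 ext0E.
Qed.

(** Before [T0] the index is carried along the homotopy [s |-> h s \o gam]. *)
Lemma h_index t gam : 0 <= t -> closed_curve (A t) gam ->
  forall n, has_index gam n <-> has_index (h t \o gam) n.
Proof.
move=> t0 cg n; have [Tt|tT] := leP T0 t; first exact: h_index_end.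
have cT : closed_curve (A T0) gam.
  by have [c1 c2 c3] := cg; split => // x /c3; apply: A_sub => //; exact: ltW.
apply: (iff_trans (h_index_end (lexx T0) cT n)); apply: iff_sym.
have [_ _ gA] := cg.
have KA : gam @` `[0, 1]%classic `<=` A t by move=> _ [x xI <-]; apply: gA; rewrite /= in_itv in xI.
have cK := curve_compact cg.
have [k [ka [_ _ cka _ H]]] := loewner_control d1 h_chain t0 tT cK KA.
apply: (@interval_induction R (fun a b => has_index (h a \o gam) n <-> has_index (h b \o gam) n) t T0 (ltW tT)).
  by move=> a m b _ _ _ _ -> ->.
move=> u uI; have /andP[tu uT] := uI; have u0 : 0 <= u := le_trans t0 tu.
have cu : closed_curve (A u) gam.
  by have [c1 c2 c3] := cg; split => // x /c3; exact: A_sub.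
(* the curve at time [u] stays at a distance [m] from 0, so the index does not
   change while the curves move by less than [m] *)
have [m m0 Hm] : exists2 m : R, 0 < m & forall x : R, 0 <= x <= 1 -> m <= cnorm (h u (gam x)).
  have cn : {within `[0, 1], continuous (fun x => cnorm (h u (gam (clamp 0 1 x))))}.
    apply: continuous_subspaceT => x; apply: (@rcont_cnorm _ (fun x => h u (gam (clamp 0 1 x)))).
    by have [c1 _] := curve_h u0 (lexx u) cu; exact: c1.
  have [y yI Hy] := EVT_min ler01 cn.
  exists (cnorm (h u (gam (clamp 0 1 y)))).
    by rewrite cnorm_gt0 h_neq0 //; apply: (A_sub t0 tu); exact: gA (clamp01 y).
  by move=> x x01; have := Hy x; rewrite in_itv /= => /(_ x01); rewrite (clamp01_id x01).
have [e e0 He] := control_near u cka m0.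
have near b : t <= b <= T0 -> `|b - u| < e -> has_index (h u \o gam) n <-> has_index (h b \o gam) n.
  move=> bI be; have /andP[tb _] := bI.
  apply: has_index_near; [exact: curve_h tu cg|exact: curve_h tb cg|].
  move=> x x01 /=; apply: lt_le_trans (Hm x x01).
  apply: le_lt_trans (H _ b u _ bI uI) _; first by exists x => //; rewrite /= in_itv.
  by rewrite distrC; exact: He.
exists e => // a b ta au ub bT ae be.
rewrite -near; last 2 first.
- by rewrite ta (le_trans au).
- by rewrite distrC ger0_norm ?subr_ge0 // ltrBlDr addrC -ltrBlDr.
apply: near; first by rewrite bT (le_trans tu).
by rewrite ger0_norm ?subr_ge0 // ltrBlDr addrC.
Qed.

(** All choices of the normalising map [F] lead to a standard chain; only its
    image distinguishes the types. *)
Lemma standard_of_map L : L = punctured_disk \/ L = punctured_plane -> F @` chain_range r f = L ->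
  loewner_range d r f L.
Proof.
move=> HL FL; split; first by case: HL => ->; [constructor 1|constructor 3].
have invP := @inv_onP R (chain_range r f) F.
have roo : lim (r t @[t --> +oo]) = 0.
  apply: (@cvg_lim _ (@Rhausdorff R)).
  apply: cvg_near_cst; near=> t; apply: rT; near: t.
  by apply: nbhs_pinfty_ge; exact: num_real.
exists F; split.
  split; [by apply/hol_cdiff| |].
    exact: FL.
  exists (inv_on (chain_range r f) F); split.
  - by apply/hol_cdiff => w; rewrite -FL; exact: (inv_on_cdiff range_open dF Fi).
  - apply/seteqP; split => [_ [w wL <-]|v vR].
      by rewrite -FL in wL; have [] := invP w wL.
    by exists (F v); [rewrite -FL; exists v|rewrite inv_onK].
  - by move=> v vR; rewrite inv_onK.
split.
- exact: h_chain.
- by move=> t gam t0 cg; apply/esym/index0_eq/(h_index t0 cg).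
- by rewrite roo ltxx.
- move=> _; suff E : chain_range r h = L by case: HL => EL; rewrite -EL; [constructor 1|constructor 3].
  rewrite -FL; apply/seteqP; split => w.
    by move=> [t t0 [z zA <-]]; exists (f t z) => //; exists t => //; exists z.
  by move=> [_ [t t0 [z zA <-]] <-]; exists t => //; exists z.
Unshelve. all: by end_near.
Qed.

End Transport.
End LoewnerData.

(** * The two types in terms of the derivative at the puncture *)

#[local] Opaque chain_deriv.

Section LoewnerTypes.
Variable R : realType.
Variables (d : \bar R) (r : R -> R) (f : R -> R[i] -> R[i]) (T0 : R).
Local Notation D := (@udisk R).
Local Notation D' := (@punctured_disk R).

Hypothesis d1 : (1 <= d)%E.
Hypothesis rmono : forall s t, 0 <= s -> s <= t -> r t <= r s.
Hypothesis T00 : 0 <= T0.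
Hypothesis rT : forall t, T0 <= t -> r t = 0.
Hypothesis hf : loewner_chain d r f.

Variable M : R[i] -> R[i].
Hypothesis dM : forall v, chain_range r f v -> cdiff M v.
Hypothesis Mi : forall v w, chain_range r f v -> chain_range r f w -> M v = M w -> v = w.
Hypothesis M0 : forall t, T0 <= t -> tends0 (fun z => M (f t z)) 0.

Definition normalized t := ext0 0 (fun z => M (f t z)).
Local Notation g := normalized.
Definition normalized_deriv t : R := cnorm (cderive (g t) 0).

Lemma normalized_derivE t : normalized_deriv t = cnorm (cderive (g t) 0). Proof. by []. Qed.

Lemma normalized_univ t : T0 <= t -> univ0 (g t).
Proof. by move=> Tt; exact: (h_end_univ T00 rT hf dM Mi M0 Tt). Qed.

Lemma normalized_sub s t : T0 <= s -> s <= t -> g s @` D `<=` g t @` D.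
Proof.
move=> Ts st _ [z zD <-]; have [->|z0] := eqVneq z 0.
  by exists 0; [exact: udisk0|rewrite /g !ext00].
have zD' : D' z by apply/pdisk_udisk.
have [y yD yE] : (f t @` D') (f s z) by apply: (end_image T00 rT hf Ts st); exists z.
exists y; first by have [] := (pdisk_udisk y).1 yD.
by rewrite /g !ext0E ?yE // (pdisk_neq0 yD).
Qed.

Lemma normalized_deriv_le s t : T0 <= s -> s <= t -> normalized_deriv s <= normalized_deriv t.
Proof.
move=> Ts st; apply: trans_deriv_le; [exact: normalized_univ|apply: normalized_univ|exact: normalized_sub].
exact: le_trans st.
Qed.

(** The chain is sampled along integers: the images increase, so countably
    many times determine the union. *)
Definition gseq (n : nat) := g (T0 + n%:R).

Lemma gseq_univ n : univ0 (gseq n).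
Proof. by apply: normalized_univ; rewrite lerDl. Qed.

Lemma gseq_sub n : gseq n @` D `<=` gseq n.+1 @` D.
Proof. by apply: normalized_sub; rewrite ?lerDl // lerD2l ler_nat. Qed.

Lemma gseq_beyond t : exists n : nat, t <= T0 + n%:R.
Proof.
have [n _ Hn] := @nbhs_infty_ger R (t - T0).
by exists n; rewrite -lerBlDl; apply: Hn => /=.
Qed.

Lemma gseq_union v : chain_union gseq v <-> v = 0 \/ exists2 w, chain_range r f w & M w = v.
Proof.
split=> [[n [z [zD <-]]]|[->|[w wR <-]]].
- rewrite /gseq /g; have [->|z0] := eqVneq z 0; [by left; rewrite ext00|right].
  have Tn : T0 <= T0 + n%:R by rewrite lerDl.
  exists (f (T0 + n%:R) z); last by rewrite ext0E.
  apply: (chain_range_mem f (le_trans T00 Tn)); rewrite (A_end rT Tn); exact/pdisk_udisk.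
- exists 0%N, 0; split; [exact: udisk0|by rewrite /gseq /g ext00].
- move: wR; rewrite (chain_range_punion T00 rT hf) => -[t [z [Tt zD wE]]].
  have [n tn] := gseq_beyond t.
  have [y yD yE] : (f (T0 + n%:R) @` D') w by apply: (end_image T00 rT hf Tt tn); exists z.
  exists n, y; split; first by have [] := (pdisk_udisk y).1 yD.
  by rewrite /gseq /g ext0E ?yE // (pdisk_neq0 yD).
Qed.

Lemma map_neq0 w : chain_range r f w -> M w != 0.
Proof.
rewrite (chain_range_punion T00 rT hf) => -[t [z [Tt zD <-]]].
apply: (h_neq0 T00 rT hf dM Mi M0 (le_trans T00 Tt)).
by rewrite (A_end rT Tt).
Qed.

(** The normalised images exhaust the plane, and only 0 is not a value on the
    punctured disks. *)
Lemma unbounded_type_IV : (forall B, exists2 t, T0 <= t & B < normalized_deriv t) -> type_IV d r f.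
Proof.
move=> unb; apply: (standard_of_map d1 rmono T00 rT hf dM Mi M0); first by right.
have ub B : exists n, B < chain_deriv gseq n.
  have [t Tt Bt] := unb B; have [n tn] := gseq_beyond t; exists n; apply: (lt_le_trans Bt).
  by rewrite chain_derivE; exact: normalized_deriv_le.
apply/seteqP; split => [_ [w wR <-]|v v0]; first exact: map_neq0.
have /gseq_union [v00|[w wR wv]] := chain_unbounded_cover gseq_univ gseq_sub ub v; last by exists w.
by move: v0; rewrite /punctured_plane /= v00 eqxx.
Qed.

(** The Moebius map followed by the limit of the rotated inverses is the
    normalising map; it sends 0 to 0, hence the punctured images onto the
    punctured disk. *)
Lemma bounded_type_II B : (forall t, T0 <= t -> normalized_deriv t <= B) -> type_II d r f.
Proof.
move=> bB; have bB' : exists B, forall n, chain_deriv gseq n <= B.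
  by exists B => n; rewrite chain_derivE; apply: bB; rewrite lerDl.
have inU w : chain_range r f w -> chain_union gseq (M w).
  by move=> wR; apply/gseq_union; right; exists w.
have U0 : chain_union gseq 0 by apply/gseq_union; left.
pose F v := chain_map gseq (M v).
have dC v : chain_union gseq v -> cdiff (chain_map gseq) v := @chain_map_cdiff R gseq gseq_univ gseq_sub bB' v.
have C0 : chain_map gseq 0 = 0 := chain_map0 gseq_univ gseq_sub bB'.
have Ci v w : chain_union gseq v -> chain_union gseq w -> chain_map gseq v = chain_map gseq w -> v = w.
  exact: (@chain_map_inj R gseq gseq_univ gseq_sub bB').
have CD : chain_map gseq @` chain_union gseq = D := chain_map_image gseq_univ gseq_sub bB'.
have dF v : chain_range r f v -> cdiff F v.
  by move=> vR; apply: (@cdiff_comp _ M (chain_map gseq)); [exact: dM|apply: dC; exact: inU].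
have Fi v w : chain_range r f v -> chain_range r f w -> F v = F w -> v = w.
  by move=> vR wR E; apply: Mi => //; apply: Ci => //; exact: inU.
have F0 t : T0 <= t -> tends0 (fun z => F (f t z)) 0.
  move=> Tt e e0; have [e1 e10 H1] := cdiff_ccont (dC 0 U0) e0.
  have [e2 e20 H2] := M0 Tt e10; exists e2 => // z /H2; rewrite subr0 => Hz.
  by have := H1 (M (f t z)); rewrite subr0 C0; apply.
apply: (standard_of_map d1 rmono T00 rT hf dF Fi F0); first by left.
apply/seteqP; split => [_ [w wR <-]|v vD'].
  apply/pdisk_udisk; split.
    by apply/eqP => E; move/eqP: (map_neq0 wR); apply; apply: Ci; rewrite ?C0 //; exact: inU.
  by rewrite -CD; exists (M w) => //; exact: inU.
have [v0 vD] := (pdisk_udisk v).1 vD'.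
move: vD; rewrite -CD => -[u /gseq_union uU uv].
case: uU => [u0|[w wR wu]]; first by move: v0; rewrite -uv u0 C0 eqxx.
by exists w => //; rewrite /F wu.
Qed.

End LoewnerTypes.

(** * Convergence of derivatives at the origin *)

Section DerivativeTools.
Variable R : realType.
Implicit Types (z w q c : R[i]).
Local Notation D := (@udisk R).
Local Notation D' := (@punctured_disk R).

(** The quotient [h z / z] extends to the disk with the value [h'(0)] at 0 and
    is bounded by [c] on the circle of radius 1/2, hence Lipschitz on that of
    radius 1/4 by [lip_disk], with constant [c * (1/2) / (1/4)^2 = 8 c]. *)
Lemma derivative_quotient (h : R[i] -> R[i]) (c : R) z : h 0 = 0 -> (forall z, D z -> cdiff h z) ->
  (forall z, cnorm z <= 1 / 2 -> cnorm (h z) <= c * cnorm z) -> 0 < cnorm z <= 1 / 4 ->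
  cnorm (h z / z - cderive h 0) <= 8 * c * cnorm z.
Proof.
move=> h0 dh hc /andP[z0 z1].
have [u [du uE hu]] := factor0 ltr01 h0 dh.
have z00 : z != 0 by rewrite -cnorm_gt0.
have half : 1 / 2 < 1 :> R by lra.
have uc w : cnorm w = 1 / 2 -> cnorm (u w) <= c.
  move=> w2; have w0 : 0 < cnorm w by rewrite w2 divr_gt0.
  have := hc w; rewrite w2 lexx => /(_ isT); rewrite uE cnormM -w2 mulrC ler_pM2r //.
have du' w : cnorm w <= 1 / 2 -> cdiff u w by move=> w2; apply: du; exact: le_lt_trans half.
have := @lip_disk R u (1 / 2) (1 / 4) c z 0 _ _ du' uc z1 _.
have -> : h z / z = u z by rewrite uE mulrAC mulfV // mul1r.
rewrite subr0 cnorm0 (cd_cderive hu).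
have -> : c * (1 / 2 / (1 / 2 - 1 / 4) ^+ 2) = 8 * c by field.
by apply; lra.
Qed.

(** The derivative is the value at 0 of the quotient by the coordinate. *)
Lemma derivative_bound (h : R[i] -> R[i]) (c : R) : h 0 = 0 -> (forall z, D z -> cdiff h z) ->
  (forall z, cnorm z <= 1 / 2 -> cnorm (h z) <= c * cnorm z) -> cnorm (cderive h 0) <= c.
Proof.
move=> h0 dh hc; have [u [du uE hu]] := factor0 ltr01 h0 dh.
rewrite (cd_cderive hu); apply: (@max_circle R u (1 / 2) c 0).
- by rewrite divr_gt0.
- by move=> w w2; apply: du; apply: le_lt_trans w2 _; lra.
- move=> w w2; have w0 : 0 < cnorm w by rewrite w2 divr_gt0.
  by have := hc w; rewrite w2 lexx => /(_ isT); rewrite uE cnormM -w2 mulrC ler_pM2r.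
- by rewrite cnorm0 divr_ge0.
Qed.

(** Pointwise convergence in the punctured disk forces convergence of the
    derivatives at 0 as long as the functions stay bounded. *)
Lemma derivative_limit (Dl : nat -> R[i] -> R[i]) (wt : nat -> R) (Q : R[i] -> R[i]) q N0 :
  (forall j, Dl j 0 = 0) -> (forall j z, D z -> cdiff (Dl j) z) ->
  (forall j z, (N0 <= j)%N -> cnorm z <= 1 / 2 -> cnorm (Dl j z) <= wt j * cnorm z) ->
  (forall z, D' z -> forall e : R, 0 < e -> exists N, forall j, (N <= j)%N -> cnorm (Dl j z - Q z) < e) ->
  tends0 (fun z => Q z / z) q ->
  forall e B : R, 0 < e -> exists N, forall j, (N <= j)%N -> wt j <= B ->
    cnorm (cderive (Dl j) 0 - q) <= e.
Proof.
move=> D0 dD Dw DQ Qq e B e0.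
have e3 : 0 < e / 3 by rewrite divr_gt0.
have [d d0 Hd] := Qq _ e3.
have B1 : 0 < 24 * (`|B| + 1) by rewrite mulr_gt0 // ltr_wpDl.
pose t := Num.min (Num.min (d / 2) (1 / 4)) (e / (24 * (`|B| + 1))).
have t0 : 0 < t by rewrite !lt_min !divr_gt0.
have : t <= t by []. 
rewrite {2}/t !le_min => /andP[/andP[td t4] tB]; clearbody t.
have nt : cnorm (t%:C : R[i]) = t by rewrite cnorm_real gtr0_norm.
have tn0 : (t%:C : R[i]) != 0 by rewrite -cnorm_gt0 nt.
have tD : D' t%:C by rewrite /punctured_disk /annulus /= nt t0 /=; move: t4; clear; lra.
have te : 0 < t * (e / 3) by rewrite mulr_gt0.
have [N HN] := DQ _ tD _ te.
exists (maxn N N0) => j Nj wB.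
have Nj0 := leq_trans (leq_maxr _ _) Nj.
have h1 := @derivative_quotient (Dl j) (wt j) t%:C (D0 j) (dD j) (fun z => Dw j z Nj0).
rewrite nt t0 t4 in h1; have {}h1 := h1 isT.
have h2 := HN j (leq_trans (leq_maxl _ _) Nj).
have h3 := Hd t%:C; rewrite nt t0 /= in h3; have {}h3 := h3 ltac:(by move: td d0; clear; lra).
have h2' : cnorm (Dl j t%:C / t%:C - Q t%:C / t%:C) <= e / 3.
  by rewrite -mulrBl cnormM cnormV nt ler_pdivrMr // mulrC ltW.
have h1' : 8 * wt j * t <= e / 3.
  move: tB; rewrite ler_pdivlMr // => tB.
  have : wt j * t <= `|B| * t by rewrite ler_pM2r // (le_trans wB) // ler_norm.
  by move: tB t0; clear; lra.
apply: le_trans (cdist_triangle _ _ (Q t%:C / t%:C)) _.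
apply: le_trans (lerD (cdist_triangle _ _ (Dl j t%:C / t%:C)) (lexx _)) _.
rewrite (cnormC (cderive _ _)).
by move: h1 h1' h2' h3; clear; lra.
Qed.

Lemma cd_plog1 : cd (@plog R) 1 1.
Proof.
have r1 : 0 < complex.Re (1 : R[i]) by rewrite ltr01.
have [l Hl] := plog_cdiff r1.
have H := cd_comp Hl (cd_cexp (plog 1)); rewrite cexp_plog // mul1r in H.
suff E : 1 = l :> R[i] by rewrite -E in Hl.
apply: (cd_uniq _ H); apply: (@cd_near _ id); last exact: cd_id.
exists 1 => // w w1; rewrite cexp_plog //.
have := le_lt_trans (Re_le_cnorm _) w1; rewrite ReD ReN /= ltr_norml => /andP[h _].
by move: h; clear; lra.
Qed.

(** The estimate is uniform in the increment [w]: it depends only on the size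
    of [h w]. This is what allows [w] to vary with the index in
    [log_increment]. *)
Lemma ln_slope (e : R) : 0 < e -> exists2 d : R, 0 < d & forall (h : R) w, 0 < h ->
  h * cnorm w < d -> `|h^-1 * ln (cnorm (1 + h%:C * w)) - complex.Re w| <= e * cnorm w.
Proof.
move=> e0; have [d d0 Hd] := cd_plog1 e0; exists d => // h w h0 hw.
have nh : cnorm (h%:C * w) = h * cnorm w by rewrite cnormM cnorm_real gtr0_norm.
have := Hd (1 + h%:C * w); rewrite addrAC subrr add0r nh => /(_ hw).
move=> /(le_trans (Re_le_cnorm _)).
rewrite mul1r !ReD !ReN [complex.Re (plog 1)]/= cnorm1 ln1 subr0 [complex.Re (plog _)]/=.
have -> : complex.Re (h%:C * w) = h * complex.Re w by rewrite ReZ.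
move=> H; rewrite -(ler_pM2l h0); rewrite -[X in X * `|_|](gtr0_norm h0) -normrM mulrBr.
by rewrite mulVKf ?gt_eqF // mulrCA.
Qed.

End DerivativeTools.

(** * The logarithm of the derivative at the puncture *)

#[local] Opaque normalized_deriv.

Lemma ln_diff_le (R : realType) (a x y k : R) : 0 < a -> a <= x -> x <= y -> y - x <= k ->
  ln y - ln x <= k / a.
Proof.
move=> a0 ax xy yk; have x0 := lt_le_trans a0 ax; have y0 := lt_le_trans x0 xy.
rewrite -(ln_div y0 x0); have -> : y / x = 1 + (y - x) / x by field; rewrite gt_eqF.
have q0 : 0 <= (y - x) / x by rewrite divr_ge0 ?subr_ge0 // ltW.
apply: le_trans (le_ln1Dx _) _; first by apply: lt_le_trans q0; rewrite ltrN10.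
apply: (@le_trans _ _ ((y - x) / a)); first by rewrite ler_wpM2l ?subr_ge0 // lef_pV2 ?posrE.
by rewrite ler_pM2r // invr_gt0.
Qed.

Lemma half_lower (R : realType) (u v w : R) : u - v <= w -> w < u / 2 -> u / 2 <= v.
Proof. by lra. Qed.

Lemma ratio_increment (F : fieldType) (u v : F) : u != 0 -> 1 + (v - u) / u = v / u.
Proof. by move=> u0; field. Qed.

Lemma ratio_shift (F : fieldType) (u v c : F) : u != 0 -> v / u + c = (v - - c * u) / u.
Proof. by move=> u0; field. Qed.

Section LogDerivative.
Variable R : realType.
Notation mu := (@completed_lebesgue_measure R).
Notation LR := (lebesgueR R).
Variables (d : \bar R) (r : R -> R) (f : R -> R[i] -> R[i]) (T0 : R).
Local Notation D := (@udisk R).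
Local Notation D' := (@punctured_disk R).

Hypothesis d1 : (1 <= d)%E.
Hypothesis rmono : forall s t, 0 <= s -> s <= t -> r t <= r s.
Hypothesis T00 : 0 <= T0.
Hypothesis rT : forall t, T0 <= t -> r t = 0.
Hypothesis hf : loewner_chain d r f.

Variable M : R[i] -> R[i].
Hypothesis dM : forall v, chain_range r f v -> cdiff M v.
Hypothesis Mi : forall v w, chain_range r f v -> chain_range r f w -> M v = M w -> v = w.
Hypothesis M0 : forall t, T0 <= t -> tends0 (fun z => M (f t z)) 0.

Variable G : R[i] -> R -> R[i].
Hypothesis hG : associated_vector_field d r f G.
Variable rho : R -> R.
Hypothesis hrho : forall t, 0 <= t -> r t < rho t < 1.

Local Notation g := (normalized f M).
Local Notation b := (normalized_deriv f M).

Let ug t : T0 <= t -> univ0 (g t) := normalized_univ T00 rT hf dM Mi M0 (t := t).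
Let b_le s t : T0 <= s -> s <= t -> b s <= b t := normalized_deriv_le T00 rT hf dM Mi M0 (s := s) (t := t).

Lemma b_gt0 t : T0 <= t -> 0 < b t.
Proof. by move=> Tt; rewrite normalized_derivE cnorm_gt0; apply: univ0_deriv; exact: ug. Qed.

Lemma cd_diff x y : T0 <= x -> T0 <= y ->
  cd (fun z => g y z - g x z) 0 (cderive (g y) 0 - cderive (g x) 0).
Proof.
move=> Tx Ty; have [dx _ _] := ug Tx; have [dy _ _] := ug Ty.
by apply: cdB; apply: cdiff_cd; [apply: dy|apply: dx]; exact: udisk0.
Qed.

(** Regularity in time on the circle of radius 1/2 alone suffices: by
    Schwarz's lemma the bound on [g y - g x] there extends to the disk inside
    with the factor [|z|], and bounds the derivative at 0; the bound for the
    logarithm follows, [b] being bounded below by [b s]. *)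
Lemma normalized_control s t : T0 <= s -> s < t -> exists2 K, control s t K &
  forall x y, s <= x -> x <= y -> y <= t ->
    (forall z, cnorm z <= 1 / 2 -> cnorm (g y z - g x z) <= (K y - K x) * cnorm z) /\
    ln (b y) - ln (b x) <= K y - K x.
Proof.
move=> Ts st; have s0 : 0 <= s := le_trans T00 Ts.
have KA : [set z : R[i] | 1 / 2 <= cnorm z <= 1 / 2] `<=` annulus (r s).
  rewrite rT // => z /andP[h1 h2]; apply/andP; split.
    by apply: lt_le_trans h1; rewrite divr_gt0.
  by apply: le_lt_trans h2 _; rewrite ltr_pdivrMr // mul1r ltr1n.
have cK := @ring_compact R (1 / 2) (1 / 2) (divr_ge0 ler01 (ler0n _ 2)).
have [_ [ka [_ _ cka _ H]]] := loewner_control d1 hf s0 st cK KA.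
have [hka _ _] := cka.
have [C C0 HC] := h_control d1 rmono T00 rT hf dM s0 st cK KA hka H.
pose C3 := 2 * C + 2 * C / b s.
have bs := b_gt0 Ts.
have C30 : 0 <= C3 by rewrite addr_ge0 // ?divr_ge0 ?mulr_ge0 // ltW.
exists (fun x => C3 * ka x); first exact: control_scale.
move=> x y sx xy yt; have Tx := le_trans Ts sx; have Ty := le_trans Tx xy.
have kxy : 0 <= ka y - ka x by rewrite subr_ge0 hka.
have B z : cnorm z <= 1 / 2 -> cnorm (g y z - g x z) <= 2 * C * (ka y - ka x) * cnorm z.
  move=> z2; have [dx _ gx0] := ug Tx; have [dy _ gy0] := ug Ty.
  have h12 : 1 / 2 < 1 :> R by rewrite ltr_pdivrMr // mul1r ltr1n.
  have h0 : 0 < 1 / 2 :> R by rewrite divr_gt0.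
  have := @schwarz_circle R (fun z => g y z - g x z) (1 / 2) 1 (C * (ka y - ka x)) z h0 h12.
  rewrite gx0 gy0 subrr => /(_ erefl) H1.
  have -> : 2 * C * (ka y - ka x) = C * (ka y - ka x) / (1 / 2) by field.
  apply: H1 => // w w1.
    by apply: cdiffB; [exact: dy|exact: dx].
  have w0 : w != 0 by rewrite -cnorm_gt0 w1.
  rewrite /normalized !ext0E // cnormC; apply: HC => //=.
  by rewrite w1 lexx.
rewrite -mulrBr; split.
  move=> z z2; apply: le_trans (B z z2) _; rewrite ler_wpM2r ?cnorm_ge0 //.
  by rewrite ler_wpM2r // lerDl divr_ge0 ?mulr_ge0 // ltW.
have dB : cnorm (cderive (g y) 0 - cderive (g x) 0) <= 2 * C * (ka y - ka x).
  rewrite -(cd_cderive (cd_diff Tx Ty)); have [dx _ gx0] := ug Tx; have [dy _ gy0] := ug Ty.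
  apply: derivative_bound => //; first by rewrite gx0 gy0 subrr.
  by move=> z zD; apply: cdiffB; [exact: dy|exact: dx].
have dB2 : b y - b x <= 2 * C * (ka y - ka x) by rewrite !normalized_derivE; apply: le_trans dB; exact: cnorm_sub_ge.
apply: (@le_trans _ _ (2 * C / b s * (ka y - ka x))); last first.
  by rewrite ler_wpM2r // lerDr mulr_ge0.
by rewrite mulrAC; exact: (ln_diff_le bs (b_le Ts sx) (b_le Tx xy) dB2).
Qed.

Definition increment x j z : R[i] := ((stp R j)^-1)%:C * (g (x + stp R j) z - g x z).

(** The Loewner equation at the time [x]; it holds for almost every time. *)
Definition vf_limit x := forall z, annulus (r x) z ->
  (((h^-1)%:C * (f (h + x) z - f x z) : R[i]^o) @[h --> 0^'] -->
     (- G z x * cderive (f x) z : R[i]^o)).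

(** The chain rule for [M o f] along the times [x + stp j], in slope form. *)
Lemma increment_limit x z : T0 <= x -> vf_limit x -> D' z -> forall e : R, 0 < e ->
  exists N, forall j, (N <= j)%N -> cnorm (increment x j z - (- G z x * cderive (g x) z)) < e.
Proof.
move=> Tx vx zD; have x0 : 0 <= x := le_trans T00 Tx.
have zA : annulus (r x) z by rewrite rT.
have z0 := pdisk_neq0 zD.
pose v j := f (x + stp R j) z; pose v0 := f x z.
have [l Ml] : cdiff M v0 by apply: dM; exact: chain_range_mem.
have gl : cderive (g x) z = l * cderive (f x) z.
  apply: cd_cderive; apply: (@cd_near _ (fun z => M (f x z))).
    exists (cnorm z); first by rewrite cnorm_gt0.
    move=> w wz; rewrite /normalized ext0E //; apply/eqP => w0.
    by move: wz; rewrite w0 sub0r cnormN ltxx.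
  by apply: cd_comp Ml; apply: cdiff_cd; exact: (f_cdiff hf).
have [q [cq ql [del del0 Hq]]] := (cd_slope _ _ _).1 Ml.
pose a j : R[i] := ((stp R j)^-1)%:C * (v j - v0).
have ca : (a j : R[i]^o) @[j --> \oo] --> (- G z x * cderive (f x) z : R[i]^o).
  apply: cvg_trans (cvg_comp _ _ (@stp_dnbhs R) (vx z zA)).
  by apply: near_eq_cvg; near=> j; rewrite /a /v /v0 /= [stp R j + x]addrC.
have cs : ((stp R j)%:C : R[i]^o) @[j --> \oo] --> (0 : R[i]^o).
  apply/cvg_cP => e e0; near=> j; rewrite subr0 cnorm_real gtr0_norm ?stp_gt0 //.
  by near: j; apply: (@cvgr_lt R _ _ _ _ 0 (@stp_cvg0 R)).
have sn0 j : (stp R j)%:C != 0 :> R[i].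
  by rewrite -cnorm_gt0 cnorm_real gtr0_norm stp_gt0.
have va j : v j = v0 + (stp R j)%:C * a j.
  by rewrite /a mulrA -rmorphM /= mulfV ?gt_eqF ?stp_gt0 // mul1r addrC subrK.
have cv : (v j : R[i]^o) @[j --> \oo] --> (v0 : R[i]^o).
  rewrite -[X in _ --> X]addr0 -[X in _ --> _ + X](mul0r (- G z x * cderive (f x) z)).
  apply: cvg_trans (cvgD (cvg_cst (v0 : R[i]^o)) (cvgM cs ca)).
  by apply: near_eq_cvg; near=> j; rewrite va.
have cqv : (q (v j) : R[i]^o) @[j --> \oo] --> (l : R[i]^o).
  apply/cvg_cP => e e0; have [d' d'0 Hd] := cq e e0; near=> j; rewrite -ql; apply: Hd.
  by near: j; move/cvg_cP: cv => cv; exact: cv.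
have cm : (a j * q (v j) : R[i]^o) @[j --> \oo] --> (- G z x * cderive (f x) z * l : R[i]^o).
  exact: (cvgM ca cqv).
move=> e e0; have /cvg_cP /(_ e e0) H1 := cm; have /cvg_cP /(_ del del0) H2 := cv.
have : \forall j \near \oo, cnorm (increment x j z - (- G z x * cderive (g x) z)) < e.
  near=> j.
  have h1 : cnorm (a j * q (v j) - - G z x * cderive (f x) z * l) < e by near: j; exact: H1.
  have h2 : cnorm (v j - v0) < del by near: j; exact: H2.
  suff -> : increment x j z = a j * q (v j) by rewrite gl; move: h1; rewrite -mulrA (mulrC l).
  rewrite /increment /normalized !ext0E // -/(v j) (Hq _ h2) addrAC subrr add0r.
  by rewrite /a -mulrA [q _ * _]mulrC.
by move=> [N _ HN]; exists N => j Nj; exact: HN.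
Unshelve. all: by end_near.
Qed.

Lemma increment_cd x j : T0 <= x ->
  cd (increment x j) 0 (((stp R j)^-1)%:C * (cderive (g (x + stp R j)) 0 - cderive (g x) 0)).
Proof.
move=> Tx; apply: cdZ; apply: cd_diff => //.
by rewrite (le_trans Tx) // lerDl ltW // stp_gt0.
Qed.

Section AtTime.
Variables (x t : R) (K : R -> R).
Hypothesis Tx : T0 <= x.
Hypothesis xt : x < t.
Hypothesis KD : forall y, x <= y -> y <= t ->
  forall z, cnorm z <= 1 / 2 -> cnorm (g y z - g x z) <= (K y - K x) * cnorm z.
Hypothesis vx : vf_limit x.
Hypothesis Gx : holomorphic_on (annulus (r x)) (fun z => G z x).
Hypothesis often : exists B : R, forall N, exists2 j, (N <= j)%N & dq K j x <= B.

Let xs j : x <= x + stp R j. Proof. by rewrite lerDl ltW // stp_gt0. Qed.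

Lemma increment_le : exists N, forall j z, (N <= j)%N -> cnorm z <= 1 / 2 ->
  cnorm (increment x j z) <= dq K j x * cnorm z.
Proof.
have : \forall j \near \oo, stp R j <= t - x.
  by apply: (@cvgr_le R _ _ _ _ 0 (@stp_cvg0 R)); rewrite subr_gt0.
move=> [N _ HN]; exists N => j z Nj z2; have := HN j Nj; rewrite /= lerBrDl => xjt.
have s0 := stp_gt0 R j.
rewrite /increment cnormM cnorm_real gtr0_norm ?invr_gt0 // /dq -mulrA ler_pM2l ?invr_gt0 //.
exact: KD.
Qed.

Let Q z := - G z x * cderive (g x) z.

(** The bound of [increment_le] passes to the limit along the indices at which
    the difference quotients of [K] are bounded. *)
Lemma vf_bound : exists2 B : R, 0 <= B & forall z, D' z -> cnorm z <= 1 / 2 -> cnorm (Q z) <= B * cnorm z.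
Proof.
have [B HB] := often; have [N0 HN0] := increment_le; exists (Num.max B 0); first by rewrite le_max lexx orbT.
move=> z zD z2; apply/ler_addgt0Pr => e e0.
have [N1 HN1] := increment_limit Tx vx zD e0.
have [j Nj Bj] := HB (maxn N0 N1).
have h1 := HN0 j z (leq_trans (leq_maxl _ _) Nj) z2.
have h2 := HN1 j (leq_trans (leq_maxr _ _) Nj).
have h3 := cnorm_sub_ge (Q z) (increment x j z); rewrite cnormC in h3.
have h4 : dq K j x * cnorm z <= Num.max B 0 * cnorm z.
  by rewrite ler_wpM2r ?cnorm_ge0 // le_max Bj.
move: h1 h2 h3 h4; rewrite -/(Q z); lra.
Qed.

Lemma derivative_cont : ccont (cderive (g x)) 0.
Proof.
have [dx _ _] := ug Tx; apply: cdiff_ccont; apply: (@cdiff_cderive _ _ 0 1) => // z.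
by rewrite subr0; exact: dx.
Qed.

Let p z := G z x / z.

Lemma quotient_cdiff z : D' z -> cdiff p z.
Proof.
move=> zD; apply: cdiffM; last by apply: cdiffV; [exact: pdisk_neq0|exact: cdiff_id].
by move/hol_cdiff: Gx; apply; rewrite rT.
Qed.

(** [G(z, x) / z] is bounded near the puncture by [vf_bound], since the
    derivative of [g x] does not vanish at 0. *)
Lemma quotient_limit : exists c, tends0 p c.
Proof.
have [B B0 HB] := vf_bound.
have bx : 0 < cnorm (cderive (g x) 0) by rewrite -normalized_derivE b_gt0.
have b2 : 0 < cnorm (cderive (g x) 0) / 2 by rewrite divr_gt0.
have [del del0 Hd] := derivative_cont b2.
have m0 : 0 < Num.min del (1 / 2) by rewrite lt_min del0 divr_gt0.
apply: (@bounded_tends0 _ p (B / (cnorm (cderive (g x) 0) / 2)) _ m0 quotient_cdiff).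
move=> z; rewrite lt_min => /andP[z0 /andP[zd z2]].
have zD : D' z.
  by rewrite /punctured_disk /annulus /= z0 /= (lt_trans z2) // ltr_pdivrMr // mul1r ltr1n.
have h1 := HB z zD (ltW z2).
have h2 := Hd z; rewrite subr0 in h2; have {}h2 := h2 zd.
have h3 := cnorm_sub_ge (cderive (g x) 0) (cderive (g x) z); rewrite cnormC in h3.
have h4 : cnorm (cderive (g x) 0) / 2 <= cnorm (cderive (g x) z) by exact: half_lower h3 h2.
rewrite /p cnormM cnormV; rewrite /Q cnormM cnormN in h1.
rewrite ler_pdivrMr // mulrAC ler_pdivlMr //; apply: le_trans h1.
by rewrite ler_wpM2l ?cnorm_ge0.
Qed.

(** The mean value property for the extension over the puncture. *)
Lemma quotient_mean c : tends0 p c -> c = circle_mean (rho x) p.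
Proof.
move=> pc; rewrite circle_meanE.
have /andP[r1 r2] := hrho (le_trans T00 Tx); rewrite rT // in r1.
have dE z : D z -> cdiff (ext0 c p) z := ext0_cdiff quotient_cdiff pc (z := z).
transitivity (ext0 c p 0); first by rewrite ext00.
rewrite (@mean_value _ (ext0 c p) (rho x) r1).
  apply: cmean_eq; first exact: ltW.
  by move=> z zr; rewrite ext0E // -cnorm_gt0 zr.
by move=> z zr; apply: dE; exact: le_lt_trans r2.
Qed.

(** At indices with bounded [dq K] the derivatives at 0 of the increments of
    the chain are close to [- c (g x)'(0)] by [derivative_limit]; the
    logarithm of the modulus turns a relative increment of the derivative into
    its real part. *)
Lemma log_increment c : tends0 p c -> forall e B : R, 0 < e ->
  exists N, forall j, (N <= j)%N -> dq K j x <= B ->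
    `|dq (fun y => ln (b y)) j x - - complex.Re c| <= e.
Proof.
move=> pc e B e0.
have bx : 0 < cnorm (cderive (g x) 0) by rewrite -normalized_derivE b_gt0.
have gx0 : cderive (g x) 0 != 0 by rewrite -cnorm_gt0.
have Qc : tends0 (fun z => Q z / z) (- c * cderive (g x) 0).
  have cc : ccont (fun z => - ext0 c p z * cderive (g x) z) 0.
    by apply: ccontM; [apply: ccontN; exact: ext0_ccont|exact: derivative_cont].
  move=> e' e'0; have [del del0 Hd] := cc e' e'0; exists del => // z /andP[z0 zd].
  have := Hd z; rewrite subr0 ext00 => /(_ zd); rewrite ext0E -?cnorm_gt0 //.
  by rewrite /Q /p mulrAC !mulNr.
have [N0 HN0] := increment_le.
have inc0 j : increment x j 0 = 0.
  by rewrite /increment /normalized !ext00 subrr mulr0.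
have dinc j z : D z -> cdiff (increment x j) z.
  move=> zD; have [dx _ _] := ug Tx; have [dy _ _] := ug (le_trans Tx (xs j)).
  by apply: cdiffM; [exact: cdiff_cst|apply: cdiffB; [exact: dy|exact: dx]].
pose m := cnorm c + 1.
have m0 : 0 < m by rewrite ltr_wpDl ?cnorm_ge0.
pose e1 := Num.min (e / 2) 1.
have e10 : 0 < e1 by rewrite lt_min divr_gt0 ?ltr01.
have e1b : 0 < e1 * cnorm (cderive (g x) 0) by rewrite mulr_gt0.
have [N1 HN1] := derivative_limit inc0 dinc HN0 (fun z zD e' e'0 => increment_limit Tx vx zD e'0) Qc B e1b.
have e2 : 0 < e / 2 / m by rewrite !divr_gt0.
have [del del0 Hln] := ln_slope e2.
have [N2 HN2] : exists N, forall j, (N <= j)%N -> stp R j < del / m.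
  have : \forall j \near \oo, stp R j < del / m.
    by apply: (@cvgr_lt R _ _ _ _ 0 (@stp_cvg0 R)); rewrite divr_gt0.
  by move=> [N _ HN]; exists N => j Nj; exact: HN.
exists (maxn N1 N2) => j Nj kB.
have h1 := HN1 j (leq_trans (leq_maxl _ _) Nj) kB.
have h2 := HN2 j (leq_trans (leq_maxr _ _) Nj).
have s0 := stp_gt0 R j.
pose W := cderive (increment x j) 0 / cderive (g x) 0.
have WE : 1 + (stp R j)%:C * W = cderive (g (x + stp R j)) 0 / cderive (g x) 0.
  rewrite /W (cd_cderive (increment_cd j Tx)) mulrA mulrA -rmorphM /= mulfV ?gt_eqF // mul1r.
  exact: ratio_increment.
have Wc : cnorm (W + c) <= e1.
  have -> : W + c = (cderive (increment x j) 0 - - c * cderive (g x) 0) / cderive (g x) 0.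
    exact: ratio_shift.
  by rewrite cnormM cnormV ler_pdivrMr.
have [e1l e11] : e1 <= e / 2 /\ e1 <= 1 by rewrite /e1 !ge_min !lexx orbT.
have Wm : cnorm W <= m.
  rewrite /m -lerBlDl.
  have := cnorm_sub_ge W (- c); rewrite opprK cnormN => h.
  exact: le_trans h (le_trans Wc e11).
have hW : stp R j * cnorm W < del.
  by apply: (@le_lt_trans _ _ (stp R j * m)); [rewrite ler_pM2l|rewrite -ltr_pdivlMr].
have h3 := Hln (stp R j) W s0 hW.
have bE : ln (cnorm (1 + (stp R j)%:C * W)) = ln (b (x + stp R j)) - ln (b x).
  rewrite WE cnormM cnormV !normalized_derivE.
  have by_ := b_gt0 (le_trans Tx (xs j)); rewrite normalized_derivE in by_.
  exact: (ln_div by_ bx).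
rewrite bE in h3.
have h4 : e / 2 / m * cnorm W <= e / 2.
  by rewrite mulrAC ler_pdivrMr // ler_pM2l ?divr_gt0.
have h5 : `|complex.Re W + complex.Re c| <= e / 2.
  by rewrite -ReD (le_trans (Re_le_cnorm _)) // (le_trans Wc).
have {}h3 : `|dq (fun y => ln (b y)) j x - complex.Re W| <= e / 2 := le_trans h3 h4.
have -> : dq (fun y => ln (b y)) j x - - complex.Re c =
  (dq (fun y => ln (b y)) j x - complex.Re W) + (complex.Re W + complex.Re c) by rewrite opprK addrA subrK.
by rewrite (le_trans (ler_normD _ _)) // [e]splitr lerD.
Qed.

End AtTime.

Definition mean_vf x : R := complex.Re (circle_mean (rho x) (fun w => G w x / w)).

(** [ac_ftc] for [ln b] with derivative [- mean_vf]. The sign of the mean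
    follows from [b] being nondecreasing, once more along the indices with
    bounded difference quotients. *)
Lemma log_integral s t : T0 <= s -> s < t ->
  [/\ mu.-integrable `[s, t] (EFin \o ((fun x => - mean_vf x) : LR -> R)),
      (\int[mu]_(x in `[s, t]) (- mean_vf x)%:E = (ln (b t) - ln (b s))%:E)%E &
      {ae mu, forall x : LR, s < x < t -> mean_vf x <= 0}].
Proof.
move=> Ts st; have [K cK HK] := normalized_control Ts st.
have [[_ hol _] aeG] := hG.
have lnb x y : T0 <= x -> x <= y -> ln (b x) <= ln (b y).
  move=> Tx xy; rewrite ler_ln ?posrE; [exact: b_le|exact: b_gt0|].
  by apply: b_gt0; exact: le_trans xy.
have key : {ae mu, forall x : LR, s < x < t ->
    (exists B : R, forall N, exists2 j, (N <= j)%N & dq K j x <= B) /\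
    forall e B : R, 0 < e -> exists N, forall j, (N <= j)%N -> dq K j x <= B ->
      `|dq (fun y => ln (b y)) j x - - mean_vf x| <= e}.
  have aeB := dq_bounded_often st cK.
  have FF := ae_filter_ringOfSetsType (completed_lebesgue_measure : {measure set LR -> \bar R}).
  move: aeG aeB; apply: filterS2 => x /= vx often xst; have /andP[sx xt] := xst.
  have Tx : T0 <= x := le_trans Ts (ltW sx); have x0 : 0 <= x := le_trans T00 Tx.
  have {}vx : vf_limit x := vx x0; have {}often := often xst.
  have KD y : x <= y -> y <= t -> forall z, cnorm z <= 1 / 2 -> cnorm (g y z - g x z) <= (K y - K x) * cnorm z.
    by move=> xy yt; have [] := HK x y (ltW sx) xy yt.
  have Gx := hol x x0; split => //.
  have [c pc] := quotient_limit Tx xt KD vx Gx often.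
  have := log_increment Tx xt KD vx pc.
  by rewrite (quotient_mean Tx Gx pc).
have [iN eN] : mu.-integrable `[s, t] (EFin \o ((fun x => - mean_vf x) : LR -> R)) /\
   (\int[mu]_(x in `[s, t]) (- mean_vf x)%:E = (ln (b t) - ln (b s))%:E)%E.
  apply: (ac_ftc (y := fun x => ln (b x)) st cK).
  - move=> x y sx xy yt; have [_ h] := HK x y sx xy yt; rewrite ger0_norm // subr_ge0.
    by apply: lnb => //; exact: le_trans sx.
  - by move=> x y sx xy yt; apply: lnb => //; exact: le_trans sx.
  - by apply: filterS key => x H xst; have [] := H xst.
split => //; apply: filterS key => x H xst; have [[B HB] H2] := H xst.
have /andP[sx xt] := xst; have Tx : T0 <= x := le_trans Ts (ltW sx).
rewrite -oppr_ge0; apply/ler_addgt0Pr => e e0; have [N HN] := H2 e B e0.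
have [j Nj kB] := HB N.
have := HN j Nj kB; rewrite ler_norml => /andP[_].
have : 0 <= dq (fun y => ln (b y)) j x.
  rewrite /dq mulr_ge0 ?invr_ge0 ?(ltW (stp_gt0 R j)) // subr_ge0; apply: lnb => //.
  by rewrite lerDl ltW // stp_gt0.
by generalize (dq (fun y => ln (b y)) j x) (mean_vf x) => u v; lra.
Qed.

End LogDerivative.

(** * Means of the vector field as functions of time *)

Section RiemannSums.
Variable R : realType.
Implicit Types (F : R[i] -> R[i]).

Lemma expi_near (e : R) : 0 < e -> exists2 d : R, 0 < d & forall x y : R, `|x - y| < d ->
  cnorm (expi x - expi y) < e.
Proof.
move=> e0; have H : rcont (fun x : R => 1%:C * expi x) 0.
  apply: (@circle_rcont R id 1 0) => //; exact: (cdiff_ccont (cdiff_id _)).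
have [d d0 Hd] := H e e0; exists d => // x y xy.
have -> : expi x - expi y = expi y * (expi (x - y) - expi 0).
  by rewrite mulrBr -!expiD addr0 [y + _]addrC subrK.
rewrite cnormM cnorm_expi mul1r; have := Hd (x - y); rewrite subr0 => /(_ xy).
by rewrite !mul1r.
Qed.

Lemma circle_uniform F (rho e : R) : 0 < rho -> circ_cont rho F -> 0 < e ->
  exists2 d : R, 0 < d & forall x y : R, `|x - y| < d ->
    cnorm (F (rho%:C * expi x) - F (rho%:C * expi y)) <= e.
Proof.
move=> r0 cF e0.
have [d d0 Hd] : exists2 d : R, 0 < d & forall z, (rho <= cnorm z <= rho) ->
    (rho <= cnorm z <= rho) -> forall w, cnorm w = rho -> cnorm (w - z) < d -> cnorm (F w - F z) <= e.
  apply: (@compact_uniform R [set z | rho <= cnorm z <= rho] (fun d z => rho <= cnorm z <= rho ->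
     forall w, cnorm w = rho -> cnorm (w - z) < d -> cnorm (F w - F z) <= e)).
    by apply: ring_compact; exact: ltW.
  move=> z0 z0r; have nz0 : cnorm z0 = rho by apply: le_anti; rewrite andbC.
  have e2 : 0 < e / 2 by rewrite divr_gt0.
  have [d d0 Hd] := cF z0 nz0 _ e2.
  have d2 : 0 < d / 2 by rewrite divr_gt0.
  exists (d / 2) => // d' z d'0 d'd zz0 zr w wr wz.
  have dd : d / 2 < d by move: d0; clear; lra.
  have h1 := Hd z (lt_trans zz0 dd).
  have h2 : cnorm (w - z0) < d.
    by apply: le_lt_trans (cdist_triangle _ _ z) _; move: zz0 wz d'd; clear; lra.
  have h3 := Hd w h2; apply: le_trans (cdist_triangle _ _ (F z0)) _.
  by rewrite (cnormC (F z0)); move: h1 h3; clear; lra.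
have dr : 0 < d / rho by rewrite divr_gt0.
have [d' d'0 Hd'] := expi_near dr; exists d' => // x y xy.
have yr : rho <= cnorm (rho%:C * expi y) <= rho by rewrite cnorm_circle ?lexx // ltW.
apply: (Hd _ yr yr); first by rewrite cnorm_circle // ltW.
rewrite -mulrBr cnormM cnorm_real gtr0_norm // mulrC -ltr_pdivlMr //.
exact: Hd'.
Qed.

(** Means over a circle are limits of these sums, which involve only finitely
    many points of the plane; this is how measurability of the mean in time
    follows from that of the vector field at each point. *)
Definition riemann (rho : R) F (n : nat) : R[i] :=
  (n.+1%:R^-1)%:C * \sum_(k < n.+1) F (rho%:C * expi (2 * pi * k%:R / n.+1%:R)).

Lemma riemann_cvg F (rho e : R) : 0 < rho -> circ_cont rho F -> 0 < e ->
  exists N, forall n, (N <= n)%N -> cnorm (cmean rho F - riemann rho F n) <= e.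
Proof.
move=> r0 cF e0; have [d d0 Hd] := circle_uniform r0 cF e0.
pose phi x := F (rho%:C * expi x).
have cphi (a b : R) : contI a b phi.
  by move=> x _; apply: circle_rcont => //; apply: cF; rewrite cnorm_circle // ltW.
have [N HN] : exists N : nat, forall n, (N <= n)%N -> 2 * pi / n.+1%:R < d.
  have H := @nbhs_infty_ger R (2 * pi / d); case: H => N _ HN; exists N => n Nn.
  rewrite ltr_pdivrMr ?ltr0Sn // [d * _]mulrC -ltr_pdivrMr //.
  by apply: le_lt_trans (HN n Nn) _; rewrite ltr_nat.
exists N => n Nn; have hd := HN n Nn; set h := 2 * pi / n.+1%:R in hd.
have n0 : 0 < n.+1%:R :> R by rewrite ltr0Sn.
have h0 : 0 < h by rewrite divr_gt0 // pi2_gt0.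
have step k : cnorm (cint 0 (k%:R * h) phi - h%:C * \sum_(i < k) phi (i%:R * h)) <= e * (k%:R * h).
  elim: k => [|k IH].
    rewrite mul0r mulr0 big_ord0 mulr0 subr0.
    have := @cint_norm R 0 0 phi (cnorm (phi 0)) (lexx 0) (cphi 0 0); rewrite subrr mulr0; apply.
    by move=> x /le_anti <-.
  have kh0 : 0 <= k%:R * h by rewrite mulr_ge0 // ltW.
  have kh1 : k%:R * h <= k.+1%:R * h by rewrite ler_pM2r // ler_nat.
  have hE : k.+1%:R * h - k%:R * h = h by rewrite -mulrBl -natrB // subSnn mul1r.
  have ksplit : 0 <= k%:R * h <= k.+1%:R * h by rewrite kh0.
  rewrite (cint_split ksplit (cphi _ _)) big_ord_recr /= mulrDr.
  have piece : cnorm (cint (k%:R * h) (k.+1%:R * h) phi - h%:C * phi (k%:R * h)) <= e * h.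
    set c := phi (k%:R * h).
    have -> : cint (k%:R * h) (k.+1%:R * h) phi =
        cint (k%:R * h) (k.+1%:R * h) (fun x => phi x + - c) + cint (k%:R * h) (k.+1%:R * h) (fun=> c).
      rewrite -cintD; [|by move=> x xI; apply: rcontD; [exact: cphi xI|exact: rcont_cst]|by move=> x _; exact: rcont_cst].
      by apply: cint_eq => x _; rewrite subrK.
    rewrite (cint_cst _ kh1) hE [c * _]mulrC addrK.
    have := @cint_norm R _ _ (fun x => phi x + - c) e kh1; rewrite hE; apply.
      by move=> x xI; apply: rcontD; [exact: cphi xI|exact: rcont_cst].
    move=> x /andP[x1 x2]; apply: Hd; rewrite ger0_norm ?subr_ge0 //.
    by apply: (@le_lt_trans _ _ (k.+1%:R * h - k%:R * h)); [exact: lerB|rewrite hE].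
  set A := cint 0 _ phi in IH *; set B := cint _ _ phi in piece *.
  set S := h%:C * \sum_(i < k) _ in IH *; set P := h%:C * _ in piece *.
  have -> : A + B - (S + P) = (A - S) + (B - P) by ring.
  apply: le_trans (cnormD _ _) _; apply: le_trans (lerD IH piece) _.
  by rewrite -natr1 mulrDl mul1r mulrDr.
have := step n.+1.
have -> : n.+1%:R * h = 2 * pi by rewrite /h mulrCA mulfV ?gt_eqF // mulr1.
move=> H.
have -> : cmean rho F - riemann rho F n = ((2 * pi)^-1)%:C *
    (cint 0 (2 * pi) phi - h%:C * \sum_(i < n.+1) phi (i%:R * h)).
  rewrite mulrBr /cmean /riemann mulrA -rmorphM /=; congr (_ - _ * _).
    by congr (_%:C); rewrite /h mulrA mulVf ?mul1r // gt_eqF // pi2_gt0.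
  by apply: eq_bigr => i _; rewrite /phi /h; congr (F (_ * expi _)); rewrite mulrCA mulrA.
rewrite cnormM cnorm_real gtr0_norm ?invr_gt0 ?pi2_gt0 // ler_pdivrMl ?pi2_gt0 //.
by rewrite [leRHS]mulrC.
Qed.

End RiemannSums.

Section MeanIntegrable.
Variable R : realType.
Notation mu := (@completed_lebesgue_measure R).
Notation LR := (lebesgueR R).
Variables (d : \bar R) (r : R -> R) (G : R[i] -> R -> R[i]) (rho : R -> R).
Hypothesis d1 : (1 <= d)%E.
Hypothesis r01 : forall t, 0 <= t -> 0 <= r t < 1.
Hypothesis rmono : forall s t, 0 <= s -> s <= t -> r t <= r s.
Hypothesis wG : weak_holomorphic_vector_field d r G.
Hypothesis hrho : forall t, 0 <= t -> r t < rho t < 1.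

(** A radius common to all the annuli. *)
Let r0 := rho 0.

Let r0I t : 0 <= t -> r t < r0 < 1.
Proof.
move=> t0; have /andP[h1 h2] := hrho (lexx 0); rewrite h2 andbT.
by apply: le_lt_trans h1; exact: rmono.
Qed.

Let r00 : 0 < r0.
Proof. by have /andP[h _] := r01 (lexx 0); have /andP[h' _] := r0I (lexx 0); exact: le_lt_trans h'. Qed.

Let quotient_cdiff t z : 0 <= t -> annulus (r t) z -> cdiff (fun w => G w t / w) z.
Proof.
move=> t0 zA; have [_ hol _] := wG; have /hol_cdiff H := hol t t0.
apply: cdiffM; first exact: H.
apply: cdiffV; last exact: cdiff_id.
have /andP[h _] := r01 t0; have /andP[h' _] := zA.
by rewrite -cnorm_gt0; exact: le_lt_trans h'.
Qed.

Let circle_in t z : 0 <= t -> cnorm z = r0 -> annulus (r t) z.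
Proof. by move=> t0 zr; rewrite /annulus /= zr; exact: r0I. Qed.

(** The prescribed radius may vary with time; by Cauchy's theorem it can be
    replaced by a fixed one, which makes the dependence on time tractable. *)
Lemma mean_vf_radius t : 0 <= t -> mean_vf G rho t = complex.Re (cmean r0 (fun w => G w t / w)).
Proof.
move=> t0; rewrite /mean_vf circle_meanE; congr complex.Re.
have /andP[h1 h2] := hrho t0; have /andP[h3 h4] := r0I t0.
have /andP[h5 _] := r01 t0.
have [h|/ltW h] := leP (rho t) r0.
  apply: cmean_annulus => //; first exact: le_lt_trans h1.
  move=> z /andP[z1 z2]; apply: quotient_cdiff => //; apply/andP; split; first exact: lt_le_trans z1.
  exact: le_lt_trans h4.
apply/esym/cmean_annulus => //.
move=> z /andP[z1 z2]; apply: quotient_cdiff => //; apply/andP; split; first exact: lt_le_trans z1.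
exact: le_lt_trans h2.
Qed.

Lemma mean_vf_measurable : measurable_fun (`[0, +oo[ : set LR) (mean_vf G rho : LR -> R).
Proof.
have meas z : cnorm z = r0 -> measurable_fun (`[0, +oo[ : set LR) ((fun t => complex.Re (G z t / z)) : LR -> R).
  move=> zr; have [mG _ _] := wG; have /= := mG z.
  have -> : [set t : R | 0 <= t /\ annulus (r t) z] = `[0, +oo[%classic.
    apply/seteqP; split => t; rewrite /= in_itv /= andbT; first by case.
    by move=> t0; split => //; exact: circle_in.
  move=> [m1 m2].
  have -> : (fun t => complex.Re (G z t / z)) =
      (fun t => complex.Re (G z t) * complex.Re z^-1 - complex.Im (G z t) * complex.Im z^-1).
    by apply/funext => t; rewrite ReM.
  apply: measurable_funB; apply: measurable_funM => //; exact: measurable_cst.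
apply: (@measurable_fun_cvg _ LR R _ (fun n t => complex.Re (riemann r0 (fun w => G w t / w) n))).
  move=> n; rewrite /riemann.
  have -> : (fun t : LR => complex.Re ((n.+1%:R^-1)%:C * \sum_(k < n.+1)
       (G (r0%:C * expi (2 * pi * k%:R / n.+1%:R)) t / (r0%:C * expi (2 * pi * k%:R / n.+1%:R))))) =
     (fun t : LR => n.+1%:R^-1 * \sum_(k < n.+1)
       complex.Re (G (r0%:C * expi (2 * pi * k%:R / n.+1%:R)) t / (r0%:C * expi (2 * pi * k%:R / n.+1%:R)))).
    by apply/funext => t; rewrite ReZ raddf_sum.
  apply: measurable_funM; first exact: measurable_cst.
  apply: measurable_sum => k; apply: meas.
  by rewrite cnorm_circle // ltW.
move=> t; rewrite /= in_itv /= andbT => t0; rewrite mean_vf_radius //.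
apply/(@cvgrPdist_le R R^o) => e e0.
have cc : circ_cont r0 (fun w => G w t / w).
  by move=> z zr; apply: cdiff_ccont; apply: quotient_cdiff => //; exact: circle_in.
have [N HN] := riemann_cvg r00 cc e0; exists N => // n Nn.
by have := le_trans (Re_le_cnorm _) (HN n Nn); rewrite ReD ReN.
Qed.

(** On a bounded time interval the fixed circle times the interval is a
    compact subset of the domain of the vector field. *)
Lemma mean_vf_integrable (T : R) : 0 <= T -> mu.-integrable `[0, T] (EFin \o (mean_vf G rho : LR -> R)).
Proof.
move=> T00; have [_ _ bG] := wG.
pose K : set (R[i]^o * R)%type := [set z : R[i]^o | r0 <= cnorm z <= r0] `*` `[0, T]%classic.
have cK : compact K by apply: compact_setX; [apply: ring_compact; exact: ltW|exact: segment_compact].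
have KD : K `<=` [set p | 0 <= p.2 /\ annulus (r p.2) p.1].
  move=> [z t] [/= z1]; rewrite in_itv /= => /andP[t0 _]; split => //; apply: circle_in => //.
  by apply: le_anti; rewrite andbC.
have [k [kd k0 Gk]] := bG K cK KD.
have E : snd @` K = `[0, T]%classic.
  apply/seteqP; split => [_ [[z t] [_ tT] <-]//|t tT].
  exists (r0%:C, t) => //; split => //=.
  by rewrite cnorm_real gtr0_norm ?lexx.
rewrite E in kd k0.
have ik := in_Ld_integrable d1 T00 kd.
have ik2 : mu.-integrable `[0, T] (EFin \o ((fun t => r0^-1 * k t) : LR -> R)).
  exact: (integrableZl (lmeas_itv _) r0^-1 ik).
apply: (le_integrable (lmeas_itv _) _ _ ik2).
  apply/measurable_EFinP; apply: measurable_funS mean_vf_measurable; first exact: lmeas_itv.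
  by move=> t; rewrite /= !in_itv /= andbT => /andP[].
move=> t /= tT; have := tT; rewrite in_itv /= => /andP[t0 _]; rewrite lee_fin mean_vf_radius //.
rewrite [leRHS]ger0_norm ?mulr_ge0 ?invr_ge0 ?(ltW r00) ?k0 //.
apply: le_trans (Re_le_cnorm _) _; apply: cmean_norm => //.
  by move=> z zr; apply: cdiff_ccont; apply: quotient_cdiff => //; exact: circle_in.
move=> z zr; rewrite cnormM cnormV zr mulrC ler_pM2l ?invr_gt0 //; apply: Gk; split => //=.
by rewrite zr lexx.
Qed.

End MeanIntegrable.

(** * Integrals over the half-line *)

Section HalfLine.
Variable R : realType.
Notation mu := (@completed_lebesgue_measure R).
Notation LR := (lebesgueR R).
Variables (nu be : R -> R) (T0 : R).
Hypothesis T00 : 0 <= T0.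
Hypothesis mnu : measurable_fun (`[0, +oo[ : set LR) (nu : LR -> R).
Hypothesis inu : mu.-integrable `[0, T0] (EFin \o (nu : LR -> R)).
Hypothesis nube : forall s t, T0 <= s -> s < t ->
  [/\ mu.-integrable `[s, t] (EFin \o ((fun x => - nu x) : LR -> R)),
      (\int[mu]_(x in `[s, t]) (- nu x)%:E = (be t - be s)%:E)%E &
      {ae mu, forall x : LR, s < x < t -> nu x <= 0}].

Let P (x : LR) : R := Num.max (- nu x) 0.
Let J : \bar R := (\int[mu]_(x in `[T0, +oo[) (P x)%:E)%E.
Let I : \bar R := (- \int[mu]_(x in `[0%R, +oo[) (nu x)%:E)%E.

Let P0 x : 0 <= P x. Proof. by rewrite /P le_max lexx orbT. Qed.

Let mray : measurable (`[T0, +oo[%classic : set LR) := lmeas_itv _.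

Let mtail : measurable_fun (`[T0, +oo[ : set LR) (nu : LR -> R).
Proof.
apply: measurable_funS mnu; first exact: lmeas_itv.
by move=> x; rewrite /= !in_itv /= !andbT; exact: le_trans.
Qed.

Let mP : measurable_fun (`[T0, +oo[ : set LR) P.
Proof.
apply: measurable_maxr; last exact: measurable_cst.
exact: measurableT_comp mtail.
Qed.

Let ae_neg : {ae mu, forall x : LR, T0 < x -> nu x <= 0}.
Proof.
have H n : {ae mu, forall x : LR, T0 < x < T0 + n.+1%:R -> nu x <= 0}.
  by have [] := @nube T0 (T0 + n.+1%:R) (lexx _); rewrite ?ltrDl.
have FF := ae_filter_ringOfSetsType (completed_lebesgue_measure : {measure set LR -> \bar R}).
have := ae_foralln H; apply: filterS => x Hx Tx.
have [n _ Hn] := @nbhs_infty_ger R (x - T0).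
by apply: (Hx n); rewrite Tx /= -ltrBlDl (le_lt_trans (Hn n (leqnn n))) // ltr_nat.
Qed.

Let tailE : (\int[mu]_(x in `[T0, +oo[) (nu x)%:E = - J)%E.
Proof.
rewrite /J -integral_ge0N; last by move=> x _; rewrite lee_fin.
apply: (ae_eq_integral _ _ mray).
- exact/measurable_EFinP.
- by apply/measurable_EFinP; exact: measurableT_comp mP.
have aeT := @ae_neq R T0; move: ae_neg aeT; apply: filterS2 => x /= H xT.
rewrite in_itv /= andbT => Tx; have {}H := H ltac:(by rewrite lt_neqAle eq_sym xT).
by rewrite /P max_l ?oppr_ge0 // opprK.
Qed.

Let split_integral : exists a : R, I = (- (a%:E - J))%E.
Proof.
have mhead : measurable (`[0, T0[%classic : set LR) := lmeas_itv _.
have sub : `[0, T0[%classic `<=` `[0, T0]%classic.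
  by move=> x; rewrite /= !in_itv /= => /andP[-> /ltW].
have ihead : mu.-integrable `[0, T0[ (EFin \o (nu : LR -> R)).
  exact: (integrableS (lmeas_itv _) mhead sub inu).
exists (fine (\int[mu]_(x in `[0%R, T0[) (nu x)%:E)%E).
rewrite fineK; last exact: (integrable_fin_num mhead ihead).
rewrite /I; congr (- _)%E.
have E : (`[0, +oo[%classic : set LR) = `[0, T0[%classic `|` `[T0, +oo[%classic.
  by rewrite -itv_bndbnd_setU ?bnd_simp.
have dj : [disjoint `[0, T0[%classic & `[T0, +oo[%classic].
  apply/disj_setPS => x [/=]; rewrite !in_itv /= andbT => /andP[_ xT] Tx.
  by have := lt_le_trans xT Tx; rewrite ltxx.
have mf : measurable_fun (`[0, T0[%classic `|` `[T0, +oo[%classic : set LR) (EFin \o (nu : LR -> R)).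
  by rewrite -E; exact/measurable_EFinP.
by rewrite E (integral_setU mu mhead mray mf dj) tailE.
Qed.

Let I_lty : (I < +oo)%E <-> (J < +oo)%E.
Proof.
have [a ->] := split_integral; have J0 : (0 <= J)%E by apply: integral_ge0 => x _; rewrite lee_fin.
by case: J J0 => [j||] //= _; rewrite ?ltry.
Qed.

Let intP t : T0 < t -> (\int[mu]_(x in `[T0, t]) (P x)%:E = (be t - be T0)%:E)%E.
Proof.
move=> Tt; have [iN <- _] := nube (lexx T0) Tt.
have mTt : measurable (`[T0, t]%classic : set LR) := lmeas_itv _.
apply: (ae_eq_integral _ _ mTt).
- apply/measurable_EFinP; apply: measurable_funS mP => //.
  by move=> x; rewrite /= !in_itv /= andbT => /andP[].
- exact: (measurable_int _ iN).
have aeT := @ae_neq R T0; move: ae_neg aeT; apply: filterS2 => x /= H xT.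
rewrite in_itv /= => /andP[Tx _]; have {}H := H ltac:(by rewrite lt_neqAle eq_sym xT).
by rewrite /P max_l ?oppr_ge0.
Qed.

(** Up to the finite contribution of [[0, T0]], the integral is that of the
    positive part of [- nu], so the increments of [be] are bounded by it. *)
Lemma half_line_bounded : (I < +oo)%E -> exists B, forall t, T0 <= t -> be t <= B.
Proof.
move=> /I_lty Joo; have J0 : (0 <= J)%E by apply: integral_ge0 => x _; rewrite lee_fin.
exists (be T0 + fine J) => t; rewrite le_eqVlt => /predU1P[<-|Tt].
  by rewrite lerDl fine_ge0.
rewrite -lerBlDl -lee_fin fineK ?ge0_fin_numE // -intP //.
apply: (ge0_subset_integral _ (lmeas_itv _) mray).
- exact/measurable_EFinP.
- by move=> x _; rewrite lee_fin.
- by move=> x; rewrite /= !in_itv /= andbT => /andP[].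
Qed.

(** Monotone convergence along the intervals [[T0, T0 + n]], over which the
    integral is an increment of [be]. *)
Lemma half_line_finite B : (forall t, T0 <= t -> be t <= B) -> (I < +oo)%E.
Proof.
move=> bB; apply/I_lty; apply: le_lt_trans (ltry (B - be T0)).
pose F (n : nat) : set LR := `[T0, T0 + n.+1%:R]%classic.
have FU : \bigcup_n F n = `[T0, +oo[%classic.
  apply/seteqP; split => x; rewrite /F /=.
    by move=> [n _]; rewrite /= !in_itv /= andbT => /andP[].
  rewrite in_itv /= andbT => Tx; have [n _ Hn] := @nbhs_infty_ger R (x - T0).
  exists n => //; rewrite /= in_itv /= Tx -lerBlDl (le_trans (Hn n (leqnn n))) //.
  by rewrite ler_nat.
have F1 n x : F n x -> T0 <= x by rewrite /F /= in_itv /= => /andP[].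
have H : (\int[mu]_(x in F n) (P x)%:E)%E @[n --> \oo] --> J.
  rewrite /J -FU; apply: ge0_nondecreasing_set_cvg_integral.
  - move=> n m nm; apply/subsetPset => x; rewrite /F /= !in_itv /= => /andP[-> xn].
    by rewrite (le_trans xn) // lerD2l ler_nat.
  - by move=> n; exact: lmeas_itv.
  - move=> n; apply/measurable_EFinP; apply: measurable_funS mP => //.
    by move=> x /F1; rewrite /= in_itv /= andbT.
  - by move=> n x _; rewrite lee_fin.
rewrite -(cvg_lim _ H) //; apply: lime_le; first by apply/cvg_ex; exists J.
apply: nearW => n; rewrite /F intP ?ltrDl // lee_fin lerB // bB //.
by rewrite lerDl.
Qed.

End HalfLine.

(** * The criterion *)

Theorem proposition7p2 (R : realType) (d : \bar R) (r : R -> R)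
    (f : R -> R[i] -> R[i]) (G : R[i] -> R -> R[i]) (rho : R -> R)
    (hd : (1 <= d)%E)
    (hr : canonical_domain_system d r)
    (hr0 : degenerate r \/ mixed_type r)
    (hf : loewner_chain d r f)
    (hG : associated_vector_field d r f G)
    (hrho : forall t : R, 0 <= t -> r t < rho t < 1) :
  let I : \bar R :=
    (- \int[@completed_lebesgue_measure R]_(t in `[0%R, +oo[)
         (complex.Re (circle_mean (rho t) (fun w => G w t / w)))%:E)%E in
  ((I < +oo)%E -> type_II d r f) /\ (~ (I < +oo)%E -> type_IV d r f).
Proof.
move=> I; have [r01 _ _] := hr; have rmono s t := @domains_decreasing R d r s t hr.
have [T0 [T00 rT]] : exists T0, 0 <= T0 /\ forall t, T0 <= t -> r t = 0.
  by case: hr0 => [H|[T [T0 _ H]]]; [exists 0|exists T; split => //; exact: ltW].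
have [M [dM Mi M0]] := normalization (end_cdiff T00 rT hf) (end_inj T00 rT hf)
  (end_image T00 rT hf) (end_cont hd T00 rT hf).
rewrite -(chain_range_punion T00 rT hf) in dM Mi.
have mnu := mean_vf_measurable r01 rmono hG.1 hrho.
have inu := mean_vf_integrable hd r01 rmono hG.1 hrho T00.
have nube := log_integral hd rmono T00 rT hf dM Mi M0 hG hrho.
split=> [Ifin|Iinf].
  have [B HB] := half_line_bounded T00 mnu inu nube Ifin.
  apply: (bounded_type_II hd rmono T00 rT hf dM Mi M0 (B := expR B)) => t Tt.
  by rewrite -ler_ln ?posrE ?expR_gt0 ?expRK ?HB //; exact: (b_gt0 T00 rT hf dM Mi M0).
apply: (unbounded_type_IV hd rmono T00 rT hf dM Mi M0) => B; apply: contrapT => no.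
apply: Iinf; apply: (half_line_finite T00 mnu inu nube (B := ln (Num.max B 1))) => t Tt.
have B1 : 0 < Num.max B 1 by rewrite lt_max ltr01 orbT.
rewrite ler_ln ?posrE //; last exact: (b_gt0 T00 rT hf dM Mi M0).
rewrite le_max; apply/orP; left; rewrite leNgt; apply/negP => Bt.
by apply: no; exists t.
Qed.
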